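(* There is a flag-transitive, point-imprimitive symmetric $2$-$(1408,336,80)$ design whose full automorphism group is $2^{12}:((3\cdot\mathrm{M}_{22}):2)$. More precisely, let $G=3\cdot\mathrm{M}_{22}$ (a triple cover of the Mathieu group $\mathrm{M}_{22}$), let $V$ be a $6$-dimensional irreducible module for $G$ over $\mathrm{GF}(4)$, let $H=3\cdot\mathrm{M}_{21}\cong\mathrm{SL}(3,4)$ be the subgroup of $G$ that is the preimage of a point stabiliser $\mathrm{M}_{21}$ of $\mathrm{M}_{22}$ in its action on $22$ points, and let $W$ be a $3$-dimensional $H$-submodule of $V$. Then the action of the semidirect product $VG$ on the $1408$ cosets of $WH$ is imprimitive with $22$ blocks of imprimitivity of size $64$ (corresponding to the cosets of $VH$); the stabiliser of a point has orbits of lengths $1,63,336,1008$; the images under $VG$ of the orbit of size $336$ form the blocks of a symmetric $2$-$(1408,336,80)$ design, on which $VG$ acts flag-transitively and point-imprimitively; and $VG$ is a subgroup of index $2$ in the full automorphism group of this design, which is itself point-imprimitive.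
   Context: A $2$-$(v,k,\lambda)$ design has $v$ points, blocks of size $k$, and any two distinct points in exactly $\lambda$ blocks; it is symmetric if it has as many blocks as points. A group of automorphisms is flag-transitive if it is transitive on incident point-block pairs, and point-imprimitive if it preserves a non-trivial partition of the point set. $N:K$ denotes a split extension (semidirect product), $3\cdot\mathrm{M}_{22}$ a non-split central extension of $\mathrm{M}_{22}$ by a cyclic group of order $3$, and $2^{12}$ an elementary abelian group (here the additive group of $V$). *)

(* Defs.v *)
From HB Require Import structures.
From mathcomp Require Import all_boot all_order all_fingroup all_algebra.
From mathcomp Require Import all_solvable all_field all_character.

Set Implicit Arguments.
Unset Strict Implicit.
Unset Printing Implicit Defensive.

Import GroupScope GRing.Theory.

(* Block designs. Blocks are subsets of the point set P and B is a set of
   subsets, so there are no repeated blocks; incidence is membership. *)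

Definition two_design (T : finType) (P : {set T}) (B : {set {set T}})
    (v k lambda : nat) : Prop :=
  [/\ #|P| = v,
      forall b, b \in B -> b \subset P /\ #|b| = k
    & forall x y, x \in P -> y \in P -> x != y ->
        #|[set b in B | (x \in b) && (y \in b)]| = lambda].

Definition symmetric_design (T : finType) (P : {set T}) (B : {set {set T}})
    (v k lambda : nat) : Prop :=
  two_design P B v k lambda /\ #|B| = #|P|.

(* Permutations of T are restricted to those supported on P, i.e. they are the
   permutations of P. *)
Definition design_aut (T : finType) (P : {set T}) (B : {set {set T}}) :
    {group {perm T}} :=
  'N_(perm.Sym P)(B | 'P^*)%G.

Definition flag_transitive (aT : finGroupType) (T : finType) (A : {set aT})
    (to : {action aT &-> T}) (B : {set {set T}}) : Prop :=
  forall x b y c, b \in B -> x \in b -> c \in B -> y \in c ->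
    exists a, [/\ a \in A, to x a = y & to^*%act b a = c].

Definition point_imprimitive (aT : finGroupType) (T : finType) (A : {set aT})
    (to : {action aT &-> T}) (P : {set T}) : Prop :=
  exists Q : {set {set T}}, imprimitivity_system A P to Q.

(* The Mathieu groups, on the projective line over F_23 with None as infinity.
   The binary words of the extended Golay code are identified with their
   supports; the code is spanned over F_2 (symmetric differences) by the sets
   N - i for i in F_23, where N consists of infinity and the nonsquares. *)

Definition line23 : finType := option 'F_23.

Definition golay_gen (i : 'F_23) : {set line23} :=
  None |: [set Some z | z : 'F_23 & ~~ [exists y : 'F_23, y * y == z + i]%R].

Definition golay_code : {set {set line23}} :=
  [set [set p | odd #|[set i in S | p \in golay_gen i]|] | S : {set 'F_23}].

Definition M24 : {group {perm line23}} := 'N(golay_code | 'P^*)%G.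

Definition M22_fixed : {set line23} := [set None; Some 0%R].

Definition M22 : {group {perm line23}} := 'C_M24(M22_fixed | 'P)%G.

(* f presents G as a non-split central extension of M22 by a group of order 3. *)
Definition triple_cover_M22 (gT : finGroupType) (G : {group gT})
    (f : {morphism G >-> {perm line23}}) : Prop :=
  [/\ f @* G = M22, #|'ker f| = 3, 'ker f \subset 'Z(G)
    & ~~ [splits G, over 'ker f]].

(* The group A has the shape 2^12 : ((3.M22) : 2). *)
Definition has_shape_2p12_3M22_2 (aT : finGroupType) (A : {set aT}) : Prop :=
  exists N L C K : {group aT},
    [/\ N ><| K = A, L ><| C = K,
        2.-abelem N /\ #|N| = (2 ^ 12)%N,
        exists f : {morphism L >-> {perm line23}}, triple_cover_M22 f
      & #|C| = 2].

Definition SL3 (F : finFieldType) : {set {'GL_3[F]}} :=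
  [set u : {'GL_3[F]} | (\det (GLval u) == 1)%R].

(* Preimage in G of the stabiliser M21 of the point x. *)
Definition preim_M21 (gT : finGroupType) (G : {group gT})
    (f : {morphism G >-> {perm line23}}) (x : line23) : {group gT} :=
  (f @*^-1 'C_M22[x | 'P])%G.

Lemma preim_M21_sub (gT : finGroupType) (G : {group gT})
    (f : {morphism G >-> {perm line23}}) (x : line23) :
  preim_M21 f x \subset G.
Proof. exact: subsetIl. Qed.

(* G is a triple cover of M22, x one of the 22 points, F = GF(4), V = F^6 the
   irreducible module afforded by rG, and W (the row space of a matrix) a
   3-dimensional H-submodule of V, where H is the preimage of M21. *)
Definition mathieu_setup (gT : finGroupType) (G : {group gT})
    (f : {morphism G >-> {perm line23}}) (x : line23) (F : finFieldType)
    (rG : mx_representation F G 6) (W : 'M[F]_6) : Prop :=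
  [/\ triple_cover_M22 f,
      x \notin M22_fixed,
      #|F| = 4,
      mx_irreducible rG
    & \rank W = 3 /\ mxmodule (subg_repr rG (preim_M21_sub f x)) W].

(* The semidirect product VG and its subgroups V, G, WH and VH. *)

Definition VG (gT : finGroupType) (G : {group gT}) (F : finFieldType)
    (rG : mx_representation F G 6) : finGroupType :=
  sdprod_by ('MR rG).

Definition subV (gT : finGroupType) (G : {group gT}) (F : finFieldType)
    (rG : mx_representation F G 6) : {group VG rG} :=
  (sdpair1 ('MR rG) @* [set: 'rV[F]_6])%G.

Definition subG (gT : finGroupType) (G : {group gT}) (F : finFieldType)
    (rG : mx_representation F G 6) : {group VG rG} :=
  (sdpair2 ('MR rG) @* G)%G.

Definition subWH (gT : finGroupType) (G : {group gT})
    (f : {morphism G >-> {perm line23}}) (x : line23) (F : finFieldType)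
    (rG : mx_representation F G 6) (W : 'M[F]_6) : {group VG rG} :=
  ((sdpair1 ('MR rG) @* rowg W) <*> (sdpair2 ('MR rG) @* preim_M21 f x))%G.

Definition subVH (gT : finGroupType) (G : {group gT})
    (f : {morphism G >-> {perm line23}}) (x : line23) (F : finFieldType)
    (rG : mx_representation F G 6) : {group VG rG} :=
  (subV rG <*> (sdpair2 ('MR rG) @* preim_M21 f x))%G.

(* The cosets of K in X that lie in a common coset of a larger subgroup L. *)
Definition coset_blocks (gT : finGroupType) (X K L : {set gT}) :
    {set {set {set gT}}} :=
  [set [set p : {set gT} in rcosets K X | p \subset c]
    | c : {set gT} in rcosets L X].

(* The lengths of the orbits of A on S, with multiplicity. *)
Definition orbit_lengths (aT : finGroupType) (T : finType) (A : {set aT})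
    (to : {action aT &-> T}) (S : {set T}) : seq nat :=
  [seq #|o| | o : {set T} <- enum (orbit to A @: S)].

(* The permutation group induced by right multiplication by A on a set P of
   cosets. *)
Definition coset_perms (gT : finGroupType) (P : {set {set gT}}) (A : {set gT}) :
    {set {perm {set gT}}} :=
  restr_perm P @* (actperm 'Rs @* A).

(* Main.v *)
(** The images of W under G form 22 planes W_i of V = GF(4)^6, permuted as M22 permutes
    the 22 points; by 3-transitivity and irreducibility any two of them meet in exactly a
    line of vectors and any three have zero intersection and span V. The 1408 points are the
    cosets v + W_i. Two of them, v + W_i and u + W_j, are incident when i <> j and u - v lies
    in the hyperplane W_i + W_j, and the design parameters come from counting vectors in
    these hyperplanes.

    An automorphism of the design preserves the relation of being disjoint cosets of one
    plane, so it permutes the planes; families of cosets that pairwise meet all come from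
    single vectors of V, so it is induced by a permutation of V, which turns out to be
    additive up to translation and semilinear. The linear ones form G, because a linear map
    fixing all planes and a frame of one of them is a scalar. In suitable coordinates the
    planes are defined over GF(4) by an explicit table stable under the Frobenius map, and
    this accounts for the remaining index 2.

    For existence, three explicit matrices permute the planes of the table as generators of
    M22 do. The stabiliser of the family is irreducible since an element of order 11 has a
    one-dimensional fixed space whose images span, and non-split over the scalars since two
    of its elements commute only up to a cube root of unity. *)
Require Import Defs.
From HB Require Import structures.
From mathcomp Require Import all_boot all_order all_fingroup all_algebra.
From mathcomp Require Import all_solvable all_field all_character.
From mathcomp Require Import zify ring.
From Stdlib Require BinNat Nnat.

Set Implicit Arguments.
Unset Strict Implicit.
Unset Printing Implicit Defensive.

Import GroupScope GRing.Theory.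

(** * Arithmetic of the field with four elements *)

Module FieldOfFour.

Local Open Scope ring_scope.

Section GF4.

Variable F : finFieldType.
Hypothesis cF : #|F| = 4%N.

(** Nothing is known of the triple cover beyond its definition, so its action on [V] has to be
    derived. [H] is perfect, since by Gaschütz's theorem a splitting of [H] over the kernel would
    split [G], the index 22 being prime to 3. Hence [H] acts on [W] with determinant 1, and
    comparing orders makes the image all of SL(3,4). This gives the faithfulness and the freedom to
    move frames on which the geometry rests. Irreducibility and 3-transitivity leave open that the
    planes pairwise meet in 0; an involution fixing six planes excludes it. An automorphism moves
    points and blocks by two maps. A vector thus yields two families of cosets, related only across
    different planes; that both come from one vector is where the irreducible stabiliser enters. The
    table of coordinates fits every instance because collinearity of the meeting lines inside a
    plane is the hexad relation of the Steiner system: an invariant relation with three fourth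
    points for each triple can be no other. Hexads then propagate coordinates from six basis
    vectors, and the one free choice of a field element is settled by a coincidence of points that
    cannot happen. *)

Lemma GF4_pchar2 : 2%N \in [pchar F].
Proof. by apply: (@card_finPcharP _ 2 2). Qed.

Lemma GF4_addrr (a : F) : a + a = 0.
Proof. exact: addrr_pchar2 GF4_pchar2 a. Qed.

Lemma GF4_oppr (a : F) : - a = a.
Proof. exact: oppr_pchar2 GF4_pchar2 a. Qed.

Lemma GF4_cube (a : F) : a != 0 -> a ^+ 3 = 1.
Proof.
by move=> a0; have := expf_card a; rewrite cF exprS => h; apply: (mulfI a0); rewrite h mulr1.
Qed.

Lemma GF4_elements (w : F) : w != 0 -> w != 1 ->
  w * w = w + 1 /\ forall a : F, a \in [:: 0; 1; w; w + 1].
Proof.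
move=> w0 w1; split.
  have : (w - 1) * (w * w + w + 1) = 0.
    by transitivity (w ^+ 3 - 1); [ring | rewrite GF4_cube // subrr].
  move/eqP; rewrite mulf_eq0 subr_eq0 (negPf w1) /= -addrA addr_eq0 GF4_oppr.
  by move/eqP.
have U : uniq [:: 0; 1; w; w + 1].
  rewrite /= !inE !negb_or !andbT eq_sym oner_eq0 eq_sym w0 eq_sym addr_eq0 GF4_oppr w1.
  rewrite eq_sym w1 -subr_eq0 opprD addrCA subrr addr0 oppr_eq0 w0.
  by rewrite -subr_eq0 opprD addrA subrr add0r oppr_eq0 oner_eq0.
move=> a; suff: a \in [set x in [:: 0; 1; w; w + 1]] by rewrite inE.
suff -> : [set x in [:: 0; 1; w; w + 1]] = [set: F] by [].
by apply/eqP; rewrite eqEcard subsetT cardsT cF cardsE (card_uniqP U).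
Qed.

Lemma GF4_primitive : exists w : F, w != 0 /\ w != 1.
Proof.
have : (0 < #|~: [set 0%R; 1%R : F]|)%N.
  by have := cardsC [set 0%R; 1%R : F]; rewrite cards2 eq_sym oner_eq0 cF /=; lia.
by case/card_gt0P=> w; rewrite !inE negb_or => /andP[w0 w1]; exists w.
Qed.

End GF4.

End FieldOfFour.

(** * Annihilators, and covering a plane by the lines in which it meets the others *)

Module Orthogonality.

Local Open Scope ring_scope.

(** The annihilator of the row space of [A] for the standard dot product. It is locked so that
    unification treats it as opaque. *)
HB.lock Definition perp (F : fieldType) (n : nat) (A : 'M[F]_n) : 'M[F]_n :=
  (cokermx A)^T.
Arguments perp {F n} A%_MS.

Section Perp.

Variables (F : fieldType) (n : nat).
Implicit Types (A B : 'M[F]_n) (u v : 'rV[F]_n).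

Definition dot u v : F := (u *m v^T) 0 0.

Lemma dot_eq0 u v : (dot u v == 0) = (u *m v^T == 0).
Proof.
apply/eqP/eqP=> [h|h]; last by rewrite /dot h mxE.
by apply/matrixP=> i j; rewrite !ord1 [RHS]mxE; exact: h.
Qed.

Lemma dotC u v : dot u v = dot v u.
Proof. by rewrite /dot -{1}[u]trmxK -trmx_mul mxE. Qed.

Lemma dotDl u u' v : dot (u + u') v = dot u v + dot u' v.
Proof. by rewrite /dot mulmxDl mxE. Qed.

Lemma dotDr u v v' : dot u (v + v') = dot u v + dot u v'.
Proof. by rewrite dotC dotDl dotC (dotC v'). Qed.

Lemma dotZl a u v : dot (a *: u) v = a * dot u v.
Proof. by rewrite /dot -scalemxAl mxE. Qed.

Lemma dotZr a u v : dot u (a *: v) = a * dot u v.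
Proof. by rewrite dotC dotZl dotC. Qed.

Lemma rank_perp A : \rank (perp A) = (n - \rank A)%N.
Proof. by rewrite perp.unlock mxrank_tr mxrank_coker. Qed.

Lemma sub_perp v A : (v <= A)%MS = (v *m (perp A)^T == 0).
Proof. by rewrite perp.unlock submxE trmxK. Qed.

Lemma perp_ker A : (perp A :=: kermx A^T)%MS.
Proof.
apply/eqmxP; rewrite -(geq_leqif (mxrank_leqif_eq _)).
  by rewrite rank_perp mxrank_ker mxrank_tr.
by apply/sub_kermxP; rewrite perp.unlock -trmx_mul mulmx_coker trmx0.
Qed.

Lemma perpP u A : reflect (forall v, (v <= A)%MS -> dot v u = 0) (u <= perp A)%MS.
Proof.
rewrite (perp_ker A); apply: (iffP sub_kermxP) => [uA v /submxP[x ->] | H].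
  by rewrite /dot -mulmxA -[A *m u^T]trmxK trmx_mul trmxK uA trmx0 mulmx0 mxE.
apply/trmx_inj; rewrite trmx_mul trmxK trmx0; apply/row_matrixP=> i.
rewrite row_mul row0; apply/eqP; rewrite -dot_eq0; apply/eqP/H; exact: row_sub.
Qed.

Lemma subP_perp v A : reflect (forall u, (u <= perp A)%MS -> dot v u = 0) (v <= A)%MS.
Proof.
apply: (iffP idP) => [vA u /perpP H | H]; first exact: H.
rewrite sub_perp; apply/eqP/trmx_inj; rewrite trmx_mul trmxK trmx0.
apply/row_matrixP=> i; rewrite row_mul row0; apply/trmx_inj; rewrite trmx_mul trmxK trmx0.
by apply/eqP; rewrite -dot_eq0; apply/eqP/H; exact: row_sub.
Qed.

Lemma perpD A B : (perp (A + B) :=: perp A :&: perp B)%MS.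
Proof.
apply/eqmxP/andP; split; apply/rV_subP=> u; rewrite sub_capmx.
  move/perpP=> H; apply/andP; split; apply/perpP=> v vA; apply: H.
    exact: submx_trans vA (addsmxSl _ _).
  exact: submx_trans vA (addsmxSr _ _).
case/andP=> /perpP HA /perpP HB; apply/perpP=> v /sub_addsmxP[[x y] /= ->].
by rewrite dotDl HA ?HB ?addr0 // submxMl.
Qed.

Lemma rank1P A : \rank A = 1%N ->
  exists u, [/\ u != 0, (u <= A)%MS & forall v, (v <= A)%MS -> exists a, v = a *: u].
Proof.
move=> rA; have nzA : A != 0 by rewrite -mxrank_eq0 rA.
exists (nz_row A); rewrite nz_row_eq0 nz_row_sub; split=> // v vA.
have /eqmxP E : (nz_row A == A)%MS.
  rewrite -(geq_leqif (mxrank_leqif_eq (nz_row_sub A))) rA lt0n mxrank_eq0.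
  by rewrite nz_row_eq0.
by apply/sub_rVP; rewrite E.
Qed.

End Perp.

Section Counting.

Variables (F : finFieldType) (n : nat).

Lemma card_nonzero (A : 'M[F]_n) :
  #|[set v : 'rV[F]_n | (v != 0) && (v <= A)%MS]| = (#|F| ^ \rank A - 1)%N.
Proof.
rewrite -card_rowg (cardsD1 0 (rowg A)) mem_rowg sub0mx add1n subn1 /=.
by apply: eq_card => v; rewrite !inE.
Qed.

Lemma card_affine (A : 'M[F]_n) (c : 'rV[F]_n) :
  #|[set v : 'rV[F]_n | (v - c <= A)%MS]| = (#|F| ^ \rank A)%N.
Proof.
rewrite -card_rowg -[RHS](card_imset _ (addIr c)).
apply: eq_card => v; rewrite inE; apply/idP/imsetP => [h | [w]].
  by exists (v - c); rewrite ?mem_rowg ?subrK.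
by rewrite mem_rowg => h ->; rewrite addrK.
Qed.

End Counting.

Section Cover.

Variables (F : finFieldType) (I : finType) (W : I -> 'M[F]_6).

Hypothesis cF : #|F| = 4%N.
Hypothesis cI : #|I| = 22%N.
Hypothesis W3 : forall i, \rank (W i) = 3%N.
Hypothesis W1 : forall i j, i != j -> \rank (W i :&: W j) = 1%N.
Hypothesis W0 : forall i j k, i != j -> i != k -> j != k ->
  \rank (W i :&: W j :&: W k) = 0%N.

Lemma meet0 i j k (v : 'rV[F]_6) : i != j -> i != k -> j != k ->
  (v <= W i)%MS -> (v <= W j)%MS -> (v <= W k)%MS -> v = 0.
Proof.
move=> ij ik jk vi vj vk; apply/eqP; rewrite -submx0.
have /eqP <- : (W i :&: W j :&: W k)%MS == 0 by rewrite -mxrank_eq0 W0.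
by rewrite !sub_capmx vi vj vk.
Qed.

(** The 21 lines in which [W i] meets the other planes have 3 nonzero vectors each, 63 in all, as
    many as [W i] has. No vector is counted twice, since three planes meet in 0; so each nonzero
    vector of [W i] lies on exactly one of these lines. The predicate [Q] allows the count to be
    made inside a subset. *)
Lemma sum_cover i (Q : pred 'rV[F]_6) :
  (\sum_(j | j != i) #|[set v | [&& v != 0%R, (v <= W i :&: W j)%MS & Q v]]| =
   #|[set v : 'rV[F]_6 | [&& v != 0%R, (v <= W i)%MS & Q v]]|)%N.
Proof.
have le1 (v : 'rV[F]_6) : v != 0 -> (v <= W i)%MS ->
    (#|[set j | (j != i) && (v <= W j)%MS]| <= 1)%N.
  move=> vn0 vi; rewrite leqNgt; apply/negP=> /card_gt1P[j [k]].
  rewrite !inE => -[/andP[ji vj] /andP[ki vk] jk].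
  by case/eqP: vn0; apply: (@meet0 j k i).
have E (R : pred 'rV[F]_6) : (\sum_(j | j != i) #|[set v | [&& v != 0%R, (v <= W i :&: W j)%MS & R v]]| =
    \sum_(v | [&& v != 0%R, (v <= W i)%MS & R v]) #|[set j | (j != i) && (v <= W j)%MS]|)%N.
  under eq_bigr => j ji do rewrite -sum1dep_card.
  under [RHS]eq_bigr => v _ do rewrite -sum1dep_card.
  rewrite (exchange_big_dep (fun v => [&& v != 0%R, (v <= W i)%MS & R v])) /=.
    apply: eq_bigr => v /and3P[v0 vi Rv]; apply: eq_bigl => j.
    by rewrite v0 sub_capmx vi Rv /= andbT.
  by move=> j v _ /and3P[-> ]; rewrite sub_capmx => /andP[-> _] ->.
have tot : (\sum_(v : 'rV[F]_6 | (v != 0%R) && (v <= W i)%MS)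
     #|[set j | (j != i) && (v <= W j)%MS]| = 63)%N.
  have := E predT; under eq_bigr => j ji.
    rewrite (_ : [set v | _] = [set v | (v != 0) && (v <= W i :&: W j)%MS]); last first.
      by apply/setP=> v; rewrite !inE andbT.
    rewrite card_nonzero W1 1?eq_sym // cF; over.
  rewrite sum_nat_const (_ : #|[pred j | j != i]| = 21%N); last first.
    by have := cardC1 i; rewrite cI /= => <-; apply: eq_card.
  move=> /esym E1; rewrite -[RHS]E1.
  by apply: eq_bigl => v; rewrite andbT.
have all1 (v : 'rV[F]_6) : v != 0 -> (v <= W i)%MS ->
    #|[set j | (j != i) && (v <= W j)%MS]| = 1%N.
  move=> v0 vi; have leqs (w : 'rV[F]_6) : (w != 0) && (w <= W i)%MS ->
    (#|[set j | (j != i) && (w <= W j)%MS]| <= 1 ?= iff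
       (#|[set j | (j != i) && (w <= W j)%MS]| == 1))%N.
    by case/andP=> w0 wi; split=> //; apply: le1.
  (* The total 63 equals the number of terms and each term is at most 1, so every term is 1. *)
  have [_] := leqif_sum leqs.
  rewrite tot sum1dep_card card_nonzero W3 cF eqxx => /esym/forall_inP/(_ v).
  by rewrite v0 vi => /(_ isT)/eqP.
rewrite E -sum1dep_card; apply: eq_bigr => v /and3P[v0 vi _]; exact: all1.
Qed.

Lemma cover_ex i (v : 'rV[F]_6) : v != 0 -> (v <= W i)%MS ->
  exists2 j, j != i & (v <= W j)%MS.
Proof.
move=> v0 vi; have := sum_cover i (pred1 v).
rewrite (_ : [set v0 | _] = [set v]) ?cards1; last first.
  by apply/setP=> w; rewrite !inE /=; case: (w =P v) => [->|_]; rewrite ?v0 ?vi ?andbF //.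
move=> S1; have : (0 < \sum_(j | j != i)
    #|[set v0 | [&& v0 != 0%R, (v0 <= W i :&: W j)%MS & pred1 v v0]]|)%N by rewrite S1.
rewrite lt0n sum_nat_eq0 negb_forall => /existsP[j]; rewrite negb_imply.
case/andP=> ji; rewrite -lt0n => /card_gt0P[w]; rewrite !inE sub_capmx.
by case/and3P=> _ /andP[_ wj] /eqP <-; exists j.
Qed.

End Cover.

End Orthogonality.

(** * Dual hyperovals in PG(5,4): counting hyperplanes, and families of cosets with a common
    vector *)

Module DualHyperovals.

Import Orthogonality.
Local Open Scope ring_scope.

(** Projectively: 22 planes of PG(5,4), any two sharing one point and no three sharing one. As a
    plane has 21 points, 22 is the largest possible number. The field [dho_span3] is [dho_rank3] for
    the annihilators, so that the structure passes to them and every count has a dual. *)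
Record dual_hyperoval (F : finFieldType) (I : finType) (W : I -> 'M[F]_6) : Prop :=
  DualHyperoval {
    dho_field : #|F| = 4%N;
    dho_index : #|I| = 22%N;
    dho_rank : forall i, \rank (W i) = 3%N;
    dho_rank2 : forall i j, i != j -> \rank (W i :&: W j) = 1%N;
    dho_rank3 : forall i j k, i != j -> i != k -> j != k ->
      \rank (W i :&: W j :&: W k) = 0%N;
    dho_span3 : forall i j k, i != j -> i != k -> j != k ->
      \rank (W i + W j + W k) = 6%N }.

Section Hyperplanes.

Variables (F : finFieldType) (I : finType) (W : I -> 'M[F]_6).
Hypothesis dW : dual_hyperoval W.

Let cF := dho_field dW.
Let cI := dho_index dW.
Let W3 := dho_rank dW.
Let W1 := dho_rank2 dW.
Let W0 := dho_rank3 dW.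
Let W6 := dho_span3 dW.

Lemma pchar2 : 2%N \in [pchar F].
Proof. by apply: (@card_finPcharP _ 2 2). Qed.

Lemma rowDD (v : 'rV[F]_6) : v + v = 0.
Proof. by rewrite -mulr2n -scaler_nat (pcharf0 pchar2) scale0r. Qed.

Lemma rowN (v : 'rV[F]_6) : - v = v.
Proof. by apply/eqP; rewrite eq_sym -addr_eq0 rowDD. Qed.

Lemma rowB (u v : 'rV[F]_6) : u - v = u + v.
Proof. by rewrite rowN. Qed.

Lemma rankH i j : i != j -> \rank (W i + W j) = 5%N.
Proof. by move=> ij; have := mxrank_sum_cap (W i) (W j); rewrite !W3 W1 //; lia. Qed.

Lemma dual_rank i : \rank (perp (W i)) = 3%N.
Proof. by rewrite rank_perp W3. Qed.

Lemma dual_rank2 i j : i != j -> \rank (perp (W i) :&: perp (W j)) = 1%N.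
Proof. by move=> ij; rewrite -(perpD _ _) rank_perp rankH. Qed.

Lemma dual_rank3 i j k : i != j -> i != k -> j != k ->
  \rank (perp (W i) :&: perp (W j) :&: perp (W k)) = 0%N.
Proof.
move=> ij ik jk; rewrite -(cap_eqmx (perpD _ _) (eqmx_refl _)) -(perpD _ _).
by rewrite rank_perp W6.
Qed.

Lemma H_perp i j (u v : 'rV[F]_6) : i != j -> u != 0 ->
  (u <= perp (W i) :&: perp (W j))%MS -> (v <= W i + W j)%MS = (dot v u == 0).
Proof.
move=> ij u0 uP; apply/idP/eqP => [vH | vu].
  by move: uP; rewrite -(perpD _ _) => /perpP; apply.
apply/subP_perp=> w; rewrite (perpD _ _) => wP.
have [x [x0 xP gen]] := rank1P (dual_rank2 ij).
have [a wa] := gen w wP; have [b ub] := gen u uP.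
have b0 : b != 0 by apply: contraNneq u0 => b0; rewrite ub b0 scale0r.
by rewrite wa (_ : x = b^-1 *: u) ?dotZr ?vu ?mulr0 // ub scalerA mulVf ?scale1r.
Qed.

(** The normals of the hyperplanes [W i + W j] fill the plane [perp (W i)], three nonzero vectors
    for each [j]. Those orthogonal to [v] form a subspace of rank 2 with 15 nonzero vectors, hence
    belong to 15 / 3 = 5 indices. *)
Lemma hyperplane_count i (v : 'rV[F]_6) : ~~ (v <= W i)%MS ->
  #|[set j | (j != i) && (v <= W i + W j)%MS]| = 5%N.
Proof.
move=> nv.
have cov := @sum_cover F I (fun i => perp (W i)) cF cI dual_rank dual_rank2 dual_rank3
  i (fun u => dot v u == 0).
have R : #|[set u : 'rV[F]_6 | [&& u != 0, (u <= perp (W i))%MS & dot v u == 0]]| = 15%N.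
  have R0 := card_nonzero (perp (W i) :&: perp <<v>>)%MS.
  have E15 : (#|F| ^ \rank (perp (W i) :&: perp <<v>>) - 1)%N = 15%N.
    rewrite -(perpD _ _) rank_perp cF.
    have := mxrank_sum_cap (W i) <<v>>%MS; rewrite W3 genmxE rank_rV.
    have -> : (W i :&: <<v>>)%MS = 0.
      apply/eqP; rewrite -submx0; apply/rV_subP=> u; rewrite sub_capmx genmxE.
      case/andP=> uW /sub_rVP[a ua]; rewrite ua.
      have [-> | a0] := eqVneq a 0; first by rewrite scale0r sub0mx.
      case/negP: nv; rewrite (_ : v = a^-1 *: u) ?scalemx_sub //.
      by rewrite ua scalerA mulVf ?scale1r.
    rewrite mxrank0; have -> : v != 0 by apply: contraNneq nv => ->; rewrite sub0mx.
    by rewrite addn0 => ->.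
  rewrite E15 in R0; apply: etrans R0; apply: eq_card => u; rewrite !inE sub_capmx.
  congr (_ && (_ && _)); apply/eqP/perpP => [vu w | H].
    by rewrite genmxE => /sub_rVP[a ->]; rewrite dotZl vu mulr0.
  by apply: H; rewrite genmxE.
move: cov; rewrite R.
rewrite (eq_bigr (fun j => if (v <= W i + W j)%MS then 3 else 0)%N); last first.
  move=> j ji; have ij : i != j by rewrite eq_sym.
  case: ifP => vH.
    have R1 := card_nonzero (perp (W i) :&: perp (W j))%MS.
    rewrite cF dual_rank2 // in R1; apply: etrans R1.
    apply: eq_card => u; rewrite !inE; apply/and3P/andP => [[-> ->] // | [u0 uP]].
    by split=> //; rewrite -(H_perp v ij u0 uP).
  apply/eqP; rewrite cards_eq0; apply/eqP/setP=> u; rewrite !inE.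
  apply/negP=> /and3P[u0 uP vu]; move: vH.
  by rewrite (H_perp v ij u0 uP) vu.
rewrite -big_mkcondr sum_nat_const => /eqP.
rewrite -[15%N]/(5 * 3)%N eqn_pmul2r // => /eqP E5; apply: etrans E5.
by apply: eq_card => j; rewrite !inE.
Qed.

(** The reverse inclusion is clear, and both sides have rank 4: 5 + 5 - 6 on the left, as three
    planes span, and 3 + 1 - 0 on the right. *)
Lemma cap_hyperplanes i j k : i != j -> i != k -> j != k ->
  ((W i + W k) :&: (W j + W k) <= W k + (W i :&: W j))%MS.
Proof.
move=> ij ik jk.
have sub : (W k + (W i :&: W j) <= (W i + W k) :&: (W j + W k))%MS.
  rewrite sub_capmx !addsmx_sub !addsmxSr /=; apply/andP; split.
    exact: submx_trans (capmxSl _ _) (addsmxSl _ _).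
  exact: submx_trans (capmxSr _ _) (addsmxSl _ _).
rewrite -(geq_leqif (mxrank_leqif_sup sub)).
have := mxrank_sum_cap (W k) (W i :&: W j)%MS.
rewrite W3 W1 // (capmxC (W k)) W0 // addn0 => ->.
have := mxrank_sum_cap (W i + W k)%MS (W j + W k)%MS; rewrite !rankH //.
have : \rank (W i + W k + (W j + W k)) = 6%N.
  apply/eqP; rewrite eqn_leq rank_leq_col.
  apply: (leq_trans (eq_leq (esym (W6 ij ik jk)))); apply: mxrankS.
  rewrite !addsmx_sub -andbA; apply/and3P; split.
  - exact: submx_trans (addsmxSl _ _) (addsmxSl _ _).
  - exact: submx_trans (addsmxSl _ _) (addsmxSr _ _).
  exact: submx_trans (addsmxSr _ _) (addsmxSl _ _).
by move=> ->; lia.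
Qed.

(* If every candidate v for a common point of three of the cosets c_k + W_k lay in at
   most five of the cosets, the four points of (c_i + W_i) ∩ (c_j + W_j) could not
   meet the other 20 cosets; and six cosets through v force all of them through v,
   by hyperplane_count. *)
Lemma coset_family (c : I -> 'rV[F]_6) :
    (forall i j, i != j -> (c i - c j <= W i + W j)%MS) ->
  exists v, forall i, (c i - v <= W i)%MS.
Proof.
move=> cc; pose Z v := [set i | (c i - v <= W i)%MS].
suff [v Zv] : exists v, (5 < #|Z v|)%N.
  exists v => j; apply: contraLR Zv => nj; rewrite -leqNgt -(hyperplane_count nj).
  apply/subset_leq_card/subsetP=> k; rewrite !inE => kZ.
  have kj : k != j by apply: contraNneq nj => <-.
  rewrite kj -(subrKA (c k)) addmx_sub //; first by apply: cc; rewrite eq_sym.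
  exact: submx_trans kZ (addsmxSr _ _).
have [i _] : exists i : I, i \in I by apply/card_gt0P; rewrite cI.
have [j ji] : exists j, j != i.
  have /card_gt0P[j ji] : (0 < #|predC1 i|)%N by rewrite cardC1 cI.
  by exists j.
have ij : i != j by rewrite eq_sym.
pose cand := [set v | (i \in Z v) && (j \in Z v)].
have ex v k : v \in cand -> k != i -> k != j -> exists2 w, w \in cand & k \in Z w.
  rewrite !inE => /andP[iv jv] ki kj.
  have ck : (c k - v <= W k + (W i :&: W j))%MS.
    apply: submx_trans (cap_hyperplanes ij _ _); rewrite 1?eq_sym //.
    rewrite sub_capmx; apply/andP; split.
      rewrite -(subrKA (c i)) addmx_sub //; first by rewrite addsmxC cc.
      exact: submx_trans iv (addsmxSl _ _).
    rewrite -(subrKA (c j)) addmx_sub //; first by rewrite addsmxC cc.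
    exact: submx_trans jv (addsmxSl _ _).
  have [[x y] /= E] := sub_addsmxP ck.
  exists (v + y *m (W i :&: W j)%MS); rewrite !inE !opprD !addrA.
    have yi : (- (y *m (W i :&: W j)%MS) <= W i)%MS.
      by rewrite eqmx_opp (submx_trans (submxMl _ _)) ?capmxSl.
    have yj : (- (y *m (W i :&: W j)%MS) <= W j)%MS.
      by rewrite eqmx_opp (submx_trans (submxMl _ _)) ?capmxSr.
    by apply/andP; split; apply: addmx_sub.
  by rewrite E addrK submxMl.
have [v0 v0c] : exists v, v \in cand.
  have [[x y] /= E] := sub_addsmxP (cc _ _ ij).
  exists (c i - x *m W i); rewrite !inE; apply/andP; split.
    by rewrite opprB addrCA subrr addr0 submxMl.
  have -> : c i = c j + (x *m W i + y *m W j) by rewrite -E addrC subrK.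
  by rewrite addrA addrAC addrK opprD addrA subrr add0r eqmx_opp submxMl.
have cardc : (#|cand| <= 4)%N.
  have C4 := card_affine (W i :&: W j)%MS v0; rewrite cF W1 // in C4.
  apply: (leq_trans _ (eq_leq C4)).
  apply/subset_leq_card/subsetP=> v; move: v0c; rewrite !inE => /andP[i0 j0] /andP[i1 j1].
  rewrite sub_capmx; have E k : v - v0 = (c k - v0) - (c k - v).
    by rewrite opprB [RHS]addrC subrKA.
  by rewrite {1}(E i) (E j); apply/andP; split; apply: addmx_sub; rewrite ?eqmx_opp.
case: (boolP [exists v, (5 < #|Z v|)%N]) => [/existsP // | /existsPn H].
have : (#|\bigcup_(v in cand) (Z v :\: [set i; j])| <= 12)%N.
  apply: leq_trans (_ : \sum_(v in cand) 3 <= _)%N; last first.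
    by rewrite sum_nat_const (leq_mul cardc (leqnn 3)).
  elim/big_ind2: _ => [|m A p B Am Bp|v]; first by rewrite cards0.
    exact: leq_trans (leq_card_setU A B) (leq_add Am Bp).
  rewrite inE => /andP[iv jv].
  have := cardsD (Z v) [set i; j]; rewrite (setIidPr _); last first.
    by rewrite subUset !sub1set iv jv.
  by rewrite cards2 ij => ->; have := H v; rewrite -leqNgt => /leq_sub2r-/(_ 2%N).
suff : (20 <= #|\bigcup_(v in cand) (Z v :\: [set i; j])|)%N by move=> /leq_trans h/h.
have <- : #|~: [set i; j]| = 20%N.
  by have := cardsC [set i; j]; rewrite cards2 ij cI /=; lia.
apply/subset_leq_card/subsetP=> k; rewrite !inE negb_or => /andP[ki kj].
have [w wc kw] := ex v0 k v0c ki kj.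
by apply/bigcupP; exists w; rewrite // in_setD kw !inE negb_or ki kj.
Qed.

End Hyperplanes.

End DualHyperovals.

(** * Pairs of coset families, and the shift between them *)

Module CosetFamilies.

Import Orthogonality DualHyperovals.
Local Open Scope ring_scope.

Lemma perpI (F : fieldType) n (A B : 'M[F]_n) :
  (perp (A :&: B) :=: perp A + perp B)%MS.
Proof.
have sub : (perp A + perp B <= perp (A :&: B))%MS.
  rewrite addsmx_sub; apply/andP; split; apply/rV_subP=> u /perpP uA;
    apply/perpP=> v; rewrite sub_capmx => /andP[vA vB]; exact: uA.
apply/eqmxP; rewrite sub andbT -(geq_leqif (mxrank_leqif_sup sub)).
have := mxrank_sum_cap (perp A) (perp B).
rewrite -(perpD A B) !rank_perp; have := mxrank_sum_cap A B.
have := rank_leq_col A; have := rank_leq_col B; have := rank_leq_col (A + B)%MS.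
have := mxrankS (capmxSl A B); lia.
Qed.

Definition permutes (F : finFieldType) (I : finType) (W : I -> 'M[F]_6) (g : 'M[F]_6)
    (s : I -> I) : Prop :=
  [/\ g \in unitmx, injective s & forall i, (W i *m g :=: W (s i))%MS].

(** Asked of all linear maps that permute the planes, so that no group or representation enters the
    arguments on designs. *)
Definition irreducible_stabilizer (F : finFieldType) (I : finType) (W : I -> 'M[F]_6) :=
  forall U : 'M[F]_6, (forall g s, permutes W g s -> (U *m g <= U)%MS) ->
    U != 0 -> \rank U = 6%N.

Section Bifamily.

Variables (F : finFieldType) (I : finType) (W : I -> 'M[F]_6).
Hypothesis dW : dual_hyperoval W.
Hypothesis irrW : irreducible_stabilizer W.

Let cF := dho_field dW.
Let cI := dho_index dW.
Let W3 := dho_rank dW.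
Let W1 := dho_rank2 dW.
Let W0 := dho_rank3 dW.
Let W6 := dho_span3 dW.
Let D i := perp (W i).

Lemma dual_meet0 i j k (v : 'rV[F]_6) : i != j -> i != k -> j != k ->
  (v <= D i)%MS -> (v <= D j)%MS -> (v <= D k)%MS -> v = 0.
Proof. exact: (meet0 (dual_rank3 dW)). Qed.

(** The distributive law D_i ∩ (D_j + D_k) = (D_i ∩ D_j) + (D_i ∩ D_k), obtained from
    [cap_hyperplanes] by taking annihilators. *)
Lemma dual_span i j k (n : 'rV[F]_6) : i != j -> i != k -> j != k ->
    (n <= D i)%MS -> (n <= perp (W j :&: W k))%MS ->
  exists x y, [/\ n = x + y, (x <= D i)%MS, (x <= D j)%MS, (y <= D i)%MS & (y <= D k)%MS].
Proof.
move=> ij ik jk ni njk.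
have : (n <= perp ((W j + W i) :&: (W k + W i)))%MS.
  have : (n <= perp (W i + (W j :&: W k)))%MS by rewrite (perpD _ _) sub_capmx ni.
  move/perpP=> H; apply/perpP=> v vH; apply: H.
  by apply: submx_trans vH (cap_hyperplanes dW _ _ _); rewrite // eq_sym.
rewrite (perpI _ _) => /sub_addsmxP[[x y] /= ->].
have := submxMl x (perp (W j + W i)); have := submxMl y (perp (W k + W i)).
rewrite !(perpD _ _) !sub_capmx => /andP[yk yi] /andP[xj xi].
by exists (x *m perp (W j + W i)), (y *m perp (W k + W i)).
Qed.

Lemma I_distinct : exists i j k : I, [/\ i != j, i != k & j != k].
Proof.
have /card_gt2P[i [j [k [_ [ij jk ki]]]]] : (2 < #|I|)%N by rewrite cI.
by exists i, j, k; split; rewrite // eq_sym.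
Qed.

(* Four members of a hexad: their 6 meeting hyperplanes have normals n_ij that are
   dependent at each of the 4 indices, and n_12 + n_13 + n_23 is the functional. *)
Lemma shift_functional : exists2 w : 'rV[F]_6, w != 0 &
  forall (a : I -> 'rV[F]_6) v,
    (forall i j, i != j -> ((a i + a j + v)%R <= W i + W j)%MS) -> dot v w = 0.
Proof.
have [i1 [i2 [i4 [n12 n14 n24]]]] := I_distinct.
have [p [p0 + _]] := rank1P (dual_rank2 dW n14); rewrite sub_capmx => /andP[p1 p4].
have [q [q0 + _]] := rank1P (dual_rank2 dW n24); rewrite sub_capmx => /andP[q2 q4].
have pq0 : p + q != 0.
  apply: contraNneq q0 => /eqP; rewrite addr_eq0 (rowN dW) => /eqP pq.
  by apply/eqP/(dual_meet0 n12 n14 n24) => //; rewrite -pq.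
have pq4 : ((p + q)%R <= D i4)%MS by rewrite addmx_sub.
(* The points [p], [q] and [p + q] are collinear in [D i4]; the member containing the third one
   completes the four indices. *)
have [i3 n34 pq3] := cover_ex cF cI (dual_rank dW) (dual_rank2 dW) (dual_rank3 dW) pq0 pq4.
have n13 : i1 != i3.
  apply: contraNneq q0 => e; apply/eqP/(dual_meet0 n12 n14 n24) => //.
  have -> : q = (p + q) - p by rewrite addrC addKr.
  by rewrite addmx_sub ?eqmx_opp // e.
have n23 : i2 != i3.
  apply: contraNneq p0 => e; apply/eqP/(dual_meet0 n12 n14 n24) => //.
  have -> : p = (p + q) - q by rewrite addrK.
  by rewrite addmx_sub ?eqmx_opp // e.
have [n21 n31 n32] : [/\ i2 != i1, i3 != i1 & i3 != i2] by split; rewrite eq_sym.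
have perpl i j (u : 'rV[F]_6) : (u <= D i)%MS -> (u <= perp (W i :&: W j))%MS.
  move=> ui; rewrite (perpI _ _); exact: submx_trans ui (addsmxSl _ _).
have perpr i j (u : 'rV[F]_6) : (u <= D j)%MS -> (u <= perp (W i :&: W j))%MS.
  move=> ui; rewrite (perpI _ _); exact: submx_trans ui (addsmxSr _ _).
have pE : p = (p + q) + q by rewrite -addrA (rowDD dW) addr0.
have qE : q = (p + q) + p by rewrite addrAC (rowDD dW) add0r.
have [x12 [x13 [Ep x12_1 x12_2 x13_1 x13_3]]] : exists x y,
    [/\ p = x + y, (x <= D i1)%MS, (x <= D i2)%MS, (y <= D i1)%MS & (y <= D i3)%MS].
  apply: dual_span => //; rewrite [X in (X <= _)%MS]pE.
  by apply: addmx_sub; [apply: perpr | apply: perpl].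
have [y12 [y23 [Eq y12_2 y12_1 y23_2 y23_3]]] : exists x y,
    [/\ q = x + y, (x <= D i2)%MS, (x <= D i1)%MS, (y <= D i2)%MS & (y <= D i3)%MS].
  apply: dual_span => //; rewrite [X in (X <= _)%MS]qE.
  by apply: addmx_sub; [apply: perpr | apply: perpl].
have [z13 [z23 [Er z13_3 z13_1 z23_3 z23_2]]] : exists x y,
    [/\ p + q = x + y, (x <= D i3)%MS, (x <= D i1)%MS, (y <= D i3)%MS & (y <= D i2)%MS].
  apply: dual_span => //.
  by apply: addmx_sub; [apply: perpl | apply: perpr].
(* The decompositions of [p], [q] and [p + q] add up to 0. Grouped by pairs of the indices 1, 2, 3,
   each group lies in the two members of its pair and, by this relation, in the third, so it
   vanishes. *)
have s0 : (x12 + y12) + (x13 + z13) + (y23 + z23) = 0.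
  rewrite -[RHS](rowDD dW (p + q)) {2}Er Ep Eq.
  by apply/rowP=> k; rewrite !mxE; ring.
have e12 : x12 + y12 = 0.
  apply: (dual_meet0 n12 n13 n23); [exact: addmx_sub | exact: addmx_sub |].
  move/eqP: s0; rewrite -addrA addr_eq0 => /eqP ->; rewrite eqmx_opp.
  by apply: addmx_sub; apply: addmx_sub.
have e13 : x13 + z13 = 0.
  apply: (dual_meet0 n12 n13 n23); [exact: addmx_sub | | exact: addmx_sub].
  move/eqP: s0; rewrite e12 add0r addr_eq0 => /eqP ->; rewrite eqmx_opp.
  exact: addmx_sub.
have e23 : y23 + z23 = 0 by move: s0; rewrite e12 e13 !add0r.
have Ey : y12 = x12 by apply/eqP; rewrite -subr_eq0 (rowB dW) addrC e12.
exists (x12 + x13 + y23).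
  apply: contraNneq p0 => w0; apply/eqP; rewrite Ep.
  have x0 : x12 = 0.
    apply: (dual_meet0 n12 n13 n23) => //.
    by move/eqP: w0; rewrite -addrA addr_eq0 => /eqP ->; rewrite eqmx_opp addmx_sub.
  apply: (dual_meet0 n13 n14 n34).
  - by rewrite addmx_sub.
  - by rewrite x0 add0r.
  by rewrite -Ep.
move=> a v H.
have K i j u : i != j -> (u <= D i)%MS -> (u <= D j)%MS ->
    dot (a i) u + dot (a j) u + dot v u = 0.
  move=> ij ui uj; rewrite -!dotDl.
  have /perpP/(_ _ (H i j ij)) // : (u <= perp (W i + W j))%MS.
  by rewrite (perpD _ _) sub_capmx ui uj.
have n43 : i3 != i4 by [].
have E1 := K _ _ _ n12 x12_1 x12_2.
have E2 := K _ _ _ n13 x13_1 x13_3.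
have E3 := K _ _ _ n23 y23_2 y23_3.
have E4 := K _ _ _ n14 p1 p4.
have E5 := K _ _ _ n24 q2 q4.
have E6 := K _ _ _ n43 pq3 pq4.
move: E4 E5 E6; rewrite Ep Eq Ey !dotDr => E4 E5 E6.
have two : (2%:R : F) = 0 := pcharf0 (pchar2 dW).
(* This is the sum of the six relations. Every term with some [a] occurs an even number of times,
   and each of the three terms with [v] an odd number of times. *)
transitivity ((dot (a i1) x12 + dot (a i2) x12 + dot v x12) +
  (dot (a i1) x13 + dot (a i3) x13 + dot v x13) +
  (dot (a i2) y23 + dot (a i3) y23 + dot v y23) +
  (dot (a i1) x12 + dot (a i1) x13 + (dot (a i4) x12 + dot (a i4) x13) +
     (dot v x12 + dot v x13)) +
  (dot (a i2) x12 + dot (a i2) y23 + (dot (a i4) x12 + dot (a i4) y23) +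
     (dot v x12 + dot v y23)) +
  (dot (a i3) x12 + dot (a i3) x13 + (dot (a i3) x12 + dot (a i3) y23) +
     (dot (a i4) x12 + dot (a i4) x13 + (dot (a i4) x12 + dot (a i4) y23)) +
     (dot v x12 + dot v x13 + (dot v x12 + dot v y23)))); last first.
  by rewrite E1 E2 E3 E4 E5 E6 !addr0.
transitivity (dot v x12 + dot v x13 + dot v y23 + 2%:R *
  (dot (a i1) x12 + dot (a i1) x13 + dot (a i2) x12 + dot (a i2) y23 + dot (a i3) x12 +
   dot (a i3) x13 + dot (a i3) y23 + 2%:R * dot (a i4) x12 + dot (a i4) x13 + dot (a i4) y23
   + 2%:R * dot v x12 + dot v x13 + dot v y23)); last by ring.
by rewrite two mul0r addr0.
Qed.

Lemma coset_bifamily (a b : I -> 'rV[F]_6) :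
    (forall i j, i != j -> (a i - b j <= W i + W j)%MS) ->
  exists v, forall i, (a i - v <= W i)%MS /\ (b i - v <= W i)%MS.
Proof.
move=> ab; have [w w0 Hw] := shift_functional.
have add3 (x y z : 'rV[F]_6) : (x + y) + (y + z) = x + z.
  by rewrite addrA -(addrA x) (rowDD dW) addr0.
pose S := [set v0 : 'rV[F]_6 | [exists a : {ffun I -> 'rV[F]_6},
  [forall i, forall j, (i != j) ==> ((a i + a j + v0)%R <= W i + W j)%MS]]].
have SP v0 : reflect (exists a : I -> 'rV[F]_6, forall i j, i != j ->
    ((a i + a j + v0)%R <= W i + W j)%MS) (v0 \in S).
  rewrite inE; apply: (iffP existsP) => [[c /forallP H] | [c H]].
    by exists c => i j ij; have /forallP/(_ j) := H i; rewrite ij.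
  exists [ffun i => c i]; apply/forallP=> i; apply/forallP=> j.
  by apply/implyP=> ij; rewrite !ffunE; apply: H.
pose U := (\sum_(v0 in S) <<v0>>)%MS.
have SU v0 : v0 \in S -> (v0 <= U)%MS.
  by move=> v0S; apply: (submx_trans _ (sumsmx_sup v0 v0S (submx_refl _))); rewrite genmxE.
have U0 : U = 0.
  apply/eqP; apply: contraTT w0 => /irrW U6; rewrite negbK.
  have {}U6 : \rank U = 6%N.
    apply: U6 => g s [gu injs Wg]; rewrite sumsmxMr_gen; apply/sumsmx_subP=> v0 v0S.
    rewrite genmxE (eqmxMr _ (genmxE _)); apply: SU; apply/SP.
    have [s' sK s'K] := injF_bij injs.
    have [c cH] := SP _ v0S; exists (fun i => c (s' i) *m g) => i j ij.
    rewrite -!mulmxDl -(s'K i) -(s'K j) !sK.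
    have := cH (s' i) (s' j); rewrite (can_eq s'K) => /(_ ij)/(submxMr g)/submx_trans.
    by apply; rewrite addsmxMr; apply: addsmxS; rewrite Wg.
  have : (w <= perp U)%MS.
    apply/perpP=> v /sub_sumsmxP[u ->].
    rewrite /dot mulmx_suml summxE big1 // => v0 v0S.
    have : (u v0 *m <<v0>> <= v0)%MS by rewrite (submx_trans (submxMl _ _)) ?genmxE.
    by case/sub_rVP=> x ->; apply/eqP; rewrite -/(dot _ _) dotZl;
       have [c cH] := SP _ v0S; rewrite (Hw c v0 cH) mulr0.
  have /eqP -> : perp U == 0 by rewrite -mxrank_eq0 rank_perp U6.
  by rewrite submx0.
have fam : forall i j, i != j -> ((a i + b i) - (a j + b j) <= W i + W j)%MS.
  move=> i j ij; have ji : j != i by rewrite eq_sym.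
  have -> : (a i + b i) - (a j + b j) = (a i - b j) + (b i - a j).
    by apply/rowP=> k; rewrite !mxE; ring.
  rewrite addmx_sub ?ab // (rowB dW) addrC -(rowB dW) addsmxC.
  exact: ab.
have [v0 v0P] := coset_family dW fam.
have v00 : v0 = 0.
  apply/eqP; rewrite -submx0 -U0; apply/SU/SP; exists a => i j ij.
  have -> : a i + a j + v0 = (a i - b j) + (a j + b j - v0).
    rewrite !(rowB dW); apply/esym; rewrite addrA; congr (_ + _).
    by rewrite (addrC (a j)) add3.
  by rewrite addmx_sub ?ab // (submx_trans (v0P j)) ?addsmxSr.
have fam2 : forall i j, i != j -> (a i - a j <= W i + W j)%MS.
  move=> i j ij; rewrite (rowB dW) -(add3 _ (b j)) addmx_sub //.
    by rewrite -(rowB dW) ab.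
  have := v0P j; rewrite v00 subr0 addrC => h; exact: submx_trans h (addsmxSr _ _).
have [v vP] := coset_family dW fam2; exists v => i; split=> //.
have -> : b i - v = (a i + b i - v0) + (a i - v).
  by rewrite v00 subr0 !(rowB dW) (addrC (a i) (b i)) add3.
exact: addmx_sub.
Qed.

End Bifamily.

End CosetFamilies.

(** * The symmetric design on the cosets of the planes *)

Module CosetDesign.

Import Orthogonality DualHyperovals CosetFamilies.
Local Open Scope ring_scope.

Section Design.

Variables (F : finFieldType) (I : finType) (W : I -> 'M[F]_6).
Hypothesis dW : dual_hyperoval W.

Let cF := dho_field dW.
Let cI := dho_index dW.
Let W3 := dho_rank dW.
Let W1 := dho_rank2 dW.
Let W0 := dho_rank3 dW.
Let W6 := dho_span3 dW.

Variables (T : finType) (pt : I -> 'rV[F]_6 -> T).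
Hypothesis ptE : forall i j u v, (pt i u == pt j v) = (i == j) && (u - v <= W i)%MS.

Definition points : {set T} := [set pt x.1 x.2 | x : I * 'rV[F]_6].

(** All that is known of [pt i v], which stands for the coset v + W_i, is the equality test [ptE].
    Adjacency is therefore defined on [T] through all ways of writing the two points. *)
Definition adj (p q : T) : bool :=
  [exists x : I * 'rV[F]_6, exists y : I * 'rV[F]_6,
    [&& p == pt x.1 x.2, q == pt y.1 y.2, x.1 != y.1 & (x.2 - y.2 <= W x.1 + W y.1)%MS]].

Definition nbhd (p : T) : {set T} := [set q | adj p q].

Definition blocks : {set {set T}} := [set nbhd p | p in points].

Lemma pt_points i v : pt i v \in points.
Proof. by apply/imsetP; exists (i, v). Qed.

Lemma pointsP p : reflect (exists i v, p = pt i v) (p \in points).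
Proof.
by apply: (iffP imsetP) => [[[i v] _ ->] | [i [v ->]]]; [exists i, v | exists (i, v)].
Qed.

Lemma adjE i j u v : adj (pt i u) (pt j v) = (i != j) && (u - v <= W i + W j)%MS.
Proof.
apply/existsP/idP => [[[i' u']] /existsP[[j' v']] /= | ij].
  rewrite !ptE => /and4P[/andP[/eqP <- uu] /andP[/eqP <- vv] -> uv] /=.
  rewrite -(subrKA u') addmx_sub ?(submx_trans uu) ?addsmxSl //.
  rewrite -(subrKA v') addmx_sub // (submx_trans _ (addsmxSr _ _)) //.
  by rewrite -opprB eqmx_opp.
by exists (i, u); apply/existsP; exists (j, v); rewrite !eqxx.
Qed.

Lemma adj_points p q : adj p q -> p \in points /\ q \in points.
Proof.
by case/existsP=> x /existsP[y /and4P[/eqP-> /eqP-> _ _]]; rewrite !pt_points.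
Qed.

Lemma adjC p q : adj p q = adj q p.
Proof.
suff H p' q' : adj p' q' -> adj q' p' by apply/idP/idP; apply: H.
move=> /[dup] /adj_points[/pointsP[i [u ->]] /pointsP[j [v ->]]].
by rewrite !adjE eq_sym -opprB eqmx_opp addsmxC.
Qed.

Lemma adj_same i u v : adj (pt i u) (pt i v) = false.
Proof. by rewrite adjE eqxx. Qed.

(** Points are counted through pairs of a plane and a vector; a point comes from 64 pairs, the
    number of vectors of a plane. *)
Lemma count_points (Q : pred T) :
  (#|[set p in points | Q p]| * 64 = \sum_i #|[set v | Q (pt i v)]|)%N.
Proof.
under eq_bigr => i _ do rewrite -sum1dep_card.
rewrite pair_big_dep /= (partition_big (fun x : I * 'rV[F]_6 => pt x.1 x.2)
   (fun p => (p \in points) && Q p)) /=; last by move=> x Qx; rewrite pt_points.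
rewrite (eq_bigr (fun _ => 64)%N); last first.
  move=> p /andP[/pointsP[i [v ->]] Qp].
  have C := card_affine (W i) v; rewrite cF W3 in C; apply: etrans C.
  rewrite sum1dep_card -(card_imset [set w | (w - v <= W i)%MS] (_ : injective (pair i))).
    apply: eq_card => -[j w]; rewrite !inE /= ptE; apply/idP/imsetP => /=.
      by case/and3P=> _ /eqP-> wv; exists w; rewrite ?inE.
    by case=> x; rewrite inE => xv [-> ->]; rewrite eqxx xv (_ : pt i x = pt i v) ?Qp //;
       apply/eqP; rewrite ptE eqxx.
  by move=> x y [].
rewrite sum_nat_const; congr (_ * _)%N; apply: eq_card => p; rewrite !inE //.
Qed.

Lemma card_points : #|points| = 1408%N.
Proof.
have := count_points predT; rewrite (eq_bigr (fun _ => 4 ^ 6)%N); last first.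
  move=> i _; have C : #|{: 'rV[F]_6}| = (4 ^ 6)%N by rewrite card_mx cF.
  by apply: etrans C; apply: eq_card => v; rewrite !inE.
rewrite sum_nat_const cI => /eqP; rewrite (_ : 22 * _ = 1408 * 64)%N //.
rewrite eqn_pmul2r // => /eqP <-; apply: eq_card => p; rewrite !inE andbT //.
Qed.

(** The two hyperplanes span [V], so their cosets meet in a coset of the intersection, which has
    rank 5 + 5 - 6 = 4. *)
Lemma card_meet_cosets i j k (u v : 'rV[F]_6) : i != j -> i != k -> j != k ->
  #|[set w | (w - u <= W i + W k)%MS && (w - v <= W j + W k)%MS]| = 256%N.
Proof.
move=> ij ik jk.
have full : \rank (W i + W k + (W j + W k)) = 6%N.
  apply/eqP; rewrite eqn_leq rank_leq_col.
  apply: (leq_trans (eq_leq (esym (W6 ij ik jk)))); apply: mxrankS.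
  rewrite !addsmx_sub -andbA; apply/and3P; split.
  - exact: submx_trans (addsmxSl _ _) (addsmxSl _ _).
  - exact: submx_trans (addsmxSl _ _) (addsmxSr _ _).
  exact: submx_trans (addsmxSr _ _) (addsmxSl _ _).
have : (u - v <= W i + W k + (W j + W k))%MS by apply: submx_full; rewrite /row_full full.
case/sub_addsmxP=> -[x y] /= E; pose w0 := u - x *m (W i + W k)%MS.
have rk : \rank ((W i + W k) :&: (W j + W k)) = 4%N.
  have := mxrank_sum_cap (W i + W k)%MS (W j + W k)%MS.
  by rewrite full !(rankH dW) // => /eqP; rewrite -[(5 + 5)%N]/(6 + 4)%N eqn_add2l => /eqP.
have C := card_affine ((W i + W k) :&: (W j + W k))%MS w0; rewrite cF rk in C.
apply: etrans C; apply: eq_card => w; rewrite !inE sub_capmx.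
have w0u : (w0 - u <= W i + W k)%MS by rewrite /w0 addrC addKr eqmx_opp submxMl.
have w0v : (w0 - v <= W j + W k)%MS.
  by rewrite /w0 addrAC E addrAC subrr add0r submxMl.
congr (_ && _).
  apply/idP/idP => h; last by rewrite -(subrKA w0) addmx_sub.
  by rewrite -(subrKA u) addmx_sub // -opprB eqmx_opp.
apply/idP/idP => h; last by rewrite -(subrKA w0) addmx_sub.
by rewrite -(subrKA v) addmx_sub // -opprB eqmx_opp.
Qed.

(** Each of the 21 other planes contributes the 4^5 vectors of a hyperplane coset, and 21 * 4^5 =
    336 * 64. *)
Lemma card_nbhd p : p \in points -> #|nbhd p| = 336%N.
Proof.
case/pointsP=> i [v ->].
have -> : nbhd (pt i v) = [set q in points | adj (pt i v) q].
  apply/setP=> q; rewrite !inE andb_idl // => /adj_points[] //.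
have := count_points (adj (pt i v)); rewrite (bigD1 i) //= (eq_bigr (fun _ => 4 ^ 5)%N); last first.
  move=> j ji; have ij : i != j by rewrite eq_sym.
  have C := card_affine (W i + W j)%MS v; rewrite cF (rankH dW ij) in C; apply: etrans C.
  by apply: eq_card => u; rewrite !inE adjE ij -opprB eqmx_opp.
rewrite sum_nat_const.
have /= -> : #|[pred j | j != i]| = 21%N.
  have := cardC1 i; rewrite cI /= => C; apply: etrans C; apply: eq_card => j; by rewrite !inE.
rewrite (_ : #|[set u | adj (pt i v) (pt i u)]| = 0)%N; last first.
  by apply/eqP; rewrite cards_eq0; apply/eqP/setP=> u; rewrite !inE adj_same.
rewrite add0n => /eqP; rewrite (_ : 21 * _ = 336 * 64)%N //.
by rewrite eqn_pmul2r // => /eqP.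
Qed.

(** For two cosets of W_i only the hyperplanes W_i + W_k that contain their difference contribute:
    five of them by [hyperplane_count], with 4^5 vectors each. For cosets of different planes each
    of the 20 remaining planes contributes 256 vectors. Both totals are 5120 = 80 * 64. *)
Lemma card_common p q : p \in points -> q \in points -> p != q ->
  #|[set r | adj r p && adj r q]| = 80%N.
Proof.
case/pointsP=> i [u ->] /pointsP[j [v ->]]; rewrite ptE => ne.
have -> : [set r | adj r (pt i u) && adj r (pt j v)] =
    [set r in points | adj r (pt i u) && adj r (pt j v)].
  apply/setP=> q'; rewrite !inE [RHS]andb_idl // => /andP[/adj_points[] //].
suff S : (\sum_k #|[set w | adj (pt k w) (pt i u) && adj (pt k w) (pt j v)]| = 80 * 64)%N.
  by have := count_points (fun r => adj r (pt i u) && adj r (pt j v)); rewrite S => /eqP;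
     rewrite eqn_pmul2r // => /eqP.
have [ij|ij] := eqVneq i j.
  subst j; rewrite eqxx /= in ne.
  rewrite (bigID (fun k => (k != i) && (u - v <= W i + W k)%MS)) /=.
  rewrite (eq_bigr (fun _ => 4 ^ 5)%N); last first.
    move=> k /andP[ki uv]; have ik : i != k by rewrite eq_sym.
    have C := card_affine (W i + W k)%MS u; rewrite cF (rankH dW ik) in C; apply: etrans C.
    apply: eq_card => w; rewrite !inE !adjE ki addsmxC andb_idr // => h.
    by rewrite -(subrKA u) addmx_sub.
  rewrite sum_nat_const big1 ?addn0; last first.
    move=> k; rewrite negb_and negbK => /orP[/eqP-> | nuv].
      by apply/eqP; rewrite cards_eq0; apply/eqP/setP=> w; rewrite !inE adj_same.
    apply/eqP; rewrite cards_eq0; apply/eqP/setP=> w; rewrite !inE !adjE.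
    apply/negP=> /andP[/andP[_ wu] /andP[_ wv]]; case/negP: nuv.
    by rewrite -(subrKA w) addmx_sub // 1?addsmxC // -opprB eqmx_opp.
  have C := hyperplane_count dW ne.
  have /= -> // : #|[pred k | (k != i) && (u - v <= W i + W k)%MS]| = 5%N.
  by apply: etrans C; apply: eq_card => k; rewrite !inE.
rewrite (bigID (fun k => (k != i) && (k != j))) /=.
rewrite (eq_bigr (fun _ => 256)%N); last first.
  move=> k /andP[ki kj]; have [ik jk] : i != k /\ j != k by rewrite !(eq_sym _ k).
  have C := card_meet_cosets u v ij ik jk; apply: etrans C.
  by apply: eq_card => w; rewrite !inE !adjE ki kj !(addsmxC (W k)).
rewrite sum_nat_const big1 ?addn0; last first.
  move=> k; rewrite negb_and !negbK => /orP[] /eqP->;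
    apply/eqP; rewrite cards_eq0; apply/eqP/setP=> w; rewrite !inE adj_same ?andbF //.
have /= -> // : #|[pred k | (k != i) && (k != j)]| = 20%N.
have := cardsC [set i; j]; rewrite cards2 ij cI => /eqP.
rewrite -[22%N]/(2 + 20)%N eqn_add2l => /eqP C; apply: etrans C.
by apply: eq_card => k; rewrite !inE negb_or.
Qed.

(** Two points with the same block would have 336 common neighbours instead of 80. *)
Lemma nbhd_inj : {in points &, injective nbhd}.
Proof.
move=> p q pP qP E; apply: contraTeq isT => ne; have := card_common pP qP ne.
rewrite (_ : [set r | _] = nbhd p) ?card_nbhd //.
apply/setP=> r; move/setP/(_ r): E; rewrite !inE !(adjC r) => ->.
by rewrite andbb.
Qed.

(** Adjacency is symmetric, so [nbhd p] contains two given points exactly when [p] is a common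
    neighbour of them. *)
Lemma blocks_design : symmetric_design points blocks 1408 336 80.
Proof.
split; last by rewrite card_in_imset //; apply: nbhd_inj.
split; first exact: card_points.
  move=> b /imsetP[p pP ->]; rewrite card_nbhd //; split=> //.
  by apply/subsetP=> q; rewrite inE => /adj_points[].
move=> x y xP yP xy; rewrite -(card_common xP yP xy).
rewrite -(card_in_imset (f := nbhd)) => [|p q]; last first.
  by rewrite !inE => /andP[/adj_points[pP _] _] /andP[/adj_points[qP _] _]; apply: nbhd_inj.
apply: eq_card => b; apply/idP/imsetP => [| [p]].
  rewrite inE => /andP[/imsetP[p pP ->]]; rewrite !inE => h.
  by exists p; rewrite ?inE.
rewrite inE => /andP[px py] ->; rewrite !inE px py andbT.
by rewrite andbT; apply: imset_f; have [] := adj_points px.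
Qed.

End Design.

End CosetDesign.

(** * Automorphisms of the design come from semilinear affine maps *)

Module DesignPairs.

Import FieldOfFour Orthogonality DualHyperovals CosetFamilies CosetDesign.
Local Open Scope ring_scope.

Section Automorphisms.

Variables (F : finFieldType) (I : finType) (W : I -> 'M[F]_6).
Hypothesis dW : dual_hyperoval W.
Hypothesis irrW : irreducible_stabilizer W.

Let cF := dho_field dW.
Let cI := dho_index dW.
Let W3 := dho_rank dW.
Let W1 := dho_rank2 dW.
Let W0 := dho_rank3 dW.
Let W6 := dho_span3 dW.

Variables (T : finType) (pt : I -> 'rV[F]_6 -> T).
Hypothesis ptE : forall i j u v, (pt i u == pt j v) = (i == j) && (u - v <= W i)%MS.

Notation P := (points pt).
Notation adj := (adj W pt).
Notation adjE := (adjE ptE).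

Lemma cap_coset i j (u v : 'rV[F]_6) k : i != k -> j != k -> i != j ->
  exists w : 'rV[F]_6, (w - u <= W i + W k)%MS /\ (w - v <= W j + W k)%MS.
Proof.
move=> ik jk ij; have C := card_meet_cosets dW u v ij ik jk.
have /card_gt0P[w] : (0 < #|[set w | ((w - u)%R <= W i + W k)%MS && ((w - v)%R <= W j + W k)%MS]|)%N.
  by rewrite C.
by rewrite inE => /andP[]; exists w.
Qed.

(** Phrased by incidence alone, so that automorphisms preserve it: some third point lies in every
    block containing [p] and [q]. *)
Definition parallel (p q : T) := (p != q) &&
  [exists r, [&& r \in P, r != p, r != q & [forall s, adj s p && adj s q ==> adj s r]]].

(** For cosets of one plane, every block containing both also contains the further points of the
    affine line joining them. For cosets of different planes each candidate for a third point is
    missed by some common block, because cosets of different hyperplanes always meet. *)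
Lemma parallelE i j u v :
  parallel (pt i u) (pt j v) = (i == j) && ~~ (u - v <= W i)%MS.
Proof.
rewrite /parallel ptE negb_and; have [<-|ij] := eqVneq i j => /=; last first.
  apply/existsP=> -[r /and4P[/pointsP[k [w ->]] ru rv /forallP H]].
  have bad l x : adj (pt l x) (pt i u) -> adj (pt l x) (pt j v) ->
      adj (pt l x) (pt k w) = false -> False.
    by move=> a1 a2 a3; have := H (pt l x); rewrite a1 a2 a3.
  have step i' j' (u' v' : 'rV[F]_6) : i' != j' -> k = i' -> pt k w != pt i' u' ->
      exists l x, [/\ adj (pt l x) (pt i' u'), adj (pt l x) (pt j' v')
        & adj (pt l x) (pt k w) = false].
    move=> ij' ki; rewrite ptE ki eqxx /= => nuw.
    have C := hyperplane_count dW nuw.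
    (* At most 1 + 1 + 5 of the 22 indices are excluded. *)
    have /card_gt0P[l] : (0 < #|~: (i' |: (j' |: [set l | (l != i') && ((w - u')%R <= W i' + W l)%MS]))|)%N.
      set S := [set l | _] in C *.
      have := cardsC (i' |: (j' |: S)); rewrite cI.
      have [+ _] := leq_card_setU [set i'] (j' |: S).
      have [+ _] := leq_card_setU [set j'] S.
      by rewrite !cards1 C; lia.
    rewrite !inE !negb_or => /and3P[li lj]; rewrite li /= => nl.
    have il : i' != l by rewrite eq_sym. have jl : j' != l by rewrite eq_sym.
    have [x [xu xv]] := cap_coset u' v' il jl ij'.
    exists l, x; rewrite !adjE li lj !(addsmxC (W l)) xu xv; split=> //.
    apply/negP=> /= xw; case/negP: nl.
    by rewrite -(subrKA x) addmx_sub // -opprB eqmx_opp.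
  have [ki|ki] := eqVneq k i.
    have [l [x [a1 a2 a3]]] := step i j u v ij ki ru.
    exact: bad a1 a2 a3.
  have [kj|kj] := eqVneq k j.
    have ji : j != i by rewrite eq_sym.
    have [l [x [a1 a2 a3]]] := step j i v u ji kj rv.
    exact: bad a2 a1 a3.
  have ik : i != k by rewrite eq_sym. have jk : j != k by rewrite eq_sym.
  have [x [xu xv]] := cap_coset u v ik jk ij.
  apply: (bad k x); rewrite ?adjE ?eqxx ?ki ?kj ?(addsmxC (W k)) //.
have [uv|nuv] := boolP (u - v <= W i)%MS => //=; apply/existsP.
have [w [w0 w1]] := GF4_primitive cF.
exists (pt i (u + w *: (v - u))); rewrite pt_points !ptE eqxx /=.
rewrite addrAC subrr add0r; apply/and3P; split.
- rewrite eqmx_scale // -opprB eqmx_opp //.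
- have -> : u + w *: (v - u) - v = (w - 1) *: (v - u).
    by apply/rowP=> k; rewrite !mxE; ring.
  by rewrite eqmx_scale ?subr_eq0 // -opprB eqmx_opp.
apply/forallP=> s; apply/implyP=> /andP[su sv].
have [/pointsP[k [x sE]] _] := adj_points su; subst s.
move: su sv; rewrite !adjE => /andP[-> xu] /andP[_ xv] /=.
rewrite opprD addrA addmx_sub // eqmx_opp scalemx_sub //.
by rewrite -(subrKA x) addmx_sub // -opprB eqmx_opp.
Qed.

(* A permutation f of the points together with the permutation g it induces on the
   blocks, the block nbhd p being identified with p. *)
Definition design_pair (f g : T -> T) : Prop :=
  [/\ {in P, forall p, f p \in P}, {in P, forall p, g p \in P},
      {in P &, injective f}, {in P &, injective g}
    & {in P &, forall p q, adj (g p) (f q) = adj p q}].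

Lemma design_pairC f g : design_pair f g -> design_pair g f.
Proof.
case=> fP gP fi gi fg; split=> // p q pP qP.
by rewrite adjC // fg // adjC.
Qed.

Lemma pair_onto (f : T -> T) : {in P, forall p, f p \in P} -> {in P &, injective f} ->
  forall q, q \in P -> exists2 p, p \in P & f p = q.
Proof.
move=> fP fi q; have E : f @: P = P.
  apply/eqP; rewrite eqEcard card_in_imset // leqnn andbT.
  by apply/subsetP=> x /imsetP[y yP ->]; apply: fP.
by rewrite -{1}E => /imsetP[p pP ->]; exists p.
Qed.

Lemma pair_parallel f g : design_pair f g ->
  {in P &, forall p q, parallel (f p) (f q) = parallel p q}.
Proof.
case=> fP gP fi gi fg p q pP qP; rewrite /parallel.
have -> : (f p == f q) = (p == q) by apply/eqP/eqP => [/fi -> // | ->].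
congr (_ && _); apply/existsP/existsP => -[r /and4P[rP rp rq /forallP H]].
  have [r' r'P r'E] := pair_onto fP fi rP; exists r'.
  rewrite r'P; apply/and4P; split=> //.
  - by apply: contraNneq rp => <-; rewrite r'E.
  - by apply: contraNneq rq => <-; rewrite r'E.
  apply/forallP=> s; apply/implyP=> /andP[sp sq].
  have [sP _] := adj_points sp; have := H (g s).
  by rewrite -r'E !fg // sp sq.
exists (f r); rewrite fP //; apply/and4P; split=> //.
- by apply: contraNneq rp => /fi ->.
- by apply: contraNneq rq => /fi ->.
apply/forallP=> s; apply/implyP=> /andP[sp sq].
have [sP _] := adj_points sp; have [s' s'P s'E] := pair_onto gP gi sP.
by have := H s'; move: sp sq; rewrite -s'E !fg // => -> -> /=.
Qed.

Lemma cls_exists f : {in P, forall p, f p \in P} ->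
  exists s : I -> I, forall i, exists v, f (pt i 0) = pt (s i) v.
Proof.
move=> fP; have H i : exists j, [exists v, f (pt i 0) == pt j v].
  have /pointsP[j [v E]] := fP _ (pt_points pt i 0).
  by exists j; apply/existsP; exists v; rewrite E.
exists (fun i => xchoose (H i)) => i.
by have /existsP[v /eqP E] := xchooseP (H i); exists v.
Qed.

(** Parallelism makes both maps permute the planes. They do it in the same way: if [g] sent plane
    [i] to the plane to which [f] sends some other [j], the adjacent points [pt i 0] and [pt j 0]
    would get images in one plane, and such points are never adjacent. *)
Lemma pair_classes f g : design_pair f g ->
  exists s : I -> I, injective s /\
    forall i v, exists u w, f (pt i v) = pt (s i) u /\ g (pt i v) = pt (s i) w.
Proof.
move=> fg; have gf := design_pairC fg.
have cls h h' : design_pair h h' -> exists s : I -> I, injective s /\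
    forall i v, exists u, h (pt i v) = pt (s i) u.
  move=> hh; have par := pair_parallel hh; have [hP _ hi _ _] := hh.
  have [s sE] := cls_exists hP.
  have sE' i v : exists u, h (pt i v) = pt (s i) u.
    have [u0 E0] := sE i; have /pointsP[j [u E]] := hP _ (pt_points pt i v).
    have := par _ _ (pt_points pt i v) (pt_points pt i 0).
    rewrite E E0 !parallelE eqxx /=; have [-> | ji] /= := eqVneq j (s i).
      by exists u.
    move/esym/negbFE => vW; have : pt i v = pt i 0 by apply/eqP; rewrite ptE eqxx.
    by move=> e; exists u0; rewrite -E0 -e.
  exists s; split=> // i j sij; apply: contraTeq isT => ij.
  have [u E] := sE' i 0; have [v E'] := sE' j 0.
  have := par _ _ (pt_points pt i 0) (pt_points pt j 0).
  rewrite E E' !parallelE sij eqxx (negPf ij) /= => /negbFE uv.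
  have : pt i 0 = pt j 0.
    by apply: hi; rewrite ?pt_points // E E'; apply/eqP; rewrite ptE sij eqxx.
  by move/eqP; rewrite ptE (negPf ij).
have [s [si sE]] := cls f g fg; have [t [ti tE]] := cls g f gf.
have st i : t i = s i.
  have [s' sK s'K] := injF_bij si.
  have [ij|ij] := eqVneq i (s' (t i)); first by rewrite {2}ij s'K.
  have [_ _ _ _ fgE] := fg.
  have := fgE _ _ (pt_points pt i 0) (pt_points pt (s' (t i)) 0).
  have [u ->] := sE (s' (t i)) 0; have [v ->] := tE i 0.
  by rewrite s'K adj_same // adjE ij subr0 sub0mx.
exists s; split=> // i v; have [u E] := sE i v; have [w E'] := tE i v.
by exists u, w; rewrite E E' st.
Qed.

(** The 22 cosets through a vector are pairwise adjacent, so their images under [f] and [g] are two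
    families as in [coset_bifamily]; the common vector of these is the image of the vector.
    Injectivity holds because three of the cosets through a vector determine it. *)
Lemma pair_lift f g : design_pair f g ->
  exists (s : I -> I) (t : 'rV[F]_6 -> 'rV[F]_6), [/\ injective s, injective t
    & forall i v, f (pt i v) = pt (s i) (t v)].
Proof.
move=> fg; have [s [si sE]] := pair_classes fg.
have [s' sK s'K] := injF_bij si; have [fP _ fi _ fgE] := fg.
have lift v : exists w, [forall i, f (pt i v) == pt (s i) w].
  have H i : exists u, [exists w, (f (pt (s' i) v) == pt i u) && (g (pt (s' i) v) == pt i w)].
    have [u [w [E1 E2]]] := sE (s' i) v; exists u; apply/existsP; exists w.
    by rewrite E1 E2 s'K !eqxx.
  pose a i := xchoose (H i); have aP i := existsP (xchooseP (H i)).
  pose b i := xchoose (aP i); have bP i := xchooseP (aP i).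
  have [i j ij|w wP] := @coset_bifamily F I W dW irrW b a.
    have /andP[/eqP fj _] := bP j; have /andP[_ /eqP gi] := bP i.
    have := fgE _ _ (pt_points pt (s' i) v) (pt_points pt (s' j) v).
    rewrite -/(a j) -/(b i) in fj gi; rewrite fj gi !adjE subrr sub0mx andbT ij.
    by rewrite (inj_eq (can_inj s'K)) ij.
  exists w; apply/forallP=> i; rewrite -(sK i); move: (s i) => j.
  have /andP[/eqP fj _] := bP j; rewrite fj s'K ptE eqxx /=.
  by have [_] := wP j.
pose t v := xchoose (lift v).
have tE i v : f (pt i v) = pt (s i) (t v).
  by have /forallP/(_ i)/eqP := xchooseP (lift v).
exists s, t; split=> // u v uv; apply/eqP; rewrite -subr_eq0.
have [i [j [k [ij ik jk]]]] := I_distinct dW.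
apply/eqP/(meet0 W0 ij ik jk); have E l : pt l u = pt l v by
  apply: fi; rewrite ?pt_points // !tE uv.
- by move/eqP: (E i); rewrite ptE eqxx.
- by move/eqP: (E j); rewrite ptE eqxx.
by move/eqP: (E k); rewrite ptE eqxx.
Qed.

(** Two planes can be avoided: any three of the others span [V], and a nonzero vector of such a
    plane W_l lies in some other W_k. *)
Lemma additive_closed_full (K : {set 'rV[F]_6}) i j :
    (forall v w, v \in K -> w \in K -> v + w \in K) -> 0 \in K ->
    (forall k l v, k != l -> l != i -> l != j -> (v <= W k :&: W l)%MS -> v \in K) ->
  forall v, v \in K.
Proof.
move=> KD K0 H v.
have sub l u : l != i -> l != j -> (u <= W l)%MS -> u \in K.
  move=> li lj ul; have [-> // | u0] := eqVneq u 0.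
  have [k kl uk] := cover_ex cF cI W3 W1 W0 u0 ul.
  by apply: (H k l) => //; rewrite sub_capmx uk.
have : (2 < #|~: [set i; j]|)%N.
  have := cardsC [set i; j]; rewrite cards2 cI; case: (i != j) => /=; lia.
case/card_gt2P=> a [b [c [[aS bS cS] [ab bc ca]]]].
have ac : a != c by rewrite eq_sym.
move: aS bS cS; rewrite !inE !negb_or => /andP[ai aj] /andP[bi bj] /andP[ci cj].
have : (v <= W a + W b + W c)%MS by apply: submx_full; rewrite /row_full W6.
case/sub_addsmxP=> -[x z] /= ->.
have /sub_addsmxP[[x' y] /= ->] := submxMl x (W a + W b)%MS.
by apply: (KD); [apply: (KD)|]; [apply: (sub a) | apply: (sub b) | apply: (sub c)];
   rewrite // submxMl.
Qed.

(** Differences of [t] along W_i stay in the image plane. The mixed second difference along [u] in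
    W_i ∩ W_j and [v] in W_k ∩ W_l thus lies in three distinct planes, and is 0, as soon as [l] is
    neither [i] nor [j]. [additive_closed_full] extends this to all [v], and then to all [u]. *)
Lemma pair_additive f g s t : design_pair f g -> injective s -> injective t ->
    (forall i v, f (pt i v) = pt (s i) (t v)) ->
  forall u v, t (u + v) = t u + t v - t 0.
Proof.
move=> fg si ti tE.
have tW i u v : (u - v <= W i)%MS -> (t u - t v <= W (s i))%MS.
  move=> uv; have /eqP : f (pt i u) = f (pt i v) by congr f; apply/eqP; rewrite ptE eqxx.
  by rewrite !tE ptE eqxx.
have tp i j u x : (u <= W i :&: W j)%MS -> (t (x + u)%R - t x <= W (s i) :&: W (s j))%MS.
  by rewrite !sub_capmx => /andP[ui uj]; rewrite !tW // addrC addKr.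
have step i j k l u v x : i != j -> l != i -> l != j ->
    (u <= W i :&: W j)%MS -> (v <= W k :&: W l)%MS ->
  t (x + v + u) - t (x + v) = t (x + u) - t x.
  move=> ij li lj uij vkl; apply/eqP; rewrite -subr_eq0; apply/eqP.
  set d := (X in X = 0).
  have /andP[d1 d2] : (d <= W (s i))%MS && (d <= W (s j))%MS.
    by rewrite -sub_capmx; apply: addmx_sub; rewrite ?eqmx_opp tp.
  have /andP[_ d3] : (d <= W (s k))%MS && (d <= W (s l))%MS.
    have -> : d = (t (x + u + v) - t (x + u)) - (t (x + v) - t x).
      by rewrite /d [x + v + u]addrAC; apply/rowP=> m; rewrite !mxE; ring.
    by rewrite -sub_capmx; apply: addmx_sub; rewrite ?eqmx_opp tp.
  by apply: (meet0 W0 _ _ _ d1 d2 d3); rewrite (inj_eq si) // eq_sym.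
have cst i j u : i != j -> (u <= W i :&: W j)%MS -> forall x, t (x + u) - t x = t u - t 0.
  move=> ij uij.
  pose K := [set v | [forall x, t (x + v + u) - t (x + v) == t (x + u) - t x]].
  have KP v : reflect (forall x, t (x + v + u) - t (x + v) = t (x + u) - t x) (v \in K).
    by rewrite inE; apply: (iffP forallP) => H x; apply/eqP.
  have KT v : v \in K.
    apply: (@additive_closed_full K i j) => [v1 v2 /KP v1K /KP v2K | | k l v1 kl li lj vkl].
    - by apply/KP=> x; rewrite addrA v2K v1K.
    - by apply/KP=> x; rewrite addr0.
    by apply/KP=> x; apply: (step i j k l).
  by move=> x; have /KP/(_ 0) := KT x; rewrite !add0r.
pose L := [set u | [forall x, t (x + u) - t x == t u - t 0]].
have LP u : reflect (forall x, t (x + u) - t x = t u - t 0) (u \in L).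
  by rewrite inE; apply: (iffP forallP) => H x; apply/eqP.
have [i [j [k [ij _ _]]]] := I_distinct dW.
have LT u : u \in L.
  apply: (@additive_closed_full L i i) => [u1 u2 /LP u1L /LP u2L | | k' l v kl _ _ vkl].
  - apply/LP=> x; rewrite addrA -[LHS](subrKA (t (x + u1))) u2L u1L.
    by rewrite -[RHS](subrKA (t u1)) u2L.
  - by apply/LP=> x; rewrite addr0 !subrr.
  by apply/LP; apply: (cst k' l).
move=> u v; have /LP/(_ u) := LT v => /(canRL (subrK _)) ->.
by rewrite addrAC (addrC (t v)).
Qed.

(** A line W_i ∩ W_j goes to a line, so multiplication by [w] there becomes multiplication by [w] or
    by w + 1, the square of [w]. Within one plane the choice agrees for [u] and [v] because one of
    the two also holds for [u + v]; any two planes share a line, so the choice is the same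
    everywhere. *)
Lemma pair_semilinear f g s t : design_pair f g -> injective s -> injective t ->
    (forall i v, f (pt i v) = pt (s i) (t v)) ->
  let h (v : 'rV[F]_6) : 'rV[F]_6 := t v - t 0 in
  [/\ forall u v, h (u + v) = h u + h v, forall i v, (v <= W i)%MS -> (h v <= W (s i))%MS
    & (forall a (v : 'rV[F]_6), h (a *: v) = a *: h v) \/
      (forall a (v : 'rV[F]_6), h (a *: v) = a ^+ 2 *: h v)].
Proof.
move=> fg si ti tE h.
have hD u v : h (u + v) = h u + h v.
  by rewrite /h (pair_additive fg si ti tE); apply/rowP=> m; rewrite !mxE; ring.
have h0 : h 0 = 0 by rewrite /h subrr.
have hi u : h u = 0 -> u = 0 by move/eqP; rewrite subr_eq0 => /eqP/ti.
have hW i v : (v <= W i)%MS -> (h v <= W (s i))%MS.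
  move=> vi; have : f (pt i v) = f (pt i 0) by congr f; apply/eqP; rewrite ptE eqxx subr0.
  by rewrite !tE => /eqP; rewrite ptE eqxx.
split=> //; have [w [w0 w1]] := GF4_primitive cF.
have [ww wE] := GF4_elements cF w0 w1.
have hB (u v : 'rV[F]_6) : h (u - v) = h u - h v by rewrite !(rowN dW) hD.
have loc i u : (u <= W i)%MS -> u != 0 ->
    h (w *: u) = w *: h u \/ h (w *: u) = (w + 1) *: h u.
  move=> ui u0; have [j ji uj] := cover_ex cF cI W3 W1 W0 u0 ui.
  have sij : s i != s j by rewrite (inj_eq si) eq_sym.
  have [x [x0 xP gen]] := rank1P (W1 sij).
  have [b hb] : exists b, h u = b *: x by apply: gen; rewrite sub_capmx !hW.
  have b0 : b != 0 by apply: contraNneq u0 => b0; apply/eqP/hi; rewrite hb b0 scale0r.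
  have [c hc] : exists c, h (w *: u) = c *: x.
    by apply: gen; rewrite sub_capmx !hW // scalemx_sub.
  have {hc x x0 xP gen hb}[d hd] : exists d, h (w *: u) = d *: h u.
    by exists (c / b); rewrite hc hb scalerA mulfVK.
  have := wE d; rewrite !inE => /or4P[] /eqP dE; rewrite dE in hd; last 2 first.
  - by left.
  - by right.
  - have /hi/eqP : h (w *: u) = 0 by rewrite hd scale0r.
    by rewrite scaler_eq0 (negPf w0) (negPf u0).
  have /hi/eqP : h (w *: u - u) = 0 by rewrite hB hd scale1r subrr.
  by rewrite -{2}[u]scale1r -scalerBl scaler_eq0 subr_eq0 (negPf w1) (negPf u0).
have same i u v : (u <= W i)%MS -> (v <= W i)%MS -> u != 0 -> v != 0 ->
    h (w *: u) = w *: h u -> h (w *: v) = w *: h v.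
  move=> ui vi u0 v0 hu; have [// | hv] := loc i v vi v0.
  have [uv0 | uv0] := eqVneq (u + v) 0.
    have <- // : u = v by apply/eqP; rewrite -subr_eq0 (rowB dW) uv0.
  have uvi : ((u + v)%R <= W i)%MS by rewrite addmx_sub.
  have := loc i _ uvi uv0; rewrite scalerDr !hD hu hv => -[] E.
    have v00 : h v = w *: h u + (w + 1) *: h v - w *: (h u + h v).
      by apply/rowP=> m; rewrite !mxE; ring.
    by move: v00; rewrite E subrr => /hi v00; rewrite v00 eqxx in v0.
  have u00 : h u = (w + 1) *: (h u + h v) - (w *: h u + (w + 1) *: h v).
    by apply/rowP=> m; rewrite !mxE; ring.
  by move: u00; rewrite E subrr => /hi u00; rewrite u00 eqxx in u0.
have [i0 [j0 [k0 [ij0 _ _]]]] := I_distinct dW.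
have [e [e0 eP _]] := rank1P (W1 ij0).
have [ei ej] : (e <= W i0)%MS /\ (e <= W j0)%MS by apply/andP; rewrite -sub_capmx.
have glob c : (c = w \/ c = w + 1) -> h (w *: e) = c *: h e ->
    forall v : 'rV[F]_6, h (w *: v) = c *: h v.
  move=> cE he.
  have dif : h (w *: e) = w *: h e -> c = w.
    rewrite he => /eqP; rewrite -subr_eq0 -scalerBl scaler_eq0 subr_eq0.
    by case/orP=> [/eqP // | /eqP/hi e00]; rewrite e00 eqxx in e0.
  have onW k (u : 'rV[F]_6) : (u <= W k)%MS -> h (w *: u) = c *: h u.
    move=> uk; have [-> | u0] := eqVneq u 0; first by rewrite scaler0 h0 scaler0.
    have [e' [e'0 e'k e'E]] : exists e', [/\ e' != 0, (e' <= W k)%MS &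
        (h (w *: e') = w *: h e') <-> (h (w *: e) = w *: h e)].
      have [ki | ki] := eqVneq k i0; first by exists e; rewrite ki.
      have [e' [e'0 + _]] := rank1P (W1 ki); rewrite sub_capmx => /andP[e'k e'i].
      by exists e'; split=> //; split; apply: (same i0).
    have [hu | hu] := loc k u uk u0.
      by rewrite dif //; apply/e'E; apply: (same k u).
    case: cE => cE; last by rewrite cE.
    by rewrite cE; apply: (same k e') => //; apply/e'E; rewrite he cE.
  have addc (x y : 'rV[F]_6) : h (w *: x) = c *: h x -> h (w *: y) = c *: h y ->
      h (w *: (x + y)) = c *: h (x + y).
    by move=> hx hy; rewrite (scalerDr w x y) !hD hx hy; apply/esym/scalerDr.
  have zero : h (w *: (0 : 'rV[F]_6)) = c *: h 0 by rewrite scaler0 h0 scaler0.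
  move=> v; pose K := [set v : 'rV[F]_6 | h (w *: v) == c *: h v].
  suff : v \in K by rewrite inE => /eqP.
  apply: (@additive_closed_full K i0 i0) => [x y | | k l x kl _ _].
  - by rewrite !inE => /eqP hx /eqP hy; apply/eqP/addc.
  - by rewrite inE; apply/eqP.
  by rewrite sub_capmx inE => /andP[xk _]; apply/eqP/(onW k).
have [he | he] := loc i0 e ei e0; [left | right] => a v.
  have H := glob w (or_introl erefl) he.
  have := wE a; rewrite !inE => /or4P[] /eqP->.
  - by rewrite !scale0r h0.
  - by rewrite !scale1r.
  - exact: H.
  by rewrite !scalerDl !scale1r hD H.
have H := glob (w + 1) (or_intror erefl) he.
have := wE a; rewrite !inE => /or4P[] /eqP->.
- by rewrite expr2 mul0r !scale0r h0.
- by rewrite expr1n !scale1r.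
- by rewrite expr2 ww H.
rewrite scalerDl scale1r hD H.
have -> : (w + 1) ^+ 2 = w.
  by rewrite expr2 mulrDl mulrDr ww !mul1r mulr1 addrAC (GF4_addrr cF) add0r.
by rewrite scalerDl scale1r -addrA (rowDD dW) addr0.
Qed.

End Automorphisms.

End DesignPairs.

(** * Rigidity: linear maps that fix enough points of a plane *)

Module PlanePoints.

Import FieldOfFour Orthogonality DualHyperovals CosetFamilies CosetDesign DesignPairs.
Local Open Scope ring_scope.

Ltac distinct := rewrite /= ?inE ?negb_or ?andbT;
  repeat (apply/andP; split); solve [assumption | rewrite eq_sym; assumption].

Section Rigidity.

Variables (F : finFieldType) (I : finType) (W : I -> 'M[F]_6).
Hypothesis dW : dual_hyperoval W.

Let cF := dho_field dW.
Let cI := dho_index dW.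
Let W3 := dho_rank dW.
Let W1 := dho_rank2 dW.
Let W0 := dho_rank3 dW.
Let W6 := dho_span3 dW.

(** Both sides have rank 2: 1 + 1 - 0 on the left and 3 + 5 - 6 on the right. *)
Lemma line_cap i j k : i != j -> i != k -> j != k ->
  ((W i :&: W j) + (W i :&: W k) :=: W i :&: (W j + W k))%MS.
Proof.
move=> ij ik jk.
have sub : ((W i :&: W j) + (W i :&: W k) <= W i :&: (W j + W k))%MS.
  by rewrite sub_capmx !addsmx_sub !capmxSl (submx_trans (capmxSr _ _) (addsmxSl _ _))
    (submx_trans (capmxSr _ _) (addsmxSr _ _)).
apply/eqmxP; rewrite sub -(geq_leqif (mxrank_leqif_sup sub)).
have := mxrank_sum_cap (W i) (W j + W k)%MS.
rewrite W3 (rankH dW) // addsmxA W6 // => E.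
have := mxrank_sum_cap (W i :&: W j)%MS (W i :&: W k)%MS; rewrite !W1 //.
have -> : \rank (W i :&: W j :&: (W i :&: W k)) = 0%N.
  apply/eqP; rewrite -leqn0; apply: (leq_trans _ (eq_leq (W0 ij ik jk))); apply: mxrankS.
  by rewrite sub_capmx capmxSl (submx_trans (capmxSr _ _) (capmxSr _ _)).
by lia.
Qed.

(** A spanning vector of W_i ∩ W_j. In the projective plane of W_i it is the point labelled [j], and
    each of the 21 points has one label. *)
Definition pnt i j : 'rV[F]_6 := nz_row (W i :&: W j)%MS.

Lemma pntC i j : pnt i j = pnt j i. Proof. by rewrite /pnt capmxC. Qed.

Lemma pnt_neq0 i j : i != j -> pnt i j != 0.
Proof. by move=> ij; rewrite nz_row_eq0 -mxrank_eq0 W1. Qed.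

Lemma pnt_subl i j : (pnt i j <= W i)%MS.
Proof. exact: submx_trans (nz_row_sub _) (capmxSl _ _). Qed.

Lemma pnt_subr i j : (pnt i j <= W j)%MS.
Proof. exact: submx_trans (nz_row_sub _) (capmxSr _ _). Qed.

Lemma pnt_cap i j : i != j -> (pnt i j :=: W i :&: W j)%MS.
Proof.
move=> ij; apply/eqmxP; rewrite -(geq_leqif (mxrank_leqif_eq (nz_row_sub _))).
by rewrite W1 // lt0n mxrank_eq0 pnt_neq0.
Qed.

Lemma pntP i j (v : 'rV[F]_6) : i != j -> (v <= W i)%MS -> (v <= W j)%MS ->
  exists c, v = c *: pnt i j.
Proof. by move=> ij vi vj; apply/sub_rVP; rewrite (pnt_cap ij) sub_capmx vi. Qed.

Lemma pnt_notin i j k : i != j -> i != k -> j != k -> ~~ (pnt i j <= W k)%MS.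
Proof.
move=> ij ik jk; apply: contra (pnt_neq0 ij) => pk; apply/eqP.
by apply: (meet0 W0 ij ik jk) => //; [apply: pnt_subl | apply: pnt_subr].
Qed.

(** The image of the point lies in W_i and W_j by assumption and in W_(s j) anyway, so [s j] cannot
    be a third plane. *)
Lemma fix_label g s i j : permutes W g s -> s i = i -> i != j ->
  (pnt i j *m g <= pnt i j)%MS -> s j = j.
Proof.
move=> [gu sI gW] si ij; move/submx_trans=> H; apply/eqP; apply: contraTT isT => sj.
have sji : s j != i.
  by apply: contra ij => /eqP sji; rewrite -(inj_eq sI) si sji.
have inW k : (pnt i j <= W k)%MS -> (pnt i j *m g <= W (s k))%MS.
  by move=> pk; rewrite -(gW k) submxMr.
suff : pnt i j *m g = 0.
  move/(congr1 (mulmx^~ (invmx g))); rewrite mulmxK // mul0mx => /eqP.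
  by rewrite (negPf (pnt_neq0 ij)).
have [is' js'] : i != s j /\ j != s j by split; rewrite eq_sym.
apply: (meet0 W0 ij is' js').
- by apply: H; apply: pnt_subl.
- by apply: H; apply: pnt_subr.
- by apply/inW/pnt_subr.
Qed.

(** Every vector of a plane spans a meeting line and so is an eigenvector; hence [g] is a scalar on
    each plane. Any two planes share a line, and three planes span. *)
Lemma kernel_scalar g : permutes W g id -> exists c, g = c%:M.
Proof.
move=> [gu _ gW].
have gWi i (v : 'rV[F]_6) : (v <= W i)%MS -> (v *m g <= W i)%MS.
  by move=> vi; rewrite -(gW i) submxMr.
have eig i (v : 'rV[F]_6) : (v <= W i)%MS -> exists c, v *m g = c *: v.
  have [-> | v0 vi] := eqVneq v 0; first by exists 0; rewrite mul0mx scale0r.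
  have [j ji vj] := cover_ex cF cI W3 W1 W0 v0 vi.
  have [a va] := pntP ji vj vi; have [b vb] := pntP ji (gWi _ _ vj) (gWi _ _ vi).
  exists (b / a); rewrite vb [in RHS]va scalerA divfK //.
  by apply: contraNneq v0 => a0; rewrite va a0 scale0r.
have onW c i (u v : 'rV[F]_6) : u != 0 -> (u <= W i)%MS -> u *m g = c *: u ->
    (v <= W i)%MS -> v *m g = c *: v.
  move=> u0 ui uc vi; have [b vb] := eig i v vi; rewrite vb.
  have [-> // | bc] := eqVneq b c; have [d uvd] := eig i (u + v)%R (addmx_sub ui vi).
  have E : (d - c) *: u = (b - d) *: v.
    apply/eqP; rewrite !scalerBl subr_eq addrAC eq_sym subr_eq; apply/eqP.
    by rewrite -vb -uc addrC -mulmxDl uvd scalerDr.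
  have [dc | dc] := eqVneq d c.
    move: E; rewrite dc subrr scale0r => /esym/eqP; rewrite scaler_eq0 subr_eq0.
    by rewrite (negPf bc) => /eqP->; rewrite !scaler0.
  have uE : u = ((d - c)^-1 * (b - d)) *: v.
    by rewrite -scalerA -E scalerA mulVf ?scale1r // subr_eq0.
  have : b *: u = c *: u by rewrite -uc uE -scalemxAl vb !scalerA mulrC.
  by move/eqP; rewrite -subr_eq0 -scalerBl scaler_eq0 subr_eq0 (negPf bc) (negPf u0).
have [i [j [k [ij ik jk]]]] := I_distinct dW.
have [c ec] := eig i _ (pnt_subl i j); exists c.
have all_k l (v : 'rV[F]_6) : (v <= W l)%MS -> v *m g = c *: v.
  have [-> | li] := eqVneq l i; first exact: onW (pnt_neq0 ij) (pnt_subl i j) ec.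
  apply: (onW c l (pnt l i)); rewrite ?pnt_neq0 ?pnt_subl //.
  exact: onW (pnt_neq0 ij) (pnt_subl i j) ec (pnt_subr l i).
have ker l : (W l <= kermx (g - c%:M))%MS.
  apply/rV_subP=> v vl; apply/sub_kermxP.
  by rewrite mulmxBr mul_mx_scalar (all_k l) // subrr.
have /sub_kermxP : (1%:M <= kermx (g - c%:M))%MS.
  apply: (@submx_trans _ _ _ _ _ _ (W i + W j + W k)%MS); last by rewrite !addsmx_sub !ker.
  by rewrite sub1mx /row_full W6.
by rewrite mul1mx => /eqP; rewrite subr_eq0 => /eqP.
Qed.

(** The points labelled [j], [k], [l] of the projective plane W_i are collinear. *)
Definition coll i j k l := (pnt i l <= pnt i j + pnt i k)%MS.

Lemma collE i j k l : i != j -> i != k -> j != k -> coll i j k l = (pnt i l <= W j + W k)%MS.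
Proof.
move=> ij ik jk; rewrite /coll (adds_eqmx (pnt_cap ij) (pnt_cap ik)) (line_cap ij ik jk).
by rewrite sub_capmx pnt_subl.
Qed.

Lemma collC i j k l : coll i j k l = coll i k j l. Proof. by rewrite /coll addsmxC. Qed.

(** By [collE] the relation says that the point common to W_i and W_l lies in W_j + W_k, and this is
    symmetric in [i] and [l]. With the exchange of collinear points it makes [coll] a relation on
    sets of four planes. *)
Lemma coll_swap i j k l : uniq [:: i; j; k; l] -> coll i j k l = coll l j k i.
Proof.
rewrite /= !inE !negb_or -!andbA => /and5P[ij ik il jk /and3P[jl kl _]].
by rewrite !collE ?(pntC l) // eq_sym.
Qed.

Lemma coll_coef i j k l : uniq [:: i; j; k; l] -> coll i j k l ->
  exists a b, [/\ a != 0, b != 0 & pnt i l = a *: pnt i j + b *: pnt i k].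
Proof.
rewrite /= !inE !negb_or -!andbA => /and5P[ij ik il jk /and3P[jl kl _]].
case/sub_addsmxP=> -[x y] /=; rewrite [x]mx11_scalar [y]mx11_scalar !mul_scalar_mx => E.
exists (x 0 0), (y 0 0); split=> //.
  apply: contraNneq (pnt_notin il ik _) => [x0|]; last by rewrite eq_sym.
  by rewrite E x0 scale0r add0r scalemx_sub // pnt_subr.
apply: contraNneq (pnt_notin il ij _) => [x0|]; last by rewrite eq_sym.
by rewrite E x0 scale0r addr0 scalemx_sub // pnt_subr.
Qed.

Lemma coll_exch i j k l : uniq [:: i; j; k; l] -> coll i j k l -> coll i j l k.
Proof.
move=> U /(coll_coef U)[a [b [a0 b0 E]]].
have -> : coll i j l k = (b *: pnt i k <= pnt i j + pnt i l)%MS.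
  by rewrite /coll (eqmx_scale _ b0).
have -> : b *: pnt i k = pnt i l - a *: pnt i j by rewrite E addrC addKr.
apply: addmx_sub; first exact: addsmxSr.
by rewrite eqmx_opp scalemx_sub // addsmxSl.
Qed.

Lemma coll_trans i j k l m : uniq [:: i; j; k; l] -> coll i j k l -> coll i j k m ->
  coll i j l m.
Proof.
move=> U c1 c2; apply: (submx_trans c2); rewrite addsmx_sub addsmxSl.
exact: coll_exch.
Qed.

Lemma pnt_basis i j k l : i != j -> i != k -> i != l -> j != k -> ~~ coll i j k l ->
  (pnt i l + (pnt i j + pnt i k) :=: W i)%MS.
Proof.
move=> ij ik il jk nx.
  apply/eqmxP; have sub : (pnt i l + (pnt i j + pnt i k) <= W i)%MS by rewrite !addsmx_sub !pnt_subl.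
  rewrite sub -(geq_leqif (mxrank_leqif_sup sub)) W3.
  have : (pnt i j + pnt i k < pnt i l + (pnt i j + pnt i k))%MS.
  by rewrite ltmxE addsmxSr addsmx_sub submx_refl andbT.
  rewrite ltmxErank => /andP[_]; rewrite [\rank (pnt i j + _)](_ : _ = 2%N) //.
  have := mxrank_sum_cap (pnt i j) (pnt i k); rewrite !rank_rV !pnt_neq0 //= => E.
  have : \rank (pnt i j :&: pnt i k) = 0%N.
  apply/eqP; rewrite mxrank_eq0 -submx0; apply/rV_subP=> v; rewrite sub_capmx => /andP[va vb].
  rewrite submx0; apply/eqP; apply: (meet0 W0 ij ik jk).
  - exact: submx_trans va (pnt_subl _ _).
  - exact: submx_trans va (pnt_subr _ _).
  exact: submx_trans vb (pnt_subr _ _).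
  by move=> r0; move: E; rewrite r0 addn0.
Qed.

(** Every nonzero vector of W_i is a multiple of some [pnt i l]; if all of these lay on one line,
    W_i would have rank at most 2. *)
Lemma exists_noncoll i j k : i != j -> i != k -> j != k ->
  exists l, [/\ i != l, j != l, k != l & ~~ coll i j k l].
Proof.
move=> ij ik jk; pose Q l := [&& i != l, j != l, k != l & ~~ coll i j k l].
suff /existsP[l /and4P[]] : [exists l, Q l] by exists l.
apply: contraT; rewrite negb_exists => /forallP N.
have : (W i <= pnt i j + pnt i k)%MS.
  apply/rV_subP=> v vi; have [-> | v0] := eqVneq v 0; first exact: sub0mx.
  have [l li vl] := cover_ex cF cI W3 W1 W0 v0 vi; have il : i != l by rewrite eq_sym.
  have [c ->] := pntP il vi vl; apply: scalemx_sub.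
  have [-> | jl] := eqVneq l j; first exact: addsmxSl.
  have [-> | kl] := eqVneq l k; first exact: addsmxSr.
  by have := N l; rewrite /Q il ![_ == l]eq_sym jl kl /= negbK.
move/mxrankS; rewrite W3 => H.
have [+ _] := mxrank_adds_leqif (pnt i j) (pnt i k).
by rewrite !rank_rV !pnt_neq0 //; move/(leq_trans H).
Qed.

(* All triples of the four points p_cx, p_ca, p_cb, p_cl of the plane W c are
   independent, so a map fixing them projectively is a scalar on W c. *)
Lemma homology_trivial g s x a b c d : permutes W g s -> s x = x ->
    uniq [:: x; a; b; c] -> ~~ coll x a b c -> pnt x a *m g = pnt x a ->
    pnt x b *m g = pnt x b -> pnt x c *m g = d *: pnt x c ->
  g = 1%:M.
Proof.
move=> pg sx U nc ga gb gc.
have [[xa xb xc] [ab ac bc]] : [/\ x != a, x != b & x != c] /\ [/\ a != b, a != c & b != c].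
  by move: U; rewrite /= !inE !negb_or -!andbA => /and5P[-> -> -> -> /and3P[-> -> _]].
have sa : s a = a by apply: (fix_label pg sx xa); rewrite ga.
have sb : s b = b by apply: (fix_label pg sx xb); rewrite gb.
have sc : s c = c by apply: (fix_label pg sx xc); rewrite gc scalemx_sub.
pose u : 'rV[F]_6 := pnt x a + pnt x b.
have [ub ua] : pnt x b = u - pnt x a /\ pnt x a = u - pnt x b.
  by rewrite /u addrK addrAC subrr add0r.
have u0 : u != 0.
  by apply: contra (pnt_notin xa xb ab) => /eqP u0; rewrite ua u0 sub0r eqmx_opp pnt_subr.
have ux : (u <= W x)%MS by rewrite addmx_sub ?pnt_subl.
(* The sum of two fixed vectors gives a further fixed point of W_x, whose label [l] is then fixed by
   [s] too. *)
have [l lx ul] := cover_ex cF cI W3 W1 W0 u0 ux.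
have xl : x != l by rewrite eq_sym.
have la : l != a.
  apply: contra (pnt_notin xb xa _) => [/eqP la|]; last by rewrite eq_sym.
  by rewrite ub addmx_sub ?eqmx_opp ?pnt_subr -?la.
have lb : l != b.
  apply: contra (pnt_notin xa xb ab) => /eqP lb.
  by rewrite ua addmx_sub ?eqmx_opp ?pnt_subr -?lb.
have [e ue] := pntP xl ux ul.
have e0 : e != 0 by apply: contraNneq u0 => e0; rewrite ue e0 scale0r.
have cl : coll x a b l.
  by rewrite /coll -(eqmx_scale _ e0) -ue addmx_sub ?addsmxSl ?addsmxSr.
have lc : l != c by apply: contraNneq nc => <-.
have gl : pnt x l *m g = pnt x l.
  have -> : pnt x l = e^-1 *: u by rewrite ue scalerA mulVf ?scale1r.
  by rewrite -scalemxAl mulmxDl ga gb.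
have sl : s l = l by apply: (fix_label pg sx xl); rewrite gl.
have eig j : s j = j -> c != j -> exists d, pnt c j *m g = d *: pnt c j.
  move=> sj cj; have [_ _ gW] := pg; apply: (pntP cj).
    by rewrite -{2}sc -(gW c) submxMr ?pnt_subl.
  by rewrite -{2}sj -(gW j) submxMr ?pnt_subr.
have [cx ca cb cl'] : [/\ c != x, c != a, c != b & c != l] by split; rewrite eq_sym.
have [dx Ex] := eig x sx cx; have [da Ea] := eig a sa ca; have [db Eb] := eig b sb cb.
have [dl El] := eig l sl cl'.
have nx : ~~ coll c a b x by apply: contra nc; rewrite coll_swap //; distinct.
have nb : ~~ coll c x a b.
  by apply: contra nx => H; apply: coll_exch; [distinct | rewrite collC].
have na : ~~ coll c x b a by apply: contra nb; apply: coll_exch; distinct.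
have Wc := pnt_basis ca cb cx ab nx.
have := pnt_subl c l; rewrite -Wc => /sub_addsmxP[[y z] /= clE]; have : (z *m (pnt c a + pnt c b)%MS <= pnt c a + pnt c b)%MS.
  exact: submxMl.
case/sub_addsmxP=> -[z1 z2] /= zE; rewrite zE {zE} in clE.
rewrite [y]mx11_scalar [z1]mx11_scalar [z2]mx11_scalar !mul_scalar_mx in clE.
move: (y 0 0) (z1 0 0) (z2 0 0) clE => {y z z1 z2} al be ga' clE.
(* A zero coefficient would make three of the four points of W_c collinear; by the symmetries of
   [coll] the points a, b, c of W_x would be collinear as well, against [nc]. *)
have al0 : al != 0.
  apply: contraNneq nc => al0; rewrite al0 scale0r add0r in clE.
  have H : coll c b a l.
    by rewrite collC /coll clE addmx_sub ?scalemx_sub ?addsmxSl ?addsmxSr.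
  have H1 : coll a b l c by rewrite coll_swap; [apply: coll_exch => // | ]; distinct.
  have H2 : coll a b l x.
    by rewrite coll_swap; [apply: coll_exch; [distinct | rewrite collC] | distinct].
  have H3 : coll x b c a.
    by rewrite coll_swap; [rewrite (coll_trans _ H1 H2) //; distinct | distinct].
  by rewrite collC; apply: coll_exch; [distinct | ].
have be0 : be != 0.
  apply: contraNneq nc => be0; rewrite be0 scale0r add0r in clE.
  have H : coll c b x l.
    by rewrite collC /coll clE addmx_sub ?scalemx_sub ?addsmxSl ?addsmxSr.
  have H1 : coll x b l c by rewrite coll_swap; [apply: coll_exch => // | ]; distinct.
  have H2 : coll x b l a by apply: coll_exch; [distinct | rewrite collC].
  by rewrite collC; apply: coll_exch; [distinct | apply: coll_trans H1 H2; distinct].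
have ga0 : ga' != 0.
  apply: contraNneq nc => ga0; rewrite ga0 scale0r addr0 in clE.
  have H : coll c a x l.
    by rewrite collC /coll clE addmx_sub ?scalemx_sub ?addsmxSl ?addsmxSr.
  have H1 : coll x a l c by rewrite coll_swap; [apply: coll_exch => // | ]; distinct.
  have H2 : coll x a l b by apply: coll_exch; distinct.
  by apply: coll_exch; [distinct | apply: coll_trans H1 H2; distinct].
have E0 : ((dl - dx) * al) *: pnt c x + ((dl - da) * be) *: pnt c a +
    ((dl - db) * ga') *: pnt c b = 0.
  have : pnt c l *m g - dl *: pnt c l = 0 by rewrite El subrr.
  rewrite [in LHS]clE !mulmxDl -!scalemxAl Ex Ea Eb => /rowP E; apply/rowP=> k.
  by have := E k; rewrite !mxE => Ek; apply: oppr_inj; rewrite oppr0 -[RHS]Ek; ring.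
have dep (e1 e2 e3 : F) (v1 v2 v3 : 'rV[F]_6) : e1 *: v1 + e2 *: v2 + e3 *: v3 = 0 ->
    ~~ (v1 <= v2 + v3)%MS -> e1 = 0.
  move=> E n1; apply: contraNeq n1 => e10; rewrite -(eqmx_scale _ e10).
  have -> : e1 *: v1 = - e2 *: v2 - e3 *: v3.
    by apply/eqP; rewrite -subr_eq0 scaleNr opprD !opprK addrA E.
  by rewrite addmx_sub ?eqmx_opp ?scalemx_sub ?addsmxSl ?addsmxSr.
have zx := dep _ _ _ _ _ _ E0 nx.
have za : (dl - da) * be = 0.
  apply: (dep _ _ _ _ _ _ _ na).
  by rewrite (addrC (((dl - da) * be) *: _)); exact: E0.
have zb : (dl - db) * ga' = 0.
  by apply: (dep _ _ _ _ _ _ _ nb); rewrite -addrA addrC; exact: E0.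
have {zx}dxE : dx = dl.
  by move/eqP: zx; rewrite mulf_eq0 (negPf al0) orbF subr_eq0 => /eqP.
have {za}daE : da = dl.
  by move/eqP: za; rewrite mulf_eq0 (negPf be0) orbF subr_eq0 => /eqP.
have {zb}dbE : db = dl.
  by move/eqP: zb; rewrite mulf_eq0 (negPf ga0) orbF subr_eq0 => /eqP.
have ker : (W c <= kermx (g - dl%:M))%MS.
  by rewrite -Wc !addsmx_sub; apply/and3P; split; apply/sub_kermxP;
    rewrite mulmxBr mul_mx_scalar ?Ex ?Ea ?Eb ?dxE ?daE ?dbE subrr.
have [gu _ gW] := pg.
(* Being scalar on W_c, the map fixes every point of that plane, hence every label. *)
have sid j : s j = j.
  have [-> // | jc] := eqVneq j c; have cj : c != j by rewrite eq_sym.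
  apply: (fix_label pg sc cj).
  have /sub_kermxP : (pnt c j <= kermx (g - dl%:M))%MS by apply: submx_trans (pnt_subl _ _) ker.
  by rewrite mulmxBr mul_mx_scalar => /eqP; rewrite subr_eq0 => /eqP->; rewrite scalemx_sub.
have [|k gk] := @kernel_scalar g.
  by split=> // j; apply: eqmx_trans (gW j) _; rewrite sid.
move: ga; rewrite gk mul_mx_scalar => /eqP; rewrite -subr_eq0 -{2}[pnt x a]scale1r -scalerBl.
by rewrite scaler_eq0 (negPf (pnt_neq0 xa)) orbF subr_eq0 => /eqP->.
Qed.

End Rigidity.

End PlanePoints.

(** * The Golay code as binary numbers *)

Module GolayCode.

Local Open Scope nat_scope.

(** The points are numbered so that finite checks can run on natural numbers: a residue by its
    value, infinity by 23. *)
Definition enc (p : line23) : nat := if p is Some z then val z else 23.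

Definition dec (n : nat) : line23 :=
  if n < 23 then Some (inZp n : 'F_23) else None.

Lemma enc_lt p : enc p < 24.
Proof. by case: p => [z|] //=; apply: ltn_trans (ltn_ord z) _. Qed.

Lemma encK : cancel enc dec.
Proof.
case=> [z|] //=; rewrite /dec (ltn_ord z : z < 23).
by congr Some; apply: valZpK.
Qed.

Lemma decK n : n < 24 -> enc (dec n) = n.
Proof.
rewrite /dec => lt24; case: (ltnP n 23) => [lt23 | ge23] /=.
  by change (n %% 23 = n)%N; rewrite modn_small.
by apply/eqP; rewrite eqn_leq ge23 andbC -ltnS lt24.
Qed.

Lemma enc_inj : injective enc. Proof. exact: can_inj encK. Qed.

Lemma dec_inj m n : m < 24 -> n < 24 -> dec m = dec n -> m = n.
Proof. by move=> lm ln /(congr1 enc); rewrite !decK. Qed.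

Lemma decP (P : line23 -> Prop) : (forall n, n < 24 -> P (dec n)) -> forall p, P p.
Proof. by move=> H p; rewrite -(encK p); apply: H; apply: enc_lt. Qed.

Definition nats24 : seq nat := iota 0 24.

Definition squares23 : seq nat := [:: 0; 1; 2; 3; 4; 6; 8; 9; 12; 13; 16; 18].

Lemma square23E (z : 'F_23) :
  [exists y : 'F_23, (y * y == z)%R] = (val z \in squares23).
Proof.
apply/existsP/idP => [[y /eqP <-] | ].
  have /allP/(_ (val y)) : all (fun n => n * n %% 23 \in squares23) (iota 0 23) by [].
  by rewrite mem_iota; apply; apply: ltn_ord.
have /allP H : all (fun q => has (fun n => n * n %% 23 == q) (iota 0 23)) squares23 by [].
move=> /H /hasP[n _ /eqP En]; exists (inZp n : 'F_23).
by apply/eqP/val_inj; rewrite /= modnMm.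
Qed.

Definition in_golay_gen (i p : nat) : bool :=
  if p < 23 then (p + i) %% 23 \notin squares23 else true.

Lemma golay_genE (i : 'F_23) n : n < 24 ->
  (dec n \in golay_gen i) = in_golay_gen i n.
Proof.
rewrite /dec /in_golay_gen => lt24; case: ifP => [lt23 | _]; last by rewrite !inE.
rewrite in_setU1 /= mem_imset; last by move=> ? ? [].
have -> : (n + i) %% 23 = val (inZp n + i : 'F_23)%R.
  by change ((n + i) %% 23 = (n %% 23 + i) %% 23); rewrite modnDml.
by rewrite -square23E inE.
Qed.

Notation "u (+)w v" := (BinNat.N.lxor u v) (at level 50, left associativity).

(** A set of points is a binary number whose bit [n] stands for the point numbered [n]; symmetric
    difference is then a bitwise operation. *)
Definition bit (w : BinNums.N) (n : nat) : bool :=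
  BinNat.N.testbit w (BinNat.N.of_nat n).

Lemma bit_lxor u v n : bit (u (+)w v) n = bit u n (+) bit v n.
Proof. by rewrite /bit BinNat.N.lxor_spec; case: BinNat.N.testbit. Qed.

Lemma bit0 n : bit BinNums.N0 n = false.
Proof. exact: BinNat.N.bits_0. Qed.

Definition word_of (s : seq nat) : BinNums.N :=
  foldr (fun n w => BinNat.N.setbit w (BinNat.N.of_nat n)) BinNums.N0 s.

Definition golay_words : seq BinNums.N := Eval vm_compute in
  [seq word_of [seq n <- nats24 | in_golay_gen i n] | i <- iota 0 23].

Lemma golay_wordsE i n : i < 23 -> n < 24 ->
  bit (nth BinNums.N0 golay_words i) n = in_golay_gen i n.
Proof.
move=> lti ltn; have /allP/(_ i) : all (fun i => all (fun n =>
  bit (nth BinNums.N0 golay_words i) n == in_golay_gen i n) nats24) (iota 0 23).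
  by vm_compute.
by rewrite mem_iota => /(_ lti) /allP/(_ n); rewrite mem_iota => /(_ ltn)/eqP.
Qed.

Definition wset (w : BinNums.N) : {set line23} := [set p | bit w (enc p)].

Definition wsum (ws : seq BinNums.N) : BinNums.N := foldr BinNat.N.lxor BinNums.N0 ws.

Lemma wset_dec w n : n < 24 -> (dec n \in wset w) = bit w n.
Proof. by move=> lt; rewrite inE decK. Qed.

Lemma wset_lxor u v : wset (u (+)w v) = [set p | (p \in wset u) (+) (p \in wset v)].
Proof. by apply/setP=> p; rewrite !inE bit_lxor. Qed.

Lemma bit_wsum ws n : bit (wsum ws) n = \big[addb/false]_(w <- ws) bit w n.
Proof.
elim: ws => [|w ws IH]; first by rewrite big_nil bit0.
by rewrite big_cons /= bit_lxor IH.
Qed.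

Lemma golay_codeP (c : {set line23}) :
  reflect (exists S : {set 'F_23}, forall p,
             (p \in c) = \big[addb/false]_i ((i \in S) && (p \in golay_gen i)))
          (c \in golay_code).
Proof.
have E (S : {set 'F_23}) p : odd #|[set i in S | p \in golay_gen i]|
    = \big[addb/false]_i ((i \in S) && (p \in golay_gen i)).
  rewrite -sum1dep_card (big_morph odd oddD (erefl : odd 0 = false)) big_mkcond.
  by apply: eq_bigr => i _; rewrite inE; case: ifP.
apply: (iffP imsetP) => [[S _ ->] | [S cS]]; exists S => //.
  by move=> p; rewrite inE E.
by apply/setP=> p; rewrite inE E cS.
Qed.

Lemma golay_code_add c d : c \in golay_code -> d \in golay_code ->
  [set p | (p \in c) (+) (p \in d)] \in golay_code.
Proof.
move=> /golay_codeP[S cS] /golay_codeP[T dT]; apply/golay_codeP.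
exists [set i | (i \in S) (+) (i \in T)] => p; rewrite inE cS dT -big_split /=.
by apply: eq_bigr => i _; rewrite [i \in [set _ | _]]inE andb_addl.
Qed.

Lemma golay_code_gen (i : 'F_23) : golay_gen i \in golay_code.
Proof.
apply/golay_codeP; exists [set i] => p.
rewrite (bigD1 i) //= set11 big1 ?addbF // => j ji.
by rewrite in_set1 (negbTE ji).
Qed.

Lemma wset_golay_words i : i < 23 ->
  wset (nth BinNums.N0 golay_words i) = golay_gen (inZp i : 'F_23).
Proof.
move=> lti; apply/setP; apply: decP => n ltn.
by rewrite wset_dec // golay_wordsE // golay_genE //= modn_small.
Qed.

Lemma wset_sum_code (ws : seq BinNums.N) : all (mem golay_words) ws ->
  wset (wsum ws) \in golay_code.
Proof.
elim: ws => [_ | w ws IH /= /andP[ww /IH wsc]].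
  apply/golay_codeP; exists set0 => p; rewrite inE bit0 big1 // => i _.
  by rewrite inE.
rewrite wset_lxor golay_code_add //.
have := nth_index BinNums.N0 ww; have := ww; rewrite -index_mem => lt <-.
by rewrite wset_golay_words ?golay_code_gen.
Qed.

(** Twelve of the 23 generators already span the code, as [golay_words_span] checks, so that listing
    the code takes 4096 words. *)
Definition golay_basis := take 12 golay_words.

Fixpoint word_span (B : seq BinNums.N) : seq BinNums.N :=
  if B is b :: B' then
    let L := word_span B' in L ++ map (fun w => b (+)w w) L
  else [:: BinNums.N0].

Lemma word_span_add B u v :
  u \in word_span B -> v \in word_span B -> u (+)w v \in word_span B.
Proof.
elim: B u v => [|b B IH] u v /=; first by rewrite !inE => /eqP-> /eqP->.
rewrite !mem_cat => /orP[uB | /mapP[u' uB ->]] /orP[vB | /mapP[v' vB ->]].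
- by rewrite IH.
- apply/orP; right; apply/mapP; exists (u (+)w v'); first exact: IH.
  by rewrite -!BinNat.N.lxor_assoc (BinNat.N.lxor_comm u).
- apply/orP; right; apply/mapP; exists (u' (+)w v); first exact: IH.
  by rewrite BinNat.N.lxor_assoc.
apply/orP; left; rewrite (_ : _ (+)w _ = u' (+)w v') ?IH //.
rewrite (BinNat.N.lxor_comm b u') BinNat.N.lxor_assoc -(BinNat.N.lxor_assoc b).
by rewrite BinNat.N.lxor_nilpotent BinNat.N.lxor_0_l.
Qed.

Lemma golay_words_span : {subset golay_words <= word_span golay_basis}.
Proof.
apply/allP; vm_compute; reflexivity.
Qed.

Lemma golay_code_span c : c \in golay_code ->
  exists2 w, w \in word_span golay_basis & c = wset w.
Proof.
move/golay_codeP=> [S cS].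
exists (wsum [seq nth BinNums.N0 golay_words (val i) | i <- enum S]).
  elim: (enum S) => [|i s IH].
    by have : BinNums.N0 \in word_span golay_basis by vm_compute.
  apply: word_span_add IH; apply/golay_words_span/mem_nth.
  exact: ltn_ord.
apply/setP; apply: decP => n ltn.
rewrite cS wset_dec // bit_wsum big_map big_enum_cond [RHS]big_mkcond.
apply: eq_bigr => i _; rewrite andbT; case: (i \in S) => //=.
by rewrite golay_wordsE ?golay_genE //; apply: ltn_ord.
Qed.

Definition weight (w : BinNums.N) : nat := count (bit w) nats24.

Lemma card_count_code (T : finType) (e : T -> nat) (d : nat -> T) m (A : {set T}) :
    cancel e d -> (forall x, e x < m) -> (forall n, n < m -> e (d n) = n) ->
  #|A| = count (fun n => d n \in A) (iota 0 m).
Proof.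
move=> ed em de.
have U : uniq [seq d n | n <- iota 0 m & d n \in A].
  rewrite map_inj_in_uniq ?filter_uniq ?iota_uniq // => i j.
  rewrite !mem_filter !mem_iota => /andP[_ /= li] /andP[_ /= lj] /(congr1 e).
  by rewrite !de.
rewrite -size_filter -(size_map d) -(card_uniqP U).
apply: eq_card => x; apply/idP/mapP => [xA | [n]].
  by exists (e x); rewrite ?ed // mem_filter mem_iota em ed xA.
by rewrite mem_filter => /andP[nA _] ->.
Qed.

Lemma card_wset w : #|wset w| = weight w.
Proof.
rewrite (card_count_code (wset w) encK enc_lt decK) -/nats24.
by apply: eq_in_count => n; rewrite mem_iota => ltn; rewrite wset_dec.
Qed.

Lemma golay_min_weight c : c \in golay_code -> c != set0 -> 8 <= #|c|.
Proof.
move=> /golay_code_span[w wB ->] nz.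
have /allP/(_ _ wB) : all (fun w => (w == BinNums.N0) || (8 <= weight w)) (word_span golay_basis).
  by vm_compute.
rewrite card_wset => /orP[/eqP w0 | //].
by case/eqP: nz; apply/setP=> p; rewrite w0 !inE bit0.
Qed.

End GolayCode.

(** * Certifying elements of M22 *)

Module M22Elements.

Import GolayCode.
Local Open Scope nat_scope.

(** Pivot bits with words of the code, each given as the sum of the generators with the listed
    indices. A word that is reduced to 0 by clearing the pivots in turn belongs to the code; this
    avoids a search through the code. *)
Definition golay_echelon : seq (nat * BinNums.N) := Eval vm_compute in
  [seq (q.1, wsum [seq nth BinNums.N0 golay_words i | i <- q.2]) | q <-
  [:: (5, [:: 0]); (4, [:: 1]); (3, [:: 0; 2]); (2, [:: 1; 3]);
      (1, [:: 0; 2; 4]); (0, [:: 0; 1; 3; 5]); (7, [:: 1; 2; 4; 6]);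
      (6, [:: 2; 3; 5; 7]); (11, [:: 0; 3; 4; 6; 8]); (10, [:: 1; 4; 5; 7; 9]);
      (9, [:: 0; 2; 3; 4; 5; 10]); (8, [:: 1; 3; 4; 5; 6; 11])]].

Definition golay_reduce (w : BinNums.N) : BinNums.N :=
  foldl (fun w q => if bit w q.1 then w (+)w q.2 else w) w golay_echelon.

Lemma span_code w : w \in word_span golay_basis -> wset w \in golay_code.
Proof.
have: all (mem golay_words) golay_basis by vm_compute.
elim: golay_basis w => [|b B IH] w /=.
  by rewrite inE => _ /eqP->; apply: (@wset_sum_code [::]).
case/andP=> bg /IH {}IH; rewrite mem_cat => /orP[/IH // | /mapP[u /IH uC ->]].
rewrite wset_lxor golay_code_add // -(BinNat.N.lxor_0_r b).
by apply: (@wset_sum_code [:: b]); rewrite /= bg.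
Qed.

Lemma golay_reduce_code w : golay_reduce w = BinNums.N0 -> wset w \in golay_code.
Proof.
have: all (fun q => q.2 \in word_span golay_basis) golay_echelon by vm_compute.
rewrite /golay_reduce; elim: golay_echelon w => [|q E IH] w /=.
  by move=> _ ->; apply: (@wset_sum_code [::]).
case/andP=> /span_code qC /IH {}IH; case: ifP => _ /IH // wC.
have -> : w = (w (+)w q.2) (+)w q.2.
  by rewrite BinNat.N.lxor_assoc BinNat.N.lxor_nilpotent BinNat.N.lxor_0_r.
by rewrite wset_lxor golay_code_add.
Qed.

Lemma bit_word_of s n : bit (word_of s) n = (n \in s).
Proof.
elim: s => [|m s IH] //=.
rewrite /bit BinNat.N.setbit_eqb -/(bit _ _) IH inE eq_sym; congr (_ || _).
by apply/BinNat.N.eqb_spec/eqP => [/Nnat.Nat2N.inj // | -> //].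
Qed.

Lemma eq_code (c d : {set line23}) :
  c = d -> c \in golay_code -> d \in golay_code.
Proof. by move->. Qed.

Lemma golay_code_sum (S : {set 'F_23}) (D : 'F_23 -> {set line23}) :
    (forall i, D i \in golay_code) ->
  [set p | \big[addb/false]_i ((i \in S) && (p \in D i))] \in golay_code.
Proof.
move=> DC; elim: (index_enum _) => [|i r IH].
  rewrite (_ : [set p | _] = wset BinNums.N0); first exact: (@wset_sum_code [::]).
  by apply/setP=> p; rewrite !inE big_nil bit0.
have [iS | niS] := boolP (i \in S).
  move: (golay_code_add (DC i) IH); apply: eq_code.
  by apply/setP=> p; rewrite !in_set big_cons iS.
move: IH; apply: eq_code.
by apply/setP=> p; rewrite !in_set big_cons (negPf niS).
Qed.

Lemma setactPE (T : finType) (c : {set T}) (s : {perm T}) : 'P^*%act c s = s @: c.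
Proof. by apply/setP=> x; apply/imsetP/imsetP => [] [y yc ->]; exists y; rewrite ?apermE. Qed.

(** Taking images commutes with symmetric differences, so testing the generators is enough. *)
Lemma M24P (s : {perm line23}) :
  reflect (forall i : 'F_23, s @: golay_gen i \in golay_code) (s \in M24).
Proof.
rewrite /M24 /= inE in_setT /= inE; apply: (iffP subsetP) => [H i | H c].
  by have := H _ (golay_code_gen i); rewrite inE setactPE.
move=> /golay_codeP[S cS]; rewrite inE setactPE.
move: (golay_code_sum S H); apply: eq_code; apply/setP=> p; rewrite in_set.
rewrite -{2}(permKV s p) mem_imset ?cS; last exact: perm_inj.
apply: eq_bigr => i _; congr (_ && _).
by rewrite -{1}(permKV s p) mem_imset //; apply: perm_inj.
Qed.

Lemma M24_code s c : s \in M24 -> c \in golay_code -> s @: c \in golay_code.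
Proof.
by move=> sM cC; have := astabs_act c sM; rewrite setactPE cC => ->.
Qed.

Lemma M22P (s : {perm line23}) :
  reflect [/\ s \in M24, s (dec 23) = dec 23 & s (dec 0) = dec 0] (s \in M22).
Proof.
have E0 : dec 0 = Some 0%R by congr Some; apply: val_inj.
rewrite [s \in M22](in_setI s M24 'C(M22_fixed | 'P)); apply: (iffP andP) => [[-> /astabP H] | [-> H1 H2]].
  by split=> //; [apply: H | rewrite E0; apply: H]; rewrite !inE eqxx ?orbT.
by split=> //; apply/astabP=> p; rewrite !inE => /orP[] /eqP->; rewrite -?E0.
Qed.

(** The default 1 is never reached for a list accepted by [is_lperm]. *)
Definition lperm (l : seq nat) : {perm line23} :=
  odflt 1%g [pick s : {perm line23} | [forall p, s p == dec (nth 0 l (enc p))]].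

Definition is_lperm l := perm_eq l nats24.

Lemma is_lperm_lt l n : is_lperm l -> n < 24 -> nth 0 l n < 24.
Proof.
move=> pl ltn; have := perm_mem pl (nth 0 l n); rewrite mem_nth ?(perm_size pl) //.
by rewrite mem_iota => /esym.
Qed.

Lemma lpermE l n : is_lperm l -> n < 24 -> lperm l (dec n) = dec (nth 0 l n).
Proof.
move=> pl ltn; rewrite /lperm; case: pickP => [s /forallP/(_ (dec n))/eqP-> | H].
  by rewrite decK.
have inj : injective (fun p => dec (nth 0 l (enc p))).
  move=> p q /dec_inj; rewrite !is_lperm_lt ?enc_lt // => /(_ isT isT)/eqP.
  by rewrite nth_uniq ?(perm_size pl) ?enc_lt ?(perm_uniq pl) ?iota_uniq // => /eqP/enc_inj.
by case/negP: (negbT (H (perm inj))); apply/forallP => p; rewrite permE.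
Qed.

Definition M22_check l :=
  [&& is_lperm l, nth 0 l 23 == 23, nth 0 l 0 == 0
    & all (fun i => golay_reduce (word_of [seq nth 0 l n | n <- nats24 & in_golay_gen i n])
             == BinNums.N0) (iota 0 23)].

Lemma lperm_M22 l : M22_check l -> lperm l \in M22.
Proof.
case/and4P=> pl /eqP l23 /eqP l0 /allP H.
apply/M22P; rewrite !lpermE ?l23 ?l0 //; split=> //; apply/M24P=> i.
have /H/eqP/golay_reduce_code : val i \in iota 0 23.
  by rewrite mem_iota; apply: ltn_ord.
apply: eq_code; apply/setP=> p; rewrite inE bit_word_of.
apply/mapP/imsetP => [[n] | [q]].
  rewrite mem_filter mem_iota => /andP[ni /= ltn] En.
  by exists (dec n); rewrite ?golay_genE // lpermE // -En encK.
rewrite -(encK q); move: (enc q) (enc_lt q) => n ltn.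
rewrite golay_genE // lpermE // => ni ->.
by exists n; rewrite ?mem_filter ?ni ?mem_iota // decK ?is_lperm_lt.
Qed.

(* Permutations of the labels 0..23, with 23 for infinity; the first two generate the
   stabiliser M21 of the point labelled 1. *)
Definition perm_a : seq nat :=
  [:: 0; 1; 18; 14; 3; 4; 13; 19; 20; 8; 12; 5; 6; 7; 21; 11; 9; 10; 22; 17;
      2; 15; 16; 23].
Definition perm_b : seq nat :=
  [:: 0; 1; 21; 20; 12; 8; 5; 11; 18; 19; 6; 14; 10; 22; 17; 2; 3; 16; 4; 13;
      7; 9; 15; 23].
Definition perm_m : seq nat :=
  [:: 0; 21; 2; 10; 15; 13; 7; 6; 20; 9; 3; 11; 14; 5; 12; 4; 16; 17; 22; 19;
      8; 1; 18; 23].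

Lemma checks : [/\ M22_check perm_a, M22_check perm_b & M22_check perm_m].
Proof. by split; vm_compute. Qed.

End M22Elements.

(** * Octads, and what a permutation in M24 fixes *)

Module Octads.

Import GolayCode M22Elements.
Local Open Scope nat_scope.

Local Opaque line23 lperm dec enc is_lperm M22_check.

(** The symmetric difference is a word of weight at most 6, hence empty. *)
Lemma code_diff_eq c d : c \in golay_code -> d \in golay_code ->
  #|c| = 8 -> #|d| = 8 -> 4 < #|c :&: d| -> c = d.
Proof.
move=> cC dC c8 d8 lt.
have := golay_code_add cC dC; set e := [set p | _] => eC.
have Ee : e = (c :\: d) :|: (d :\: c).
  by apply/setP=> p; rewrite !inE; do 2!case: (_ \in _).
have e8 : #|e| < 8.
  rewrite Ee; apply: leq_ltn_trans (leq_card_setU _ _) _.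
  have := cardsID d c; have := cardsID c d; rewrite c8 d8 setIC.
  by move: lt; move: #|_ :&: _| #|_ :\: _| #|_ :\: _| => x y z; lia.
have [e0|/(golay_min_weight eC)] := eqVneq e set0; last by rewrite leqNgt e8.
apply/setP=> p; have := in_set0 p; rewrite -e0 inE.
by do 2!case: (_ \in _).
Qed.

Definition is_octad (o : seq nat) :=
  [&& golay_reduce (word_of o) == BinNums.N0, uniq o, size o == 8 & all (gtn 24) o].

Lemma wset_octad o : is_octad o ->
  wset (word_of o) \in golay_code /\ #|wset (word_of o)| = 8.
Proof.
case/and4P=> /eqP/golay_reduce_code oC uo /eqP so /allP lo; split=> //.
rewrite card_wset /weight -size_filter -so; apply: perm_size.
apply: uniq_perm; rewrite ?filter_uniq ?iota_uniq // => n.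
rewrite mem_filter bit_word_of mem_iota; case no: (n \in o) => //=.
exact: lo.
Qed.

Definition pfix (s : {perm line23}) (l : seq nat) : bool :=
  all (fun n => s (dec n) == dec n) l.

(** The octad and its image share five fixed points, so they coincide. *)
Lemma octad_fixed s l o : s \in M24 -> is_octad o -> pfix s l -> uniq l ->
    4 < count (mem o) l ->
  forall p, (s p \in wset (word_of o)) = (p \in wset (word_of o)).
Proof.
move=> sM oo /allP fl ul cl; have [oC o8] := wset_octad oo.
have lo n : n \in o -> n < 24 by have /and4P[_ _ _ /allP lo] := oo; apply: lo.
suff E : s @: wset (word_of o) = wset (word_of o).
  by move=> p; rewrite -{1}E mem_imset //; apply: perm_inj.
apply: code_diff_eq; rewrite ?card_imset ?M24_code //; first exact: perm_inj.
apply: leq_trans cl _; rewrite -size_filter -(size_map dec).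
set l' := filter _ _; have ul' : uniq (map dec l').
  rewrite map_inj_in_uniq ?filter_uniq // => m n.
  rewrite !mem_filter => /andP[/lo lm _] /andP[/lo ln _]; exact: dec_inj.
rewrite -(card_uniqP ul'); apply/subset_leq_card/subsetP=> p /mapP[n].
rewrite mem_filter => /andP[/= no nl] ->; have ltn := lo _ no.
rewrite inE wset_dec // bit_word_of no andbT.
by rewrite -(eqP (fl _ nl)) mem_imset ?wset_dec ?bit_word_of //; apply: perm_inj.
Qed.

(** The listed octads distinguish [n] from every other point, so a permutation preserving all of
    them fixes [n]. *)
Definition separates (ols : seq (seq nat)) (n : nat) : bool :=
  all (fun m => (m == n) || has (fun o => (n \in o) (+) (m \in o)) ols) nats24.

Lemma fixed_by_octads s l ols l' : s \in M24 -> pfix s l -> uniq l ->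
    all (fun o => is_octad o && (4 < count (mem o) l)) ols ->
    all (fun n => (n \in l) || (n < 24) && separates ols n) l' ->
  pfix s l'.
Proof.
move=> sM fl ul /allP ho /allP hl; apply/allP=> n /hl/orP[/(allP fl) // | /andP[ltn /allP hs]].
have /hs : enc (s (dec n)) \in nats24 by rewrite mem_iota; apply: enc_lt.
case/orP=> [/eqP E | /hasP[o /[dup] oo /ho/andP[ho1 ho2]]]; first by rewrite -{2}E encK.
have := octad_fixed sM ho1 fl ul ho2 (dec n).
rewrite -{1}(encK (s (dec n))) !wset_dec ?enc_lt // !bit_word_of => ->.
by rewrite addbb.
Qed.

Definition octads1 : seq (seq nat) :=
  [:: [:: 0; 1; 2; 4; 13; 16; 22; 23]; [:: 0; 1; 2; 3; 5; 14; 17; 23];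
      [:: 0; 2; 3; 4; 5; 15; 20; 22]; [:: 1; 2; 3; 4; 6; 15; 18; 23];
      [:: 0; 1; 3; 4; 5; 6; 16; 21]; [:: 1; 2; 4; 5; 12; 20; 21; 23];
      [:: 2; 3; 4; 5; 7; 16; 19; 23]; [:: 0; 1; 4; 5; 7; 8; 15; 23];
      [:: 0; 1; 2; 4; 5; 9; 18; 19]; [:: 1; 3; 4; 5; 9; 10; 22; 23]].

Definition octads2 : seq (seq nat) :=
  [:: [:: 0; 1; 13; 15; 17; 18; 19; 23]; [:: 0; 2; 13; 14; 15; 16; 17; 20];
      [:: 3; 5; 6; 7; 14; 17; 19; 21]] ++ octads1.

(** The seven points are six of one octad and one outside it. Octads with five fixed points show
    that everything but 14 and 17 is fixed; the three octads added in [octads2] then deal with these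
    two. *)
Lemma octads_trivial s : s \in M24 -> pfix s [:: 23; 0; 1; 2; 3; 5; 4] -> s = 1%g.
Proof.
set l1 := [:: _; _; _; _; _; _; _] => sM f1.
pose l2 := rem 14 (rem 17 nats24).
have f2 : pfix s l2.
  have c1 : all (fun o => is_octad o && (4 < count (mem o) l1)) octads1 by vm_compute.
  apply: (fixed_by_octads sM f1 _ c1); first by vm_compute.
  by vm_compute.
have f3 : pfix s nats24.
  have c2 : all (fun o => is_octad o && (4 < count (mem o) l2)) octads2 by vm_compute.
  apply: (fixed_by_octads sM f2 _ c2); first by vm_compute.
  by vm_compute.
apply/permP => p; rewrite perm1; rewrite -(encK p).
move: (enc p) (enc_lt p) => n ltn.
by apply/eqP/(allP f3); rewrite mem_iota.
Qed.

Definition orb_step (fs : seq (seq nat)) (S : seq nat) : seq nat :=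
  undup (S ++ flatten [seq [seq nth 0 f n | n <- S] | f <- fs]).

Definition realized (K : {set {perm line23}}) (f : seq nat) :=
  exists2 s, s \in K & forall n, n < 24 -> s (dec n) = dec (nth 0 f n) /\ nth 0 f n < 24.

Lemma orb_iter (K : {group {perm line23}}) fs a k n : a < 24 ->
    (forall f, f \in fs -> realized K f) ->
    n \in iter k (orb_step fs) [:: a] ->
  dec n \in orbit 'P K (dec a) /\ n < 24.
Proof.
move=> lta Hf; elim: k n => [|k IH] n /=.
  by rewrite inE => /eqP->; split=> //; apply: orbit_refl.
rewrite mem_undup mem_cat => /orP[/IH // | /flattenP[_ /mapP[f /Hf[s sK Es] ->]]].
case/mapP=> m /IH[mK ltm] ->; have [Em lt] := Es _ ltm; split=> //.
apply: (orbit_trans _ mK); rewrite -Em -apermE.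
exact: (mem_orbit 'P).
Qed.

Definition word_list (w : seq bool) : seq nat :=
  foldl (fun l (b : bool) => [seq nth 0 (if b then perm_b else perm_a) n | n <- l]) nats24 w.

Definition K21 : {group {perm line23}} := <<[set lperm perm_a; lperm perm_b]>>%G.

Lemma word_realized w : realized K21 (word_list w).
Proof.
have [/and4P[ca _ _ _] /and4P[cb _ _ _] _] := checks.
rewrite /word_list; have : realized K21 nats24 /\ size nats24 = 24.
  split; last by rewrite size_iota.
  exists 1%g => [|n ltn]; first exact: group1.
  rewrite nth_iota; last by [].
  rewrite add0n; split; last by [].
  exact: perm1.
elim: w nats24 => [|b w IH] l [[s sK Hs] sl]; first by exists s.
apply: IH.
split; last by rewrite size_map.
exists (s * lperm (if b then perm_b else perm_a))%g.
  by apply: (groupM sK); apply: mem_gen; case: b; [apply: set22 | apply: set21].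
move=> n ltn; have [E lt] := Hs n ltn; rewrite permM E (nth_map 0) ?sl //.
by case: b; rewrite lpermE // is_lperm_lt.
Qed.

Lemma word_in_stab w a : a < 24 -> nth 0 (word_list w) a = a ->
  forall K : {group {perm line23}}, realized K (word_list w) ->
  realized 'C_K[dec a | 'P] (word_list w).
Proof.
move=> lta wa K [s sK Hs]; exists s => //; rewrite inE sK.
by apply/astab1P; rewrite /= apermE; case: (Hs a lta) => ->; rewrite wa.
Qed.

End Octads.

(** * The order of the point stabiliser M21, and generators for it *)

Module M22Stabilizers.

Import GolayCode M22Elements Octads.
Local Open Scope nat_scope.
Local Opaque line23 lperm dec enc is_lperm M22_check M22 M24.

Lemma orbit_lower (K : {group {perm line23}}) fs a k (l : seq nat) : a < 24 ->
    (forall f, f \in fs -> realized K f) -> uniq l ->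
    all (mem (iter k (orb_step fs) [:: a])) l ->
  [/\ size l <= #|orbit 'P K (dec a)|
    & forall n, n \in l -> dec n \in orbit 'P K (dec a)].
Proof.
move=> lta Hf ul /allP sub.
have H n : n \in l -> dec n \in orbit 'P K (dec a) /\ n < 24.
  by move/sub; apply: orb_iter.
split=> [|n /H[] //].
have U : uniq (map dec l).
  by rewrite map_inj_in_uniq // => m n /H[_ lm] /H[_ ln]; apply: dec_inj.
rewrite -(size_map dec) -(card_uniqP U); apply/subset_leq_card/subsetP=> p.
by case/mapP=> n /H[nK _] ->.
Qed.

Lemma orbit_upper (K : {group {perm line23}}) a (l : seq nat) : a < 24 -> uniq l ->
    (forall s, s \in K -> enc (s (dec a)) \in l) ->
  #|orbit 'P K (dec a)| <= size l.
Proof.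
move=> lta ul H.
apply: leq_trans (_ : #|[set p in map dec l]| <= _); last first.
  by rewrite cardsE -(size_map dec) card_size.
apply/subset_leq_card/subsetP=> p /orbitP[s /H sl <-]; rewrite inE /= apermE.
by apply/mapP; exists (enc (s (dec a))); rewrite ?encK.
Qed.

Lemma not_fixed_image s a (l : seq nat) : a < 24 -> all (gtn 24) l -> a \notin l -> pfix s l ->
  enc (s (dec a)) \in [seq n <- nats24 | n \notin l].
Proof.
move=> lta /allP ll al /allP fl; rewrite mem_filter mem_iota enc_lt /= andbT.
apply: contra al => sl; move: (fl _ sl); rewrite encK => /eqP/perm_inj E.
by rewrite -(decK lta) -E.
Qed.

Definition stab1 (K : {group {perm line23}}) a : {group {perm line23}} :=
  'C_K[dec a | 'P]%G.

Lemma in_stab1 (K : {group {perm line23}}) a s :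
  (s \in stab1 K a) = (s \in K) && (s (dec a) == dec a).
Proof.
rewrite in_setI; congr (_ && _).
by apply/astab1P/eqP; rewrite /= apermE.
Qed.

Definition G1 := stab1 M22 1.
Definition G2 := stab1 G1 2.
Definition G3 := stab1 G2 3.
Definition G4 := stab1 G3 5.

Lemma M22_fix s : s \in M22 -> (s \in M24) && pfix s [:: 23; 0].
Proof. by case/M22P=> -> e23 e0; rewrite /pfix /= e23 e0 !eqxx. Qed.

Lemma G1_fix s : s \in G1 -> (s \in M24) && pfix s [:: 23; 0; 1].
Proof.
rewrite in_stab1 => /andP[/M22_fix/andP[-> /and3P[f1 f2 _]] f3].
by apply/and5P.
Qed.

Lemma G2_fix s : s \in G2 -> (s \in M24) && pfix s [:: 23; 0; 1; 2].
Proof.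
rewrite in_stab1 => /andP[/G1_fix/andP[-> /and4P[f1 f2 f3 _]] f4].
by rewrite /= f1 f2 f3 f4.
Qed.

Lemma G3_fix s : s \in G3 -> (s \in M24) && pfix s [:: 23; 0; 1; 2; 3].
Proof.
rewrite in_stab1 => /andP[/G2_fix/andP[-> /and5P[f1 f2 f3 f4 _]] f5].
by rewrite /= f1 f2 f3 f4 f5.
Qed.

Lemma G4_fix s : s \in G4 -> (s \in M24) && pfix s [:: 23; 0; 1; 2; 3; 5].
Proof.
rewrite in_stab1 => /andP[/G3_fix/andP[->]] /=.
by case/and5P=> -> -> -> -> /andP[-> _] ->.
Qed.

Definition octad0 := [:: 0; 1; 2; 3; 5; 14; 17; 23].

Lemma G3_octad s : s \in G3 -> forall p,
  (s p \in wset (word_of octad0)) = (p \in wset (word_of octad0)).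
Proof.
case/G3_fix/andP=> sM fs.
have oo : is_octad octad0 by vm_compute.
exact: (octad_fixed sM oo fs).
Qed.

(** Along the chain of stabilisers of 1, 2, 3, 5, 4 the successive orbits lie among the 21 points
    other than 23, 0, 1; the 20 that remain without 2; the three points completing the octad through
    23, 0, 1, 2, 3; and the 16 points outside that octad. After that only the identity is left. *)
Lemma card_G1_upper : #|G1| <= 21 * (20 * (3 * 16)).
Proof.
have H2 : #|orbit 'P G1 (dec 2)| <= 21.
  apply: (@orbit_upper _ _ [seq n <- nats24 | n \notin [:: 23; 0; 1]]) => // s.
  by case/G1_fix/andP=> _ fs; apply: not_fixed_image.
have H3 : #|orbit 'P G2 (dec 3)| <= 20.
  apply: (@orbit_upper _ _ [seq n <- nats24 | n \notin [:: 23; 0; 1; 2]]) => // s.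
  by case/G2_fix/andP=> _ fs; apply: not_fixed_image.
have H5 : #|orbit 'P G3 (dec 5)| <= 3.
  apply: (@orbit_upper _ _ [:: 5; 14; 17]) => // s sG3.
  have [/andP[sM fs] oE] := (G3_fix sG3, G3_octad sG3 (dec 5)).
  have := @not_fixed_image s 5 [:: 23; 0; 1; 2; 3] isT isT isT fs.
  have : enc (s (dec 5)) \in octad0.
    by move: oE; rewrite -{1}(encK (s _)) !wset_dec ?enc_lt // !bit_word_of => ->.
  rewrite mem_filter => o5 /andP[n5 _]; apply: implyP n5.
  by move: (enc _) o5; apply/allP.
have H4 : #|orbit 'P G4 (dec 4)| <= 16.
  apply: (@orbit_upper _ _ [seq n <- nats24 | n \notin octad0]) => // s sG4.
  have := sG4; rewrite in_stab1 => /andP[/G3_octad/(_ (dec 4)) oE _].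
  rewrite mem_filter mem_iota enc_lt /= andbT.
  by move: oE; rewrite -{1}(encK (s _)) !wset_dec ?enc_lt // !bit_word_of => ->.
have H6 : #|stab1 G4 4| <= 1.
  rewrite -[X in _ <= X](cards1 (1%g : {perm line23})); apply/subset_leq_card/subsetP=> s.
  rewrite in_stab1 => /andP[/G4_fix/andP[sM]] /=.
  case/and5P=> f1 f2 f3 f4 /and3P[f5 f6 _] f7; rewrite inE; apply/eqP.
  by apply: octads_trivial => //=; rewrite f1 f2 f3 f4 f5 f6 f7.
rewrite -(card_orbit_stab 'P G1 (dec 2)) -(card_orbit_stab 'P G2 (dec 3)).
rewrite -(card_orbit_stab 'P G3 (dec 5)) -(card_orbit_stab 'P G4 (dec 4)).
by rewrite (leq_mul H2 (leq_mul H3 (leq_mul H5 (leq_mul H4 H6)))).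
Qed.

Lemma K21_sub : K21 \subset G1.
Proof.
have [pa pb] : lperm perm_a \in M22 /\ lperm perm_b \in M22.
  by have [/lperm_M22 pa /lperm_M22 pb _] := checks.
have [la lb] : is_lperm perm_a /\ is_lperm perm_b.
  by have [/and4P[la _ _ _] /and4P[lb _ _ _] _] := checks.
rewrite gen_subG; apply/subsetP=> s; rewrite in_set2.
by case/orP=> /eqP->; rewrite in_stab1 ?pa ?pb lpermE /=.
Qed.

(** Here and in the next two lists: words in the generators, [true] for [perm_b], that fix 2, then 2
    and 3, then 2, 3 and 5. Their orbits attain the upper bounds of [card_G1_upper]. *)
Definition words2 : seq (seq bool) :=
  [:: [:: true; false; true]; [:: false; false; true; true]].
Definition words23 : seq (seq bool) :=
  [:: [:: false; false; true; false; true; false; false; true]].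
Definition words235 : seq (seq bool) :=
  [:: [:: false; false; false; true; false; false; false; true];
      [:: true; true; true; false; true; true; true; false];
      [:: false; true; true; false; true; false; false; true; false; true;
          false; true];
      [:: false; false; true; true; false; false; false; true; true; false;
          true; false; true]].

Definition K2 := stab1 K21 2.
Definition K3 := stab1 K2 3.
Definition K4 := stab1 K3 5.

Lemma K21_orbits :
  [/\ forall n, n \in [seq n <- nats24 | n \notin [:: 23; 0; 1]] ->
        dec n \in orbit 'P K21 (dec 2),
      forall n, n \in [seq n <- nats24 | n \notin [:: 23; 0; 1; 2]] ->
        dec n \in orbit 'P K2 (dec 3),
      forall n, n \in [seq n <- nats24 | n \notin octad0] ->
        dec n \in orbit 'P K4 (dec 4)
    & 21 * (20 * (3 * 16)) <= #|K21|].
Proof.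
have [||| c1 h1] := @orbit_lower K21 (map word_list [:: [:: false]; [:: true]]) 2 10
  [seq n <- nats24 | n \notin [:: 23; 0; 1]] isT.
- by move=> f /mapP[w _ ->]; apply: word_realized.
- by [].
- by vm_compute.
have [||| c2 h2] := @orbit_lower K2 (map word_list words2) 3 10
  [seq n <- nats24 | n \notin [:: 23; 0; 1; 2]] isT.
- move=> f /mapP[w ww ->]; apply: word_in_stab (word_realized w) => //.
  by apply/eqP; move: w ww; apply/allP; vm_compute.
- by [].
- by vm_compute.
have [||| c3 _] := @orbit_lower K3 (map word_list words23) 5 5 [:: 5; 14; 17] isT.
- move=> f /mapP[w ww ->].
  have /andP[/eqP w2 /eqP w3] : (nth 0 (word_list w) 2 == 2) && (nth 0 (word_list w) 3 == 3).
    by move: w ww; apply/allP; vm_compute.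
  by do 2![apply: word_in_stab => //]; apply: word_realized.
- by [].
- by vm_compute.
have [||| c4 h4] := @orbit_lower K4 (map word_list words235) 4 10
  [seq n <- nats24 | n \notin octad0] isT.
- move=> f /mapP[w ww ->].
  have /and3P[/eqP w2 /eqP w3 /eqP w5] : [&& nth 0 (word_list w) 2 == 2,
      nth 0 (word_list w) 3 == 3 & nth 0 (word_list w) 5 == 5].
    by move: w ww; apply/allP; vm_compute.
  by do 3![apply: word_in_stab => //]; apply: word_realized.
- by [].
- by vm_compute.
split; [exact: h1 | exact: h2 | exact: h4 |].
rewrite -(card_orbit_stab 'P K21 (dec 2)) -(card_orbit_stab 'P K2 (dec 3)).
rewrite -(card_orbit_stab 'P K3 (dec 5)) -(card_orbit_stab 'P K4 (dec 4)).
apply: leq_trans (leq_mul c1 (leq_mul c2 (leq_mul c3 (leq_mul c4 (cardG_gt0 _))))).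
by vm_compute.
Qed.

Lemma K21_G1 : K21 = G1.
Proof.
have [_ _ _ H] := K21_orbits.
by apply/val_inj/eqP; rewrite /= eqEcard K21_sub (leq_trans card_G1_upper).
Qed.

Lemma card_G1 : #|G1| = 21 * (20 * (3 * 16)).
Proof.
apply/eqP; rewrite eqn_leq card_G1_upper -K21_G1.
by have [_ _ _ ->] := K21_orbits.
Qed.

End M22Stabilizers.

(** * The 22 points as labels, 3-transitivity, and the hexad relation *)

Module M22Labels.

Import GolayCode M22Elements Octads M22Stabilizers.
Local Open Scope nat_scope.
Local Opaque line23 lperm dec enc is_lperm M22_check M22 M24.

Notation I22 := 'I_22.

(** The numbers 0 and 23 belong to the two points fixed by M22, hence the shift by one. *)
Definition lab (i : I22) : line23 := dec i.+1.
Definition unlab (p : line23) : I22 := inord (enc p).-1.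
Definition act22 (s : {perm line23}) (i : I22) : I22 := unlab (s (lab i)).

Lemma lab_lt (i : I22) : i.+1 < 24.
Proof. by rewrite ltnS (ltn_trans (ltn_ord i)). Qed.

Lemma enc_lab i : enc (lab i) = i.+1.
Proof. by rewrite decK ?lab_lt. Qed.

Lemma labK : cancel lab unlab.
Proof. by move=> i; rewrite /unlab enc_lab inord_val. Qed.

Lemma lab_inj : injective lab. Proof. exact: can_inj labK. Qed.

Lemma M22_fixedE p : (p \in M22_fixed) = (enc p == 23) || (enc p == 0).
Proof.
have E0 : dec 0 = Some 0%R by congr Some; apply: val_inj.
have E23 : dec 23 = None by [].
by rewrite in_set2 -E0 -E23 -!(inj_eq enc_inj) !decK.
Qed.

Lemma lab_not_fixed i : lab i \notin M22_fixed.
Proof.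
by rewrite M22_fixedE enc_lab orbF eqSS ltn_eqF ?ltn_ord.
Qed.

Lemma unlabK p : p \notin M22_fixed -> lab (unlab p) = p.
Proof.
rewrite M22_fixedE => H; apply: enc_inj; rewrite enc_lab /unlab.
have := enc_lt p; move: H; case: (enc p) => [|n]; rewrite ?orbT // orbF /= eqSS ltnS.
by move=> H lt; rewrite inordK // ltn_neqAle H -ltnS.
Qed.

Lemma M22_stable s p : s \in M22 -> (s p \in M22_fixed) = (p \in M22_fixed).
Proof.
case/M22P=> _ e23 e0; rewrite !M22_fixedE -[23](@decK 23) // -{2 4}[0](@decK 0) //.
by rewrite !(inj_eq enc_inj) -{1}e23 -{1}e0 !(inj_eq perm_inj).
Qed.

Lemma lab_act s i : s \in M22 -> lab (act22 s i) = s (lab i).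
Proof. by move=> sM; rewrite unlabK // M22_stable // lab_not_fixed. Qed.

Lemma act22M s t i : s \in M22 -> act22 (s * t) i = act22 t (act22 s i).
Proof. by move=> sM; rewrite /act22 -/(act22 s i) lab_act // permM. Qed.

Lemma act22_1 i : act22 1 i = i.
Proof. by rewrite /act22 perm1 labK. Qed.

Lemma act22_inj s : s \in M22 -> injective (act22 s).
Proof.
move=> sM i j /(congr1 lab); rewrite !lab_act // => /perm_inj; exact: lab_inj.
Qed.

Lemma act22_eq1 s : s \in M22 -> (forall i, act22 s i = i) -> s = 1%g.
Proof.
move=> sM H; apply/permP=> p; rewrite perm1.
have [pf|npf] := boolP (p \in M22_fixed); last first.
  by rewrite -(unlabK npf) -lab_act // H.
case/M22P: sM => _ e23 e0; move: pf; rewrite M22_fixedE.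
by case/orP=> /eqP e; rewrite -(encK p) e.
Qed.

Definition o22 (n : nat) : I22 := inord n.

Lemma lab_o22 n : n < 22 -> lab (o22 n) = dec n.+1.
Proof. by move=> lt; rewrite /lab inordK. Qed.

Lemma M22_check_realized l : M22_check l -> realized M22 l.
Proof.
move=> /[dup] /lperm_M22 pl /and4P[ll _ _ _]; exists (lperm l) => // n ltn.
by rewrite lpermE // is_lperm_lt.
Qed.

Lemma M22_trans1 a : exists2 s, s \in M22 & act22 s a = o22 0.
Proof.
have H : forall n, n \in [seq n <- nats24 | n \notin [:: 23; 0]] ->
    dec n \in orbit 'P M22 (dec 1).
  have [|||_ H] := @orbit_lower M22 [:: perm_a; perm_b; perm_m] 1 20
    [seq n <- nats24 | n \notin [:: 23; 0]] isT; last exact: H.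
  - have [ha hb hm] := checks.
    move=> f; rewrite !inE; case/or3P=> /eqP->; apply: M22_check_realized;
      [exact: ha | exact: hb | exact: hm].
  - by vm_compute.
  by vm_compute.
have /H : (a.+1 : nat) \in [seq n <- nats24 | n \notin [:: 23; 0]].
  rewrite mem_filter mem_iota lab_lt andbT /= !inE orbF eqSS.
  by rewrite ltn_eqF ?ltn_ord.
rewrite orbit_sym => /orbitP[s sM]; rewrite /= apermE => E.
by exists s => //; rewrite /act22 E -(lab_o22 (isT : 0 < 22)) labK.
Qed.

Lemma act22_dec s n : s \in M22 -> n < 22 ->
  (act22 s (o22 n) == o22 n) = (s (dec n.+1) == dec n.+1).
Proof.
by move=> sM ln; rewrite -lab_o22 // -(inj_eq lab_inj) lab_act.
Qed.

Lemma G1P s : (s \in G1) = (s \in M22) && (act22 s (o22 0) == o22 0).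
Proof. by rewrite in_stab1; case: (boolP (s \in M22)) => //= sM; rewrite act22_dec. Qed.

Lemma G1_trans a : a != o22 0 -> exists2 s, s \in G1 & act22 s a = o22 1.
Proof.
move=> na; have [/(_ a.+1) H _ _ _] := K21_orbits; move: H; rewrite K21_G1.
rewrite mem_filter mem_iota lab_lt andbT /= !inE !eqSS.
rewrite (ltn_eqF (ltn_ord a)) /=; case: (altP (_ =P 0)) => [a0|_ /(_ isT)].
  by case/eqP: na; apply: val_inj; rewrite /= a0 inordK.
rewrite orbit_sym => /orbitP[s sM]; rewrite /= apermE => E.
by exists s => //; rewrite /act22 E -(lab_o22 (isT : 1 < 22)) labK.
Qed.

Lemma G2P s : (s \in G2) = [&& s \in M22, act22 s (o22 0) == o22 0 & act22 s (o22 1) == o22 1].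
Proof.
rewrite in_stab1 G1P -andbA; case: (boolP (s \in M22)) => //= sM.
by congr (_ && _); rewrite act22_dec.
Qed.

Lemma G2_trans a : a != o22 0 -> a != o22 1 -> exists2 s, s \in G2 & act22 s a = o22 2.
Proof.
move=> na nb; have [_ /(_ a.+1) H _ _] := K21_orbits; move: H.
rewrite /K2 K21_G1 -/G2 mem_filter mem_iota lab_lt andbT /= !inE !eqSS.
rewrite (ltn_eqF (ltn_ord a)) /=; case: (altP (_ =P 0)) => [a0|_].
  by case/eqP: na; apply: val_inj; rewrite /= a0 inordK.
case: (altP (_ =P 1)) => [a0|_ /(_ isT)].
  by case/eqP: nb; apply: val_inj; rewrite /= a0 inordK.
rewrite orbit_sym => /orbitP[s sM]; rewrite /= apermE => E.
by exists s => //; rewrite /act22 E -(lab_o22 (isT : 2 < 22)) labK.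
Qed.

Lemma M22_3trans a b c : a != b -> a != c -> b != c ->
  exists2 s, s \in M22 & [/\ act22 s a = o22 0, act22 s b = o22 1 & act22 s c = o22 2].
Proof.
move=> ab ac bc; have [s sM sa] := M22_trans1 a.
have inj := inj_eq (act22_inj sM).
have b0 : act22 s b != o22 0 by rewrite -sa inj eq_sym.
have [t tG tb] := G1_trans b0.
move: (tG); rewrite G1P => /andP[tM /eqP t0].
have injt := inj_eq (act22_inj tM).
have c0 : act22 t (act22 s c) != o22 0 by rewrite -t0 injt -sa inj eq_sym.
have c1 : act22 t (act22 s c) != o22 1 by rewrite -tb injt inj eq_sym.
have [u uG uc] := G2_trans c0 c1.
move: (uG); rewrite G2P => /and3P[uM /eqP u0 /eqP u1].
exists (s * t * u)%g; first by rewrite !groupM.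
by rewrite !act22M ?groupM // sa t0 u0 tb u1.
Qed.

Lemma G3P s : (s \in G3) = [&& s \in M22, act22 s (o22 0) == o22 0,
  act22 s (o22 1) == o22 1 & act22 s (o22 2) == o22 2].
Proof.
rewrite in_stab1 G2P -!andbA; case: (boolP (s \in M22)) => //= sM.
by do 2!congr (_ && _); rewrite act22_dec.
Qed.

Lemma G3_trans (d : I22) : d.+1 \notin octad0 -> exists2 s, s \in G3 & act22 s d = o22 3.
Proof.
move=> nd; have [_ _ /(_ d.+1) H _] := K21_orbits.
move: H; rewrite mem_filter mem_iota nd lab_lt => /(_ isT).
rewrite orbit_sym => /orbitP[s sK]; rewrite /= apermE => E.
exists s; last by rewrite /act22 E -(lab_o22 (isT : 3 < 22)) labK.
have sub : K4 \subset G3.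
  apply: subset_trans (subsetIl _ _) _; rewrite /K3 /G3 /K2 K21_G1; exact: subxx.
exact: (subsetP sub).
Qed.

(** By 3-transitivity the triple may be taken to be 0, 1, 2. Its stabiliser is transitive on the 16
    points outside the hexad, so an invariant set that contains one of them has at least 16
    elements; a set of three must be the rest of the hexad. *)
Lemma hexad_relE (R : I22 -> I22 -> I22 -> I22 -> bool) (h : seq nat) (a b c d : I22) :
    (forall s a b c d, s \in M22 ->
       R (act22 s a) (act22 s b) (act22 s c) (act22 s d) = R a b c d) ->
    #|[set d in ~: [set o22 0; o22 1; o22 2] | R (o22 0) (o22 1) (o22 2) d]| = 3 ->
    is_octad (0 :: 23 :: map S h) ->
    [&& (a : nat) \in h, (b : nat) \in h & (c : nat) \in h] ->
    [&& a != b, a != c & b != c] -> [&& d != a, d != b & d != c] ->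
  R a b c d = ((d : nat) \in h).
Proof.
move=> Rinv R3 oh /and3P[ah bh ch] /and3P[ab ac bc] /and3P[da db dc].
have [s sM [sa sb sc]] := M22_3trans ab ac bc.
have [sM24 s23 s0] := M22P s sM.
have [O0C O08] := @wset_octad octad0 (isT <: is_octad octad0).
have [OC O8] := wset_octad oh.
(* The two octads share infinity, 0 and the three base points, and so are equal. *)
have sO : s @: wset (word_of (0 :: 23 :: map S h)) = wset (word_of octad0).
  apply: code_diff_eq => //; [exact: M24_code | by rewrite card_imset //; apply: perm_inj |].
  have l5 : all (gtn 24) [:: 0; 23; 1; 2; 3] by [].
  apply: leq_trans (_ : #|[set p in map dec [:: 0; 23; 1; 2; 3]]| <= _).
    rewrite cardsE; have /card_uniqP -> // : uniq (map dec [:: 0; 23; 1; 2; 3]).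
    rewrite map_inj_in_uniq // => m n /(allP l5) lm /(allP l5) ln.
    exact: (dec_inj lm ln).
  have injs := @perm_inj _ s.
  have mO n : n < 24 -> n \in 0 :: 23 :: map S h ->
      s (dec n) \in s @: wset (word_of (0 :: 23 :: map S h)).
    by move=> ltn nO; rewrite mem_imset // wset_dec // bit_word_of.
  have mI x : (x : I22) \in [:: a; b; c] ->
      lab (act22 s x) \in s @: wset (word_of (0 :: 23 :: map S h)).
    move=> xI; rewrite lab_act // mO ?lab_lt // !inE.
    rewrite mem_map ?orbA; last by move=> ? ? [].
    by move: xI; rewrite !inE => /or3P[] /eqP->; rewrite ?ah ?bh ?ch orbT.
  have m1 := mI a; have m2 := mI b; have m3 := mI c; clear mI.
  move: m1 m2 m3; rewrite sa sb sc !lab_o22 // !inE !eqxx ?orbT.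
  move=> /(_ isT) m1 /(_ isT) m2 /(_ isT) m3.
  apply/subset_leq_card/subsetP=> p; rewrite inE => /mapP[n nl ->].
  rewrite in_setI; apply/andP; split.
    move: nl; rewrite !inE; case/or4P=> [||| /orP[]] /eqP -> //.
      by rewrite -s0 mO // inE.
    by rewrite -s23 mO // inE orbT.
  have nl24 := allP l5 n nl.
  rewrite wset_dec // bit_word_of; move: n nl {nl24}.
  by apply/allP.
have dE : ((d : nat) \in h) = ((act22 s d).+1 \in octad0).
  rewrite -(bit_word_of octad0) -wset_dec ?lab_lt // -/(lab _) lab_act // -sO.
  rewrite mem_imset ?wset_dec ?lab_lt ?bit_word_of //; last exact: perm_inj.
  have dlt : (d.+1 == 23) = false by rewrite ltn_eqF // ltnS ltn_ord.
  by rewrite in_cons in_cons dlt /= mem_map //; apply: succn_inj.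
rewrite dE -(Rinv s) // sa sb sc; set e := act22 s d.
have [e0 e1 e2] : [/\ e != o22 0, e != o22 1 & e != o22 2].
  by rewrite -sa -sb -sc !(inj_eq (act22_inj sM)).
move: R3; set X := [set d in _ | _] => R3.
have small (x : I22) : x.+1 \in octad0 -> x != o22 0 -> x != o22 1 -> x != o22 2 ->
    (x : nat) \in [:: 4; 13; 16].
  move=> xo x0 x1 x2; have E n : n < 22 -> x != o22 n -> (x : nat) != n.
    by move=> ln; apply: contra => /eqP xn; apply/eqP/val_inj; rewrite /= xn inordK.
  move: (E 0 isT x0) (E 1 isT x1) (E 2 isT x2) xo (ltn_ord x).
  by move: (nat_of_ord x) => n n0 n1 n2; rewrite !inE !eqSS (negPf n0) (negPf n1)
    (negPf n2) /= => /or4P[||| /eqP-> //] /eqP->.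
have X16 x : x \in X -> x.+1 \notin octad0 ->
    forall y : I22, y.+1 \notin octad0 -> y \in X.
  move=> xX nx y ny.
  have [t tG tx] := G3_trans nx; have [u uG uy] := G3_trans ny.
  have : (t * u^-1)%g \in G3 by rewrite groupM ?groupV.
  move: (tG) (uG); rewrite !G3P => /and4P[tM _ _ _] /and4P[uM /eqP u0 /eqP u1 /eqP u2].
  case/and4P=> vM /eqP v0 /eqP v1 /eqP v2.
  have vx : act22 (t * u^-1) x = y.
    apply: (act22_inj uM); rewrite -act22M // mulgKV tx uy //.
  move: xX; rewrite !in_set !negb_or => /andP[/andP[/andP[x0 x1] x2] Rx].
  move: x0 x1 x2; rewrite !in_set1 -vx -(inj_eq (act22_inj vM) x (o22 0)).
  rewrite -(inj_eq (act22_inj vM) x (o22 1)) -(inj_eq (act22_inj vM) x (o22 2)).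
  rewrite v0 v1 v2 => -> -> -> /=.
  by rewrite -[o22 0]v0 -[o22 1]v1 -[o22 2]v2 Rinv.
pose Y := [set x : I22 | (x : nat) \in [:: 4; 13; 16]].
have Xsub : X \subset Y.
  apply/subsetP=> x xX; have [xo|nx] := boolP (x.+1 \in octad0).
    move: xX; rewrite !in_set !negb_or !in_set1 => /andP[/andP[/andP[x0 x1] x2] _].
    exact: small.
  (* Four of the 16 outer points are enough to contradict [R3]. *)
  have : #|X| >= size (map o22 [:: 3; 5; 6; 7]).
    rewrite -(card_uniqP _); last first.
      by rewrite map_inj_in_uniq // => m n; rewrite !inE; do 2!(case/or4P=> /eqP->);
         move/(congr1 val) => /=; rewrite !inordK.
    apply/subset_leq_card/subsetP=> y yl; apply: (X16 x xX nx).
    by move: yl; rewrite !inE => /or4P[] /eqP->; rewrite inordK.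
  by rewrite R3.
have XY : X = Y.
  apply/eqP; rewrite eqEcard Xsub R3 /=.
  apply: leq_trans (_ : size (map o22 [:: 4; 13; 16]) <= _); last by [].
  apply: leq_trans (card_size (map o22 [:: 4; 13; 16])).
  apply/subset_leq_card/subsetP=> y; rewrite inE => yl.
  by apply/mapP; exists (y : nat); [exact: yl | rewrite /o22 inord_val].
have : (e \in X) = (e \in Y) by rewrite XY.
rewrite !in_set !negb_or !in_set1 e0 e1 e2 /= => ->; apply/idP/idP => [| eo].
  by rewrite !inE => /or3P[] /eqP->.
exact: small.
Qed.

End M22Labels.

(** * Simplicity of M21, and an involution of M22 with six fixed labels *)

Module M21Simplicity.

Import GolayCode M22Elements Octads M22Stabilizers M22Labels.
Local Open Scope nat_scope.
Local Opaque line23 lperm dec enc is_lperm M22_check M22 M24.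

Definition M21 (x : line23) : {group {perm line23}} := 'C_M22[x | 'P]%G.

Lemma G1_lab0 : G1 = M21 (lab (o22 0)).
Proof. by rewrite lab_o22. Qed.

Lemma in_M21 x s : (s \in M21 x) = (s \in M22) && (s x == x).
Proof.
rewrite in_setI; congr (_ && _).
by apply/astab1P/eqP; rewrite /= apermE.
Qed.

Lemma M21_conj x s : s \in M22 -> M21 (s x) = (M21 x :^ s)%G.
Proof.
move=> sM; apply/val_inj/setP=> t /=; rewrite mem_conjg !in_M21.
rewrite groupJr ?groupV //; congr (_ && _).
rewrite conjgE invgK !permM -(inj_eq (@perm_inj _ s^-1%g)).
by rewrite permK.
Qed.

Lemma M21_conj_G1 x : x \notin M22_fixed -> exists2 s, s \in M22 & M21 x = (G1 :^ s)%G.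
Proof.
move=> nx; have [s sM sx] := M22_trans1 (unlab x).
exists s^-1%g; rewrite ?groupV //; rewrite G1_lab0 -sx lab_act // unlabK //.
by rewrite -M21_conj ?groupV // permK.
Qed.

Lemma card_M21 x : x \notin M22_fixed -> #|M21 x| = 21 * (20 * (3 * 16)).
Proof. by case/M21_conj_G1=> s sM ->; rewrite cardJg card_G1. Qed.

Definition S21 := ~: [set dec 23; dec 0; dec 1].

Lemma S21E p : (p \in S21) = (enc p \notin [:: 23; 0; 1]).
Proof.
by rewrite !inE -!(inj_eq enc_inj) !decK // orbA.
Qed.

Lemma orbit_G1 : orbit 'P G1 (dec 2) = S21.
Proof.
apply/setP=> p; rewrite S21E -K21_G1; apply/idP/idP => [/orbitP[s sK <-] |].
  have /G1_fix/andP[_ fs] : s \in G1 by rewrite -K21_G1.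
  have := @not_fixed_image s 2 [:: 23; 0; 1] isT isT isT fs.
  by rewrite mem_filter => /andP[].
move=> np; rewrite -(encK p); have [H _ _ _] := K21_orbits; apply: H.
by rewrite mem_filter np mem_iota enc_lt.
Qed.

Lemma orbit_G2 : orbit 'P G2 (dec 3) = S21 :\ dec 2.
Proof.
apply/setP=> p; rewrite in_setD1 S21E; apply/idP/idP => [/orbitP[s /G2_fix/andP[_ fs] <-] |].
  have := @not_fixed_image s 3 [:: 23; 0; 1; 2] isT isT isT fs.
  rewrite mem_filter -(inj_eq enc_inj) (@decK 2) // !inE => /andP[].
  by rewrite !negb_or => /and4P[-> -> -> ->].
case/andP=> p2 np; rewrite -(encK p); have [_ H _ _] := K21_orbits.
rewrite /G2 -K21_G1; apply: H.
rewrite mem_filter mem_iota enc_lt andbT; move: p2 np.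
rewrite -(inj_eq enc_inj) (@decK 2) // !inE !negb_or => ->.
by case/and3P=> -> -> ->.
Qed.

Lemma G1_2trans : [transitive^2 G1, on S21 | 'P].
Proof.
have m2 : dec 2 \in S21 by rewrite S21E decK.
apply: (stab_ntransitiveI m2).
  by apply/imsetP; exists (dec 2); rewrite ?orbit_G1.
have m3 : dec 3 \in S21 :\ dec 2.
  by rewrite in_setD1 S21E decK // -(inj_eq enc_inj) !decK.
apply: (stab_ntransitiveI m3 _ (ntransitive0 _ _ _)).
apply/imsetP; exists (dec 3) => //; exact/esym/orbit_G2.
Qed.

Lemma lperm_iter l k n : is_lperm l -> n < 24 ->
  (lperm l ^+ k)%g (dec n) = dec (iter k (nth 0 l) n) /\ iter k (nth 0 l) n < 24.
Proof.
move=> ll ltn; elim: k => [|k [E lt]]; first by rewrite expg0 perm1.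
by rewrite expgSr permM E lpermE // iterS is_lperm_lt.
Qed.

Lemma lperm_expg_eq1 l k : is_lperm l ->
  all (fun n => iter k (nth 0 l) n == n) nats24 -> (lperm l ^+ k = 1)%g.
Proof.
move=> ll /allP H; apply/permP=> p; rewrite perm1 -(encK p).
move: (enc p) (enc_lt p) => n ltn.
have [-> _] := lperm_iter k ll ltn; congr dec; apply/eqP/H.
by rewrite mem_iota.
Qed.

(** [G1] is 2-transitive on 21 points, so a nontrivial normal [N] is transitive and 7 divides its
    order. As 7 divides the order of [G1] only once, [N] contains a Sylow 7-subgroup of [G1] and,
    being normal, every element of order 7; both generators [perm_a] and [perm_b] have order 7. *)
Lemma G1_simple (N : {group {perm line23}}) : N <| G1 -> N :=: 1%g \/ N :=: G1.
Proof.
move=> nN; have pG := ntransitive_primitive (isT : 1 < 2) G1_2trans.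
case: (prim_trans_norm pG nN) => [NC | trN].
  left; apply/trivgP/subsetP=> s /(subsetP NC); rewrite in_setI => /andP[sG sC].
  have /G1_fix/andP[_ fs] := sG; rewrite inE; apply/eqP/permP=> p; rewrite perm1.
  have [pS|] := boolP (p \in S21); first exact: (astabP sC p pS).
  by rewrite S21E negbK => /(allP fs)/eqP; rewrite encK.
right; have d7 : 7 %| #|N|.
  apply: dvdn_trans (atrans_dvd trN).
  rewrite (card_count_code S21 encK enc_lt decK) -/nats24.
  rewrite (@eq_in_count _ _ [pred n | n \notin [:: 23; 0; 1]]) // => n.
  by rewrite mem_iota => ltn; rewrite S21E decK.
have sNG : N \subset G1 by case/andP: nN.
have [Q sylQ] := Sylow_exists 7 N.
have cG : #|G1|`_7 = 7.
  rewrite card_G1 (_ : 21 * _ = 7 * (3 * (20 * (3 * 16)))) ?mulnA // -!mulnA.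
  by rewrite partnM // (part_pnat_id (pnat_id _)) // part_p'nat ?p'natE.
have cQ : #|Q| = 7.
  apply/eqP; rewrite eqn_dvd (card_Hall sylQ); apply/andP; split.
    by rewrite -[X in _ %| X]cG partn_dvd ?cardG_gt0 ?cardSg.
  by rewrite -[X in X %| _](part_pnat_id (pnat_id (isT : prime 7))) partn_dvd ?cardG_gt0.
have sylG : 7.-Sylow(G1) Q.
  rewrite pHallE (subset_trans _ sNG) ?(pHall_sub sylQ) //=.
  by rewrite cQ cG.
have mem7 s : s \in G1 -> (s ^+ 7 = 1)%g -> s \in N.
  move=> sG s7; have s7g : 7.-group <[s]>.
    rewrite /pgroup -orderE; apply: (@pnat_dvd _ 7); first by rewrite order_dvdn s7.
    by rewrite pnat_id.
  have sSG : <[s]> \subset G1 by rewrite cycle_subG.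
  have [x xG sub] := Sylow_subJ sylG sSG s7g.
  rewrite -cycle_subG; apply: subset_trans sub _.
  have /normP <- : x \in 'N(N) by apply: (subsetP (normal_norm nN)).
  by rewrite conjSg (pHall_sub sylQ).
apply/eqP; rewrite eqEsubset sNG andTb -K21_G1 gen_subG.
have [la lb] : is_lperm perm_a /\ is_lperm perm_b.
  by have [/and4P[la _ _ _] /and4P[lb _ _ _] _] := checks.
have sub := K21_sub.
apply/subsetP=> s; rewrite in_set2 => /orP[] /eqP->; apply: mem7.
- by apply: (subsetP sub); apply: mem_gen; apply: set21.
- by apply: lperm_expg_eq1 => //; vm_compute.
- by apply: (subsetP sub); apply: mem_gen; apply: set22.
by apply: lperm_expg_eq1 => //; vm_compute.
Qed.

Lemma M21_simple x (N : {group {perm line23}}) : x \notin M22_fixed ->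
  N <| M21 x -> N :=: 1%g \/ N :=: M21 x.
Proof.
move=> nx; have [s sM ->] := M21_conj_G1 nx => nN.
have : (N :^ s^-1)%G <| G1 by rewrite -(normalJ _ _ s) /= conjsgKV.
case/G1_simple => /= /(congr1 (fun A => A :^ s)); rewrite conjsgKV.
  by rewrite conjs1g; left.
by right.
Qed.

Definition perm_t : seq nat :=
  [:: 0; 1; 20; 6; 21; 5; 3; 11; 13; 15; 10; 7; 12; 8; 18; 9; 16; 22; 14; 19;
      2; 4; 17; 23].

(** The six fixed labels are what the count in [cap_neq0] needs. *)
Lemma M22_involution : exists s, [/\ s \in M22, s != 1%g, (s ^+ 2 = 1)%g
  & forall n, n \in [:: 0; 4; 9; 11; 15; 18] -> act22 s (o22 n) = o22 n].
Proof.
have ct : M22_check perm_t by vm_compute.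
have tM := lperm_M22 ct; have /and4P[lt _ _ _] := ct; clear ct.
exists (lperm perm_t); split=> //.
- apply/eqP=> /permP/(_ (dec 2)); by rewrite perm1 (@lpermE perm_t 2).
- exact: (@lperm_expg_eq1 perm_t 2 lt isT).
move=> n nl; apply/eqP; rewrite act22_dec //.
  by rewrite lpermE; move: n nl; apply/allP.
by move: n nl; apply/allP.
Qed.

End M21Simplicity.

(** * The preimage of M21 in a triple cover *)

Module M21Preimage.

Import GolayCode M22Elements Octads M22Stabilizers M22Labels M21Simplicity.
Local Opaque line23 lperm dec enc is_lperm M22_check M22 M24.

Lemma M22_3trans2 a b c a' b' c' : uniq [:: a; b; c] -> uniq [:: a'; b'; c'] ->
  exists2 s, s \in M22 & [/\ act22 s a = a', act22 s b = b' & act22 s c = c'].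
Proof.
rewrite /= !inE !negb_or !andbT => /andP[/andP[ab ac] bc] /andP[/andP[ab' ac'] bc'].
have [s sM [sa sb sc]] := M22_3trans ab ac bc; have [t tM [ta tb tc]] := M22_3trans ab' ac' bc'.
have tK i j : act22 t i = j -> act22 t^-1 j = i by move=> <-; rewrite -act22M // mulgV act22_1.
exists (s * t^-1); first by rewrite groupM ?groupV.
by rewrite !act22M // sa sb sc; split; apply: tK.
Qed.

Lemma I22_third (a b : I22) : exists c, (c != a) && (c != b).
Proof.
have : (#|[set a; b]| < #|[set: I22]|)%N by rewrite cardsT card_ord cards2; case: (_ != _).
rewrite ltnNge => /negP H; apply/existsP; apply: contraT; rewrite negb_exists => /forallP N.
case: H; apply: subset_leq_card; apply/subsetP=> c _; rewrite !inE.
by have := N c; rewrite negb_and !negbK.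
Qed.

Lemma M22_stab_trans (a b c : I22) : b != a -> c != a ->
  exists2 s, s \in M22 & act22 s a = a /\ act22 s b = c.
Proof.
move=> ba ca; have [d /andP[da db]] := I22_third a b; have [e /andP[ea ec]] := I22_third a c.
have [||s sM [sa sb _]] := @M22_3trans2 a b d a c e; last by exists s.
  by rewrite /= !inE !negb_or ![a == _]eq_sym (eq_sym b d) ba da db.
by rewrite /= !inE !negb_or ![a == _]eq_sym (eq_sym c e) ca ea ec.
Qed.

Lemma in_M21_lab s i : (s \in M21 (lab i)) = (s \in M22) && (act22 s i == i).
Proof.
rewrite in_M21; apply: andb_id2l => sM.
by rewrite -(inj_eq lab_inj) lab_act.
Qed.

(** If [s] moves [a], some [m] fixing [a] takes the image of [a] to [b]. A product [k * l] of
    elements fixing [b] and [a] also takes [a] to [b], through a third point [u]; hence s m (k l)^-1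
    fixes [a]. *)
Lemma M22_gen (K : {group {perm line23}}) (a b : I22) : a != b ->
  M21 (lab a) \subset K -> M21 (lab b) \subset K -> M22 \subset K.
Proof.
move=> ab aK bK; have ba : b != a by rewrite eq_sym.
have aKP s : s \in M22 -> act22 s a = a -> s \in K.
  by move=> sM sa; apply: (subsetP aK); rewrite in_M21_lab sM sa eqxx.
have bKP s : s \in M22 -> act22 s b = b -> s \in K.
  by move=> sM sb; apply: (subsetP bK); rewrite in_M21_lab sM sb eqxx.
have [u /andP[ua ub]] := I22_third a b.
have [k kM [kb ka]] := M22_stab_trans ab ub; have [l lM [la lu]] := M22_stab_trans ua ba.
have kK := bKP k kM kb; have lK := aKP l lM la.
apply/subsetP=> s sM; have [sa | sa] := eqVneq (act22 s a) a; first exact: aKP.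
have [m mM [ma ms]] := M22_stab_trans sa ba; have mK := aKP m mM ma.
have : s * m * (k * l)^-1 \in K.
  apply: aKP; first by rewrite !(groupM, groupV).
  have klM : k * l \in M22 by rewrite groupM.
  have E : act22 (k * l) a = b by rewrite act22M // ka lu.
  by rewrite act22M ?groupM // act22M // ms -E -act22M // mulgV act22_1.
by rewrite (groupMr _ (groupVr (groupM kK lK))) (groupMr _ mK).
Qed.

(** Otherwise M21 is abelian, and its Sylow 2-subgroup of order 64 is normal, against simplicity. *)
Lemma M21_perfect x : x \notin M22_fixed -> (M21 x)^`(1) = M21 x.
Proof.
move=> xF; have [d1 | //] := M21_simple xF (der_normal 1 (M21 x)).
have ab : abelian (M21 x) by apply/derG1P.
have [P sP] := Sylow_exists 2 (M21 x); have cP : #|P| = 64.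
  by rewrite (card_Hall sP) card_M21 // p_part.
have nP : P <| M21 x by rewrite -(sub_abelian_normal _ ab) (pHall_sub sP).
by have [P1 | PM] := M21_simple xF nP; move: cP; rewrite ?P1 ?cards1 ?PM ?card_M21.
Qed.

Section TripleCover.

Variables (gT : finGroupType) (G : {group gT}) (f : {morphism G >-> {perm line23}}).
Variable x : line23.
Hypotheses (tc : triple_cover_M22 f) (xF : x \notin M22_fixed).

Let fG : f @* G = M22. Proof. by case: tc. Qed.
Let cZ : #|'ker f| = 3. Proof. by case: tc. Qed.
Let Zc : 'ker f \subset 'Z(G). Proof. by case: tc. Qed.

Notation H := (preim_M21 f x).

Lemma M21_im : M21 x \subset f @* G.
Proof. by rewrite fG subsetIl. Qed.

Lemma morphim_preim_M21 : f @* H = M21 x.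
Proof. by rewrite morphpreK // M21_im. Qed.

Lemma ker_preim_M21 : 'ker f \subset H.
Proof. exact: ker_sub_pre. Qed.

Lemma in_preim_M21 g : (g \in H) = (g \in G) && (f g x == x).
Proof.
rewrite inE; apply: andb_id2l => gG; rewrite inE in_M21 -fG mem_morphim //.
Qed.

Lemma card_preim_M21 : #|H| = (3 * (21 * (20 * (3 * 16))))%N.
Proof. by rewrite card_morphpre ?M21_im // cZ card_M21. Qed.

Lemma orbit_M22 : orbit 'P M22 x = ~: M22_fixed.
Proof.
apply/setP=> y; rewrite inE; apply/orbitP/idP => [[s sM <-] | yF].
  by rewrite /= /aperm M22_stable.
have [s sM E] := M22_trans1 (unlab x); have [t tM E'] := M22_trans1 (unlab y).
exists (s * t^-1); first by rewrite groupM ?groupV.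
rewrite /= /aperm -[x]unlabK // -lab_act ?groupM ?groupV // act22M // E -E'.
by rewrite -act22M // mulgV act22_1 unlabK.
Qed.

Lemma index_preim_M21 : #|G : H| = 22.
Proof.
have -> : #|G : H| = #|M22 : M21 x|.
  have -> : #|G : H| = #|f @*^-1 M22 : f @*^-1 M21 x|.
    by congr #|_ : _|; rewrite -fG morphimGK ?subxx ?subsetIl.
  by apply: index_morphpre; rewrite fG.
have := cardsC M22_fixed; rewrite -orbit_M22 (card_orbit 'P) card_option card_Fp //.
by rewrite cards2 (_ : (None != _) = true) // => -[].
Qed.

(** The derived group covers M21. If it does not contain the kernel, of prime order 3, it meets it
    trivially, and H splits over the kernel. Since the index 22 of H is prime to 3, Gaschütz's
    theorem would then split G. *)
Lemma preim_M21_perfect : H^`(1) = H.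
Proof.
have HG := preim_M21_sub f x.
have ZH' : 'ker f * H^`(1) = H.
  rewrite -morphimK; last exact: subset_trans (der_sub _ _) HG.
  by rewrite morphim_der // morphim_preim_M21 M21_perfect.
have [sub | nsub] := boolP ('ker f \subset H^`(1)).
  by rewrite -[RHS]ZH' mulSGid.
have pZ : prime #|'ker f| by rewrite cZ.
case: tc => _ _ _ /negP[].
have nZ : 'ker f <| G by rewrite ker_normal.
have aZ : abelian ('ker f) by apply: abelianS Zc (center_abelian G).
rewrite (Gaschutz_split nZ ker_preim_M21 HG aZ) ?cZ ?index_preim_M21 //.
by apply/splitsP; exists (H^`(1))%G; apply/complP; rewrite (prime_TIg pZ nsub) ZH'.
Qed.

(** The image of [N] is trivial or everything. In the second case H is the product of [N] and the
    central kernel, so the quotient by [N] is abelian, and H is perfect. *)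
Lemma normal_preim_M21 (N : {group gT}) : N <| H -> N \subset 'ker f \/ N :=: H.
Proof.
move=> nNH; have HG := preim_M21_sub f x; have NH := normal_sub nNH.
have NG := subset_trans NH HG.
have := morphim_normal f nNH; rewrite morphim_preim_M21 => /(M21_simple xF)[N1 | NM].
  by left; apply/subsetP=> g gN; apply/kerP; [apply: (subsetP NG) | apply/set1gP;
    rewrite -N1; apply: mem_morphim => //; apply: (subsetP NG)].
right; apply/eqP; rewrite eqEsubset NH -{1}preim_M21_perfect /=.
apply: der1_min; first exact: normal_norm.
have <- : N * 'ker f = H.
  by rewrite (normC (subset_trans NG (ker_norm f))) -morphimK // NM.
rewrite quotientMidl quotient_abelian //; exact: abelianS Zc (center_abelian G).
Qed.

Lemma gen_preim_M21 (L : {group gT}) g : L \subset G -> g \in G -> f g x != x ->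
  H \subset L -> H :^ g \subset L -> L :=: G.
Proof.
move=> LG gG gx HL HgL; apply/eqP; rewrite eqEsubset LG -(morphimSGK _ (subset_trans ker_preim_M21 HL)) //.
have fgM : f g \in M22 by rewrite -fG mem_morphim.
rewrite fG; apply: (@M22_gen _ (unlab x) (unlab (f g x))).
- apply: contra gx => /eqP/(congr1 lab); rewrite !unlabK // ?M22_stable // => /eqP.
  by rewrite eq_sym.
- by rewrite unlabK // -morphim_preim_M21 morphimS.
rewrite unlabK ?M22_stable // M21_conj //= -morphim_preim_M21 -morphimJ ?morphimS //.
Qed.

End TripleCover.

End M21Preimage.

(** * The preimage of M21 acts on [W] as SL(3,4) *)

Module SL3Isomorphism.

Import FieldOfFour GolayCode M22Elements Octads M22Stabilizers M22Labels M21Simplicity M21Preimage.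
Local Opaque line23 lperm dec enc is_lperm M22_check M22 M24.

Local Open Scope ring_scope.

Section SL3Group.

Variable F : finFieldType.

Lemma GL_of_det (A : 'M[F]_3) : \det A != 0%R -> exists u : {'GL_3[F]}, GLval u = A.
Proof.
move=> dA; have uA : A \in unitmx by rewrite unitmxE unitfE.
by exists (FinRing.unit 'M[F]_3 uA).
Qed.

Lemma in_SL3 (u : {'GL_3[F]}) : (u \in SL3 F) = (\det (GLval u) == 1)%R.
Proof. by rewrite inE. Qed.

Lemma SL3_group_set : group_set (SL3 F).
Proof.
apply/group_setP; split=> [|u v]; rewrite !in_SL3 /= ?det1 //.
by move=> /eqP du /eqP dv; rewrite det_mulmx du dv mul1r.
Qed.
Canonical SL3_group := Group SL3_group_set.

Definition diag3 (a b c : F) : 'M[F]_3 := diag_mx (\row_(j < 3) [:: a; b; c]`_j)%R.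

Lemma det_diag3 a b c : (\det (diag3 a b c) = a * b * c)%R.
Proof. by rewrite det_diag !big_ord_recl big_ord0 !mxE /= mulr1 mulrA. Qed.

(** Multiplication by the matrices diag(d, 1, 1) places three disjoint copies of SL(3,4) in
    GL(3,4). *)
Lemma card_SL3_upper : #|F| = 4 -> (#|SL3 F| <= 3 * (21 * (20 * (3 * 16))))%N.
Proof.
move=> cF; have cGL : #|'GL_3[F]| = (3 * (3 * (21 * (20 * (3 * 16)))))%N.
  by rewrite card_GL // cF big_ltn // big_ltn // big_ltn // big_geq // (_ : 'C(3, 2) = 3) //; lia.
rewrite -(leq_pmul2l (isT : 0 < 3)%N) -cGL.
have c3 : #|[set d : F | d != 0%R]| = 3.
  have := cardsC [set 0%R : F]; rewrite cF cards1 => -[c3].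
  by rewrite -[RHS]c3; apply: eq_card => d; rewrite !inE.
rewrite -[X in (X * _ <= _)%N]c3 -cardsX; pose mul (p : F * {'GL_3[F]}) : 'M[F]_3 := (diag3 p.1 1 1 *m GLval p.2)%R.
have mulI : {in setX [set d : F | d != 0%R] (SL3 F) &, injective mul}.
  move=> [d u] [e v]; rewrite !in_setX !in_SL3 !inE /= => /andP[d0 /eqP du] /andP[e0 /eqP dv] E.
  have := congr1 determinant E; rewrite !det_mulmx !det_diag3 du dv !mulr1 => /= de.
  move: E; rewrite /mul /= de => E; congr (_, _); apply: val_inj => /=.
  have uE : diag3 e 1 1 \in unitmx by rewrite unitmxE det_diag3 !mulr1 unitfE.
  by rewrite -[val u](mulKmx uE) E mulKmx.
rewrite -(card_in_imset mulI).
have -> : #|'GL_3[F]| = #|[set GLval u | u in 'GL_3[F]]| by rewrite card_imset //; apply: val_inj.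
apply: subset_leq_card; apply/subsetP=> A /imsetP[[d u]]; rewrite in_setX in_SL3 inE /=.
move=> /andP[d0 /eqP du] AE; have [|v vA] := @GL_of_det A.
  by rewrite AE det_mulmx det_diag3 du !mulr1.
by apply/imsetP; exists v; rewrite ?in_setT.
Qed.

Definition cycle3 : {perm 'I_3} := (tperm (0 : 'I_3)%R 1%R * tperm (1 : 'I_3)%R 2%:R%R)%g.

Lemma cycle3E : [/\ cycle3 0 = 2%:R, cycle3 1 = 0 & cycle3 2%:R = 1].
Proof. by rewrite !permM !permE /=. Qed.

Lemma det_cycle3 : \det (perm_mx cycle3 : 'M[F]_3) = 1.
Proof. by rewrite det_perm odd_permM !odd_tperm. Qed.

(** A cyclic permutation matrix and diag(1, w, w^2) commute up to the factor [w]. Hence the scalars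
    of SL(3,4) lie in its derived group. *)
Lemma SL3_scalar_commutator (w : F) : w ^+ 3 = 1 -> exists u v s : {'GL_3[F]},
  [/\ u \in SL3 F, v \in SL3 F, GLval s = w%:M & [~ u, v]%g = s].
Proof.
move=> w3; have w0 : w != 0 by apply: contra_eq_neq w3 => ->; rewrite expr0n eq_sym oner_eq0.
have [u uE] : exists u : {'GL_3[F]}, GLval u = diag3 1 w (w ^+ 2).
  by apply: GL_of_det; rewrite det_diag3 mul1r -exprS w3 oner_eq0.
have [v vE] : exists v : {'GL_3[F]}, GLval v = perm_mx cycle3.
  by apply: GL_of_det; rewrite det_cycle3 oner_eq0.
have [s sE] : exists s : {'GL_3[F]}, GLval s = w%:M.
  by apply: GL_of_det; rewrite det_scalar expf_neq0.
exists u, v, s; split=> //.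
- by rewrite in_SL3 uE det_diag3 mul1r -exprS w3.
- by rewrite in_SL3 vE det_cycle3.
have sC z : (s * z = z * s)%g.
  by apply: val_inj; rewrite -[LHS]/(GLval s *m GLval z) -[RHS]/(GLval z *m GLval s) sE scalar_mxC.
have uv : (u * v = s * (v * u))%g.
  apply: val_inj; rewrite -[LHS]/(GLval u *m GLval v) -[RHS]/(GLval s *m (GLval v *m GLval u)).
  rewrite uE vE sE mul_scalar_mx; apply/matrixP=> i j.
  rewrite /diag3 mul_diag_mx mul_mx_diag !mxE; have [c0 c1 c2] := cycle3E.
  have : i \in [:: 0; 1; 2%:R] by case: i => [[|[|[|]]]] //.
  rewrite !inE => /or3P[] /eqP->; rewrite ?c0 ?c1 ?c2; case: j => [[|[|[|]]]] //= k;
    by rewrite ?(mulr0, mul0r, mulr1, mul1r).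
rewrite commgEl conjgE; apply: (mulgI u); rewrite mulKVg; apply: (mulgI v).
by rewrite mulKVg uv sC mulgA.
Qed.

End SL3Group.

Section Restriction.

Variables (gT : finGroupType) (G : {group gT}) (f : {morphism G >-> {perm line23}}).
Variables (x : line23) (F : finFieldType) (rG : mx_representation F G 6) (W : 'M[F]_6).
Hypothesis ms : mathieu_setup f x rG W.

Let tc : triple_cover_M22 f. Proof. by case: ms. Qed.
Let xF : x \notin M22_fixed. Proof. by case: ms. Qed.
Let cF : #|F| = 4. Proof. by case: ms. Qed.
Let W3 : \rank W = 3. Proof. by case: ms => _ _ _ _ []. Qed.
Let cZ : #|'ker f| = 3. Proof. by case: tc. Qed.
Let Zc : 'ker f \subset 'Z(G). Proof. by case: tc. Qed.

Notation H := (preim_M21 f x).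

Let HG : H \subset G. Proof. exact: preim_M21_sub. Qed.

Lemma moduleW h : h \in H -> (W *m rG h <= W)%MS.
Proof. by case: ms => _ _ _ _ [_ /mxmoduleP mW] hH; apply: mW. Qed.

Lemma irr_rank (U : 'M[F]_6) : (forall g, g \in G -> (U *m rG g <= U)%MS) -> U != 0 ->
  \rank U = 6.
Proof.
move=> mU U0; case: ms => _ _ _ [_ _ irr] _.
apply/eqP; rewrite -[_ == _]/(row_full U) -sub1mx; apply: irr; rewrite ?submx1 //.
by apply/mxmoduleP.
Qed.

Lemma fixed_eq0 (v : 'rV[F]_6) : (forall g, g \in G -> v *m rG g = v) -> v = 0.
Proof.
move=> vG; apply/eqP; apply: contraT => v0.
have : \rank (<<v>>%MS) = 6.
  apply: irr_rank => [g gG|]; last by rewrite -mxrank_eq0 genmxE mxrank_eq0.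
  by rewrite !(eqmxMr _ (genmxE _)) genmxE vG.
by rewrite genmxE => r6; have := rank_leq_row v; rewrite r6.
Qed.

Lemma exists_moving : exists2 g, g \in G & f g x != x.
Proof.
have [c /andP[cx _]] := I22_third (unlab x) (unlab x).
have [d /andP[dx dc]] := I22_third (unlab x) c.
have [||s sM [sx _ _]] := @M22_3trans2 (unlab x) c d c (unlab x) d.
- by rewrite /= !inE !negb_or !(eq_sym _ d) dx dc eq_sym cx.
- by rewrite /= !inE !negb_or !(eq_sym _ d) dx dc cx.
have : s \in f @* G by case: tc => ->.
case/morphimP=> g _ gG sE; exists g => //; rewrite -sE.
by apply: contra cx => /eqP E; rewrite -sx /act22 unlabK // E.
Qed.

(** The product of the orders of H and its conjugate, divided by the order of G, is the order of H
    over 22, already more than 3. *)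
Lemma card_conj_preim g : g \in G -> (3 < #|H :&: H :^ g|)%N.
Proof.
move=> gG; have := mul_cardG H (H :^ g)%G; rewrite cardJg (card_preim_M21 tc xF) => E.
have sub : (#|(H * H :^ g)%g| <= #|G|)%N.
  by apply: subset_leq_card; rewrite mul_subG // conj_subG.
have := Lagrange HG; rewrite (card_preim_M21 tc xF) (index_preim_M21 tc xF) => cG.
rewrite ltnNge; apply/negP=> Y3; move: E; rewrite -cG in sub.
by move/eqP; rewrite eqn_leq => /andP[/leq_trans/(_ (leq_mul sub Y3))]; lia.
Qed.

(** If H fixed [W] pointwise, vectors of [W] and [Wg] in common would be fixed by H and its
    conjugate, hence by G, so [W] and [Wg] would be complementary. The intersection of H with its
    conjugate would then act trivially on [V]; as it has more than 3 elements, the kernel of the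
    representation would contain H, its conjugate, and so G. *)
Lemma preim_M21_nontrivial : ~ (forall h, h \in H -> W *m rG h = W).
Proof.
move=> trW; have [g gG gx] := exists_moving.
pose Wg := W *m rG g.
have trWg h : h \in (H :^ g)%g -> Wg *m rG h = Wg.
  case/imsetP=> k kH ->; have kG := subsetP HG k kH.
  by rewrite /Wg -!mulmxA -!repr_mxM ?groupJ // conjgE mulKVg repr_mxM // mulmxA trW.
have W60 : \rank (W :&: Wg) = 0%N.
  apply/eqP; rewrite mxrank_eq0 -submx0; apply/rV_subP=> v; rewrite sub_capmx.
  move=> /andP[vW vWg]; rewrite submx0; apply/eqP/fixed_eq0.
  pose L := (G :&: [set k in G | v *m rG k == v])%g.
  have gL : group_set L.
    apply/group_setP; split=> [|k l]; rewrite !inE ?group1 ?repr_mx1 ?mulmx1 ?eqxx //.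
    move=> /andP[_ /andP[kG /eqP vk]] /andP[_ /andP[lG /eqP vl]].
    by rewrite groupM //= repr_mxM // mulmxA vk vl.
  have LG : Group gL :=: G.
    apply: (gen_preim_M21 tc xF _ gG gx); first exact: subsetIl.
    - apply/subsetP=> k kH; rewrite !inE (subsetP HG) //=.
      by case/submxP: vW => y ->; rewrite -mulmxA trW.
    apply/subsetP=> k kH; rewrite !inE (subsetP (conj_subG gG HG)) //=.
    by case/submxP: vWg => y ->; rewrite -mulmxA trWg.
  move=> k kG; have : k \in Group gL by rewrite LG.
  by rewrite !inE => /andP[_ /andP[_ /eqP]].
have W6 : (1%:M <= W + Wg)%MS.
  rewrite sub1mx /row_full; have := mxrank_sum_cap W Wg; rewrite W60 addn0 => ->.
  by rewrite W3 mxrankMfree ?W3 // row_free_unit repr_mx_unit.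
have ker k : k \in (H :&: H :^ g)%g -> k \in rker rG.
  rewrite inE => /andP[kH kHg]; rewrite inE (subsetP HG) //= mul1mx.
  have /sub_kermxP : (1%:M <= kermx (rG k - 1%:M))%MS.
    apply: submx_trans W6 _; rewrite addsmx_sub.
    by apply/andP; split; apply/sub_kermxP; rewrite mulmxBr mulmx1 ?trW ?trWg ?subrr.
  by rewrite mul1mx => /eqP; rewrite subr_eq0.
have [sub | HN] := normal_preim_M21 tc xF (normalGI HG (rker_normal rG)).
  have : (#|(H :&: H :^ g)%g| <= 3)%N.
    apply: leq_trans (eq_leq cZ); apply: subset_leq_card; apply: subset_trans sub; apply/subsetP=> k kk.
    by rewrite inE ker // andbT; move: kk; rewrite inE => /andP[].
  by rewrite leqNgt card_conj_preim.
have HN' : H \subset rker rG by rewrite -HN subsetIr.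
have NG : [group of rker rG] :=: G.
  apply: (gen_preim_M21 tc xF _ gG gx HN'); first exact: normal_sub (rker_normal rG).
  have /normsP nN := normal_norm (rker_normal rG).
  by apply: (@subset_trans _ _ (rker rG :^ g)%g); rewrite ?conjSg ?nN.
have /eqP : (\row_(j < 6) 1 : 'rV[F]_6) = 0.
  apply: fixed_eq0 => k kG; have : k \in [group of rker rG] by rewrite NG.
  by rewrite inE => /andP[_ /eqP]; rewrite mul1mx => ->; rewrite mulmx1.
by move/eqP/rowP/(_ 0)/eqP; rewrite !mxE oner_eq0.
Qed.

Variable Q : 'M[F]_(3, 6).
Hypothesis QW : (Q :=: W)%MS.

Lemma Q_free : row_free Q.
Proof. by rewrite /row_free QW W3. Qed.

(** The matrix of [h] on [W] with respect to the basis formed by the rows of [Q]. *)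
Definition resW h : 'M[F]_3 := Q *m rG h *m pinvmx Q.

Lemma resWE h : h \in H -> resW h *m Q = Q *m rG h.
Proof. by move=> hH; rewrite mulmxKpV // (eqmxMr _ QW) QW moduleW. Qed.

Lemma resW_repr : mx_repr H resW.
Proof.
split=> [|h k hH kH]; first by rewrite /resW repr_mx1 mulmx1 mulmxVp ?Q_free.
apply: (row_free_inj Q_free); rewrite /= resWE ?groupM // repr_mxM ?(subsetP HG) //.
by rewrite mulmxA -resWE // -mulmxA -resWE // mulmxA.
Qed.
Canonical resW_representation := MxRepresentation resW_repr.

Definition phi := reprGLm resW_representation.

Lemma phiE h : h \in H -> GLval (phi h) = resW h.
Proof. exact: val_reprGLm. Qed.

(** The determinant is trivial on commutators, and H is perfect. *)
Lemma phi_SL3 : phi @* H \subset SL3 F.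
Proof.
pose D := [set h in H | \det (resW h) == 1].
have inD h : (h \in D) = (h \in H) && (\det (resW h) == 1) by exact: in_set.
have gD : group_set D.
  apply/group_setP; split=> [|h k]; rewrite !inD ?group1 /=.
    by rewrite (repr_mx1 resW_representation) det1.
  move=> /andP[hH /eqP dh] /andP[kH /eqP dk]; rewrite groupM //=.
  by rewrite (repr_mxM resW_representation) //= det_mulmx dh dk mulr1.
have detC h k : h \in H -> k \in H -> resW [~ h, k] = resW (h^-1) *m resW (k^-1) *m resW h *m resW k.
  move=> hH kH; rewrite commgEl conjgE !mulgA.
  by rewrite !(repr_mxM resW_representation) ?groupM ?groupV //= !mulmxA.
have detV h : h \in H -> \det (resW h^-1) * \det (resW h) = 1.
  move=> hH; rewrite -det_mulmx -(repr_mxM resW_representation) ?groupV //= mulVg.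
  by rewrite (repr_mx1 resW_representation) det1.
have HD : H \subset Group gD.
  rewrite -{1}(preim_M21_perfect tc xF) gen_subG; apply/subsetP=> c /imset2P[h k hH kH ->].
  rewrite -[_ \in _]/(_ \in D) inD groupR //= detC // !det_mulmx.
  by rewrite (mulrAC (\det (resW h^-1))) detV // mul1r detV.
apply/subsetP=> _ /morphimP[h _ hH ->]; rewrite in_SL3 phiE //.
by have := subsetP HD h hH; rewrite -[_ \in _]/(_ \in D) inD => /andP[].
Qed.

Lemma ker_phi h : h \in H -> (h \in 'ker phi) = (Q *m rG h == Q).
Proof.
move=> hH; rewrite ker_reprGLm inE hH mul1mx /=.
apply/eqP/eqP => [E | E]; first by rewrite -resWE // E mul1mx.
by apply: (row_free_inj Q_free); rewrite /= resWE // mul1mx.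
Qed.

Lemma card_phi : (#|phi @* H| * #|'ker phi| = 3 * (21 * (20 * (3 * 16))))%N.
Proof.
rewrite -(card_preim_M21 tc xF) card_morphim setIid mulnC.
by rewrite Lagrange // subsetIl.
Qed.

Lemma ker_phi_sub : 'ker phi \subset 'ker f.
Proof.
have [// | E] := normal_preim_M21 tc xF (ker_normal phi).
case: preim_M21_nontrivial => h hH; have : h \in 'ker phi by rewrite E.
rewrite ker_phi // => /eqP hQ; have /submxP[y ->] : (W <= Q)%MS by rewrite QW.
by rewrite -mulmxA hQ.
Qed.

Lemma SL3_scalars : exists2 s : {'GL_3[F]}, s \in (SL3 F)^`(1)%g & s != 1%g /\
  (s ^+ 3 = 1)%g /\ forall u, (s * u = u * s)%g.
Proof.
have [w [w0 w1]] := GF4_primitive cF.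
have w3 : w ^+ 3 = 1 by apply: (GF4_cube cF).
have [u [v [s [uS vS sE uv]]]] := SL3_scalar_commutator w3.
exists s; first by rewrite -uv mem_commg.
split.
  apply: contra w1 => /eqP s1; move: sE; rewrite s1 -[GLval _]/(1%:M) => /matrixP/(_ 0 0).
  by rewrite !mxE !mulr1n => <-.
split.
  apply: val_inj; rewrite !expgS expg0 mulg1.
  change (GLval s *m (GLval s *m GLval s) = 1%:M).
  by rewrite sE -!scalar_mxM -!expr2 -exprS w3.
move=> z; apply: val_inj; change (GLval s *m GLval z = GLval z *m GLval s).
by rewrite sE scalar_mxC.
Qed.

(** Otherwise the kernel is all of ['ker f] and the image has order 20160. Let [s] be a scalar of
    order 3, which lies in the derived group of SL(3,4). If [s] is in the image, the preimage of its
    span is normal in H, not inside ['ker f], and not H. If not, SL(3,4) is the product of the image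
    and the central span of [s], so its derived group lies in the image and yet contains [s]. *)
Lemma ker_phi1 : 'ker phi = 1%g.
Proof.
have pZ : prime #|'ker f| by rewrite cZ.
have [KZ | nKZ] := boolP ('ker f \subset 'ker phi); last first.
  apply/trivgP; rewrite -(prime_TIg pZ nKZ) subsetI subxx andbT.
  exact: ker_phi_sub.
have KE : 'ker phi = 'ker f by apply/eqP; rewrite eqEsubset ker_phi_sub.
have [s sS' [s1 [s3 sC]]] := SL3_scalars.
have os : #[s]%g = 3 by apply: nt_prime_order.
have cL : #|phi @* H| = (21 * (20 * (3 * 16)))%N.
  by have := card_phi; rewrite KE cZ mulnC => /eqP; rewrite eqn_pmul2l // => /eqP.
have sS : s \in SL3 F by apply: subsetP sS'; apply: der_sub.
have sCG : <[s]>%g \subset 'C([set: {'GL_3[F]}])%g.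
  by rewrite cycle_subG; apply/centP=> z _; apply: sC.
have sN (A : {group {'GL_3[F]}}) : A \subset 'N(<[s]>)%g.
  by apply: cents_norm; rewrite centsC; apply: subset_trans sCG (centS (subsetT _)).
have [sL | sL] := boolP (s \in phi @* H).
  pose N := (phi @*^-1 <[s]>)%G.
  have nN : N <| H.
    have HE : phi @*^-1 (phi @* H) = H by apply: morphimGK; rewrite ?subsetIl.
    have -> : (N <| H) = (phi @*^-1 <[s]> <| phi @*^-1 (phi @* H)) by rewrite HE.
    by rewrite morphpre_normal ?morphimS // /normal ?cycle_subG ?sL ?sN // morphimS.
  have [NZ | NH] := normal_preim_M21 tc xF nN.
    case/morphimP: sL => h _ hH sE; have hN : h \in N.
      by rewrite inE hH inE -sE cycle_id.
    have := subsetP NZ h hN; rewrite -KE => /kerP; rewrite -sE => /(_ hH) s1'.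
    by rewrite s1' eqxx in s1.
  have : (#|phi @* H| <= #|<[s]>%g|)%N.
    apply: subset_leq_card; apply/subsetP=> _ /morphimP[h _ hH ->].
    have : h \in gval N by rewrite NH.
    by case/morphpreP.
  by rewrite cL -orderE os.
have ti : phi @* H :&: <[s]>%g = 1%g.
  rewrite setIC; apply: prime_TIg; first by rewrite -orderE os.
  by rewrite cycle_subG.
have LS : (phi @* H * <[s]>)%g = SL3 F.
  apply/eqP; rewrite eqEcard mul_subG ?phi_SL3 ?cycle_subG //=.
  rewrite TI_cardMg //= cL -orderE os mulnC.
  exact: (card_SL3_upper cF).
have nL : SL3 F \subset 'N(phi @* H)%g.
  rewrite -LS mul_subG ?normG //; apply: cents_norm.
  exact: subset_trans sCG (centS (subsetT _)).
have : (SL3 F)^`(1)%g \subset (phi @* H)%g.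
  apply: der1_min => //=; rewrite -LS quotientMidl quotient_abelian // cycle_abelian //.
by move/subsetP/(_ s sS'); rewrite (negPf sL).
Qed.

Lemma phi_im : phi @* H = SL3 F.
Proof.
apply/eqP; rewrite eqEcard phi_SL3 (leq_trans (card_SL3_upper cF)) //.
by have := card_phi; rewrite ker_phi1 cards1 muln1 => ->.
Qed.

Lemma preim_M21_isog : H \isog SL3 F.
Proof.
by rewrite -phi_im; apply: sub_isog; rewrite ?ker_phi1.
Qed.

Lemma SL3_onto A : \det A = 1 -> exists2 h, h \in H & Q *m rG h = A *m Q.
Proof.
move=> dA; have [|u uA] := @GL_of_det F A; first by rewrite dA oner_eq0.
have : u \in phi @* H by rewrite phi_im in_SL3 uA dA.
case/morphimP=> h _ hH uE; exists h; first exact: hH.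
by rewrite -resWE // -phiE // -uA uE.
Qed.

Lemma SL3_faithful h : h \in H -> Q *m rG h = Q -> h = 1%g.
Proof. by move=> hH E; apply/set1gP; rewrite -ker_phi1 ker_phi // E. Qed.

End Restriction.

End SL3Isomorphism.

(** * The 22 images of [W] form a dual hyperoval *)

Module SetupPlanes.

Import FieldOfFour Orthogonality DualHyperovals CosetFamilies PlanePoints GolayCode M22Elements Octads M22Stabilizers M22Labels M21Simplicity M21Preimage SL3Isomorphism.
Local Opaque line23 lperm dec enc is_lperm M22_check M22 M24.
Local Open Scope ring_scope.

Section Setup.

Variables (gT : finGroupType) (G : {group gT}) (f : {morphism G >-> {perm line23}}).
Variables (x : line23) (F : finFieldType) (rG : mx_representation F G 6) (W : 'M[F]_6).
Hypothesis ms : mathieu_setup f x rG W.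

Let tc : triple_cover_M22 f. Proof. by case: ms. Qed.
Let xF : x \notin M22_fixed. Proof. by case: ms. Qed.
Let cF : #|F| = 4%N. Proof. by case: ms. Qed.
Let W3 : \rank W = 3%N. Proof. by case: ms => _ _ _ _ []. Qed.
Let fG : f @* G = M22. Proof. by case: tc. Qed.

Notation H := (preim_M21 f x).

Let HG : H \subset G. Proof. exact: preim_M21_sub. Qed.

Lemma f_M22 g : g \in G -> f g \in M22.
Proof. by move=> gG; rewrite -fG mem_morphim. Qed.

Lemma lift_M22 s : s \in M22 -> exists2 g, g \in G & f g = s.
Proof. by rewrite -fG => /morphimP[g _ gG ->]; exists g. Qed.

Lemma G_3trans a b c a' b' c' : uniq [:: a; b; c] -> uniq [:: a'; b'; c'] ->
  exists2 g, g \in G & [/\ act22 (f g) a = a', act22 (f g) b = b' & act22 (f g) c = c'].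
Proof.
move=> U U'; have [s /lift_M22[g gG <-] E] := M22_3trans2 U U'; by exists g.
Qed.

Definition tr i : gT := repr [set g in G | f g x == lab i].

Lemma trP i : tr i \in G /\ f (tr i) x = lab i.
Proof.
have : x \in orbit 'P M22 (lab i).
  by rewrite (orbit_M22 (lab_not_fixed i)) inE.
rewrite orbit_sym => /orbitP[s /lift_M22[g gG <-] E].
have : tr i \in [set g in G | f g x == lab i].
  by apply: (mem_repr g); rewrite inE gG; apply/eqP.
by rewrite inE => /andP[-> /eqP].
Qed.

(** The row space does not depend on the representative [tr i] ([Wi_coset]), because H stabilises
    [W]. *)
Definition Wi i : 'M[F]_6 := W *m rG (tr i).

Lemma Wi_rank i : \rank (Wi i) = 3%N.
Proof. by rewrite mxrankMfree // row_free_unit repr_mx_unit //; case: (trP i). Qed.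

Lemma W_stable h : h \in H -> (W *m rG h :=: W)%MS.
Proof.
move=> hH; apply/eqmxP; rewrite -(geq_leqif (mxrank_leqif_eq (moduleW ms hH))).
by rewrite mxrankMfree // row_free_unit repr_mx_unit // (subsetP HG).
Qed.

Lemma Wi_coset g i : g \in G -> f g x = lab i -> (W *m rG g :=: Wi i)%MS.
Proof.
move=> gG gi; have [tG ti] := trP i; have kG : (g * (tr i)^-1)%g \in G by rewrite groupM ?groupV.
have kH : (g * (tr i)^-1)%g \in H.
  rewrite (in_preim_M21 _ tc) kG morphM ?groupV // morphV // permM gi -ti.
  by rewrite permK eqxx.
have -> : W *m rG g = W *m rG (g * (tr i)^-1)%g *m rG (tr i).
  by rewrite -mulmxA -repr_mxM // mulgKV.
exact: eqmxMr (W_stable kH).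
Qed.

Lemma Wi_base : (Wi (unlab x) :=: W)%MS.
Proof.
apply: eqmx_sym; rewrite -{1}[W]mulmx1 -(repr_mx1 rG); apply: Wi_coset => //.
by rewrite morph1 perm1 unlabK.
Qed.

Lemma Wi_act g i : g \in G -> (Wi i *m rG g :=: Wi (act22 (f g) i))%MS.
Proof.
move=> gG; have [tG ti] := trP i.
have -> : Wi i *m rG g = W *m rG (tr i * g)%g by rewrite repr_mxM // mulmxA.
by apply: Wi_coset; rewrite ?groupM // morphM // permM ti lab_act // f_M22.
Qed.

Lemma permG g : g \in G -> permutes Wi (rG g) (act22 (f g)).
Proof.
move=> gG; split; first exact: repr_mx_unit.
  by apply: act22_inj; apply: f_M22.
by move=> i; apply: Wi_act.
Qed.

Lemma irr_stab : irreducible_stabilizer Wi.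
Proof. by move=> U US U0; apply: (irr_rank ms) => // g gG; apply: US (permG gG). Qed.

Lemma Wi_capM g i j : g \in G ->
  ((Wi i :&: Wi j) *m rG g <= Wi (act22 (f g) i) :&: Wi (act22 (f g) j))%MS.
Proof.
by move=> gG; rewrite sub_capmx -!(Wi_act _ gG) !submxMr ?capmxSl ?capmxSr.
Qed.

Lemma Wi_addM g i j : g \in G ->
  ((Wi i + Wi j)%MS *m rG g :=: Wi (act22 (f g) i) + Wi (act22 (f g) j))%MS.
Proof. by move=> gG; apply: eqmx_trans (addsmxMr _ _ _) (adds_eqmx _ _); apply: Wi_act. Qed.

Lemma pair_trans i j i' j' : i != j -> i' != j' -> exists2 g, g \in G &
  act22 (f g) i = i' /\ act22 (f g) j = j'.
Proof.
move=> ij ij'; have [k /andP[ki kj]] := I22_third i j.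
have [k' /andP[ki' kj']] := I22_third i' j'.
have [||g gG [gi gj _]] := @G_3trans i j k i' j' k'; last by exists g.
  by rewrite /= !inE !negb_or ij ![_ == k]eq_sym ki kj.
by rewrite /= !inE !negb_or ij' ![_ == k']eq_sym ki' kj'.
Qed.

Lemma cap_rank_eq i j i' j' : i != j -> i' != j' ->
  \rank (Wi i :&: Wi j) = \rank (Wi i' :&: Wi j').
Proof.
suff le a b a' b' : a != b -> a' != b' ->
    (\rank (Wi a :&: Wi b) <= \rank (Wi a' :&: Wi b'))%N.
  by move=> ij ij'; apply/eqP; rewrite eqn_leq !le.
move=> ab ab'; have [g gG [<- <-]] := pair_trans ab ab'.
apply: leq_trans (mxrankS (Wi_capM a b gG)).
by rewrite mxrankMfree // row_free_unit repr_mx_unit.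
Qed.

(* By 3-transitivity an inclusion between the spaces attached to one triple holds
   for all triples, and then these spaces are invariant under G. *)
Lemma cap_not_sub i j k : uniq [:: i; j; k] -> (Wi i :&: Wi j)%MS != 0 ->
  ~~ (Wi i :&: Wi j <= Wi k)%MS.
Proof.
move=> U n0; apply/negP=> sub; have : \rank (Wi i :&: Wi j) = 6%N; last first.
  by have := mxrankS (capmxSl (Wi i) (Wi j)); rewrite Wi_rank => + E; rewrite E.
have all3 a b c : uniq [:: a; b; c] -> (Wi a :&: Wi b <= Wi c)%MS.
  move=> U'; have [g gG [ga gb gc]] := G_3trans U' U.
  rewrite -(submxMfree _ _ (_ : row_free (rG g))); last by rewrite row_free_unit repr_mx_unit.
  by apply: submx_trans (Wi_capM a b gG) _; rewrite (Wi_act _ gG) ga gb gc.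
have all1 c : (Wi i :&: Wi j <= Wi c)%MS.
  have [-> | ci] := eqVneq c i; first exact: capmxSl.
  have [-> | cj] := eqVneq c j; first exact: capmxSr.
  by apply: all3; move: U; rewrite /= !inE !negb_or !andbT ![_ == c]eq_sym ci cj => /andP[/andP[-> _] _].
apply: (irr_rank ms) => // g gG; rewrite sub_capmx.
have H c : ((Wi i :&: Wi j) *m rG g <= Wi c)%MS.
  have -> : c = act22 (f g) (act22 (f (g^-1)%g) c).
    by rewrite -act22M ?f_M22 ?groupV // -morphM ?groupV // mulVg morph1 act22_1.
  by rewrite -(Wi_act _ gG) submxMr.
by rewrite !H.
Qed.

(** The dual of [cap_not_sub], by the same transfer along 3-transitivity. *)
Lemma add_not_sup i j k : uniq [:: i; j; k] -> \rank (Wi i + Wi j) != 6%N ->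
  ~~ (Wi k <= Wi i + Wi j)%MS.
Proof.
move=> U n6; apply/negP=> sub; case/eqP: n6.
have all3 a b c : uniq [:: a; b; c] -> (Wi c <= Wi a + Wi b)%MS.
  move=> U'; have [g gG [ga gb gc]] := G_3trans U' U.
  rewrite -(submxMfree _ _ (_ : row_free (rG g))); last by rewrite row_free_unit repr_mx_unit.
  by rewrite (Wi_act _ gG) (Wi_addM _ _ gG) ga gb gc.
have all1 c : (Wi c <= Wi i + Wi j)%MS.
  have [-> | ci] := eqVneq c i; first exact: addsmxSl.
  have [-> | cj] := eqVneq c j; first exact: addsmxSr.
  by apply: all3; move: U; rewrite /= !inE !negb_or !andbT ![_ == c]eq_sym ci cj => /andP[/andP[-> _] _].
apply: (irr_rank ms) => [g gG|]; first by rewrite (Wi_addM _ _ gG) addsmx_sub !all1.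
by rewrite -mxrank_eq0 -lt0n (leq_trans _ (mxrankS (addsmxSl _ _))) ?Wi_rank.
Qed.

Let Q : 'M[F]_(3, 6) := castmx (W3, erefl) (row_base W).
Let QW : (Q :=: W)%MS.
Proof. by apply: eqmx_trans (eq_row_base W); apply: eqmx_cast. Qed.

Lemma W_faithful h : h \in H -> W *m rG h = W -> h = 1%g.
Proof.
move=> hH E; apply: (SL3_faithful ms QW hH).
have /submxP[y ->] : (Q <= W)%MS by rewrite QW.
by rewrite -mulmxA E.
Qed.

Lemma Wi_faithful g i : g \in G -> act22 (f g) i = i -> Wi i *m rG g = Wi i -> g = 1%g.
Proof.
move=> gG gi E; have [tG ti] := trP i.
have hG : (tr i * g * (tr i)^-1)%g \in G by rewrite !groupM ?groupV.
have : (tr i * g * (tr i)^-1)%g = 1%g.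
  apply: W_faithful.
    rewrite (in_preim_M21 _ tc) hG !morphM ?groupM ?groupV // morphV // !permM ti.
    by rewrite -lab_act ?f_M22 // gi -ti permK eqxx.
  rewrite !repr_mxM ?groupM ?groupV // !mulmxA -/(Wi i) E -mulmxA.
  by rewrite -repr_mxM ?groupV // mulgV repr_mx1 mulmx1.
by move/(canRL (mulgKV _)); rewrite mul1g => /(canRL (mulKg _)); rewrite mulVg.
Qed.

(** The cube of any lift serves: it still maps to [s], and its square is the cube of an element of
    the kernel, which has order 3. *)
Lemma lift_involution s : s \in M22 -> s != 1%g -> (s ^+ 2 = 1)%g ->
  exists g, [/\ g \in G, f g = s, g != 1%g & (g ^+ 2 = 1)%g].
Proof.
move=> sM s1 s2; have [g gG fg] := lift_M22 sM.
have f3 : f (g ^+ 3)%g = s by rewrite morphX // fg (expgS s 2) s2 mulg1.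
exists (g ^+ 3)%g; split; rewrite ?groupX //.
  by apply: contra s1 => /eqP g1; rewrite -f3 g1 morph1.
have gk : (g ^+ 2)%g \in 'ker f by apply/kerP; rewrite ?groupX // morphX // fg s2.
rewrite -expgM mulnC expgM; have <- : #|'ker f| = 3%N by case: tc.
exact: expg_cardG.
Qed.

(** Suppose the planes pairwise meet in 0, and let [N] be g - 1 for a lifted involution g, so that
    N^2 = 0. On each plane fixed by g, [N] has rank 1: not 0 by faithfulness, and not 2 or 3 as N^2
    = 0. Two such planes span [V], so [N] has rank at most 2 and its image at most 15 nonzero
    vectors; but the six fixed planes contribute 18 different ones. *)
Lemma cap_neq0 i j : i != j -> \rank (Wi i :&: Wi j) != 0%N.
Proof.
move=> ij; apply/negP=> /eqP d0.
have cap0 a b : a != b -> \rank (Wi a :&: Wi b) = 0%N.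
  by move=> ab; rewrite (cap_rank_eq ab ij).
have [s [sM s1 s2 sfix]] := M22_involution.
have [g [gG fg g1 g2]] := lift_involution sM s1 s2.
pose N : 'M[F]_6 := rG g - 1%:M; pose K := [set i | act22 s i == i].
have cK : (6 <= #|K|)%N.
  pose l := map o22 [:: 0; 4; 9; 11; 15; 18]%N.
  have /card_uniqP cl : uniq l.
    by rewrite map_inj_in_uniq // => a b; rewrite !inE => aI bI /(congr1 val) /=;
      rewrite !inordK //; move: aI bI; lia.
  apply: (leq_trans (eq_leq (esym cl))).
  by apply: subset_leq_card; apply/subsetP=> i' /mapP[n nl ->]; rewrite inE sfix.
have N2 : N *m N = 0.
  rewrite mulmxBr mulmxBl mulmx1 mul1mx -repr_mxM // -[(g * g)%g]/(g ^+ 2)%g g2 repr_mx1.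
  have two (u r : F) : u - r - (r - u) = 0.
    have -> : u - r - (r - u) = (u + u) - (r + r) by ring.
    by rewrite !(GF4_addrr cF) subrr.
  by apply/matrixP=> a b; rewrite /N [LHS]mxE [(1%:M - rG g) a b]mxE [(- (rG g - _)) a b]mxE
    [(rG g - _) a b]mxE [(- rG g) a b]mxE [(- 1%:M) a b]mxE two mxE.
have fixK k : k \in K -> act22 (f g) k = k by rewrite inE fg => /eqP.
have LW k : k \in K -> (Wi k *m N <= Wi k)%MS.
  move=> kK; rewrite mulmxBr mulmx1; apply: addmx_sub; last by rewrite eqmx_opp.
  by rewrite (Wi_act _ gG) fixK.
have L1 k : k \in K -> \rank (Wi k *m N) = 1%N.
  move=> kK; have := mxrank_mul_ker (Wi k) N; rewrite Wi_rank.
  have : (\rank (Wi k *m N) <= \rank (Wi k :&: kermx N))%N.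
    by apply: mxrankS; rewrite sub_capmx LW //; apply/sub_kermxP; rewrite -mulmxA N2 mulmx0.
  have : \rank (Wi k *m N) != 0%N.
    rewrite mxrank_eq0; apply: contra g1 => /eqP E; apply/eqP.
    apply: (Wi_faithful gG (fixK k kK)).
    by apply/eqP; rewrite -subr_eq0 -{2}[Wi k]mulmx1 -mulmxBr; apply/eqP.
  by case: (\rank (Wi k *m N)) => [|[|r]] // _; lia.
have rN : (\rank N <= 2)%N.
  have /card_gt1P[a [b [aK bK ab]]] : (1 < #|K|)%N by apply: leq_trans cK.
  have : (N <= (Wi a *m N) + (Wi b *m N))%MS.
    rewrite -{1}[N]mul1mx -addsmxMr submxMr // sub1mx /row_full.
    by have := mxrank_sum_cap (Wi a) (Wi b); rewrite cap0 // !Wi_rank addn0 => ->.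
  move/mxrankS/leq_trans; apply; have [+ _] := mxrank_adds_leqif (Wi a *m N) (Wi b *m N).
  by rewrite !L1.
pose m (p : I22 * F) : 'rV[F]_6 := p.2 *: nz_row (Wi p.1 *m N).
pose D := setX K [set c : F | c != 0].
have nz k : k \in K -> nz_row (Wi k *m N) != 0.
  by move=> kK; rewrite nz_row_eq0 -mxrank_eq0 L1.
have mI : {in D &, injective m}.
  move=> [a c] [b d]; rewrite !in_setX !in_set /= => /andP[aK c0] /andP[bK _] E.
  have aK' : a \in K by rewrite in_set. have bK' : b \in K by rewrite in_set.
  have ab : a = b.
    apply/eqP; apply: contraT => ab.
    have : (m (a, c) <= Wi a :&: Wi b)%MS.
      rewrite sub_capmx {2}E /m /= !scalemx_sub //.
        exact: submx_trans (nz_row_sub _) (LW _ bK').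
      exact: submx_trans (nz_row_sub _) (LW _ aK').
    have /eqP-> : (Wi a :&: Wi b)%MS == 0 by rewrite -mxrank_eq0 cap0.
    by rewrite submx0 /m /= scaler_eq0 (negPf c0) (negPf (nz a aK')).
  move: E; rewrite /m /= ab => /eqP; rewrite -subr_eq0 -scalerBl scaler_eq0 (negPf (nz b bK')).
  by rewrite orbF subr_eq0 => /eqP->.
have : (#|m @: D| <= #|[set v : 'rV[F]_6 | (v != 0%R) && (v <= N)%MS]|)%N.
  apply: subset_leq_card; apply/subsetP=> _ /imsetP[[a c] aD ->].
  move: aD; rewrite in_setX => /andP[/= aK]; rewrite !inE => c0.
  rewrite /m /= scaler_eq0 (negPf c0) (negPf (nz a aK)) /= scalemx_sub //.
  exact: submx_trans (nz_row_sub _) (submxMl _ _).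
rewrite (card_in_imset mI) card_nonzero cardsX cF.
have -> : #|[set c : F | c != 0]| = 3%N.
  have := cardsC [set 0 : F]; rewrite cF cards1 => -[c3].
  by rewrite -[RHS]c3; apply: eq_card => d; rewrite !inE.
have : (4 ^ \rank N <= 4 ^ 2)%N by rewrite leq_exp2l.
by move: cK; lia.
Qed.

Lemma setup_dual_hyperoval : dual_hyperoval Wi.
Proof.
have U (i j k : I22) : i != j -> i != k -> j != k -> uniq [:: i; j; k].
  by move=> ij ik jk; rewrite /= !inE !negb_or ij ik jk.
have add6 i j : i != j -> \rank (Wi i + Wi j) != 6%N.
  move=> ij; have := mxrank_sum_cap (Wi i) (Wi j); rewrite !Wi_rank.
  by have := cap_neq0 ij; lia.
have tri i j k : i != j -> i != k -> j != k ->
    (\rank (Wi i :&: Wi j :&: Wi k) < \rank (Wi i :&: Wi j))%N.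
  move=> ij ik jk; have := cap_not_sub (U _ _ _ ij ik jk).
  rewrite -mxrank_eq0 cap_neq0 // => /(_ isT); rewrite ltn_neqAle => ns.
  rewrite (mxrankS (capmxSl _ _)) andbT; apply: contra ns => /eqP E.
  have /eqmxP <- : (Wi i :&: Wi j :&: Wi k == Wi i :&: Wi j)%MS.
    by rewrite -(geq_leqif (mxrank_leqif_eq (capmxSl _ _))) E.
  exact: capmxSr.
(* With d and t the ranks of double and triple meets, t < d. The sum of the meets of W_k with W_i
   and W_j has rank at least 2d - t, hence at least d + 1, and lies in W_k ∩ (W_i + W_j), of rank at
   most 2. So d = 1. *)
have cap1 i j : i != j -> \rank (Wi i :&: Wi j) = 1%N.
  move=> ij; have [k /andP[ki kj]] := I22_third i j.
  have [ik jk] : i != k /\ j != k by split; rewrite eq_sym.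
  have nk := add_not_sup (U _ _ _ ij ik jk) (add6 _ _ ij).
  have t := tri _ _ _ ik ij (_ : k != j); rewrite kj in t; have {}t := t isT.
  have eqik := cap_rank_eq ik ij; have eqjk := cap_rank_eq jk ij.
  have := cap_neq0 ij; have := mxrankS (capmxSl (Wi i) (Wi j)); rewrite Wi_rank.
  have sub : ((Wi i :&: Wi k) + (Wi j :&: Wi k) <= Wi k :&: (Wi i + Wi j))%MS.
    rewrite sub_capmx !addsmx_sub !capmxSr /= (submx_trans (capmxSl _ _) (addsmxSl _ _)).
    by rewrite (submx_trans (capmxSl _ _) (addsmxSr _ _)).
  have lt3 : (\rank (Wi k :&: (Wi i + Wi j)) < 3)%N.
    apply: leq_trans (eq_leq (Wi_rank k)).
    rewrite ltn_neqAle (mxrankS (capmxSl _ _)) andbT; apply: contra nk => /eqP E.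
    have /eqmxP <- : (Wi k :&: (Wi i + Wi j) == Wi k)%MS.
      by rewrite -(geq_leqif (mxrank_leqif_eq (capmxSl _ _))) E.
    exact: capmxSr.
  have := mxrankS sub; have := mxrank_sum_cap (Wi i :&: Wi k)%MS (Wi j :&: Wi k)%MS.
  have : (\rank (Wi i :&: Wi k :&: (Wi j :&: Wi k)) <= \rank (Wi i :&: Wi k :&: Wi j))%N.
    apply: mxrankS; rewrite sub_capmx capmxSl.
    exact: submx_trans (capmxSr _ _) (capmxSl _ _).
  move: t lt3 eqik eqjk; set a1 := \rank _; set a2 := \rank _; set a3 := \rank _.
  set a4 := \rank _; set a5 := \rank _; set a6 := \rank _; set a7 := \rank _; lia.
have add5 i j : i != j -> \rank (Wi i + Wi j) = 5%N.
  by move=> ij; have := mxrank_sum_cap (Wi i) (Wi j); rewrite !Wi_rank cap1 //; lia.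
split=> //.
- by rewrite card_ord.
- exact: Wi_rank.
- by move=> i j k ij ik jk; have := tri _ _ _ ij ik jk; rewrite cap1 // ltnS leqn0 => /eqP.
move=> i j k ij ik jk; apply/eqP; rewrite eqn_leq rank_leq_col /=.
have nk := add_not_sup (U _ _ _ ij ik jk) (add6 _ _ ij).
apply: (leq_ltn_trans (eq_leq (esym (add5 _ _ ij)))); rewrite ltn_neqAle (mxrankS (addsmxSl _ _)) andbT; apply: contra nk => /eqP E.
have /eqmxP -> : (Wi i + Wi j == Wi i + Wi j + Wi k)%MS.
  by rewrite -(geq_leqif (mxrank_leqif_eq (addsmxSl _ _))) E.
exact: addsmxSr.
Qed.

End Setup.

End SetupPlanes.

(** * Linear maps permuting the planes belong to [G] *)

Module PlaneStabilizer.

Import FieldOfFour Orthogonality DualHyperovals CosetFamilies PlanePoints GolayCode M22Elements Octads M22Stabilizers M22Labels M21Simplicity M21Preimage SL3Isomorphism SetupPlanes.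
Local Opaque line23 lperm dec enc is_lperm M22_check M22 M24.
Local Open Scope ring_scope.

Lemma permutesM (F : finFieldType) (I : finType) (W : I -> 'M[F]_6) g h s t :
  permutes W g s -> permutes W h t -> permutes W (g *m h) (t \o s).
Proof.
move=> [gu si gW] [hu ti hW]; split; first by rewrite unitmx_mul gu.
  exact: inj_comp.
by move=> i; rewrite mulmxA; apply: eqmx_trans (eqmxMr _ (gW i)) (hW _).
Qed.

Section Setup.

Variables (gT : finGroupType) (G : {group gT}) (f : {morphism G >-> {perm line23}}).
Variables (x : line23) (F : finFieldType) (rG : mx_representation F G 6) (W : 'M[F]_6).
Hypothesis ms : mathieu_setup f x rG W.

Let tc : triple_cover_M22 f. Proof. by case: ms. Qed.
Let xF : x \notin M22_fixed. Proof. by case: ms. Qed.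
Let fG : f @* G = M22. Proof. by case: tc. Qed.

Notation H := (preim_M21 f x).
Notation Wi := (Wi f x rG W).

Let HG : H \subset G. Proof. exact: preim_M21_sub. Qed.
Let dW := setup_dual_hyperoval ms.

Lemma Wi_inj i j : (Wi i <= Wi j)%MS -> i = j.
Proof.
move=> sub; apply/eqP; apply: contraT => ij; have := dho_rank2 dW ij.
by rewrite (capmx_idPl sub) (dho_rank dW).
Qed.

Lemma rG_fixes g : g \in G -> (forall i, (Wi i *m rG g <= Wi i)%MS) -> g \in 'ker f.
Proof.
move=> gG fix_g; apply/kerP => //; apply: act22_eq1 => [|i]; first by rewrite (f_M22 ms).
by apply: Wi_inj; rewrite -(Wi_act ms _ gG).
Qed.

Lemma rG_inj : {in G &, injective rG}.
Proof.
move=> g h gG hG E; have kG : (g * h^-1)%g \in G by rewrite groupM ?groupV.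
have k1 : rG (g * h^-1)%g = 1%:M.
  by rewrite repr_mxM ?groupV // E -repr_mxM ?groupV // mulgV repr_mx1.
have kk : (g * h^-1)%g \in 'ker f by apply: rG_fixes => // i; rewrite k1 mulmx1.
have k1' : (g * h^-1)%g = 1%g.
  apply: (W_faithful ms); last by rewrite k1 mulmx1.
  exact: subsetP (ker_preim_M21 f x) _ kk.
by apply: (mulIg (h^-1)%g); rewrite k1' mulgV.
Qed.

Lemma ker_scalar z : z \in 'ker f -> exists c, rG z = c%:M.
Proof.
move=> zK; have zG : z \in G by apply: subsetP (subsetIl _ _) _ zK.
apply: (kernel_scalar dW); split; [exact: repr_mx_unit | by [] | move=> i].
by apply: eqmx_trans (Wi_act ms _ zG) _; rewrite (mker zK) act22_1.
Qed.

(** G is transitive on the planes and H induces SL(3,4) on [W], so after composition with elements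
    of G the map acts on [W] as diag(1, 1, d) in a basis of three non-collinear points.
    [homology_trivial] makes it the identity. *)
Lemma linear_stabilizer g s : permutes Wi g s -> exists2 k, k \in G & g = rG k.
Proof.
move=> pg; set x0 := unlab x.
have [k kG kx] : exists2 k, k \in G & act22 (f k) (s x0) = x0.
  have [t tM tx] := M22_trans1 (s x0); have [u uM ux] := M22_trans1 x0.
  have [k kG fk] := lift_M22 ms (groupM tM (groupVr uM)); exists k => //.
  by rewrite fk act22M // tx -ux -act22M // mulgV act22_1.
have pg1 := permutesM pg (permG ms kG).
set g1 := g *m rG k in pg1; set s1 := _ \o _ in pg1.
have s1x : s1 x0 = x0 by [].
have [a /andP[ax _]] := I22_third x0 x0; have [b /andP[bx ba]] := I22_third x0 a.
have [xa xb ab] : [/\ x0 != a, x0 != b & a != b] by split; rewrite eq_sym.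
have [c [xc ac bc nc]] := exists_noncoll dW xa xb ab.
pose Q : 'M[F]_(3, 6) := \matrix_(i < 3) [:: pnt Wi x0 a; pnt Wi x0 b; pnt Wi x0 c]`_i.
have Qrow i : row i Q = [:: pnt Wi x0 a; pnt Wi x0 b; pnt Wi x0 c]`_i.
  by apply/rowP=> j; rewrite !mxE.
have QW : (Q :=: W)%MS.
  apply: eqmx_trans (Wi_base ms); apply/eqmxP.
  have sub : (Wi x0 <= Q)%MS.
    rewrite -(pnt_basis dW xa xb xc ab nc) !addsmx_sub.
    have in_Q i : ([:: pnt Wi x0 a; pnt Wi x0 b; pnt Wi x0 c]`_(i : 'I_3) <= Q)%MS.
      by rewrite -Qrow row_sub.
    by rewrite (in_Q 2%:R) (in_Q 0) (in_Q 1).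
  rewrite andbC sub -(geq_leqif (mxrank_leqif_sup sub)) (dho_rank dW).
  exact: rank_leq_row.
have Qx : (Q :=: Wi x0)%MS by apply: eqmx_trans QW (eqmx_sym (Wi_base ms)).
have [g1u _ g1W] := pg1.
have [A QA] : exists A, Q *m g1 = A *m Q.
  by apply/submxP; rewrite (eqmxMr _ Qx) (g1W x0) s1x Qx.
have Qf : row_free Q by rewrite /row_free Qx (dho_rank dW).
have Au : A \in unitmx.
  rewrite -row_free_unit /row_free -(mxrankMfree A Qf) -QA.
  by rewrite mxrankMfree ?row_free_unit.
have dA : \det A != 0 by move: Au; rewrite unitmxE unitfE.
have [|h hH Qh] := SL3_onto ms QW (A := invmx A *m diag3 1 1 (\det A)).
  by rewrite det_mulmx det_inv det_diag3 !mul1r mulVf.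
have hG := subsetP HG h hH.
have hx : act22 (f h) x0 = x0.
  apply: lab_inj; rewrite lab_act ?(f_M22 ms) // unlabK //.
  by move: hH; rewrite (in_preim_M21 _ tc) => /andP[_ /eqP].
have pg2 := permutesM pg1 (permG ms hG).
have Qg2 : Q *m (g1 *m rG h) = diag3 1 1 (\det A) *m Q.
  by rewrite mulmxA QA -mulmxA Qh -!mulmxA mulKVmx.
have rows i : row i Q *m (g1 *m rG h) = [:: 1; 1; \det A]`_i *: row i Q.
  rewrite -row_mul Qg2 /diag3 mul_diag_mx; apply/rowP=> j; rewrite !mxE.
  by [].
have E : g1 *m rG h = 1%:M.
  apply: (homology_trivial dW (d := \det A) pg2 _ _ nc).
  - by rewrite /= s1x.
  - by rewrite /= !inE !negb_or xa xb xc ab ac bc.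
  - by have := rows 0; rewrite Qrow scale1r.
  - by have := rows 1; rewrite Qrow scale1r.
  by have := rows 2%:R; rewrite Qrow.
exists (k * h)^-1%g; first by rewrite groupV groupM.
rewrite repr_mxV ?groupM // repr_mxM //.
by rewrite -[LHS]mulmx1 -(mulmxV (_ : rG k *m rG h \in unitmx)) ?unitmx_mul ?repr_mx_unit //
  !mulmxA -/g1 E mul1mx.
Qed.

End Setup.

End PlaneStabilizer.

(** * Computing with vectors over GF(4) as lists of codes *)

Module FieldCodes.

Import FieldOfFour Orthogonality DualHyperovals CosetFamilies PlanePoints GolayCode M22Elements Octads M22Stabilizers M22Labels.
Local Opaque line23 lperm dec enc is_lperm M22_check M22 M24.
Local Open Scope ring_scope.

(* The elements 0, 1, w, w + 1 of GF(4) are coded by 0, 1, 2, 3. *)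
Definition addc (a b : nat) : nat :=
  match a, b with
  | 0, 0 => 0 | 0, 1 => 1 | 0, 2 => 2 | 0, _ => 3
  | 1, 0 => 1 | 1, 1 => 0 | 1, 2 => 3 | 1, _ => 2
  | 2, 0 => 2 | 2, 1 => 3 | 2, 2 => 0 | 2, _ => 1
  | _, 0 => 3 | _, 1 => 2 | _, 2 => 1 | _, _ => 0
  end%N.

Definition mulc (a b : nat) : nat :=
  match a, b with
  | 0, _ => 0 | _, 0 => 0
  | 1, 1 => 1 | 1, 2 => 2 | 1, _ => 3
  | 2, 1 => 2 | 2, 2 => 3 | 2, _ => 1
  | _, 1 => 3 | _, 2 => 1 | _, _ => 2
  end%N.

(** Results always have length 6, so that equal vectors coming from sums are equal lists, as
    [addv_inj] needs. *)
Definition addv (s t : seq nat) : seq nat := mkseq (fun k => addc (nth 0%N s k) (nth 0%N t k)) 6.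
Definition mulv (c : nat) (s : seq nat) : seq nat := mkseq (fun k => mulc c (nth 0%N s k)) 6.

Definition comb2 (a b : nat) (s t : seq nat) := addv (mulv a s) (mulv b t).

Definition codes : seq nat := iota 0 4.

Definition meet (u1 u2 u3 u4 u : seq nat) : bool :=
  all (fun a => all (fun b => let v := comb2 a b u1 u2 in
    has (fun c => has (fun d => comb2 c d u3 u4 == v) codes) codes ==>
    has (fun c => mulv c u == v) codes) codes) codes.

Definition indep3 (u1 u2 u3 : seq nat) : bool :=
  all (fun a => all (fun b => all (fun c =>
    (addv (comb2 a b u1 u2) (mulv c u3) == mulv 0 u1) ==> [&& a == 0, b == 0 & c == 0]%N)
    codes) codes) codes.

Section Codes.

Variables (F : finFieldType) (w : F).
Hypotheses (cF : #|F| = 4%N) (w0 : w != 0) (w1 : w != 1).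

Let ww : w * w = w + 1. Proof. by case: (GF4_elements cF w0 w1). Qed.

Definition cval (c : nat) : F := match c with 0%N => 0 | 1%N => 1 | 2%N => w | _ => w + 1 end.

Lemma cval_add a b : cval (addc a b) = cval a + cval b.
Proof.
have c2 := GF4_addrr cF.
have E1 : 1 + (w + 1) = w by rewrite addrCA c2 addr0.
have E2 : w + (w + 1) = 1 by rewrite addrA c2 add0r.
have E3 : w + 1 + 1 = w by rewrite -addrA c2 addr0.
have E4 : w + 1 + w = 1 by rewrite addrAC c2 add0r.
by case: a => [|[|[|a]]]; case: b => [|[|[|b]]];
  rewrite /= ?addr0 ?add0r ?c2 ?E1 ?E2 ?E3 ?E4 ?(addrC 1 w).
Qed.

Lemma cval_mul a b : cval (mulc a b) = cval a * cval b.
Proof.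
have c2 := GF4_addrr cF.
have www : w * (w + 1) = 1 by rewrite mulrDr ww mulr1 addrAC c2 add0r.
by case: a => [|[|[|a]]]; case: b => [|[|[|b]]]; rewrite /= ?mulr0 ?mul0r ?mulr1 ?mul1r //;
  rewrite ?ww ?www ?[(w + 1) * w]mulrC ?www // mulrDl www mul1r addrCA c2 addr0.
Qed.

Lemma cval_onto (a : F) : exists2 c, c \in codes & cval c = a.
Proof.
have [_ /(_ a)] := GF4_elements cF w0 w1; rewrite !inE => /or4P[] /eqP->;
  by [exists 0%N | exists 1%N | exists 2%N | exists 3%N].
Qed.

Lemma cval_inj : {in codes &, injective cval}.
Proof.
have w2 : w + 1 != 0 by rewrite addr_eq0 (GF4_oppr cF).
have w3 : w + 1 != w by rewrite -subr_eq0 addrAC subrr add0r oner_eq0.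
have w4 : w + 1 != 1 by rewrite -subr_eq0 addrK.
move=> a b; rewrite !inE => /or4P[] /eqP-> /or4P[] /eqP-> //= /eqP;
  rewrite ?oner_eq0 1?[0 == _]eq_sym ?oner_eq0 ?(negPf w0) ?(negPf w1) ?(negPf w2) ?(negPf w3)
   ?(negPf w4) // eq_sym ?(negPf w0) ?(negPf w1) ?(negPf w2) ?(negPf w3) ?(negPf w4) //.
Qed.

Definition vec (s : seq nat) : 'rV[F]_6 := \row_(k < 6) cval (nth 0%N s k).

Lemma vec_add s t : vec (addv s t) = vec s + vec t.
Proof. by apply/rowP=> k; rewrite !mxE nth_mkseq // cval_add. Qed.

Lemma vec_mul c s : vec (mulv c s) = cval c *: vec s.
Proof. by apply/rowP=> k; rewrite !mxE nth_mkseq // cval_mul. Qed.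

Lemma vec_comb2 a b s t : vec (comb2 a b s t) = cval a *: vec s + cval b *: vec t.
Proof. by rewrite vec_add !vec_mul. Qed.

Lemma addc_codes a b : addc a b \in codes.
Proof. by case: a => [|[|[|a]]]; case: b => [|[|[|b]]]. Qed.

Lemma addv_inj s t s' t' : vec (addv s t) = vec (addv s' t') -> addv s t = addv s' t'.
Proof.
move=> /rowP E; apply: (@eq_from_nth _ 0%N); rewrite !size_mkseq // => k k6.
have := E (Ordinal k6); rewrite !mxE !nth_mkseq //; apply: cval_inj; exact: addc_codes.
Qed.

Variable B : 'M[F]_6.
Hypothesis uB : B \in unitmx.

Notation "<[ u ]>" := (vec u *m B).

Lemma line_code (x : 'rV[F]_6) u1 u2 : (x <= <[u1]> + <[u2]>)%MS ->
  exists a b, [/\ a \in codes, b \in codes & x = <[comb2 a b u1 u2]>].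
Proof.
case/sub_addsmxP=> -[y z] /=; rewrite [y]mx11_scalar [z]mx11_scalar !mul_scalar_mx => ->.
have [a ac <-] := cval_onto (y 0 0); have [b bc <-] := cval_onto (z 0 0).
by exists a, b; split=> //; rewrite vec_comb2 mulmxDl !scalemxAl.
Qed.

Lemma meetP (x : 'rV[F]_6) u1 u2 u3 u4 u : meet u1 u2 u3 u4 u ->
  (x <= <[u1]> + <[u2]>)%MS -> (x <= <[u3]> + <[u4]>)%MS -> (x <= <[u]>)%MS.
Proof.
move=> m /line_code[a [b [ac bc xE]]] /line_code[c [d [cc dc xE']]].
have E : comb2 c d u3 u4 = comb2 a b u1 u2.
  by apply: addv_inj; apply: (can_inj (mulmxK uB)); rewrite -xE'.
move/allP/(_ a ac)/allP/(_ b bc)/implyP: m => /(_ _)/hasP[|e ec /eqP eE].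
  by apply/hasP; exists c => //; apply/hasP; exists d => //; apply/eqP.
by rewrite xE -eE vec_mul -scalemxAl scalemx_sub.
Qed.

Lemma indep3P u1 u2 u3 : indep3 u1 u2 u3 ->
  \rank (<[u1]> + <[u2]> + <[u3]>)%MS = 3%N.
Proof.
move=> ind; pose M : 'M[F]_(3, 6) := \matrix_(i < 3) [:: <[u1]>; <[u2]>; <[u3]>]`_i.
have Mrow i : row i M = [:: <[u1]>; <[u2]>; <[u3]>]`_i by apply/rowP=> j; rewrite !mxE.
have free : row_free M.
  apply/inj_row_free=> y yM.
  have [a ac ya] := cval_onto (y 0 0); have [b bc yb] := cval_onto (y 0 1).
  have [c cc yc] := cval_onto (y 0 2%:R).
  have : addv (comb2 a b u1 u2) (mulv c u3) = mulv 0 u1.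
    have -> : mulv 0 u1 = addv (mulv 0 u1) (mulv 0 u1).
      by rewrite /addv /mulv /mkseq /=.
    apply: addv_inj; apply: (can_inj (mulmxK uB)).
    rewrite !vec_add !vec_mul /= !scale0r !addr0 mul0mx.
    rewrite -yM [y *m M]mulmx_sum_row (eq_bigr (fun i => y 0 i *: [:: <[u1]>; <[u2]>; <[u3]>]`_i)).
      rewrite !big_ord_recl big_ord0 /= addr0 addrA !mulmxDl -!scalemxAl ya yb yc.
      by congr (_ *: _ + _ *: _ + _ *: _); congr (y _ _); apply: val_inj.
    by move=> i _; rewrite Mrow.
  move/eqP => E; move/allP/(_ a ac)/allP/(_ b bc)/allP/(_ c cc): ind; rewrite E /=.
  move=> /and3P[/eqP a0 /eqP b0 /eqP c0]; apply/rowP=> k; rewrite mxE.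
  have : k \in [:: 0; 1; 2%:R] by case: k => [[|[|[|]]]] //.
  by rewrite !inE => /or3P[] /eqP->; rewrite -?ya -?yb -?yc ?a0 ?b0 ?c0.
apply/eqP; rewrite eqn_leq; apply/andP; split.
  apply: leq_trans (_ : (\rank (<[u1]> + <[u2]>)%MS + \rank <[u3]> <= 3)%N).
    by have [] := mxrank_adds_leqif (<[u1]> + <[u2]>)%MS <[u3]>.
  have [le _] := mxrank_adds_leqif <[u1]> <[u2]>.
  have := rank_leq_row <[u1]>; have := rank_leq_row <[u2]>; have := rank_leq_row <[u3]>.
  by move: le; lia.
move: free; rewrite /row_free => /eqP fr; apply: (leq_trans (eq_leq (esym fr))); apply: mxrankS; apply/row_subP=> i.
rewrite Mrow; have : i \in [:: 0; 1; 2%:R] by case: i => [[|[|[|]]]] //.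
rewrite !inE => /or3P[] /eqP-> /=; last exact: addsmxSr.
  exact: submx_trans (addsmxSl _ _) (addsmxSl _ _).
exact: submx_trans (addsmxSr _ _) (addsmxSl _ _).
Qed.

End Codes.

End FieldCodes.

(** * Coordinates for the 22 planes, forced by the hexads *)

Module PlaneCoordinates.

Import FieldOfFour Orthogonality DualHyperovals CosetFamilies PlanePoints GolayCode M22Elements Octads M22Stabilizers M22Labels FieldCodes.
Local Opaque line23 lperm dec enc is_lperm M22_check M22 M24.
Local Open Scope ring_scope.

Definition step := (nat * nat * (nat * nat * nat) * (nat * nat * nat) * seq nat)%type.

Definition hexads : seq (seq nat) :=
  [::
    [::0;1;2;4;13;16]; [::0;1;3;12;15;21]; [::0;1;5;6;18;20]; [::0;1;7;10;11;17];
    [::0;1;8;9;14;19]; [::0;2;3;10;18;19]; [::0;2;5;7;9;12]; [::0;2;6;8;15;17];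
    [::0;2;11;14;20;21]; [::0;3;4;6;7;14]; [::0;3;5;8;11;16]; [::0;3;9;13;17;20];
    [::0;4;8;10;12;20]; [::0;6;11;12;13;19]; [::1;2;3;7;8;20]; [::1;2;5;11;15;19];
    [::1;2;6;10;12;14]; [::1;2;9;17;18;21]; [::1;3;4;5;9;10]; [::1;3;6;16;17;19];
    [::1;3;11;13;14;18]; [::1;4;6;8;11;21]; [::1;4;7;12;18;19]; [::1;5;8;12;13;17];
    [::2;3;4;11;12;17]; [::2;3;5;6;13;21]; [::2;3;9;14;15;16]; [::2;4;6;9;19;20];
    [::2;4;7;10;15;21]; [::2;6;7;11;16;18]; [::3;4;8;13;15;19]; [::3;6;10;11;15;20]]%N.

Fixpoint lookup (K : seq (nat * nat * seq nat)) (i j : nat) : option (seq nat) :=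
  if K is (a, b, u) :: K' then
    if ((a == i) && (b == j)) || ((a == j) && (b == i)) then Some u else lookup K' i j
  else None.

Definition in_hexad (a b c d : nat) : bool :=
  uniq [:: a; b; c; d] && has (fun h => [&& a \in h, b \in h, c \in h & d \in h]) hexads.

Definition other (i j a : nat) := if a == i then j else i.

Definition step_ok K (s : step) : bool :=
  let: (i, j, (i1, a1, b1), (i2, a2, b2), u) := s in
  [&& (i < 22)%N, (j < 22)%N, (i1 == i) || (i1 == j), (i2 == i) || (i2 == j),
      in_hexad i1 a1 b1 (other i j i1), in_hexad i2 a2 b2 (other i j i2) &
      match lookup K i1 a1, lookup K i1 b1, lookup K i2 a2, lookup K i2 b2 with
      | Some u1, Some u2, Some u3, Some u4 => meet u1 u2 u3 u4 u
      | _, _, _, _ => false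
      end].

Fixpoint run K (ss : seq step) :=
  if ss is s :: ss' then
    if step_ok K s then let: (i, j, _, _, u) := s in run ((i, j, u) :: K) ss' else None
  else Some K.

(** The basis consists of the points in which two of the planes 0, 1, 2, 3 meet. The points with
    labels 4, 12 and 10 fix the scales of five basis vectors against the first, and the point of
    planes 0 and 13 defines [w]. *)
Definition known0 : seq (nat * nat * seq nat) :=
  [::
    (0, 1, [::1;0;0;0;0;0]); (0, 2, [::0;1;0;0;0;0]); (0, 3, [::0;0;1;0;0;0]);
    (1, 2, [::0;0;0;1;0;0]); (1, 3, [::0;0;0;0;1;0]); (2, 3, [::0;0;0;0;0;1]);
    (0, 4, [::1;1;0;0;0;0]); (0, 13, [::1;2;0;0;0;0]); (0, 12, [::1;0;1;0;0;0]);
    (1, 4, [::1;0;0;1;0;0]); (1, 12, [::1;0;0;0;1;0]); (2, 10, [::0;1;0;0;0;1])]%N.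

(* A step (i, j, (i1, a1, b1), (i2, a2, b2), u) finds the point u common to planes i and j as
   the meet of two known lines, a line of plane i1 through its points with a1 and b1 and a
   line of plane i2 through its points with a2 and b2. *)
Definition steps : seq step :=
  [::
    (2, 13, (2, 0, 1), (13, 0, 1), [::0;1;0;2;0;0]);
    (0, 6, (0, 3, 4), (0, 12, 13), [::1;1;2;0;0;0]);
    (0, 7, (0, 2, 12), (0, 3, 4), [::1;1;1;0;0;0]);
    (0, 8, (0, 2, 6), (0, 4, 12), [::1;3;2;0;0;0]);
    (0, 9, (0, 1, 8), (0, 2, 7), [::1;2;1;0;0;0]);
    (0, 10, (0, 1, 7), (0, 2, 3), [::0;1;1;0;0;0]);
    (0, 11, (0, 1, 7), (0, 3, 8), [::1;3;3;0;0;0]);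
    (0, 14, (0, 1, 8), (0, 2, 11), [::1;1;3;0;0;0]);
    (0, 15, (0, 1, 3), (0, 2, 6), [::1;0;2;0;0;0]);
    (0, 16, (0, 1, 2), (0, 3, 8), [::1;3;0;0;0;0]);
    (0, 17, (0, 1, 7), (0, 2, 6), [::1;2;2;0;0;0]);
    (0, 18, (0, 1, 6), (0, 2, 3), [::0;1;2;0;0;0]);
    (0, 19, (0, 1, 8), (0, 2, 3), [::0;1;3;0;0;0]);
    (0, 20, (0, 1, 6), (0, 2, 11), [::1;2;3;0;0;0]);
    (0, 21, (0, 1, 3), (0, 2, 11), [::1;0;3;0;0;0]);
    (0, 5, (0, 1, 6), (0, 2, 7), [::1;3;1;0;0;0]);
    (1, 5, (1, 3, 4), (1, 12, 13), [::1;0;0;1;3;0]);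
    (1, 6, (1, 0, 5), (1, 2, 12), [::1;0;0;2;1;0]);
    (1, 7, (1, 2, 3), (1, 4, 12), [::0;0;0;1;1;0]);
    (1, 8, (1, 2, 3), (1, 4, 6), [::0;0;0;1;2;0]);
    (1, 9, (1, 0, 8), (1, 3, 4), [::1;0;0;1;2;0]);
    (1, 10, (1, 0, 7), (1, 2, 6), [::1;0;0;1;1;0]);
    (1, 11, (1, 0, 7), (1, 2, 5), [::1;0;0;3;3;0]);
    (1, 14, (1, 0, 8), (1, 2, 6), [::1;0;0;3;1;0]);
    (1, 15, (1, 0, 3), (1, 2, 5), [::1;0;0;0;3;0]);
    (1, 16, (1, 0, 2), (1, 3, 6), [::1;0;0;2;0;0]);
    (1, 17, (1, 0, 7), (1, 2, 9), [::1;0;0;2;2;0]);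
    (1, 18, (1, 0, 5), (1, 2, 9), [::1;0;0;3;2;0]);
    (1, 19, (1, 0, 8), (1, 2, 5), [::1;0;0;2;3;0]);
    (1, 20, (1, 0, 5), (1, 2, 3), [::0;0;0;1;3;0]);
    (1, 21, (1, 0, 3), (1, 2, 9), [::1;0;0;0;2;0]);
    (2, 6, (2, 1, 10), (2, 3, 13), [::0;1;0;2;0;1]);
    (2, 7, (2, 1, 3), (2, 4, 10), [::0;0;0;1;0;1]);
    (2, 8, (2, 0, 6), (2, 1, 3), [::0;0;0;1;0;3]);
    (2, 9, (2, 0, 7), (2, 4, 6), [::0;1;0;3;0;3]);
    (2, 11, (2, 3, 4), (2, 6, 7), [::0;1;0;1;0;2]);
    (2, 12, (2, 0, 7), (2, 1, 6), [::0;1;0;1;0;1]);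
    (2, 14, (2, 0, 11), (2, 1, 6), [::0;1;0;3;0;1]);
    (2, 15, (2, 0, 6), (2, 1, 11), [::0;1;0;3;0;2]);
    (2, 16, (2, 0, 1), (2, 3, 9), [::0;1;0;3;0;0]);
    (2, 17, (2, 0, 6), (2, 1, 9), [::0;1;0;1;0;3]);
    (2, 18, (2, 0, 3), (2, 1, 9), [::0;1;0;0;0;3]);
    (2, 19, (2, 0, 3), (2, 1, 11), [::0;1;0;0;0;2]);
    (2, 20, (2, 0, 11), (2, 1, 3), [::0;0;0;1;0;2]);
    (2, 21, (2, 0, 11), (2, 1, 9), [::0;1;0;2;0;3]);
    (2, 5, (2, 0, 7), (2, 1, 11), [::0;1;0;2;0;2]);
    (3, 12, (3, 0, 1), (12, 0, 1), [::0;0;1;0;1;0]);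
    (3, 10, (3, 0, 2), (10, 0, 2), [::0;0;1;0;0;1]);
    (3, 15, (3, 0, 1), (15, 0, 1), [::0;0;1;0;2;0]);
    (3, 4, (3, 1, 10), (3, 2, 12), [::0;0;1;0;1;1]);
    (3, 6, (3, 0, 4), (3, 10, 15), [::0;0;1;0;3;3]);
    (3, 7, (3, 0, 4), (3, 1, 2), [::0;0;0;0;1;1]);
    (3, 8, (3, 1, 2), (3, 4, 15), [::0;0;0;0;1;2]);
    (3, 9, (3, 1, 4), (3, 2, 15), [::0;0;1;0;2;1]);
    (3, 11, (3, 0, 8), (3, 2, 4), [::0;0;1;0;1;2]);
    (3, 13, (3, 0, 9), (3, 1, 11), [::0;0;1;0;3;2]);
    (3, 14, (3, 0, 4), (3, 1, 11), [::0;0;1;0;2;2]);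
    (3, 16, (3, 0, 8), (3, 1, 6), [::0;0;1;0;2;3]);
    (3, 17, (3, 0, 9), (3, 1, 6), [::0;0;1;0;1;3]);
    (3, 18, (3, 0, 2), (3, 1, 11), [::0;0;1;0;0;2]);
    (3, 19, (3, 0, 2), (3, 1, 6), [::0;0;1;0;0;3]);
    (3, 20, (3, 0, 9), (3, 1, 2), [::0;0;0;0;1;3]);
    (3, 21, (3, 0, 1), (3, 2, 6), [::0;0;1;0;3;0]);
    (3, 5, (3, 0, 8), (3, 1, 4), [::0;0;1;0;3;1])]%N.

(* Three points of the plane with index j that span it, in coordinates. *)
Definition plane_tab : seq (seq (seq nat)) :=
  [::
    [::[::1;0;0;0;0;0]; [::0;1;0;0;0;0]; [::0;0;1;0;0;0]];
    [::[::1;0;0;0;0;0]; [::0;0;0;1;0;0]; [::0;0;0;0;1;0]];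
    [::[::0;1;0;0;0;0]; [::0;0;0;1;0;0]; [::0;0;0;0;0;1]];
    [::[::0;0;1;0;0;0]; [::0;0;0;0;1;0]; [::0;0;0;0;0;1]];
    [::[::1;1;0;0;0;0]; [::1;0;0;1;0;0]; [::0;0;1;0;1;1]];
    [::[::1;3;1;0;0;0]; [::1;0;0;1;3;0]; [::0;1;0;2;0;2]];
    [::[::1;1;2;0;0;0]; [::1;0;0;2;1;0]; [::0;1;0;2;0;1]];
    [::[::1;1;1;0;0;0]; [::0;0;0;1;1;0]; [::0;0;0;1;0;1]];
    [::[::1;3;2;0;0;0]; [::0;0;0;1;2;0]; [::0;0;0;1;0;3]];
    [::[::1;2;1;0;0;0]; [::1;0;0;1;2;0]; [::0;1;0;3;0;3]];
    [::[::0;1;1;0;0;0]; [::1;0;0;1;1;0]; [::0;1;0;0;0;1]];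
    [::[::1;3;3;0;0;0]; [::1;0;0;3;3;0]; [::0;1;0;1;0;2]];
    [::[::1;0;1;0;0;0]; [::1;0;0;0;1;0]; [::0;1;0;1;0;1]];
    [::[::1;2;0;0;0;0]; [::1;0;0;3;0;0]; [::0;0;1;0;3;2]];
    [::[::1;1;3;0;0;0]; [::1;0;0;3;1;0]; [::0;1;0;3;0;1]];
    [::[::1;0;2;0;0;0]; [::1;0;0;0;3;0]; [::0;1;0;3;0;2]];
    [::[::1;3;0;0;0;0]; [::1;0;0;2;0;0]; [::0;0;1;0;2;3]];
    [::[::1;2;2;0;0;0]; [::1;0;0;2;2;0]; [::0;1;0;1;0;3]];
    [::[::0;1;2;0;0;0]; [::1;0;0;3;2;0]; [::0;1;0;0;0;3]];
    [::[::0;1;3;0;0;0]; [::1;0;0;2;3;0]; [::0;1;0;0;0;2]];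
    [::[::1;2;3;0;0;0]; [::0;0;0;1;3;0]; [::0;0;0;1;0;2]];
    [::[::1;0;3;0;0;0]; [::1;0;0;0;2;0]; [::0;1;0;2;0;3]]]%N.

Definition known_ok (K : seq (nat * nat * seq nat)) (j : nat) (u : seq nat) :=
  has (fun e => ((e.1.1 == j) || (e.1.2 == j)) && (e.2 == u)) K.

Definition tab_ok K : bool :=
  all (fun j => if nth [::] plane_tab j is [:: u1; u2; u3] then
      [&& known_ok K j u1, known_ok K j u2, known_ok K j u3 & indep3 u1 u2 u3]
    else false) (iota 0 22).

(** The point of planes 1 and 13 has a coefficient that is [w] or w + 1. If it is [w], [step_w] and
    [step0] give the same point of plane 2 the labels 13 and 4, which is impossible. So the code is
    3, and the run starts from [known_w 3]. *)
Definition step0 : step := (2, 4, (2, 0, 1), (4, 0, 1), [::0;1;0;1;0;0])%N.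
Definition step_w : step := (2, 13, (2, 0, 1), (13, 0, 1), [::0;1;0;1;0;0])%N.
Definition known_w (c : nat) : seq (nat * nat * seq nat) := (1, 13, [::1;0;0;c;0;0]) :: known0%N.

Definition coords_ok : bool :=
  [&& all (fun h => is_octad (0 :: 23 :: map S h)) hexads,
      step_ok (known_w 2) step_w, step_ok (known_w 2) step0
    & if run (known_w 3) (step0 :: steps) is Some K then tab_ok K else false]%N.

Lemma coords_check : coords_ok.
Proof. by vm_compute. Qed.

Lemma sub1_sym (F : fieldType) n (u v : 'rV[F]_n) : u != 0 -> (u <= v)%MS -> (v <= u)%MS.
Proof.
move=> u0 /sub_rVP[a uE]; rewrite uE eqmx_scale ?submx_refl //.
by apply: contraNneq u0 => a0; rewrite uE a0 scale0r.
Qed.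

Lemma hexad_lt h n : is_octad (0 :: 23 :: map S h)%N -> n \in h -> (n < 22)%N.
Proof.
move=> /and4P[_ /= /andP[_ /andP[n23 _]] _ /allP all24] nh.
have Sn : S n \in map S h by apply: map_f.
have : (S n < 24)%N by exact: (all24 _ Sn).
rewrite ltnS leq_eqVlt => /orP[/eqP E | //].
by rewrite -E Sn in n23.
Qed.

Lemma collP (F : finFieldType) (I : finType) (W : I -> 'M[F]_6) i j k l :
  coll W i j k l -> (pnt W i l <= pnt W i j + pnt W i k)%MS.
Proof. by []. Qed.

Local Opaque is_octad coll pnt hexads.

Section Coordinates.

Variables (F : finFieldType) (W : I22 -> 'M[F]_6).
Hypothesis dW : dual_hyperoval W.
Hypothesis Hcoll : forall h (a b c d : I22), is_octad (0 :: 23 :: map S h)%N ->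
  (a : nat) \in h -> (b : nat) \in h -> (c : nat) \in h -> uniq [:: a; b; c; d] ->
  coll W a b c d = ((d : nat) \in h).

Let cF := dho_field dW.

Lemma o22_inj i j : (i < 22)%N -> (j < 22)%N -> (o22 i == o22 j) = (i == j).
Proof. by move=> i22 j22; rewrite -val_eqE /= !inordK. Qed.

Section Known.

Variables (w : F) (B : 'M[F]_6).
Hypotheses (w0 : w != 0) (w1 : w != 1) (uB : B \in unitmx).

Notation "<[ u ]>" := (vec w u *m B).

Definition good (i j : nat) (u : seq nat) :=
  [/\ (i < 22)%N, (j < 22)%N, i != j & (pnt W (o22 i) (o22 j) <= <[u]>)%MS].

Definition known (K : seq (nat * nat * seq nat)) : Prop :=
  forall i j u, (i, j, u) \in K -> good i j u.

Lemma known_cons K i j u : good i j u -> known K -> known ((i, j, u) :: K).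
Proof. by move=> g kK a b v; rewrite inE => /orP[/eqP[-> -> ->] // | /kK]. Qed.

Lemma lookup_good K i j u : known K -> lookup K i j = Some u ->
  (pnt W (o22 i) (o22 j) <= <[u]>)%MS.
Proof.
elim: K => [|[[a b] v] K IH] //= kK.
have kK' : known K by move=> i' j' u' e; apply: kK; rewrite inE e orbT.
case: ifP => [/orP[] /andP[/eqP<- /eqP<-] [<-] | _]; last exact: IH.
  by have [] := kK a b v (mem_head _ _).
by rewrite pntC; have [] := kK a b v (mem_head _ _).
Qed.

Hypothesis octads : forall h, h \in hexads -> is_octad (0 :: 23 :: map S h)%N.

Lemma in_hexad_coll a b c d : in_hexad a b c d ->
  [/\ (a < 22)%N, (d < 22)%N, a != d & coll W (o22 a) (o22 b) (o22 c) (o22 d)].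
Proof.
case/andP=> U /hasP[h hH /and4P[ah bh ch dh]].
have oh := octads hH.
have [a22 b22 c22 d22] := And4 (hexad_lt oh ah) (hexad_lt oh bh) (hexad_lt oh ch) (hexad_lt oh dh).
have ad : a != d by move: U; rewrite /= !inE !negb_or => /andP[/and3P[_ _ ->]].
split; [exact: a22 | exact: d22 | exact: ad |].
rewrite (Hcoll oh) /= ?inordK //.
by move: U; rewrite /= !inE !o22_inj.
Qed.

(** The hexad conditions put the common point of planes [i] and [j] on both known lines, and [meet]
    leaves only the span of [u]. *)
Lemma step_okP K i j f g u : known K -> step_ok K (i, j, f, g, u) -> good i j u.
Proof.
case: f g => [[i1 a1] b1] [[i2 a2] b2] kK /and5P[i22 j22 e1 e2 /and3P[x1 x2]].
case l1: (lookup K i1 a1) => [u1|] //; case l2: (lookup K i1 b1) => [u2|] //.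
case l3: (lookup K i2 a2) => [u3|] //; case l4: (lookup K i2 b2) => [u4|] // m.
have line i' a b v v' : (i' == i) || (i' == j) -> in_hexad i' a b (other i j i') ->
    lookup K i' a = Some v -> lookup K i' b = Some v' ->
    i != j /\ (pnt W (o22 i) (o22 j) <= <[v]> + <[v']>)%MS.
  move=> e /in_hexad_coll[_ _ no co] lv lv'.
  have -> : pnt W (o22 i) (o22 j) = pnt W (o22 i') (o22 (other i j i')).
    rewrite /other; case: eqP e => [-> // | _ /= /eqP ->]; exact: pntC.
  split; first by move: no; rewrite /other; case: eqP e => [-> // | _ /= /eqP ->]; rewrite eq_sym.
  exact: submx_trans (collP co) (addsmxS (lookup_good kK lv) (lookup_good kK lv')).
have [ij s1] := line _ _ _ _ _ e1 x1 l1 l2; have [_ s2] := line _ _ _ _ _ e2 x2 l3 l4.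
by split=> //; apply: (meetP cF w0 w1 uB m).
Qed.

Lemma run_known K ss K' : known K -> run K ss = Some K' -> known K'.
Proof.
elim: ss K => [|s ss IH] K kK /=; first by case=> <-.
case: ifP => // ok; case: s ok => [[[[i j] f] g] u] ok.
by apply: IH; apply: known_cons => //; apply: step_okP kK ok.
Qed.

Definition plane (j : nat) : 'M[F]_6 :=
  let t := nth [::] plane_tab j in
  (vec w (nth [::] t 0) + vec w (nth [::] t 1) + vec w (nth [::] t 2))%MS.

Lemma good_pnt_neq0 i j u : good i j u -> pnt W (o22 i) (o22 j) != 0.
Proof. by case=> i22 j22 ij _; apply: pnt_neq0; rewrite ?o22_inj. Qed.

Lemma known_sub K j u : known K -> known_ok K j u -> (<[u]> <= W (o22 j))%MS.
Proof.
move=> kK /hasP[[[a b] v] eK /= /andP[e /eqP <-]].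
have gd := kK _ _ _ eK; have n0 := good_pnt_neq0 gd; have [_ _ _ s] := gd.
apply: submx_trans (sub1_sym n0 s) _.
by case/orP: e => /eqP <-; [apply: pnt_subl | apply: pnt_subr].
Qed.

Lemma tab_okP K (j : I22) : known K -> tab_ok K -> (W j :=: plane j *m B)%MS.
Proof.
move=> kK /allP/(_ j); rewrite mem_iota ltn_ord => /(_ isT); rewrite /plane.
case: (nth [::] plane_tab j) => [|u1 [|u2 [|u3 [|]]]] //= /and4P[k1 k2 k3 ind].
have oj : o22 j = j by apply: val_inj; rewrite /= inordK.
have r3 := indep3P cF w0 w1 uB ind.
have E : ((vec w u1 + vec w u2 + vec w u3)%MS *m B :=: <[u1]> + <[u2]> + <[u3]>)%MS.
  by apply: eqmx_trans (addsmxMr _ _ _) (adds_eqmx (addsmxMr _ _ _) (eqmx_refl _)).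
apply: eqmx_sym; apply: eqmx_trans E _; apply/eqmxP.
have sub : (<[u1]> + <[u2]> + <[u3]> <= W j)%MS.
  by rewrite -oj !addsmx_sub !(known_sub kK).
by rewrite -(geq_leqif (mxrank_leqif_eq sub)) (dho_rank dW) r3.
Qed.

End Known.

Lemma prop_eq i j k (v : 'rV[F]_6) : i != j -> i != k -> (pnt W i j <= v)%MS ->
  (pnt W i k <= v)%MS -> j = k.
Proof.
move=> ij ik jv kv; apply/eqP; apply: contraT => jk; have kj : k != j by rewrite eq_sym.
case/negP: (pnt_notin dW ik ij kj); apply: submx_trans kv _.
exact: submx_trans (sub1_sym (pnt_neq0 dW ij) jv) (pnt_subr _ _ _).
Qed.

Lemma norm_coef i j k l (e e' : 'rV[F]_6) : uniq [:: i; j; k; l] -> coll W i j k l ->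
    e != 0 -> (e <= pnt W i j)%MS -> e' != 0 -> (e' <= pnt W i k)%MS ->
  exists2 c, c != 0 & (pnt W i l <= (e + c *: e')%R)%MS.
Proof.
move=> U /(coll_coef dW U)[a [b [a0 b0 E]]] e0 /sub_rVP[x eE] e'0 /sub_rVP[y e'E].
have x0 : x != 0 by apply: contraNneq e0 => x0; rewrite eE x0 scale0r.
have y0 : y != 0 by apply: contraNneq e'0 => y0; rewrite e'E y0 scale0r.
exists (b * x / (a * y)); first by rewrite !mulf_neq0 ?invr_eq0 ?mulf_neq0.
have -> : pnt W i l = (a / x) *: (e + (b * x / (a * y)) *: e').
  rewrite E eE e'E scalerDr !scalerA; congr (_ *: _ + _ *: _); first by rewrite divfK.
  by field; rewrite a0 x0 y0.
by rewrite scalemx_sub.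
Qed.

Lemma norm_point i j k l (e : 'rV[F]_6) : uniq [:: i; j; k; l] -> coll W i j k l ->
    e != 0 -> (e <= pnt W i j)%MS ->
  exists e', [/\ e' != 0, (e' <= pnt W i k)%MS & (pnt W i l <= (e + e')%R)%MS].
Proof.
move=> U co e0 ej.
have ik : i != k by move: U; rewrite /= !inE !negb_or => /andP[/and3P[_ ->]].
have [c c0 H] := norm_coef U co e0 ej (pnt_neq0 dW ik) (submx_refl _).
exists (c *: pnt W i k); split=> //; first by rewrite scaler_eq0 negb_or c0 pnt_neq0.
by rewrite scalemx_sub.
Qed.

Hypothesis octads : forall h, h \in hexads -> is_octad (0 :: 23 :: map S h)%N.

Lemma hexad_coll a b c d : in_hexad a b c d -> coll W (o22 a) (o22 b) (o22 c) (o22 d).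
Proof. by case/(in_hexad_coll octads). Qed.

Lemma o22_uniq l : uniq l -> all (gtn 22) l -> uniq (map o22 l).
Proof.
move=> U /allP lt; rewrite map_inj_in_uniq // => i j /lt /= i22 /lt /= j22 /eqP.
by rewrite o22_inj // => /eqP.
Qed.

Lemma base_noncoll i j k : (i < 3)%N -> (j < 3)%N -> (k < 3)%N -> uniq [:: i; j; k] ->
  ~~ coll W (o22 i) (o22 j) (o22 k) (o22 3).
Proof.
move=> i3 j3 k3 U; pose h : seq nat := [:: 0; 1; 2; 4; 13; 16]%N.
have oh : is_octad (0 :: 23 :: map S h)%N by apply: octads.
have mem n : (n < 3)%N -> (o22 n : nat) \in h.
  by move=> n3; rewrite /= inordK; [case: n n3 => [|[|[|]]] | lia].
rewrite (Hcoll oh (mem _ i3) (mem _ j3) (mem _ k3)); first by rewrite /= inordK.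
apply: (@o22_uniq [:: i; j; k; 3]%N); last by rewrite /=; lia.
by move: U; rewrite /= !inE !negb_or; lia.
Qed.

Lemma opt_ex (T : Type) (o : option T) (P : pred T) :
  (if o is Some K then P K else false) = true -> exists2 K, o = Some K & P K.
Proof. by case: o => // K PK; exists K. Qed.

Local Opaque step_ok run tab_ok.

(** The six vectors are scaled one after another, each against a vector already scaled, by a third
    point collinear with the two. They form a basis because the points with labels among 0, 1, 2, 3
    span each of the planes 0, 1 and 2, which span [V]. Neither coefficient for label 13 is 1, since
    the labels 4 and 13 belong to different points. *)
Lemma normalized_coordinates : exists (w : F) (B : 'M[F]_6),
  [/\ w != 0, w != 1, B \in unitmx & known w B (known_w 2) \/ known w B (known_w 3)].
Proof.
have U4 a b c d : uniq [:: a; b; c; d] -> all (gtn 22) [:: a; b; c; d] ->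
  uniq [:: o22 a; o22 b; o22 c; o22 d] by move=> *; apply: (@o22_uniq [:: a; b; c; d]).
have nz i j : (i < 22)%N -> (j < 22)%N -> i != j -> pnt W (o22 i) (o22 j) != 0.
  by move=> i22 j22 ij; apply: pnt_neq0; rewrite ?o22_inj.
pose e0 := pnt W (o22 0) (o22 1); have e00 : e0 != 0 by apply: nz.
have e0s : (e0 <= pnt W (o22 0) (o22 1))%MS by [].
have e0s' : (e0 <= pnt W (o22 1) (o22 0))%MS by rewrite pntC.
have [e1 [e10 e1s p04]] := norm_point (U4 0 1 2 4 isT isT)%N (hexad_coll (isT : in_hexad 0 1 2 4)) e00 e0s.
have [e2 [e20 e2s p012]] := norm_point (U4 0 1 3 12 isT isT)%N (hexad_coll (isT : in_hexad 0 1 3 12)) e00 e0s.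
have [e3 [e30 e3s p14]] := norm_point (U4 1 0 2 4 isT isT)%N (hexad_coll (isT : in_hexad 1 0 2 4)) e00 e0s'.
have [e4 [e40 e4s p112]] := norm_point (U4 1 0 3 12 isT isT)%N (hexad_coll (isT : in_hexad 1 0 3 12)) e00 e0s'.
have e1s' : (e1 <= pnt W (o22 2) (o22 0))%MS by rewrite pntC.
have [e5 [e50 e5s p210]] := norm_point (U4 2 0 3 10 isT isT)%N (hexad_coll (isT : in_hexad 2 0 3 10)) e10 e1s'.
have [w w0 p013] := norm_coef (U4 0 1 2 13 isT isT)%N (hexad_coll (isT : in_hexad 0 1 2 13)) e00 e0s e10 e1s.
have [c c0 p113] := norm_coef (U4 1 0 2 13 isT isT)%N (hexad_coll (isT : in_hexad 1 0 2 13)) e00 e0s' e30 e3s.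
have ne i j k (v : 'rV[F]_6) : i != j -> i != k -> j != k -> (pnt W i j <= v)%MS ->
    (pnt W i k <= v)%MS -> False.
  by move=> ij ik /eqP jk jv kv; apply: jk; apply: prop_eq jv kv.
have w1 : w != 1.
  apply/eqP => w1; rewrite w1 scale1r in p013.
  by apply: (ne (o22 0) (o22 4) (o22 13)) p04 p013; rewrite o22_inj.
have c1 : c != 1.
  apply/eqP => c1; rewrite c1 scale1r in p113.
  by apply: (ne (o22 1) (o22 4) (o22 13)) p14 p113; rewrite o22_inj.
pose es := [:: e0; e1; e2; e3; e4; e5].
pose B : 'M[F]_6 := \matrix_(k < 6) es`_k.
have Brow (k : 'I_6) : row k B = es`_k by apply/rowP=> j; rewrite !mxE.
have esB k : (k < 6)%N -> (es`_k <= B)%MS by move=> k6; rewrite -(Brow (Ordinal k6)) row_sub.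
have ps i j (e : 'rV[F]_6) : e != 0 -> (e <= pnt W i j)%MS -> (pnt W i j <= e)%MS.
  exact: sub1_sym.
have pB k i j : (k < 6)%N -> es`_k != 0 -> (es`_k <= pnt W i j)%MS -> (pnt W i j <= B)%MS.
  by move=> k6 k0 ks; apply: submx_trans (ps _ _ _ k0 ks) (esB _ k6).
have o3 i j : (i < 22)%N -> (j < 22)%N -> i != j -> o22 i != o22 j.
  by move=> *; rewrite o22_inj.
have uB : B \in unitmx.
  rewrite -row_full_unit -sub1mx.
  have S6 := dho_span3 dW (o3 0 1 isT isT isT)%N (o3 0 2 isT isT isT)%N (o3 1 2 isT isT isT)%N.
  apply: (@submx_trans _ _ _ _ _ _ (W (o22 0) + W (o22 1) + W (o22 2))%MS).
    by rewrite sub1mx /row_full S6.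
  rewrite !addsmx_sub; apply/andP; split; [apply/andP; split|].
  - rewrite -(pnt_basis dW (o3 0 1 isT isT isT)%N (o3 0 2 isT isT isT)%N
      (o3 0 3 isT isT isT)%N (o3 1 2 isT isT isT)%N (@base_noncoll 0 1 2 isT isT isT isT)%N).
    by rewrite !addsmx_sub (pB 2%N) // (pB 0%N) // (pB 1%N).
  - rewrite -(pnt_basis dW (o3 1 0 isT isT isT)%N (o3 1 2 isT isT isT)%N
      (o3 1 3 isT isT isT)%N (o3 0 2 isT isT isT)%N (@base_noncoll 1 0 2 isT isT isT isT)%N).
    by rewrite !addsmx_sub (pB 4%N) // (pB 0%N) // (pB 3%N).
  rewrite -(pnt_basis dW (o3 2 0 isT isT isT)%N (o3 2 1 isT isT isT)%N
    (o3 2 3 isT isT isT)%N (o3 0 1 isT isT isT)%N (@base_noncoll 2 0 1 isT isT isT isT)%N).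
  by rewrite !addsmx_sub (pB 5%N) // (pB 1%N) // (pB 3%N) // pntC.
have vecB u : vec w u *m B = \sum_(k < 6) cval w (nth 0%N u k) *: es`_k.
  by rewrite mulmx_sum_row; apply: eq_bigr => k _; rewrite Brow mxE.
have kw (n : nat) : c = cval w n -> known w B (known_w n).
  move=> cE i j u; rewrite !inE => mem.
  repeat (case/orP: mem => [/eqP[-> -> ->] | mem]); last (move/eqP: mem => [-> -> ->]);
    split=> //; rewrite vecB !big_ord_recl big_ord0 /= ?scale0r ?scale1r ?add0r ?addr0 ?cE //;
    solve [apply: ps; assumption | rewrite -cE; assumption].
have [_ /(_ c)] := GF4_elements cF w0 w1; rewrite !inE (negPf c0) (negPf c1) /=.
by case/orP=> /eqP cw; exists w, B; split=> //; [left | right]; apply: kw.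
Qed.

Lemma coordinates : coords_ok -> exists (w : F) (B : 'M[F]_6),
  [/\ w != 0, w != 1, B \in unitmx & forall j : I22, (W j :=: plane w j *m B)%MS].
Proof.
have [w [B [w0 w1 uB kn]]] := normalized_coordinates.
have ne i j k (v : 'rV[F]_6) : i != j -> i != k -> j != k -> (pnt W i j <= v)%MS ->
    (pnt W i k <= v)%MS -> False.
  by move=> ij ik /eqP jk jv kv; apply: jk; apply: prop_eq jv kv.
have n24 : o22 2 != o22 4 by rewrite o22_inj.
have n213 : o22 2 != o22 13 by rewrite o22_inj.
have n413 : o22 4 != o22 13 by rewrite o22_inj.
rewrite /coords_ok => /and4P[_ okw ok0 okr].
case: kn => [k2 | k3].
  have [_ _ _ s1] := step_okP w0 w1 uB octads k2 okw.
  have [_ _ _ s2] := step_okP w0 w1 uB octads k2 ok0.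
  by case: (ne (o22 2) (o22 4) (o22 13) _ n24 n213 n413 s2 s1).
have {okr}[K runK tk] := @opt_ex _ (run (known_w 3) (step0 :: steps)) tab_ok okr.
exists w, B; split; [exact: w0 | exact: w1 | exact: uB | move=> j].
exact: (tab_okP w0 w1 uB j (run_known w0 w1 uB octads k3 runK) tk).
Qed.

End Coordinates.

End PlaneCoordinates.

(** * The hexad relation on the planes, and a semilinear involution permuting them *)

Module FieldAutomorphism.

Import FieldOfFour Orthogonality DualHyperovals CosetFamilies PlanePoints GolayCode M22Elements Octads M22Stabilizers M22Labels M21Preimage SL3Isomorphism SetupPlanes PlaneStabilizer FieldCodes PlaneCoordinates.
Local Opaque line23 lperm dec enc is_lperm M22_check M22 M24.
Local Open Scope ring_scope.

Definition step := (nat * nat * (nat * nat * nat) * (nat * nat * nat) * seq nat)%type.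

(** The Frobenius map on codes: it exchanges w and w + 1. *)
Definition conjc (c : nat) : nat := match c with 0 => 0 | 1 => 1 | 2 => 3 | _ => 2 end%N.
Definition conjv (s : seq nat) : seq nat := mkseq (fun k => conjc (nth 0 s k)) 6%N.

Definition in_span3 (v u1 u2 u3 : seq nat) : bool :=
  has (fun a => has (fun b => has (fun c => FieldCodes.addv (comb2 a b u1 u2) (mulv c u3) == v) codes)
    codes) codes.

(* The permutation of the 22 planes induced by the field automorphism acting on
   coordinates. *)
Definition frob_perm : seq nat :=
  [:: 0; 1; 2; 3; 4; 9; 14; 7; 20; 5; 10; 17; 12; 16; 6; 21; 13; 11; 19; 18; 8; 15]%N.

Definition tab_sub (f : seq nat -> seq nat) (j k : nat) : bool :=
  let t := nth [::] plane_tab j in let t' := nth [::] plane_tab k in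
  all (fun i => in_span3 (f (nth [::] t i)) (nth [::] t' 0) (nth [::] t' 1) (nth [::] t' 2))
    (iota 0 3)%N.

Definition frob_ok : bool :=
  all (fun j => (nth 0 frob_perm j < 22)%N && tab_sub conjv j (nth 0 frob_perm j)) (iota 0 22).

Lemma frob_check : frob_ok. Proof. by vm_compute. Qed.

Local Opaque frob_ok frob_perm plane_tab.

Section Frobenius.

Variables (F : finFieldType) (w : F).
Hypotheses (cF : #|F| = 4%N) (w0 : w != 0) (w1 : w != 1).

Definition frob (v : 'rV[F]_6) : 'rV[F]_6 := map_mx (fun a => a ^+ 2) v.

Lemma frobD u v : frob (u + v) = frob u + frob v.
Proof. by apply/rowP=> k; rewrite !mxE sqrrD mulr2n (GF4_addrr cF) addr0. Qed.

Lemma frobZ a v : frob (a *: v) = a ^+ 2 *: frob v.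
Proof. by apply/rowP=> k; rewrite !mxE exprMn. Qed.

Lemma frobK : involutive frob.
Proof.
move=> v; apply/rowP=> k; rewrite !mxE -exprM.
by have := expf_card (v 0 k); rewrite cF.
Qed.

Lemma frob_vec u : frob (vec w u) = vec w (conjv u).
Proof.
have [ww _] := GF4_elements cF w0 w1.
apply/rowP=> k; rewrite !mxE nth_mkseq //.
case: (nth 0%N u k) => [|[|[|n]]] /=; rewrite ?expr0n ?expr1n ?expr2 //.
by rewrite mulrDl mulrDr ww !mulr1 mul1r addrAC (GF4_addrr cF) add0r.
Qed.

Lemma in_span3P v u1 u2 u3 : in_span3 v u1 u2 u3 ->
  (vec w v <= vec w u1 + vec w u2 + vec w u3)%MS.
Proof.
case/hasP=> a _ /hasP[b _ /hasP[c _ /eqP <-]].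
rewrite !(vec_add _ cF) !(vec_mul cF w0 w1); apply: addmx_sub.
  by apply: submx_trans (addsmxSl _ _); apply: addmx_sub;
    rewrite scalemx_sub ?addsmxSl ?addsmxSr.
by rewrite scalemx_sub ?addsmxSr.
Qed.

Lemma planeP j (v : 'rV[F]_6) : (v <= plane w j)%MS ->
  exists c : 'I_3 -> F, v = \sum_(i < 3) c i *: vec w (nth [::] (nth [::] plane_tab j) i).
Proof.
case/sub_addsmxP=> -[y z] /= ->; have := submxMl y (vec w (nth [::] (nth [::] plane_tab j) 0) +
  vec w (nth [::] (nth [::] plane_tab j) 1))%MS.
case/sub_addsmxP=> -[y1 y2] /= ->.
rewrite [y1]mx11_scalar [y2]mx11_scalar [z]mx11_scalar !mul_scalar_mx.
exists (fun i => [:: y1 0 0; y2 0 0; z 0 0]`_i).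
by rewrite !big_ord_recl big_ord0 /= addr0 addrA.
Qed.

Lemma tab_subP f j k i : tab_sub f j k -> (i < 3)%N ->
  (vec w (f (nth [::] (nth [::] plane_tab j) i)) <= plane w k)%MS.
Proof.
by move=> /allP ts i3; apply: in_span3P; apply: ts; rewrite mem_iota.
Qed.

Lemma frob_plane (j : I22) (v : 'rV[F]_6) : (v <= plane w j)%MS ->
  (frob v <= plane w (nth 0%N frob_perm j))%MS.
Proof.
have /allP/(_ (j : nat)) : frob_ok by exact: frob_check.
rewrite mem_iota ltn_ord => /(_ isT)/andP[_ ts] /planeP[c ->].
have -> : frob (\sum_(i < 3) c i *: vec w (nth [::] (nth [::] plane_tab j) i)) =
    \sum_(i < 3) c i ^+ 2 *: vec w (conjv (nth [::] (nth [::] plane_tab j) i)).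
  by rewrite !big_ord_recl !big_ord0 !addr0 !frobD !frobZ !frob_vec.
by apply: summx_sub => i _; apply: scalemx_sub; apply: tab_subP.
Qed.

End Frobenius.

Section Setup.

Variables (gT : finGroupType) (G : {group gT}) (f : {morphism G >-> {perm line23}}).
Variables (x : line23) (F : finFieldType) (rG : mx_representation F G 6) (W : 'M[F]_6).
Hypothesis ms : mathieu_setup f x rG W.

Notation Wi := (Wi f x rG W).
Let dW := setup_dual_hyperoval ms.
Let cF := dho_field dW.

Lemma permutes_pnt g s i j : permutes Wi g s -> i != j ->
  (pnt Wi (s i) (s j) :=: pnt Wi i j *m g)%MS.
Proof.
move=> [gu si gW] ij; have sij : s i != s j by rewrite (inj_eq si).
have sub : (pnt Wi i j *m g <= pnt Wi (s i) (s j))%MS.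
  rewrite (pnt_cap dW sij) sub_capmx -(gW i) -(gW j) !submxMr ?pnt_subl ?pnt_subr //.
apply: eqmx_sym; apply/eqmxP; rewrite sub /=; apply: sub1_sym => //.
by rewrite -mxrank_eq0 mxrankMfree ?row_free_unit // mxrank_eq0 pnt_neq0.
Qed.

Definition R4 a b c d := uniq [:: a; b; c; d] && coll Wi a b c d.

Lemma R4_act s a b c d : s \in M22 ->
  R4 (act22 s a) (act22 s b) (act22 s c) (act22 s d) = R4 a b c d.
Proof.
move=> sM; have [g gG gs] := lift_M22 ms sM; have pg := permG ms gG; rewrite gs in pg.
have si := act22_inj sM; have [gu _ _] := pg.
rewrite /R4 -[X in uniq X]/(map (act22 s) [:: a; b; c; d]) (map_inj_uniq si).
apply: andb_id2l; rewrite /= !inE !negb_or => /andP[/and3P[ab ac ad] _].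
rewrite /coll (permutes_pnt pg ad) (adds_eqmx (permutes_pnt pg ab) (permutes_pnt pg ac)).
by rewrite -addsmxMr submxMfree ?row_free_unit.
Qed.

(** The line through the points [j] and [k] of W_i has five points, each with exactly one label,
    which leaves three. *)
Lemma line_count (i j k : I22) : i != j -> i != k -> j != k ->
  #|[set d in ~: [set i; j; k] | R4 i j k d]| = 3%N.
Proof.
move=> ij ik jk; pose U := (pnt Wi i j + pnt Wi i k)%MS.
have U2 : \rank U = 2%N.
  have := mxrank_sum_cap (pnt Wi i j) (pnt Wi i k); rewrite !rank_rV !pnt_neq0 //.
  have -> : \rank (pnt Wi i j :&: pnt Wi i k) = 0%N; last by rewrite addn0 => ->.
  apply/eqP; rewrite -leqn0; apply: leq_trans (eq_leq (dho_rank3 dW ij ik jk)).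
  apply: mxrankS; rewrite (capmxS (_ : _ <= Wi i :&: Wi j)%MS) ?pnt_subr //.
  by rewrite (pnt_cap dW ij).
have UW : (U <= Wi i)%MS by rewrite addsmx_sub !pnt_subl.
have cov := @sum_cover F I22 Wi cF (dho_index dW) (dho_rank dW) (dho_rank2 dW) (dho_rank3 dW)
  i (fun v => v <= U)%MS.
have L : #|[set v : 'rV[F]_6 | [&& v != 0, (v <= Wi i)%MS & (v <= U)%MS]]| = 15%N.
  have C := card_nonzero U; rewrite cF U2 in C; apply: etrans C; apply: eq_card => v; rewrite !inE.
  by congr (_ && _); apply: andb_idl => /submx_trans; apply.
have Rt : (\sum_(d | d != i) #|[set v : 'rV[F]_6 |
    [&& v != 0%R, (v <= Wi i :&: Wi d)%MS & (v <= U)%MS]]| =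
    3 * #|[set d | (d != i) && (pnt Wi i d <= U)%MS]|)%N.
  rewrite (bigID (fun d => (pnt Wi i d <= U)%MS)) /= [X in (_ + X)%N]big1 => [|d /andP[di nU]].
    rewrite addn0 (eq_bigr (fun _ => 3%N)) => [|d /andP[di dU]].
      rewrite sum_nat_const mulnC; congr (_ * _)%N; apply: eq_card => d; rewrite !inE //.
    have id : i != d by rewrite eq_sym.
    have C := card_nonzero (Wi i :&: Wi d)%MS; rewrite cF (dho_rank2 dW id) in C.
    apply: etrans C.
    apply: eq_card => v; rewrite !inE; congr (_ && _); apply: andb_idr.
    by rewrite -(pnt_cap dW id) => /submx_trans; apply.
  have id : i != d by rewrite eq_sym.
  apply: eq_card0 => v; rewrite !inE; apply/negP=> /and3P[v0 vid vU].
  rewrite -(pnt_cap dW id) in vid; case/negP: nU.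
  exact: submx_trans (sub1_sym v0 vid) vU.
have C5 : #|[set d | (d != i) && (pnt Wi i d <= U)%MS]| = 5%N.
  by move: (etrans (esym L) (etrans (esym cov) Rt)); set m := #|_|; clear; lia.
have E : [set d | (d != i) && (pnt Wi i d <= U)%MS] =
    j |: (k |: [set d in ~: [set i; j; k] | R4 i j k d]).
  apply/setP=> d; rewrite !inE /R4 /= !inE !negb_or ij ik jk /=.
  have [-> | dj] := eqVneq d j; first by rewrite eq_sym ij addsmxSl.
  have [-> | dk] := eqVneq d k; first by rewrite eq_sym ik addsmxSr.
  have [-> | di] := eqVneq d i; first by [].
  exact: erefl.
move: C5; rewrite E !cardsU1 !inE !negb_or !eqxx jk /= ?orbT ?andbF /= !add1n.
by case.
Qed.

(** Collinearity is invariant under M22 and allows three fourth points, so [hexad_relE] identifies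
    it. *)
Lemma Wi_hexad h (a b c d : I22) : is_octad (0 :: 23 :: map S h)%N ->
  (a : nat) \in h -> (b : nat) \in h -> (c : nat) \in h -> uniq [:: a; b; c; d] ->
  coll Wi a b c d = ((d : nat) \in h).
Proof.
move=> oh ah bh ch U; have := U; rewrite /= !inE !negb_or => /and4P[/and3P[ab ac ad] /andP[bc bd] cd _].
have <- := hexad_relE (R := R4) (a := a) (b := b) (c := c) (d := d) R4_act _ oh; first by rewrite /R4 U.
- have o i j : (i < 22)%N -> (j < 22)%N -> i != j -> o22 i != o22 j.
    by move=> i22 j22; rewrite -val_eqE /= !inordK.
  by apply: line_count; apply: o.
- by rewrite ah bh ch.
- by rewrite ab ac bc.
by rewrite ![d == _]eq_sym ad bd cd.
Qed.

Lemma hexads_octads h : h \in hexads -> is_octad (0 :: 23 :: map S h)%N.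
Proof.
have /and4P[/allP H _ _ _] := coords_check; exact: H.
Qed.

(** The Frobenius map in the coordinates [B]. The permutation is an involution because the map is,
    and a plane determines its label. *)
Lemma semilinear_involution : exists (c : 'rV[F]_6 -> 'rV[F]_6) (p : I22 -> I22),
  [/\ forall u v, c (u + v) = c u + c v, forall a v, c (a *: v) = a ^+ 2 *: c v,
      involutive c, involutive p & forall j v, (v <= Wi j)%MS -> (c v <= Wi (p j))%MS].
Proof.
have [w [B [w0 w1 uB WE]]] := coordinates dW Wi_hexad hexads_octads coords_check.
pose c v := frob (v *m invmx B) *m B.
have cK : involutive c by move=> v; rewrite /c mulmxK // (frobK cF) mulmxKV.
pose p (j : I22) : I22 := o22 (nth 0%N frob_perm j).
have pE (j : I22) : (p j : nat) = nth 0%N frob_perm j.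
  have /allP/(_ (j : nat)) : frob_ok by exact: frob_check.
  by rewrite mem_iota ltn_ord => /(_ isT)/andP[lt _]; rewrite /p /= inordK.
have cW j v : (v <= Wi j)%MS -> (c v <= Wi (p j))%MS.
  rewrite !WE pE => vj; apply: submxMr; apply: (frob_plane cF w0 w1).
  by rewrite -(mulmxK uB (plane w j)) submxMr.
exists c, p; split=> //.
- by move=> u v; rewrite /c mulmxDl (frobD cF) mulmxDl.
- by move=> a v; rewrite /c -scalemxAl frobZ -scalemxAl.
move=> j; apply/esym/(Wi_inj ms); apply/rV_subP=> v vj.
by rewrite -[v]cK; apply/cW/cW.
Qed.

End Setup.

End FieldAutomorphism.

(** * The cosets of [WH] in [VG] as cosets of planes *)

Module CosetPoints.

Import FieldOfFour Orthogonality DualHyperovals CosetFamilies CosetDesign DesignPairs PlanePoints GolayCode M22Elements Octads M22Stabilizers M22Labels M21Simplicity M21Preimage SL3Isomorphism SetupPlanes PlaneStabilizer.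
Local Opaque line23 lperm dec enc is_lperm M22_check M22 M24.

Section Semidirect.

Variables (gT : finGroupType) (G : {group gT}) (F : finFieldType).
Variable rG : mx_representation F G 6.

(** Translations; together with the linear maps [lin g] they write every element of [VG] as
    [lin g * tsl u], which acts on vectors as the affine map v g + u. *)
Definition tsl (v : 'rV[F]_6) : VG rG := sdpair1 ('MR rG) v.
Definition lin (g : gT) : VG rG := sdpair2 ('MR rG) g.

Lemma tslD u v : tsl (u + v)%R = tsl u * tsl v.
Proof. by rewrite /tsl -morphM ?in_setT. Qed.

Lemma tsl0 : tsl 0%R = 1. Proof. exact: morph1. Qed.

Lemma tslN v : tsl (- v)%R = (tsl v)^-1.
Proof. by rewrite /tsl -morphV ?in_setT. Qed.

Lemma linM : {in G &, {morph lin : g h / g * h}}.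
Proof. by move=> g h gG hG; rewrite /lin -morphM. Qed.

Lemma linV g : g \in G -> lin g^-1 = (lin g)^-1.
Proof. by move=> gG; rewrite /lin -morphV. Qed.

Lemma lin_1 : lin 1 = 1. Proof. exact: morph1. Qed.

Lemma tsl_lin v g : g \in G -> tsl v * lin g = lin g * tsl (v *m rG g)%R.
Proof.
move=> gG; have := @sdpair_act _ _ _ _ ('MR rG) v g (in_setT _) gG.
by rewrite /= mx_repr_actE // /tsl => ->; rewrite -conjgC.
Qed.

Lemma linE g : lin g = lin g * tsl 0%R. Proof. by rewrite tsl0 mulg1. Qed.

Lemma VGP (z : VG rG) : exists g u, g \in G /\ z = lin g * tsl u.
Proof.
have E := sdpairE z; case: z E => [[g u] p] /= E; have /setXP[gG _] := p.
by exists g, u; split.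
Qed.

Lemma s_inj g h u v : g \in G -> h \in G -> lin g * tsl u = lin h * tsl v -> g = h /\ u = v.
Proof.
move=> gG hG E.
have E1 : lin (h^-1 * g) = tsl (v - u)%R.
  rewrite linM ?groupV // linV // tslD tslN; apply: (mulgI (lin h)); apply: (mulIg (tsl u)).
  by rewrite !mulgA mulgV mul1g mulgKV E.
have : tsl (v - u)%R \in (sdpair1 ('MR rG) @* setT) :&: (sdpair2 ('MR rG) @* G).
  by rewrite inE mem_morphim ?in_setT //= -E1 mem_morphim ?groupM ?groupV.
rewrite im_sdpair_TI => /set1gP tslE; rewrite tslE in E1.
split.
  have : h^-1 * g = 1.
    by apply: (injmP (injm_sdpair2 ('MR rG))); rewrite ?groupM ?groupV ?group1 // morph1.
  by move/(canRL (mulKVg h)); rewrite mulg1.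
have : (v - u)%R = 0%R.
  by apply: (injmP (injm_sdpair1 ('MR rG))); rewrite ?in_setT // morph1.
by move/eqP; rewrite subr_eq0 => /eqP.
Qed.

End Semidirect.

Section Cosets.

Variables (gT : finGroupType) (G : {group gT}) (f : {morphism G >-> {perm line23}}).
Variables (x : line23) (F : finFieldType) (rG : mx_representation F G 6) (W : 'M[F]_6).
Hypothesis ms : mathieu_setup f x rG W.

Let tc : triple_cover_M22 f. Proof. by case: ms. Qed.
Let xF : x \notin M22_fixed. Proof. by case: ms. Qed.

Notation H := (preim_M21 f x).
Notation Wi := (Wi f x rG W).
Notation tr := (tr f x).
Notation tsl := (tsl rG).
Notation lin := (lin rG).
Notation K0 := (subWH f x rG W).
Notation X := [set: VG rG].

Let HG : H \subset G. Proof. exact: preim_M21_sub. Qed.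
Let dW := setup_dual_hyperoval ms.

Lemma in_subWH g u : g \in G -> (lin g * tsl u \in K0) = (g \in H) && (u <= W)%MS.
Proof.
move=> gG; have E : K0 :=: (sdpair1 ('MR rG) @* rowg W) * (sdpair2 ('MR rG) @* H).
  rewrite /= norm_joinEr // -actsEsd ?subsetT //; apply/subsetP=> h hH.
  rewrite (astabs_rowg_repr rG W) inE (subsetP HG) //=; exact: (moduleW ms hH).
rewrite E; apply/mulsgP/andP => [[_ _ /morphimP[v _ vW ->] /morphimP[h hG hH ->] E'] | [gH uW]].
  have [-> ->] : g = h /\ u = (v *m rG h)%R.
    by apply: (@s_inj _ _ _ rG) => //; rewrite E' -tsl_lin.
  split=> //; rewrite mem_rowg in vW; apply: submx_trans (moduleW ms hH).
  exact: submxMr.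
exists (tsl (u *m rG (g^-1)%g)%R) (lin g); rewrite ?mem_morphim ?in_setT //.
  rewrite mem_rowg; apply: submx_trans (moduleW ms (groupVr gH)).
  exact: submxMr.
by rewrite tsl_lin // -mulmxA -repr_mxM ?groupV // mulVg repr_mx1 mulmx1.
Qed.

Lemma in_subVH g u : g \in G -> (lin g * tsl u \in subVH f x rG) = (g \in H).
Proof.
move=> gG; have E : subVH f x rG :=: (sdpair1 ('MR rG) @* setT) * (sdpair2 ('MR rG) @* H).
  rewrite /= norm_joinEr //; apply: subset_trans (im_sdpair_norm _); exact: morphimS.
rewrite E; apply/mulsgP/idP => [[_ _ /morphimP[v _ vW ->] /morphimP[h hG hH ->] E'] | gH].
  have [-> _] : g = h /\ u = (v *m rG h)%R.
    by apply: (@s_inj _ _ _ rG) => //; rewrite E' -tsl_lin.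
  exact: hH.
exists (tsl (u *m rG (g^-1)%g)%R) (lin g); rewrite ?mem_morphim ?in_setT //.
by rewrite tsl_lin // -mulmxA -repr_mxM ?groupV // mulVg repr_mx1 mulmx1.
Qed.

(** The coset of [WH] that plays the part of v + W_i: right multiplication becomes the affine action
    ([pt_act]). *)
Definition pt (i : I22) (v : 'rV[F]_6) : {set VG rG} := K0 :* (lin (tr i) * tsl v).

Lemma trG i : tr i \in G. Proof. by case: (trP ms i). Qed.

Lemma div_trG g i : g \in G -> g * (tr i)^-1 \in G.
Proof. by move=> gG; rewrite groupM ?groupV ?trG. Qed.

Lemma tr_div g i : g \in G -> (g * (tr i)^-1 \in H) = (f g x == lab i).
Proof.
move=> gG; have [tG ti] := trP ms i.
rewrite (in_preim_M21 _ tc) groupM ?groupV // morphM ?groupV // morphV // permM /=.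
by rewrite -(inj_eq (@perm_inj _ (f (tr i)))) permKV ti.
Qed.

Lemma quot_E g u h v : g \in G -> h \in G ->
  lin g * tsl u * (lin h * tsl v)^-1 = lin (g * h^-1) * tsl ((u - v) *m rG (h^-1)%g)%R.
Proof.
move=> gG hG; rewrite invMg mulgA -(mulgA (lin g)) -tslN -tslD -linV // -mulgA tsl_lin ?groupV //.
by rewrite mulgA -linM ?groupV.
Qed.

Lemma ptE i j u v : (pt i u == pt j v) = (i == j) && ((u - v)%R <= Wi i)%MS.
Proof.
have tGi := trG i; have tGj := trG j.
rewrite (sameP eqP (rcoset_eqP (G := K0))) mem_rcoset quot_E // (in_subWH _ (div_trG _ _)) //.
rewrite tr_div // (_ : f (tr i) x = lab i); last by case: (trP ms i).
rewrite (inj_eq lab_inj); have [-> | //] := eqVneq i j; rewrite /=.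
rewrite -(submxMfree _ _ (_ : row_free (rG (tr j)))) ?row_free_unit ?repr_mx_unit //.
by rewrite -mulmxA -repr_mxM ?groupV // mulVg repr_mx1 mulmx1.
Qed.

Lemma pt_act g u i v : g \in G ->
  pt i v :* (lin g * tsl u) = pt (act22 (f g) i) (v *m rG g + u)%R.
Proof.
move=> gG; have tGi := trG i; set j := act22 _ _; have tGj := trG j.
rewrite /pt -rcosetM; apply/rcoset_eqP; rewrite mem_rcoset.
rewrite mulgA -(mulgA (lin (tr i))) tsl_lin // mulgA -linM // -mulgA -tslD.
have tgG : tr i * g \in G by rewrite groupM.
rewrite quot_E // (in_subWH _ (div_trG _ _)) // tr_div // subrr mul0mx sub0mx andbT.
by rewrite morphM // permM; case: (trP ms i) => _ ->; rewrite -lab_act ?(f_M22 ms).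
Qed.

Lemma pt_rcoset g u : g \in G -> K0 :* (lin g * tsl u) = pt (unlab (f g x)) u.
Proof.
move=> gG; have tG := trG (unlab (f g x)).
apply/rcoset_eqP; rewrite mem_rcoset quot_E // (in_subWH _ (div_trG _ _)) //.
rewrite tr_div // subrr mul0mx sub0mx andbT unlabK //.
by rewrite M22_stable // (f_M22 ms).
Qed.

Lemma points_rcosets : rcosets K0 X = points pt.
Proof.
apply/setP=> p; apply/rcosetsP/pointsP => [[z _ ->] | [i [v ->]]].
  by have [g [u [gG ->]]] := VGP z; exists (unlab (f g x)), u; apply: pt_rcoset.
by exists (lin (tr i) * tsl v); rewrite ?in_setT.
Qed.

Notation P := (points pt).

Definition cell (i : I22) : {set {set VG rG}} := [set pt i v | v : 'rV[F]_6].

Lemma pt_cell i j v : (pt j v \in cell i) = (i == j).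
Proof.
apply/imsetP/eqP => [[w _ /eqP] | ->]; last by exists v.
by rewrite ptE => /andP[/eqP].
Qed.

Lemma cell_coset i : [set p in P | p \subset subVH f x rG :* lin (tr i)] = cell i.
Proof.
have tGi := trG i; have KV : K0 \subset subVH f x rG.
  apply/subsetP=> z; have [g [u [gG ->]]] := VGP z.
  by rewrite in_subWH // in_subVH // => /andP[].
apply/setP=> p; rewrite inE; apply/andP/idP => [[/pointsP[j [v ->]]] | /imsetP[v _ ->]].
  have tGj := trG j.
  move/subsetP/(_ _ (rcoset_refl _ _)); rewrite mem_rcoset [X in _ * X^-1]linE quot_E //.
  rewrite (in_subVH _ (div_trG _ _)) // tr_div //; case: (trP ms j) => _ ->.
  by rewrite (inj_eq lab_inj) pt_cell eq_sym.
split; first exact: pt_points.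
apply/subsetP=> y; rewrite mem_rcoset => /(subsetP KV) yV; rewrite mem_rcoset.
rewrite -(mulgKV (lin (tr i) * tsl v) y) -mulgA groupMl // [X in _ * X^-1]linE quot_E //.
by rewrite (in_subVH _ (div_trG _ _)) // mulgV group1.
Qed.

Lemma coset_blocks_cells : coset_blocks X K0 (subVH f x rG) = [set cell i | i : I22].
Proof.
apply/setP=> q; apply/imsetP/imsetP => [[c /rcosetsP[z _ ->] ->] | [i _ ->]].
  have [g [u [gG ->]]] := VGP z; exists (unlab (f g x)) => //.
  rewrite points_rcosets -cell_coset; suff -> : subVH f x rG :* (lin g * tsl u) = subVH f x rG :* lin (tr (unlab (f g x))) by [].
  have tG := trG (unlab (f g x)); apply/rcoset_eqP; rewrite mem_rcoset.
  rewrite [X in _ * X^-1]linE quot_E // (in_subVH _ (div_trG _ _)) // tr_div //.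
  by rewrite unlabK // M22_stable // (f_M22 ms).
exists (subVH f x rG :* lin (tr i)); last by rewrite points_rcosets cell_coset.
by apply/rcosetsP; exists (lin (tr i)); rewrite ?in_setT.
Qed.

Lemma cell_inj : injective cell.
Proof. by move=> i j E; apply/eqP; rewrite -(pt_cell i j 0%R) E pt_cell. Qed.

Lemma card_cells : #|[set cell i | i : I22]| = 22.
Proof. by rewrite card_imset ?card_ord //; apply: cell_inj. Qed.

Lemma card_cell i : #|cell i| = 64.
Proof.
have := count_points dW ptE (mem (cell i)).
have -> : #|[set p in P | mem (cell i) p]| = #|cell i|.
  apply: eq_card => p; rewrite !inE; apply: andb_idl => /imsetP[v _ ->]; exact: pt_points.
rewrite (bigD1 i) //= big1 => [|j ji]; last first.
  by apply: eq_card0 => v; rewrite inE /= pt_cell eq_sym (negPf ji).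
have -> : #|[set v | pt i v \in cell i]| = (64 * 64)%N.
  have : #|{: 'rV[F]_6}| = (4 ^ 6)%N by rewrite card_mx (dho_field dW).
  by move=> C; apply: etrans C; apply: eq_card => v; rewrite !inE pt_cell eqxx.
by rewrite addn0 => /eqP; rewrite eqn_pmul2r // => /eqP.
Qed.

(** Stated for any action that maps cells into cells, so as to serve for [VG] and for the full
    automorphism group. *)
Lemma cells_system (aT : finGroupType) (A : {set aT}) (to : {action aT &-> {set VG rG}}) :
    (forall a i, a \in A -> exists j, forall v, exists w, to (pt i v) a = pt j w) ->
  imprimitivity_system A P to [set cell i | i : I22].
Proof.
move=> Acell; apply/and3P; split; last by rewrite card_cells (card_points dW ptE).
  apply/and3P; split.
  - apply/eqP/setP=> p; apply/bigcupP/pointsP => [[_ /imsetP[i _ ->]] | [i [v ->]]].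
      by case/imsetP=> v _ ->; exists i, v.
    by exists (cell i); rewrite ?imset_f ?pt_cell.
  - apply/trivIsetP=> _ _ /imsetP[i _ ->] /imsetP[j _ ->] ij.
    rewrite -setI_eq0; apply/eqP/setP=> p; rewrite !inE; apply/negP=> /andP[/imsetP[v _ ->]].
    by rewrite pt_cell => /eqP ji; rewrite ji eqxx in ij.
  apply/negP=> /imsetP[i _ /setP/(_ (pt i 0%R))]; by rewrite pt_cell inE eqxx.
apply/subsetP=> a aA; rewrite !inE /=; apply/subsetP=> q /imsetP[i _ ->]; rewrite inE /=.
have [j Hj] := Acell a i aA; apply/imsetP; exists j => //; apply/eqP.
rewrite eqEcard card_setact !card_cell leqnn andbT; apply/subsetP=> p /imsetP[_ /imsetP[v _ ->] ->].
by have [w ->] := Hj v; rewrite pt_cell.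
Qed.

Lemma Rs_cells : imprimitivity_system X P 'Rs [set cell i | i : I22].
Proof.
apply: cells_system => z i _; have [g [u [gG ->]]] := VGP z.
by exists (act22 (f g) i) => v; exists (v *m rG g + u)%R; rewrite /= rcosetE pt_act.
Qed.

End Cosets.

End CosetPoints.

(** * Orbits of the stabiliser of a point *)

Module PointStabilizer.

Import FieldOfFour Orthogonality DualHyperovals CosetFamilies CosetDesign DesignPairs PlanePoints GolayCode M22Elements Octads M22Stabilizers M22Labels M21Simplicity M21Preimage SL3Isomorphism SetupPlanes PlaneStabilizer CosetPoints.
Local Opaque line23 lperm dec enc is_lperm M22_check M22 M24.

Definition row3 (K : fieldType) n (a b c : 'rV[K]_n) : 'M[K]_(3, n) :=
  (\matrix_(i < 3) [:: a; b; c]`_i)%R.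

Lemma row3E (K : fieldType) n (a b c : 'rV[K]_n) (k : 'I_3) :
  row k (row3 a b c) = ([:: a; b; c]`_k)%R.
Proof.
by apply/rowP=> j; rewrite !mxE. Qed.

Lemma row3_basis (K : fieldType) n (U : 'M[K]_n) (e w : 'rV[K]_n) : \rank U = 3 ->
    (e <= U)%MS -> (w <= U)%MS -> e != 0%R -> ~~ (w <= e)%MS ->
  exists t, (row3 e w t :=: U)%MS.
Proof.
move=> U3 eU wU e0 nwe.
have [t tU nt] : exists2 t : 'rV[K]_n, (t <= U)%MS & ~~ (t <= e + w)%MS.
  have /row_subPn[k nk] : ~~ (U <= e + w)%MS.
    apply/negP=> /mxrankS; rewrite U3; have [le _] := mxrank_adds_leqif e w.
    move=> /leq_trans/(_ le); have := rank_leq_row e; have := rank_leq_row w; lia.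
  by exists (row k U); rewrite ?row_sub.
have r1 : \rank e = 1%N by rewrite rank_rV e0.
have r2 : (1 < \rank (e + w)%MS)%N.
  have : (e < e + w)%MS by rewrite ltmxE addsmxSl addsmx_sub submx_refl.
  by rewrite ltmxErank r1 => /andP[].
exists t; apply/eqmxP.
have sub : (row3 e w t <= U)%MS.
  apply/row_subP=> i; rewrite row3E; have : i \in [:: 0; 1; 2%:R]%R by case: i => [[|[|[|]]]].
  by rewrite !inE => /or3P[] /eqP->.
rewrite sub -(geq_leqif (mxrank_leqif_sup sub)) U3.
have in3 i : (([:: e; w; t]`_(i : 'I_3))%R <= row3 e w t)%MS by rewrite -row3E row_sub.
apply: leq_trans (mxrankS (_ : e + w + t <= row3 e w t)%MS); last first.
  by rewrite !addsmx_sub (in3 0%R) (in3 1%R) (in3 2%:R%R).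
apply: leq_ltn_trans r2 _.
have : (e + w < e + w + t)%MS by rewrite ltmxE addsmxSl addsmx_sub submx_refl.
by rewrite ltmxErank => /andP[].
Qed.

Lemma orbit_lengthsE (aT : finGroupType) (T : finType) (A : {group aT})
    (to : {action aT &-> T}) (S : {set T}) (L : seq {set T}) : uniq L ->
    (forall O, O \in L -> O != set0) ->
    (forall O q, O \in L -> q \in O -> q \in S /\ orbit to A q = O) ->
    (forall q, q \in S -> exists2 O, O \in L & q \in O) ->
  (orbit to A @: S =i L) /\
  perm_eq (orbit_lengths A to S) (map (fun O : {set T} => #|O|) L).
Proof.
move=> uL nL oL cL; suff LE : orbit to A @: S =i L.
  by split=> //; apply: perm_map; apply: uniq_perm; rewrite ?enum_uniq // => O; rewrite mem_enum.
move=> O; apply/imsetP/idP => [[q /cL[O' O'L qO'] ->] | OL].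
  by have [_ ->] := oL O' q O'L qO'.
have /set0Pn[q qO] := nL O OL; have [qS qE] := oL O q OL qO.
by exists q.
Qed.

Section Stabilizer.

Variables (gT : finGroupType) (G : {group gT}) (f : {morphism G >-> {perm line23}}).
Variables (x : line23) (F : finFieldType) (rG : mx_representation F G 6) (W : 'M[F]_6).
Hypothesis ms : mathieu_setup f x rG W.

Let tc : triple_cover_M22 f. Proof. by case: ms. Qed.
Let xF : x \notin M22_fixed. Proof. by case: ms. Qed.

Notation H := (preim_M21 f x).
Notation Wi := (Wi f x rG W).
Notation tr := (tr f x).
Notation tsl := (tsl rG).
Notation lin := (lin rG).
Notation X := [set: VG rG].
Notation pt := (pt f x rG W).
Notation P := (points pt).
Notation cell := (cell f x rG W).

Let HG : H \subset G. Proof. exact: preim_M21_sub. Qed.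
Let dW := setup_dual_hyperoval ms.
Let cF := dho_field dW.
Let E := ptE ms.

Lemma SL3_onto_j j (Q : 'M[F]_(3, 6)) A : (Q :=: Wi j)%MS -> (\det A = 1)%R ->
  exists g, [/\ g \in G, act22 (f g) j = j & (Q *m rG g = A *m Q)%R].
Proof.
move=> QW dA; have tG := trG ms j; have tV := groupVr tG.
have QW' : ((Q *m rG (tr j)^-1%g)%R :=: W)%MS.
  apply: eqmx_trans (eqmxMr _ QW) _.
  by rewrite /SetupPlanes.Wi -mulmxA -repr_mxM // mulgV repr_mx1 mulmx1.
have [h hH hE] := SL3_onto ms QW' dA; have hG := subsetP HG h hH.
exists ((tr j)^-1 * h * tr j); rewrite !groupM //; split=> //.
  apply: lab_inj; rewrite lab_act ?(f_M22 ms) ?groupM // !morphM ?groupM // morphV // !permM.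
  case: (trP ms j) => _ tj; rewrite -tj permK; move: hH; rewrite (in_preim_M21 _ tc).
  by case/andP=> _ /eqP ->.
rewrite !repr_mxM ?groupM // !mulmxA hE -!mulmxA; congr (_ *m _)%R.
by rewrite -repr_mxM // mulVg repr_mx1 mulmx1.
Qed.

(** The common point [e] with W_i is completed to bases of W_j by [w1] and by [w2]; scaling the
    third vector gives the change of basis determinant 1, so G realises it. Fixing [e] keeps the
    label [i]. *)
Lemma stab_move i j (w1 w2 : 'rV[F]_6) : i != j -> (w1 <= Wi j)%MS -> (w2 <= Wi j)%MS ->
    ~~ (w1 <= Wi i)%MS -> ~~ (w2 <= Wi i)%MS ->
  exists g, [/\ g \in G, act22 (f g) i = i, act22 (f g) j = j & (w1 *m rG g = w2)%R].
Proof.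
move=> ij w1j w2j n1 n2; have ji : j != i by rewrite eq_sym.
pose e := pnt Wi j i; have e0 : e != 0%R by apply: (pnt_neq0 dW).
have ej : (e <= Wi j)%MS by apply: pnt_subl.
have ei : (e <= Wi i)%MS by apply: pnt_subr.
have ne (w : 'rV[F]_6) : ~~ (w <= Wi i)%MS -> ~~ (w <= e)%MS by apply: contra => /submx_trans; apply.
have [t1 Q1] := row3_basis (dho_rank dW j) ej w1j e0 (ne _ n1).
have [t2 Q2] := row3_basis (dho_rank dW j) ej w2j e0 (ne _ n2).
set q1 := row3 _ _ _ in Q1; set q2 := row3 _ _ _ in Q2.
have [B BE] : exists B, q2 = (B *m q1)%R by apply/submxP; rewrite Q2 Q1.
have uB : B \in unitmx.
  have : \rank (B *m q1)%R = 3 by rewrite -BE Q2 (dho_rank dW).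
  rewrite mxrankMfree; last by rewrite /row_free Q1 (dho_rank dW).
  by move=> rB; rewrite -row_free_unit /row_free rB.
have dB : (\det B != 0)%R by move: uB; rewrite unitmxE unitfE.
have [|g [gG gj gE]] := SL3_onto_j (A := diag3 1 1 (\det B)^-1 *m B)%R Q1.
  by rewrite det_mulmx det_diag3 !mul1r mulVf.
have rows k : (row k q1 *m rG g = [:: 1; 1; (\det B)^-1]`_k *: row k q2)%R.
  by rewrite -row_mul gE -mulmxA -BE /diag3 mul_diag_mx; apply/rowP=> l; rewrite !mxE.
exists g; split=> //; last by have := rows 1%R; rewrite !row3E scale1r.
apply: (fix_label dW (permG ms gG) gj ji).
by have := rows 0%R; rewrite !row3E scale1r /= => ->.
Qed.

(** The kernel acts faithfully by scalars, and there are three of each. *)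
Lemma ker_all_scalars (c : F) : c != 0%R -> exists2 z, z \in 'ker f & rG z = (c%:M)%R.
Proof.
move=> c0; pose k z := rG z 0%R 0%R.
have kE z : z \in 'ker f -> rG z = ((k z)%:M)%R.
  by move=> zK; have [d dE] := ker_scalar ms zK; rewrite /k dE mxE eqxx mulr1n.
have KG z : z \in 'ker f -> z \in G by apply: subsetP; apply: subsetIl.
have kI : {in 'ker f &, injective k}.
  move=> y z yK zK Ek; apply: (rG_inj ms); rewrite ?KG //.
  by rewrite (kE y yK) (kE z zK) Ek.
suff : c \in k @: 'ker f by case/imsetP=> z zK ->; exists z; rewrite ?kE.
suff -> : k @: 'ker f = [set c : F | c != 0%R] by rewrite inE.
apply/eqP; rewrite eqEcard; apply/andP; split.
  apply/subsetP=> _ /imsetP[z zK ->]; rewrite inE; apply: contraTneq (repr_mx_unit rG (KG z zK)).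
  by rewrite (kE z zK) => ->; rewrite unitmxE det_scalar expr0n unitr0.
rewrite card_in_imset //; have [_ -> _ _] := tc.
have := cardsC [set 0%R : F]; rewrite cF cards1 => -[c3].
by rewrite -c3; apply: subset_leq_card; apply/subsetP=> d; rewrite !inE.
Qed.

Lemma Rs_pt g u i v : g \in G ->
  ('Rs%act (pt i v) (lin g * tsl u) = pt (act22 (f g) i) (v *m rG g + u)%R).
Proof. by move=> gG; rewrite /= rcosetE (pt_act ms). Qed.

Lemma Rs_adj z p q : p \in P -> q \in P ->
  adj Wi pt ('Rs%act p z) ('Rs%act q z) = adj Wi pt p q.
Proof.
case/pointsP=> i [v ->] /pointsP[j [w ->]]; have [g [u [gG ->]]] := VGP z.
rewrite !Rs_pt // !(adjE E) (inj_eq (act22_inj (f_M22 ms gG))); congr (_ && _).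
have -> : (v *m rG g + u - (w *m rG g + u) = (v - w) *m rG g)%R.
  by rewrite opprD addrACA subrr addr0 mulmxBl.
rewrite -(adds_eqmx (Wi_act ms i gG) (Wi_act ms j gG)) -addsmxMr.
by rewrite submxMfree ?row_free_unit ?repr_mx_unit.
Qed.

Lemma Rs_points z p : p \in P -> 'Rs%act p z \in P.
Proof.
by case/pointsP=> i [v ->]; have [g [u [gG ->]]] := VGP z; rewrite Rs_pt // pt_points.
Qed.

(* The affine map y -> (y - v) g + v + a fixes the point v + W_i. *)
Lemma stab_elt i v g a : g \in G -> act22 (f g) i = i -> (a <= Wi i)%MS ->
  exists2 z, z \in 'C_X[pt i v | 'Rs] & forall k y,
    'Rs%act (pt k y) z = pt (act22 (f g) k) ((y - v) *m rG g + v + a)%R.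
Proof.
move=> gG gi ai; exists (lin g * tsl (v + a - v *m rG g)%R).
  rewrite inE in_setT; apply/astab1P; rewrite Rs_pt // gi; apply/eqP; rewrite E eqxx /=.
  set A := (v *m rG g)%R; have -> : (A + (v + a - A) - v = a)%R; last by [].
  by apply/rowP=> k; rewrite !mxE; ring.
move=> k y; rewrite Rs_pt //; congr (pt _ _); rewrite mulmxBl.
set A := (v *m rG g)%R; set B := (y *m rG g)%R.
by apply/rowP=> l; rewrite !mxE; ring.
Qed.

Section Point.

Variables (i : I22) (v : 'rV[F]_6).
Notation p := (pt i v).
Notation S := 'C_X[p | 'Rs].

(** By [hyperplane_count], w - v is a vector of W_i plus some [b] of a plane W_j, outside W_i.
    Double transitivity takes [j] to [j'] and [stab_move] then takes [b] to [b']; components in W_i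
    do not matter. *)
Lemma O1_trans w w' : ~~ ((w - v)%R <= Wi i)%MS -> ~~ ((w' - v)%R <= Wi i)%MS ->
  exists2 z, z \in S & 'Rs%act (pt i w) z = pt i w'.
Proof.
have split_w y : ~~ ((y - v)%R <= Wi i)%MS -> exists j a b, [/\ i != j, (a <= Wi i)%MS,
    (b <= Wi j)%MS, ~~ (b <= Wi i)%MS & (y - v = a + b)%R].
  move=> ny; have C := hyperplane_count dW ny.
  have /card_gt0P[j] : (0 < #|[set j | (j != i) && ((y - v)%R <= Wi i + Wi j)%MS]|)%N by rewrite C.
  rewrite inE => /andP[ji /sub_addsmxP[[c d] /= yE]].
  exists j, (c *m Wi i)%R, (d *m Wi j)%R; rewrite eq_sym !submxMl; split=> //.
  by apply: contra ny => dW'; rewrite yE addmx_sub ?submxMl.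
move=> /split_w[j [a [b [ij ai bj nb wE]]]] /split_w[j' [a' [b' [ij' ai' bj' nb' wE']]]].
have [g0 g0G [g0i g0j]] := pair_trans ms ij ij'.
have b1j : ((b *m rG g0)%R <= Wi j')%MS by rewrite -g0j -(Wi_act ms _ g0G) submxMr.
have nb1 : ~~ ((b *m rG g0)%R <= Wi i)%MS.
  by rewrite -[X in Wi X]g0i -(Wi_act ms _ g0G) submxMfree ?row_free_unit ?repr_mx_unit.
have [g1 [g1G g1i g1j g1E]] := stab_move ij' b1j bj' nb1 nb'.
have gG : g0 * g1 \in G by rewrite groupM.
have gi : act22 (f (g0 * g1)) i = i by rewrite morphM // act22M ?(f_M22 ms) // g0i.
have [z zS zE] := stab_elt v gG gi (sub0mx _ _); exists z => //.
rewrite zE gi; apply/eqP; rewrite E eqxx /= wE mulmxDl repr_mxM // [(b *m _)%R]mulmxA g1E.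
rewrite addr0 -!addrA (_ : (b' + (v - w') = - a')%R); last first.
  have -> : w' = (a' + b' + v)%R by rewrite -wE' subrK.
  by apply/rowP=> l; rewrite !mxE; ring.
apply: addmx_sub; last by rewrite eqmx_opp.
have -> : Wi i = Wi (act22 (f (g0 * g1)) i) by rewrite gi.
by rewrite -repr_mxM // -(Wi_act ms _ gG) submxMr.
Qed.

(** Double transitivity takes [j] to [j'], and a translation by a vector of W_i corrects the
    component there. *)
Lemma O2_trans j j' w w' : i != j -> i != j' -> ((w - v)%R <= Wi i + Wi j)%MS ->
    ((w' - v)%R <= Wi i + Wi j')%MS ->
  exists2 z, z \in S & 'Rs%act (pt j w) z = pt j' w'.
Proof.
move=> ij ij' /sub_addsmxP[[a b] /= wE] /sub_addsmxP[[a' b'] /= wE'].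
have [g gG [gi gj]] := pair_trans ms ij ij'.
have aS : ((a' *m Wi i - a *m Wi i *m rG g)%R <= Wi i)%MS.
  apply: addmx_sub; first exact: submxMl.
  have aW : ((a *m Wi i *m rG g)%R <= Wi (act22 (f g) i))%MS.
    by rewrite -(Wi_act ms _ gG) submxMr ?submxMl.
  by rewrite eqmx_opp; rewrite gi in aW.
have [z zS zE] := stab_elt v gG gi aS; exists z => //.
rewrite zE gj; apply/eqP; rewrite E eqxx /= wE mulmxDl.
have -> : w' = (a' *m Wi i + b' *m Wi j' + v)%R by rewrite -wE' subrK.
set A := (a *m Wi i *m rG g)%R; set A' := (a' *m Wi i)%R; set B := (b *m Wi j *m rG g)%R.
set B' := (b' *m Wi j')%R.
have -> : (A + B + v + (A' - A) - (A' + B' + v) = B - B')%R.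
  by apply/rowP=> k; rewrite !mxE; ring.
apply: addmx_sub; last by rewrite eqmx_opp submxMl.
by rewrite -gj -(Wi_act ms _ gG) submxMr ?submxMl.
Qed.

(** Outside the hyperplane the two vectors agree modulo it up to a nonzero scalar, which an element
    of ['ker f] supplies. *)
Lemma O3_trans j j' w w' : i != j -> i != j' -> ~~ ((w - v)%R <= Wi i + Wi j)%MS ->
    ~~ ((w' - v)%R <= Wi i + Wi j')%MS ->
  exists2 z, z \in S & 'Rs%act (pt j w) z = pt j' w'.
Proof.
move=> ij ij' nw nw'; have [g gG [gi gj]] := pair_trans ms ij ij'.
set U := (Wi i + Wi j')%MS in nw'; pose y := ((w - v) *m rG g)%R.
have ny : ~~ (y <= U)%MS.
  have -> : U = (Wi (act22 (f g) i) + Wi (act22 (f g) j))%MS by rewrite gi gj.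
  rewrite -(adds_eqmx (Wi_act ms i gG) (Wi_act ms j gG)) -addsmxMr.
  by rewrite submxMfree ?row_free_unit ?repr_mx_unit.
have : ((w' - v)%R <= U + y)%MS.
  apply: submx_full; rewrite /row_full eqn_leq rank_leq_col.
  have : (U < U + y)%MS by rewrite ltmxE addsmxSl addsmx_sub submx_refl.
  by rewrite ltmxErank (rankH dW ij') => /andP[].
case/sub_addsmxP=> -[c d] /= wE'; rewrite [d]mx11_scalar mul_scalar_mx in wE'.
have d0 : d 0%R 0%R != 0%R.
  by apply: contraNneq nw' => d0; rewrite wE' d0 scale0r addr0 submxMl.
have [t tK tE] := ker_all_scalars d0; have tG : t \in G by apply: subsetP (subsetIl _ _) _ tK.
have gtG : g * t \in G by rewrite groupM.
have gtE k : act22 (f (g * t)) k = act22 (f g) k by rewrite morphM // (mker tK) mulg1.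
have : ((c *m U)%R <= U)%MS by apply: submxMl.
case/sub_addsmxP=> -[a b] /= cE.
have [|z zS zE] := @stab_elt i v (g * t) (a *m Wi i)%R gtG _ (submxMl _ _); first by rewrite gtE.
exists z => //; rewrite zE gtE gj; apply/eqP; rewrite E eqxx /= repr_mxM // mulmxA -/y tE.
rewrite mul_mx_scalar (_ : (_ - _ = - (b *m Wi j'))%R) ?eqmx_opp ?submxMl //.
have -> : w' = (a *m Wi i + b *m Wi j' + d 0 0 *: y + v)%R by rewrite -cE -wE' subrK.
by apply/rowP=> k; rewrite !mxE; ring.
Qed.

Lemma stab_cell z q : z \in S -> (q \in cell i) -> 'Rs%act q z \in cell i.
Proof.
have [g [u [gG ->]]] := VGP z; rewrite inE in_setT => /astab1P; rewrite Rs_pt // => /eqP.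
rewrite E => /andP[/eqP gi _] /imsetP[w _ ->]; rewrite Rs_pt // gi.
by rewrite (pt_cell ms).
Qed.

Lemma stab_adj z q : z \in S -> q \in P -> adj Wi pt p ('Rs%act q z) = adj Wi pt p q.
Proof.
rewrite inE in_setT => /astab1P zp qP; rewrite -{1}zp Rs_adj // pt_points //.
Qed.

(** The orbits are the point, the rest of its cell, its neighbours, and the 1408 - 64 - 336 = 1008
    other points. The second part recognises the block by its length. *)
Lemma stab_orbits : perm_eq (orbit_lengths S 'Rs P) [:: 1; 63; 336; 1008]%N /\
  forall O, O \in orbit 'Rs S @: P -> #|O| = 336 -> O = nbhd Wi pt p.
Proof.
pose O3 := P :\: (cell i :|: nbhd Wi pt p).
have pP : p \in P by apply: pt_points.
have pC : p \in cell i by rewrite (pt_cell ms).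
have cellP q : q \in cell i -> q \in P by case/imsetP=> w _ ->; apply: pt_points.
have disj q : q \in cell i -> adj Wi pt p q = false by case/imsetP=> w _ ->; apply: (adj_same E).
have c1 : #|cell i :\ p| = 63.
  by have := cardsD1 p (cell i); rewrite pC (card_cell ms) add1n => -[].
have c2 : #|nbhd Wi pt p| = 336 by apply: (card_nbhd dW E).
have c3 : #|O3| = 1008.
  have : #|cell i :|: nbhd Wi pt p| = 400.
    rewrite cardsU (_ : _ :&: _ = set0) ?cards0 ?subn0 ?c2 ?(card_cell ms) //.
    by apply/setP=> q; rewrite !inE; apply/negP=> /andP[/disj ->].
  have sub : cell i :|: nbhd Wi pt p \subset P.
    rewrite subUset; apply/andP; split; apply/subsetP=> q; first exact: cellP.
    by rewrite inE => /(adj_points) [].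
  have := cardsID (cell i :|: nbhd Wi pt p) P; rewrite (card_points dW E) (setIidPr sub) -/O3.
  by move=> C U400; rewrite U400 in C; apply: (@addnI 400); rewrite C.
pose L := [:: [set p]; cell i :\ p; nbhd Wi pt p; O3].
have <- : map (fun O : {set {set VG rG}} => #|O|) L = [:: 1; 63; 336; 1008]%N.
  by rewrite /= cards1 c1 c2 c3.
suff [LE PE] : (orbit 'Rs S @: P =i L) /\
    perm_eq (orbit_lengths S 'Rs P) (map (fun O : {set {set VG rG}} => #|O|) L).
  by split=> // O; rewrite LE !inE => /or4P[] /eqP->; rewrite ?cards1 ?c1 ?c3.
apply: orbit_lengthsE.
- have : uniq (map (fun O : {set {set VG rG}} => #|O|) L) by rewrite /= cards1 c1 c2 c3.
  exact: map_uniq.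
- move=> O OL; rewrite -card_gt0; move: OL; rewrite !inE.
  by case/or4P=> /eqP->; rewrite ?cards1 ?c1 ?c2 ?c3.
- have fin (O : {set {set VG rG}}) : (forall q, q \in O -> q \in P) -> (forall q z, z \in S -> q \in O -> 'Rs%act q z \in O) ->
      (forall q q', q \in O -> q' \in O -> exists2 z, z \in S & 'Rs%act q z = q') ->
      forall q, q \in O -> q \in P /\ orbit 'Rs S q = O.
    move=> OP OS Ot q qO; split; first exact: OP.
    apply/setP=> q'; apply/orbitP/idP => [[z zS <-] | q'O]; first exact: OS.
    by have [z zS zE] := Ot q q' qO q'O; exists z.
  have stabp z : z \in S -> 'Rs%act p z = p by rewrite inE in_setT => /astab1P.
  move=> O q OL; move: OL q; rewrite !inE => /or4P[] /eqP->; apply: fin.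
  + by move=> q /set1P->.
  + by move=> q z zS /set1P->; rewrite stabp ?set11.
  + by move=> q q' /set1P-> /set1P->; exists 1; rewrite ?group1 // act1.
  + by move=> q /setD1P[_ /cellP].
  + move=> q z zS /setD1P[qp qC]; apply/setD1P; split; last exact: stab_cell.
    by apply: contra qp => /eqP zE; rewrite -(inj_eq (act_inj 'Rs z)) zE stabp.
  + move=> q q' /setD1P[qp /imsetP[w _ qE]] /setD1P[qp' /imsetP[w' _ qE']].
    move: qp qp'; rewrite qE qE' !E !eqxx /=; exact: O1_trans.
  + by move=> q; rewrite inE => /adj_points[].
  + move=> q z zS; rewrite !inE => pq; rewrite stab_adj //; by have [] := adj_points pq.
  + move=> q q'; rewrite !inE => pq pq'; move: (pq) (pq').
    have [_ /pointsP[j [w ->]]] := adj_points pq; have [_ /pointsP[j' [w' ->]]] := adj_points pq'.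
    rewrite !(adjE E) => /andP[ij s] /andP[ij' s']; apply: O2_trans => //.
      by rewrite -opprB eqmx_opp.
    by rewrite -opprB eqmx_opp.
  + by move=> q /setDP[].
  + move=> q z zS /setDP[qP nq]; apply/setDP; split; first exact: Rs_points.
    move: nq; rewrite !inE !negb_or stab_adj // => /andP[nq ->]; rewrite andbT.
    apply: contra nq => qz; rewrite -[q](actK 'Rs z); apply: stab_cell => //.
    by rewrite groupV.
  move=> q q' /setDP[/pointsP[j [w ->]]] + /setDP[/pointsP[j' [w' ->]]].
  rewrite !inE !(pt_cell ms) !(adjE E) !negb_or !negb_and !negbK.
  case/andP=> ij /orP[/eqP ij2|s]; first by rewrite ij2 eqxx in ij.
  case/andP=> ij' /orP[/eqP ij2|s']; first by rewrite ij2 eqxx in ij'.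
  by apply: O3_trans => //; rewrite -opprB eqmx_opp.
move=> q qP; have [qC | nC] := boolP (q \in cell i).
  have [-> | qp] := eqVneq q p; first by exists [set p]; rewrite ?inE ?eqxx.
  by exists (cell i :\ p); rewrite ?inE ?eqxx ?orbT // qp.
have [qa | na] := boolP (adj Wi pt p q).
  by exists (nbhd Wi pt p); rewrite ?inE ?eqxx ?orbT.
by exists O3; rewrite ?inE ?eqxx ?orbT // negb_or nC na.
Qed.

End Point.

End Stabilizer.

End PointStabilizer.

(** * The full automorphism group of the design *)

Module DesignAutomorphisms.

Import FieldOfFour Orthogonality DualHyperovals CosetFamilies CosetDesign DesignPairs PlanePoints GolayCode M22Elements Octads M22Stabilizers M22Labels M21Simplicity M21Preimage SL3Isomorphism SetupPlanes PlaneStabilizer FieldCodes PlaneCoordinates FieldAutomorphism CosetPoints PointStabilizer.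
Local Opaque line23 lperm dec enc is_lperm M22_check M22 M24.

Section Design.

Variables (gT : finGroupType) (G : {group gT}) (f : {morphism G >-> {perm line23}}).
Variables (x : line23) (F : finFieldType) (rG : mx_representation F G 6) (W : 'M[F]_6).
Hypothesis ms : mathieu_setup f x rG W.

Let tc : triple_cover_M22 f. Proof. by case: ms. Qed.
Let xF : x \notin M22_fixed. Proof. by case: ms. Qed.

Notation H := (preim_M21 f x).
Notation Wi := (Wi f x rG W).
Notation tr := (tr f x).
Notation tsl := (tsl rG).
Notation lin := (lin rG).
Notation X := [set: VG rG].
Notation pt := (pt f x rG W).
Notation P := (points pt).
Notation cell := (cell f x rG W).

Let HG : H \subset G. Proof. exact: preim_M21_sub. Qed.
Let dW := setup_dual_hyperoval ms.
Let cF := dho_field dW.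
Let E := ptE ms.

Notation B := (blocks Wi pt).

Lemma Rs_trans p q : p \in P -> q \in P -> exists z, 'Rs%act p z = q.
Proof.
case/pointsP=> i [v ->] /pointsP[j [w ->]].
exists ((lin (tr i) * tsl v)^-1 * (lin (tr j) * tsl w)).
by rewrite /= rcosetE /CosetPoints.pt -rcosetM mulKVg.
Qed.

Lemma Rs_nbhd p z : p \in P -> ('Rs^*)%act (nbhd Wi pt p) z = nbhd Wi pt ('Rs%act p z).
Proof.
move=> pP; apply/eqP; rewrite eqEcard card_setact !(card_nbhd dW E) ?(Rs_points ms) // leqnn andbT.
apply/subsetP=> _ /imsetP[q + ->]; rewrite !inE => pq.
by rewrite (Rs_adj ms) //; have [] := adj_points pq.
Qed.

Lemma orbit_nbhd p : p \in P -> orbit 'Rs^* X (nbhd Wi pt p) = B.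
Proof.
move=> pP; apply/setP=> b; apply/orbitP/imsetP => [[z _ <-] | [q qP ->]].
  by exists ('Rs%act p z); rewrite ?(Rs_points ms) // Rs_nbhd.
by have [z zE] := Rs_trans pP qP; exists z; rewrite ?in_setT // Rs_nbhd // zE.
Qed.

Lemma flags p y q y' : p \in P -> y \in nbhd Wi pt p -> q \in P -> y' \in nbhd Wi pt q ->
  exists z, [/\ 'Rs%act p z = q & 'Rs%act y z = y'].
Proof.
move=> pP yp qP y'q; have [z1 z1E] := Rs_trans pP qP.
have yP : y \in P by move: yp; rewrite inE => /adj_points[].
have: 'Rs%act y z1 \in nbhd Wi pt q.
  by move: yp; rewrite !inE -z1E (Rs_adj ms).
have [i [v qE]] := pointsP _ _ qP; rewrite qE in y'q z1E *.
have y'P : y' \in P by move: y'q; rewrite inE => /adj_points[].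
have yz : 'Rs%act y z1 \in P by apply: (Rs_points ms).
have [j [w yE]] := pointsP _ _ yz; have [j' [w' y'E]] := pointsP _ _ y'P.
move: y'q; rewrite yE y'E !inE !(adjE E) => /andP[ij' s'] /andP[ij s].
have [||z2 z2S z2E] := O2_trans ms ij ij' (v := v) (w := w) (w' := w').
- by rewrite -opprB eqmx_opp.
- by rewrite -opprB eqmx_opp.
exists (z1 * z2); rewrite !actM z1E yE z2E; split=> //.
by move: z2S; rewrite inE in_setT => /astab1P.
Qed.

(** Restricted to the points, because [design_aut] consists of permutations supported on them. *)
Definition psi (z : VG rG) : {perm {set VG rG}} := restr_perm P (actperm 'Rs z).

Lemma actperm_norm z : actperm 'Rs z \in 'N(P | 'P).
Proof. by rewrite !inE; apply/subsetP=> p pP; rewrite inE /= /aperm actpermE (Rs_points ms). Qed.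

Lemma psiE z p : p \in P -> psi z p = 'Rs%act p z.
Proof. by move=> pP; rewrite /psi restr_permE ?actperm_norm // actpermE. Qed.

Lemma psi_on z : perm_on P (psi z). Proof. exact: restr_perm_on. Qed.

Lemma eq_on_points (a b : {perm {set VG rG}}) : perm_on P a -> perm_on P b ->
  (forall i v, a (pt i v) = b (pt i v)) -> a = b.
Proof.
move=> aP bP ab; apply/permP=> p; have [/pointsP[i [v ->]] // | nP] := boolP (p \in P).
by rewrite (out_perm aP) // (out_perm bP).
Qed.

Lemma psiM : {in X &, {morph psi : y z / y * z}}.
Proof.
move=> y z _ _; apply: eq_on_points; rewrite ?psi_on //.
  exact: perm_onM (psi_on _) (psi_on _).
by move=> i v; rewrite permM !psiE ?(Rs_points ms) ?pt_points // actM.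
Qed.
Canonical psi_morphism := Morphism psiM.

Lemma psi_pt g u i v : g \in G ->
  psi (lin g * tsl u) (pt i v) = pt (act22 (f g) i) (v *m rG g + u)%R.
Proof. by move=> gG; rewrite psiE ?pt_points // (Rs_pt ms). Qed.

Lemma Rs_fix z : (forall p, p \in P -> 'Rs%act p z = p) -> z = 1.
Proof.
have [g [u [gG ->]]] := VGP z => fixP.
have fx i v : act22 (f g) i = i /\ ((v *m rG g + u - v)%R <= Wi i)%MS.
  have /eqP := fixP _ (pt_points pt i v); rewrite (Rs_pt ms) // E.
  by case/andP=> /eqP ->.
have gK : g \in 'ker f.
  apply/kerP => //; apply: act22_eq1 => [|i]; first by rewrite (f_M22 ms).
  by have [] := fx i 0%R.
have [i [j [k [ij ik jk]]]] := I_distinct dW.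
have all0 (y : 'rV[F]_6) : (forall i, (y <= Wi i)%MS) -> y = 0%R.
  by move=> yW; apply: (meet0 (dho_rank3 dW) ij ik jk).
have u0 : u = 0%R.
  by apply: all0 => l; have [_] := fx l 0%R; rewrite mul0mx add0r subr0.
have g1 : g = 1.
  apply: (rG_inj ms) => //; rewrite repr_mx1; apply/row_matrixP=> r.
  rewrite !rowE mulmx1; apply/eqP; rewrite -subr_eq0; apply/eqP/all0 => l.
  by have [_] := fx l (delta_mx 0 r)%R; rewrite u0 addr0.
by rewrite g1 u0 lin_1 tsl0 mulg1.
Qed.

Lemma injm_psi : 'injm psi.
Proof.
apply/subsetP=> z zK; apply/set1gP/Rs_fix => p pP.
by rewrite -psiE // (mker zK) perm1.
Qed.

Lemma faithful_points : [faithful X, on P | 'Rs].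
Proof.
apply/subsetP=> z; rewrite inE => /andP[_ /astabP zP]; apply/set1gP/Rs_fix => p pP.
exact: zP.
Qed.

Lemma coset_permsE (Y : {set VG rG}) : coset_perms P Y = psi @* Y.
Proof.
apply/setP=> a; apply/morphimP/morphimP => [[_ _ /morphimP[z _ zY ->] ->] | [z _ zY ->]].
  by exists z; rewrite ?in_setT.
exists (actperm 'Rs z); rewrite ?actperm_norm //.
by apply/morphimP; exists z; rewrite ?in_setT.
Qed.

Notation A := (design_aut P B).

Lemma in_aut a : perm_on P a -> {in P &, forall p q, adj Wi pt (a p) (a q) = adj Wi pt p q} ->
  a \in A.
Proof.
move=> aP aadj; rewrite inE; apply/andP; split; first by rewrite inE.
rewrite !inE /=; apply/subsetP=> b /imsetP[p pP ->]; rewrite inE /=.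
have aPP q : (a q \in P) = (q \in P) by apply: perm_closed.
apply/imsetP; exists (a p); rewrite ?aPP //; apply/eqP.
rewrite eqEcard card_setact !(card_nbhd dW E) ?aPP // leqnn andbT.
apply/subsetP=> _ /imsetP[q + ->]; rewrite !inE /= /aperm => pq.
by rewrite aadj //; have [] := adj_points pq.
Qed.

Lemma psi_aut z : psi z \in A.
Proof.
by apply: in_aut (psi_on z) _ => p q pP qP; rewrite !psiE // (Rs_adj ms).
Qed.

(** The second map is the action of [a] on blocks, read on points through the injective [nbhd]. *)
Lemma aut_pair a : a \in A -> perm_on P a /\ exists g, design_pair Wi pt a g.
Proof.
rewrite inE => /andP[aS aN]; have aP : perm_on P a by move: aS; rewrite inE.
have aPP q : (a q \in P) = (q \in P) by apply: perm_closed.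
split=> //.
have ex p : exists q, (p \in P) ==> ((q \in P) && (('P^*)%act (nbhd Wi pt p) a == nbhd Wi pt q)).
  have [pP | _] := boolP (p \in P); last by exists p.
  have : ('P^*)%act (nbhd Wi pt p) a \in B by rewrite (astabs_act _ aN) imset_f.
  by case/imsetP=> q qP ->; exists q; rewrite qP eqxx.
pose g p := xchoose (ex p).
have gP p : p \in P -> g p \in P /\ ('P^*)%act (nbhd Wi pt p) a = nbhd Wi pt (g p).
  by move=> pP; have /implyP/(_ pP)/andP[-> /eqP] := xchooseP (ex p).
exists g; split.
- by move=> p pP; rewrite aPP.
- by move=> p /gP[].
- by move=> p q _ _; apply: perm_inj.
- move=> p q pP qP gpq; apply: (nbhd_inj dW E pP qP); apply: (act_inj ('P^*) a).
  by rewrite (proj2 (gP p pP)) gpq (proj2 (gP q qP)).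
move=> p q pP qP; have [_ gE] := gP p pP.
have -> : adj Wi pt (g p) (a q) = (a q \in nbhd Wi pt (g p)) by rewrite inE.
have -> : adj Wi pt p q = (q \in nbhd Wi pt p) by rewrite inE.
by rewrite -gE /= /setact; apply: mem_imset; apply: perm_inj.
Qed.

Lemma aut_lift a : a \in A -> exists (s : I22 -> I22) (t : 'rV[F]_6 -> 'rV[F]_6),
  [/\ injective s, injective t, forall i v, a (pt i v) = pt (s i) (t v) &
    let h (v : 'rV[F]_6) : 'rV[F]_6 := (t v - t 0)%R in
  [/\ forall u v : 'rV[F]_6, (h (u + v) = h u + h v)%R, forall i v, (v <= Wi i)%MS -> (h v <= Wi (s i))%MS
    & (forall a (v : 'rV[F]_6), (h (a *: v) = a *: h v)%R) \/
      (forall a (v : 'rV[F]_6), (h (a *: v) = a ^+ 2 *: h v)%R)]].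
Proof.
case/aut_pair=> _ [g ag]; have [s [t [si ti tE]]] := pair_lift dW (irr_stab ms) E ag.
have H := pair_semilinear dW E ag si ti tE.
by exists s, t; split.
Qed.

(** The matrix of the linear part permutes the planes, so [linear_stabilizer] finds it in G; [t 0]
    is the translation. *)
Lemma linear_aut a s t : perm_on P a -> injective s -> injective t ->
    (forall i v, a (pt i v) = pt (s i) (t v)) ->
    (forall u v : 'rV[F]_6, (t (u + v) - t 0 = t u - t 0 + (t v - t 0))%R) ->
    (forall i v, (v <= Wi i)%MS -> ((t v - t 0)%R <= Wi (s i))%MS) ->
    (forall c (v : 'rV[F]_6), (t (c *: v) - t 0 = c *: (t v - t 0))%R) ->
  exists2 k, k \in G & a = psi (lin k * tsl (t 0%R)).
Proof.
move=> aP si ti tE hD hW hZ; pose h (v : 'rV[F]_6) : 'rV[F]_6 := (t v - t 0)%R.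
have h0 : h 0%R = 0%R by rewrite /h subrr.
pose M : 'M[F]_6 := (\matrix_(l < 6) h (delta_mx 0 l))%R.
have hM v : h v = (v *m M)%R.
  rewrite mulmx_sum_row [in LHS](row_sum_delta v) (big_morph h hD h0).
  by apply: eq_bigr => l _; rewrite rowK; apply: hZ.
have pM : permutes Wi M s.
  have uM : M \in unitmx.
    rewrite -row_free_unit; apply/inj_row_free=> v; rewrite -hM => /eqP.
    by rewrite subr_eq0 => /eqP/ti.
  split=> // i; apply/eqmxP.
  have sub : ((Wi i *m M)%R <= Wi (s i))%MS.
    by apply/row_subP=> l; rewrite row_mul -hM; apply: hW; apply: row_sub.
  have fM : row_free M by rewrite row_free_unit.
  by rewrite -(geq_leqif (mxrank_leqif_eq sub)) (mxrankMfree (Wi i) fM) !(dho_rank dW).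
have [k kG Mk] := linear_stabilizer ms pM; exists k => //.
apply: eq_on_points (psi_on _) _ => // i v; rewrite tE psi_pt //.
have -> : s i = act22 (f k) i.
  by apply: (Wi_inj ms); have [_ _ MW] := pM; rewrite -(MW i) Mk (Wi_act ms _ kG).
by congr (pt _ _); rewrite -Mk -hM /h subrK.
Qed.

Section Involution.

Variables (c : 'rV[F]_6 -> 'rV[F]_6) (pm : I22 -> I22).
Hypothesis cD : forall u v : 'rV[F]_6, (c (u + v) = c u + c v)%R.
Hypothesis cZ : forall a (v : 'rV[F]_6), (c (a *: v) = a ^+ 2 *: c v)%R.
Hypothesis cK : involutive c.
Hypothesis pmK : involutive pm.
Hypothesis cW : forall j v, (v <= Wi j)%MS -> (c v <= Wi (pm j))%MS.

Lemma c0 : c 0%R = 0%R.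
Proof. by have := cZ 0%R 0%R; rewrite scaler0 expr0n scale0r. Qed.

Lemma cB u v : (c (u - v) = c u - c v)%R.
Proof. by rewrite !(rowN dW) cD. Qed.

(** The map induced by [c] on points, the identity elsewhere; [cfunE] shows that the representing
    pair picked does not matter. *)
Definition cfun (q : {set VG rG}) : {set VG rG} :=
  odflt q (omap (fun y : I22 * 'rV[F]_6 => pt (pm y.1) (c y.2))
    [pick y : I22 * 'rV[F]_6 | q == pt y.1 y.2]).

Lemma cfunE i v : cfun (pt i v) = pt (pm i) (c v).
Proof.
rewrite /cfun; case: pickP => [[j w] /= | /(_ (i, v))]; last by rewrite eqxx.
rewrite E => /andP[/eqP <- vw]; apply/eqP; rewrite E eqxx /= -opprB eqmx_opp -cB.
exact: cW.
Qed.

Lemma cfun_out q : q \notin P -> cfun q = q.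
Proof.
move=> qP; rewrite /cfun; case: pickP => [[j w] /= /eqP qE | //].
by rewrite qE pt_points in qP.
Qed.

Lemma cfunK : involutive cfun.
Proof.
move=> q; have [/pointsP[i [v ->]] | qP] := boolP (q \in P); first by rewrite !cfunE cK pmK.
by rewrite !cfun_out.
Qed.

Definition ct : {perm {set VG rG}} := perm (inv_inj cfunK).

Lemma ct_pt i v : ct (pt i v) = pt (pm i) (c v). Proof. by rewrite permE cfunE. Qed.

Lemma ct_on : perm_on P ct.
Proof. by apply/subsetP=> q; apply: contraR => qP; rewrite permE cfun_out. Qed.

Lemma ct2 : ct * ct = 1.
Proof. by apply/permP=> q; rewrite permM perm1 !permE cfunK. Qed.

Lemma ctV : ct^-1 = ct. Proof. by apply: (mulgI ct); rewrite mulgV ct2. Qed.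

Lemma ct_aut : ct \in A.
Proof.
apply: in_aut ct_on _ => _ _ /pointsP[i [v ->]] /pointsP[j [w ->]].
rewrite !ct_pt !(adjE E) (inj_eq (inv_inj pmK)); congr (_ && _).
suff H k l y : (y <= Wi k + Wi l)%MS -> (c y <= Wi (pm k) + Wi (pm l))%MS.
  by apply/idP/idP => /H; rewrite cB ?cK ?pmK.
case/sub_addsmxP=> -[a b] /= ->; rewrite cD; apply: addmx_sub.
  by apply: submx_trans (addsmxSl _ _); apply: cW; apply: submxMl.
by apply: submx_trans (addsmxSr _ _); apply: cW; apply: submxMl.
Qed.

(** Agreement on the cosets of three planes forces [c v] to be v g + u with u = 0; then [c] would
    commute with multiplication by [w], but it turns [w] into its square. *)
Lemma ct_notin z : ct <> psi z.
Proof.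
have [g [u [gG ->]]] := VGP z => ctE.
have H i v : pt (pm i) (c v) = pt (act22 (f g) i) (v *m rG g + u)%R.
  by rewrite -ct_pt ctE psi_pt.
have Hs i v : ((c v - (v *m rG g + u))%R <= Wi (pm i))%MS.
  by have /eqP := H i v; rewrite E => /andP[].
have [i [j [k [ij ik jk]]]] := I_distinct dW.
have all0 (y : 'rV[F]_6) : (forall l, (y <= Wi (pm l))%MS) -> y = 0%R.
  have n l l' : l != l' -> pm l != pm l' by rewrite (inj_eq (inv_inj pmK)).
  by move=> yW; apply: (meet0 (dho_rank3 dW) (n _ _ ij) (n _ _ ik) (n _ _ jk)).
have cE v : c v = (v *m rG g + u)%R.
  by apply/eqP; rewrite -subr_eq0; apply/eqP/all0 => l; apply: Hs.
have u0 : u = 0%R by have := cE 0%R; rewrite c0 mul0mx add0r.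
have [w [w0 w1]] := GF4_primitive cF.
have e0 := pnt_neq0 dW ij; set e := pnt Wi i j in e0.
have : (w ^+ 2 *: c e = w *: c e)%R by rewrite -cZ !cE u0 !addr0 scalemxAl.
move/eqP; rewrite -subr_eq0 -scalerBl scaler_eq0 expr2 -{3}[w]mulr1 -mulrBr mulf_eq0.
rewrite (negPf w0) subr_eq0 (negPf w1) /= => /eqP ce; move: e0.
by rewrite -[e]cK ce c0 eqxx.
Qed.

(** Squaring twice is the identity on GF(4), so composing with [ct] makes a semilinear automorphism
    linear. *)
Lemma aut_cases a : a \in A -> exists k u, k \in G /\
  (a = psi (lin k * tsl u) \/ a = psi (lin k * tsl u) * ct).
Proof.
move=> aA; have [aP _] := aut_pair aA; have [s [t [si ti tE [hD hW hZ]]]] := aut_lift aA.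
case: hZ => hZ.
  have [k kG ->] := linear_aut aP si ti tE hD hW hZ.
  by exists k, (t 0%R); split=> //; left.
have act_pt i v : (a * ct) (pt i v) = pt ((pm \o s) i) ((c \o t) v) by rewrite permM tE ct_pt.
have [||||||k kG aE] := @linear_aut (a * ct) (pm \o s) (c \o t) _ _ _ act_pt.
- exact: perm_onM aP ct_on.
- exact: inj_comp (inv_inj pmK) si.
- exact: inj_comp (inv_inj cK) ti.
- by move=> u v; rewrite /= -!cB hD cD.
- by move=> i v vi; rewrite /= -cB; apply: cW; apply: hW.
- move=> b v; rewrite /= -!cB hZ cZ -exprM; congr (_ *: _)%R.
  by have := expf_card b; rewrite cF.
exists k, ((c \o t) 0%R); split=> //; right.
by rewrite -aE -mulgA ct2 mulg1.
Qed.

Notation C := <[ct]>.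

Lemma order_ct : #|C| = 2.
Proof.
apply: nt_prime_order => //; first by rewrite expgS expg1 ct2.
by apply/eqP=> c1; apply: (@ct_notin 1); rewrite c1 (morph1 psi_morphism).
Qed.

(** Conjugating a linear map by [c] gives a linear map fixing 0, which [linear_aut] returns to G
    without a translation. *)
Lemma ct_norm_subG : C \subset 'N(psi @* subG rG).
Proof.
rewrite cycle_subG inE; apply/subsetP=> _ /imsetP[_ /morphimP[_ _ /morphimP[g _ gG ->] ->] ->].
change (psi (lin g) ^ ct \in psi @* subG rG); rewrite conjgE ctV.
have gE : lin g = lin g * tsl 0%R by rewrite tsl0 mulg1.
have act_pt i v : (ct * (psi (lin g) * ct)) (pt i v) =
    pt ((pm \o act22 (f g) \o pm) i) ((fun y => c (c y *m rG g)%R) v).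
  by rewrite !permM ct_pt gE psi_pt // addr0 ct_pt.
have t0 : c (c 0 *m rG g)%R = 0%R by rewrite c0 mul0mx c0.
have [||||||k kG ->] := @linear_aut _ _ (fun y => c (c y *m rG g)%R) _ _ _ act_pt.
- exact: perm_onM ct_on (perm_onM (psi_on _) ct_on).
- apply: inj_comp (inv_inj pmK); apply: inj_comp (inv_inj pmK) _.
  exact: act22_inj (f_M22 ms gG).
- move=> y y' /(inv_inj cK) /(can_inj (mulmxK (repr_mx_unit rG gG))) /(inv_inj cK) //.
- by move=> u v; rewrite t0 !subr0 cD mulmxDl cD.
- move=> i v vi; rewrite t0 subr0 /=; apply: cW; rewrite -(Wi_act ms _ gG) submxMr //.
  exact: cW.
- move=> b v; rewrite t0 !subr0 cZ -scalemxAl cZ -exprM; congr (_ *: _)%R.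
  by have := expf_card b; rewrite cF.
rewrite t0 tsl0 mulg1; apply: mem_morphim; rewrite ?in_setT //.
exact: mem_morphim.
Qed.

Lemma ct_norm_subV : C \subset 'N(psi @* subV rG).
Proof.
rewrite cycle_subG inE; apply/subsetP=> _ /imsetP[_ /morphimP[_ _ /morphimP[u _ _ ->] ->] ->].
change (psi (tsl u) ^ ct \in psi @* subV rG); rewrite conjgE ctV.
have tE y : tsl y = lin 1 * tsl y by rewrite lin_1 mul1g.
suff -> : ct * (psi (tsl u) * ct) = psi (tsl (c u)).
  by apply: mem_morphim; rewrite ?in_setT // mem_morphim ?in_setT.
apply: eq_on_points (psi_on _) _; first exact: perm_onM ct_on (perm_onM (psi_on _) ct_on).
have tE' y j w : psi (tsl y) (pt j w) = pt j (w + y)%R.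
  by rewrite tE psi_pt ?group1 // morph1 act22_1 repr_mx1 mulmx1.
by move=> i v; rewrite !permM ct_pt !tE' ct_pt pmK cD cK.
Qed.

Lemma psiX_C : psi @* X * C = A.
Proof.
apply/eqP; rewrite eqEsubset; apply/andP; split.
  rewrite mul_subG // ?cycle_subG ?ct_aut //.
  by apply/subsetP=> _ /morphimP[z _ _ ->]; apply: psi_aut.
apply/subsetP=> a /aut_cases[k [u [kG [] ->]]].
  by rewrite -[psi _]mulg1 mem_mulg ?group1 // mem_morphim ?in_setT.
by rewrite mem_mulg ?cycle_id // mem_morphim ?in_setT.
Qed.

Lemma psiX_TI : psi @* X :&: C = 1.
Proof.
rewrite setIC; apply: prime_TIg; first by rewrite order_ct.
rewrite cycle_subG; apply/negP=> /morphimP[z _ _]; exact: ct_notin.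
Qed.

Lemma aut_index : #|A : psi @* X| = 2.
Proof.
rewrite -divgS -psiX_C ?mulG_subl // TI_cardMg ?psiX_TI // order_ct mulKn //.
Qed.

Lemma aut_sdprod : exists C' K : {group {perm {set VG rG}}},
  [/\ #|C'| = 2, psi @* subG rG ><| C' = K & psi @* subV rG ><| K = A].
Proof.
have tiGC : psi @* subG rG :&: C = 1.
  apply/trivgP; rewrite -psiX_TI; apply: setSI; apply: morphimS; exact: subsetT.
have KE := sdprodEY ct_norm_subG tiGC.
exists [group of C], (psi @* subG rG <*> C)%G; split=> //; first exact: order_ct.
have VGX : psi @* subV rG * psi @* subG rG = psi @* X.
  by rewrite -morphimMl ?subsetT // im_sdpair.
have NK : psi @* subV rG * (psi @* subG rG <*> C) = A.
  by rewrite norm_joinEr ?ct_norm_subG // mulgA VGX psiX_C.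
rewrite sdprodE //=.
  rewrite join_subG ct_norm_subV andbT.
  by apply: subset_trans (morphim_norms _ (im_sdpair_norm _)).
have tiVG : psi @* subV rG :&: psi @* subG rG = 1.
  by rewrite -injmI ?injm_psi ?subsetT // im_sdpair_TI morphim1.
have cKK : #|psi @* subG rG <*> C| = (#|psi @* subG rG| * #|C|)%N.
  by rewrite norm_joinEr ?ct_norm_subG // TI_cardMg.
have cX : #|psi @* X| = (#|psi @* subV rG| * #|psi @* subG rG|)%N.
  by rewrite -VGX TI_cardMg.
have cA : #|A| = (#|psi @* X| * #|C|)%N by rewrite -psiX_C TI_cardMg ?psiX_TI.
(* The product is all of the automorphism group and the orders multiply to its order, which leaves a
   trivial intersection. *)
apply: cardMg_TI; apply: (leq_trans _ (eq_leq (esym (congr1 (fun Z : {set _} => #|Z|) NK)))).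
apply: (leq_trans _ (eq_leq (esym cA))); rewrite cX -mulnA.
exact: (eq_leq (congr1 (muln _) cKK)).
Qed.

End Involution.

Lemma aut_imprimitive : point_imprimitive A 'P P.
Proof.
exists [set cell i | i : I22]; apply: (cells_system ms) => a i aA.
have [s [t [_ _ tE _]]] := aut_lift aA; exists (s i) => v; exists (t v).
by rewrite /= /aperm tE.
Qed.

Lemma X_flag : flag_transitive X 'Rs B.
Proof.
move=> y b y' b' /imsetP[p pP ->] yp /imsetP[q qP ->] y'q.
have [z [pz yz]] := flags pP yp qP y'q; exists z; rewrite in_setT; split=> //.
by rewrite Rs_nbhd // pz.
Qed.

Lemma aut_flag : flag_transitive A 'P B.
Proof.
move=> y b y' b' /imsetP[p pP ->] yp /imsetP[q qP ->] y'q.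
have [z [pz yz]] := flags pP yp qP y'q; exists (psi z); split; first exact: psi_aut.
  by rewrite /= /aperm psiE //; move: yp; rewrite inE => /adj_points[].
rewrite -pz -Rs_nbhd // /=; apply: eq_in_imset => r; rewrite inE => /adj_points[_ rP].
by rewrite -[LHS]/(psi z r) psiE.
Qed.

Lemma abelem_V : 2.-abelem (psi @* subV rG) /\ #|psi @* subV rG| = (2 ^ 12)%N.
Proof.
split.
  apply/abelemP => //; split.
    apply: morphim_abelian; apply: morphim_abelian; apply/centsP=> u _ v _; exact: addrC.
  move=> _ /morphimP[_ _ /morphimP[u _ _ ->] ->]; change (psi (tsl u) ^+ 2 = 1).
  rewrite expgS expg1 -psiM ?in_setT // -tslD (rowDD dW) tsl0; exact: (morph1 psi_morphism).
rewrite card_injm ?injm_psi ?subsetT // card_injm ?injm_sdpair1 ?subsetT // cardsT.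
by rewrite card_mx cF.
Qed.

End Design.

End DesignAutomorphisms.

(** * Explicit matrices that permute the tabulated planes *)

Module PlaneMatrices.

Import FieldOfFour Orthogonality DualHyperovals CosetFamilies PlanePoints GolayCode M22Elements Octads M22Stabilizers M22Labels M21Simplicity FieldCodes PlaneCoordinates FieldAutomorphism.
Local Opaque line23 lperm dec enc is_lperm M22_check M22 M24.
Local Open Scope ring_scope.

Section Codes.

Local Open Scope nat_scope.

(* Three matrices over GF(4) in the coordinates of plane_tab, mapping each plane to the one
   given by the corresponding permutation in gen_perm. *)
Definition gen_mx (g : nat) : seq (seq nat) :=
  nth [::] [::
    [:: [::1;2;2;0;0;0]; [::1;2;0;0;0;0]; [::0;3;0;0;0;0]; [::1;2;1;0;3;2]; [::0;2;0;2;0;1]; [::0;1;0;2;0;0]];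
    [:: [::1;2;3;0;0;0]; [::0;3;2;0;0;0]; [::3;2;2;0;0;0]; [::1;2;3;2;3;1]; [::2;3;1;2;0;3]; [::2;2;0;3;1;3]];
    [:: [::0;0;0;1;3;0]; [::3;1;2;0;2;1]; [::1;2;3;2;0;3]; [::1;0;0;1;2;0]; [::3;0;0;2;3;0]; [::0;1;3;3;1;0]]] g.

Definition gen_inv (g : nat) : seq (seq nat) :=
  nth [::] [::
    [:: [::0;1;3;0;0;0]; [::0;0;2;0;0;0]; [::3;3;0;0;0;0]; [::0;0;1;0;0;3]; [::1;3;3;2;3;3]; [::0;0;1;0;1;1]];
    [:: [::2;2;1;0;0;0]; [::1;0;2;0;0;0]; [::2;3;3;0;0;0]; [::0;1;2;3;3;2]; [::3;2;3;3;2;3]; [::3;3;1;2;0;1]];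
    [:: [::0;0;0;2;1;0]; [::1;2;3;0;3;2]; [::2;3;1;3;0;1]; [::2;0;0;2;3;0]; [::1;0;0;3;1;0]; [::0;2;1;1;2;0]]] g.

Definition gen_perm (g : nat) : seq nat := nth [::] [:: perm_a; perm_b; perm_m] g.

(* The elements X = word_g and X^word_k commute modulo the scalars but not exactly. *)
Definition word_g : seq nat := [::0;0;0;1;0;0;1].
Definition word_k : seq nat := [::0;0;1;1;0;0;0;1;1;1].
Definition inv_k : seq (seq nat) :=
  [:: [::0;2;2;0;0;0]; [::0;1;2;0;0;0]; [::1;2;0;0;0;0]; [::0;3;2;0;0;1]; [::3;3;1;3;3;2]; [::2;0;1;1;3;2]].

(* The sum of the powers of the element gen_mx 1 * gen_mx 2 of order 11 is the rank one
   matrix spin_phi^T *m spin_v; a step (i, g) of a spin applies generator g to the i-th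
   vector found so far. *)
Definition spin_v : seq nat := [::1;2;2;2;2;3].
Definition spin_phi : seq nat := [::2;3;3;3;3;1].
Definition spin1_steps : seq (nat * nat) := [:: (0, 0); (0, 1); (1, 0); (1, 1); (2, 1)].
Definition spin2_steps : seq (nat * nat) := [:: (0, 0); (0, 1); (0, 2); (1, 0); (1, 1)].
Definition spin1_inv : seq (seq nat) :=
  [:: [::0;1;0;1;2;2]; [::3;1;1;2;3;0]; [::0;2;3;3;0;3]; [::2;3;1;2;0;2]; [::0;0;2;2;3;3]; [::1;2;3;1;3;2]].
Definition spin2_inv : seq (seq nat) :=
  [:: [::3;3;2;2;1;3]; [::3;0;1;3;0;2]; [::2;3;0;3;3;3]; [::1;0;0;1;3;2]; [::0;3;3;2;2;0]; [::0;1;2;1;3;3]].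
Definition comm_code : nat := 2.

Definition zerov : seq nat := nseq 6 0.
Definition vmulc (u : seq nat) (M : seq (seq nat)) : seq nat :=
  foldr (fun k => FieldCodes.addv (mulv (nth 0 u k) (nth [::] M k))) zerov (iota 0 6).
Definition mmulc (M N : seq (seq nat)) := mkseq (fun i => vmulc (nth [::] M i) N) 6.
Definition addmc (M N : seq (seq nat)) := mkseq (fun i => FieldCodes.addv (nth [::] M i) (nth [::] N i)) 6.
Definition scalec c (M : seq (seq nat)) := mkseq (fun i => mulv c (nth [::] M i)) 6.
Definition idc : seq (seq nat) := mkseq (fun i => mkseq (fun j => nat_of_bool (i == j)) 6) 6.
Definition trc (M : seq (seq nat)) : seq (seq nat) :=
  mkseq (fun i => mkseq (fun j => nth 0 (nth [::] M j) i) 6) 6.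
Definition wordc (l : seq nat) := foldr (fun g => mmulc (gen_mx g)) idc l.
Definition spin (f : nat -> seq (seq nat)) (v : seq nat) (st : seq (nat * nat)) :=
  foldl (fun L s => rcons L (vmulc (nth [::] L s.1) (f s.2))) [:: v] st.
Definition sum_powers (g : seq (seq nat)) n :=
  foldr (fun k => addmc (iter k (mmulc g) idc)) (nseq 6 zerov) (iota 0 n).

(** Permutations act on the numbers 0 to 23 and planes carry labels 0 to 21, hence the successor and
    the predecessor. *)
Definition gens_ok : bool :=
  all (fun g => (mmulc (gen_mx g) (gen_inv g) == idc) &&
    all (fun j => tab_sub (fun u => vmulc u (gen_mx g)) j (nth 0 (gen_perm g) j.+1).-1)
      (iota 0 22)) (iota 0 3).
Definition planes_ok : bool :=
  all (fun j => let t := nth [::] plane_tab j in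
    indep3 (nth [::] t 0) (nth [::] t 1) (nth [::] t 2)) (iota 0 22).
Definition spins_ok : bool :=
  [&& sum_powers (mmulc (gen_mx 1) (gen_mx 2)) 11 == mkseq (fun k => mulv (nth 0 spin_phi k) spin_v) 6,
      mmulc spin1_inv (spin gen_mx spin_v spin1_steps) == idc
    & mmulc spin2_inv (spin (fun g => trc (gen_mx g)) spin_phi spin2_steps) == idc].
Definition comm_ok : bool :=
  let X := wordc word_g in let K := wordc word_k in
  let Y := mmulc (mmulc inv_k X) K in
  (mmulc K inv_k == idc) && (mmulc X Y == scalec comm_code (mmulc Y X)).

Lemma gens_check : gens_ok. Proof. by vm_compute. Qed.
Lemma planes_check : planes_ok. Proof. by vm_compute. Qed.
Lemma spins_check : spins_ok. Proof. by vm_compute. Qed.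
Lemma comm_check : comm_ok. Proof. by vm_compute. Qed.

End Codes.

Local Opaque gens_ok planes_ok spins_ok comm_ok plane_tab gen_mx gen_inv spin1_inv spin2_inv inv_k
  perm_a perm_b perm_m.

Section Matrices.

Variables (F : finFieldType) (w : F).
Hypotheses (cF : #|F| = 4%N) (w0 : w != 0) (w1 : w != 1).

Definition mat (M : seq (seq nat)) : 'M[F]_6 := \matrix_(i < 6) vec w (nth [::] M i).

Lemma vec_zero : vec w zerov = 0.
Proof. by apply/rowP=> k; rewrite !mxE nth_nseq; case: ifP. Qed.

Lemma vec_vmul u M : vec w (vmulc u M) = vec w u *m mat M.
Proof.
rewrite mulmx_sum_row /vmulc /= !(vec_add _ cF) !(vec_mul cF w0 w1) vec_zero.
rewrite !big_ord_recl big_ord0 !rowK !mxE; by [].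
Qed.

Lemma mat_mul M N : mat (mmulc M N) = mat M *m mat N.
Proof.
apply/row_matrixP=> i; rewrite row_mul !rowK nth_mkseq // vec_vmul //.
Qed.

Lemma mat_id : mat idc = 1%:M.
Proof.
apply/matrixP=> i j; rewrite !mxE nth_mkseq // nth_mkseq // -val_eqE /=.
by case: (_ == _).
Qed.

Lemma mat_tr M : mat (trc M) = (mat M)^T.
Proof. by apply/matrixP=> i j; rewrite !mxE nth_mkseq // nth_mkseq. Qed.

Lemma mat_add M N : mat (addmc M N) = mat M + mat N.
Proof.
apply/row_matrixP=> i; rewrite linearD /= !rowK nth_mkseq //; exact: (vec_add _ cF).
Qed.

Lemma mat_scale c M : mat (scalec c M) = cval w c *: mat M.
Proof.
apply/row_matrixP=> i; rewrite linearZ /= !rowK nth_mkseq //; exact: (vec_mul cF w0 w1).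
Qed.

Notation pl := (fun j : I22 => plane w j).

Lemma rank_plane (j : I22) : \rank (plane w j) = 3%N.
Proof.
have /allP/(_ (j : nat)) := planes_check; rewrite mem_iota ltn_ord => /(_ isT).
by move/(indep3P cF w0 w1 (unitmx1 F 6)); rewrite !mulmx1.
Qed.

Lemma gen_unit g : (g < 3)%N -> mat (gen_mx g) \in unitmx.
Proof.
move=> g3; have /allP/(_ g) := gens_check; rewrite mem_iota g3 => /(_ isT)/andP[/eqP E _].
by have [] := @mulmx1_unit _ _ (mat (gen_mx g)) (mat (gen_inv g)); rewrite -?mat_mul ?E ?mat_id.
Qed.

Lemma gen_M22 g : (g < 3)%N -> M22_check (gen_perm g).
Proof. case: checks => a b m; case: g => [|[|[|g]]] // _. Qed.

Lemma act_lperm l (j : I22) : M22_check l ->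
  (act22 (lperm l) j : nat) = (nth 0%N l j.+1).-1.
Proof.
move=> ml; have il : is_lperm l by have /andP[] := ml.
have lM := lperm_M22 ml.
have := lab_act j lM; rewrite {2}/lab lpermE //; last exact: lab_lt.
move/(congr1 enc); rewrite enc_lab decK ?(is_lperm_lt il) ?lab_lt //.
by move=> <-.
Qed.

Lemma gen_permutes g : (g < 3)%N ->
  permutes pl (mat (gen_mx g)) (act22 (lperm (gen_perm g))).
Proof.
move=> g3; have gu := gen_unit g3; have gM := gen_M22 g3.
split; [exact: gu | exact: (act22_inj (lperm_M22 gM)) |].
move=> j; rewrite (act_lperm _ gM); set j' := (nth _ _ _).-1.
have j'22 : (j' < 22)%N by rewrite /j' -(act_lperm _ gM) ltn_ord.
have sub : (plane w j *m mat (gen_mx g) <= plane w j')%MS.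
  have /allP/(_ g) := gens_check; rewrite mem_iota g3 => /(_ isT)/andP[_ /allP/(_ (j : nat))].
  rewrite mem_iota ltn_ord => /(_ isT) ts.
  have ts' := tab_subP cF w0 w1 ts.
  rewrite {1}/plane; set t := nth [::] plane_tab j in ts' *.
  have E : ((vec w (nth [::] t 0) + vec w (nth [::] t 1) + vec w (nth [::] t 2))%MS
      *m mat (gen_mx g) :=: vec w (nth [::] t 0) *m mat (gen_mx g)
      + vec w (nth [::] t 1) *m mat (gen_mx g) + vec w (nth [::] t 2) *m mat (gen_mx g))%MS.
    by apply: eqmx_trans (addsmxMr _ _ _) (adds_eqmx (addsmxMr _ _ _) (eqmx_refl _)).
  by rewrite E !addsmx_sub -!vec_vmul (ts' 0%N isT) (ts' 1%N isT) (ts' 2%N isT).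
apply/eqmxP; rewrite -(geq_leqif (mxrank_leqif_eq sub)) mxrankMfree ?row_free_unit; last exact: gu.
by rewrite (rank_plane (Ordinal j'22)) rank_plane.
Qed.

End Matrices.

End PlaneMatrices.

(** * Existence of the setup *)

Module PlaneGroup.

Import FieldOfFour Orthogonality DualHyperovals CosetFamilies PlanePoints GolayCode M22Elements Octads M22Stabilizers M22Labels M21Simplicity M21Preimage FieldCodes PlaneCoordinates FieldAutomorphism PlaneMatrices.
Local Open Scope ring_scope.

Lemma comm_codeE : comm_code = 2%N. Proof. by []. Qed.

Lemma gen_perm_move : (nth 0%N (gen_perm 2) 1).-1 = 20%N. Proof. by []. Qed.

Lemma plane_base (F : finFieldType) (w : F) :
  let e k := vec w (nth [::] idc k) in
  [/\ plane w 0 = (e 0%N + e 1%N + e 2%N)%MS, plane w 1 = (e 0%N + e 3%N + e 4%N)%MS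
    & plane w 2 = (e 1%N + e 3%N + e 5%N)%MS].
Proof. by []. Qed.

Local Opaque line23 lperm dec enc is_lperm M22_check M22 M24.
Local Opaque gens_ok planes_ok spins_ok comm_ok plane_tab gen_mx gen_inv spin1_inv spin2_inv inv_k
  perm_a perm_b perm_m plane gen_perm word_g word_k spin_v spin_phi spin1_steps spin2_steps comm_code idc mmulc vmulc.

Lemma spin_ind (P : seq nat -> Prop) f v st : P [::] -> P v ->
    (forall u g, (g < 3)%N -> P u -> P (vmulc u (f g))) -> all (fun s => s.2 < 3)%N st ->
  forall i, P (nth [::] (spin f v st) i).
Proof.
move=> P0 Pv Pf; rewrite /spin.
have : forall i, P (nth [::] [:: v] i) by case=> [|[|i]].
elim: st [:: v] => [|s st IH] L PL //= /andP[s3 st3]; apply: IH => // i.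
rewrite nth_rcons; case: ifP => _; first exact: PL.
by case: ifP => _ //; apply: Pf => //; apply: PL.
Qed.

Lemma steps_lt : all (fun s => s.2 < 3)%N spin1_steps /\ all (fun s => s.2 < 3)%N spin2_steps.
Proof. by split; vm_compute. Qed.

Lemma words_lt : all (gtn 3) word_g /\ all (gtn 3) word_k.
Proof. by split; vm_compute. Qed.

Lemma capmxMunit (F : fieldType) n (A B u : 'M[F]_n) : u \in unitmx ->
  (A *m u :&: B *m u :=: (A :&: B)%MS *m u)%MS.
Proof.
move=> uu; have fu : row_free u by rewrite row_free_unit.
apply/eqmx_sym/eqmxP; rewrite -(geq_leqif (mxrank_leqif_eq (capmxMr A B u))).
have := mxrank_sum_cap (A *m u) (B *m u); rewrite -addsmxMr !mxrankMfree //.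
by have := mxrank_sum_cap A B; clear; lia.
Qed.

(* Modulo a central subgroup the commutator depends only on the components in a complement. *)
Lemma split_central_comm (gT : finGroupType) (G Z K : {group gT}) (X Y : gT) :
    Z \subset 'Z(G) -> (Z :&: K = 1)%g -> (Z * K = G)%g -> X \in G -> Y \in G ->
  [~ X, Y]%g \in Z -> [~ X, Y]%g = 1%g.
Proof.
move=> ZG TI ZK; have KG : K \subset G by rewrite -ZK mulG_subr.
have cen a p : a \in Z -> p \in G -> commute a p.
  by move=> aZ; have /centerP[_ H] := subsetP ZG _ aZ; apply: H.
have ZsG : Z \subset G by rewrite -ZK mulG_subl.
rewrite -{1 2}ZK => /mulsgP[z q zZ qK ->] /mulsgP[z' q' z'Z q'K ->].
have [qG q'G] := (subsetP KG _ qK, subsetP KG _ q'K).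
have -> : [~ z * q, z' * q']%g = [~ q, q']%g.
  rewrite commMgJ; have -> : [~ z, z' * q']%g = 1%g.
    by apply/eqP/commgP; apply: cen; rewrite ?groupM // (subsetP ZsG).
  rewrite conj1g mul1g commgMJ; have -> : [~ q, z']%g = 1%g.
    by apply/eqP/commgP/commute_sym/cen.
  by rewrite conj1g mulg1.
by move=> cZ; apply/set1gP; rewrite -TI inE cZ groupR.
Qed.

Section Group.

Variables (F : finFieldType) (w : F).
Hypotheses (cF : #|F| = 4%N) (w0 : w != 0) (w1 : w != 1).

Notation gT := ({perm line23} * {'GL_6[F]})%type.

Definition gmx (p : gT) : 'M[F]_6 := GLval p.2.

Lemma gmx1 : gmx 1%g = 1%:M. Proof. exact: (@GL_1E 6 F). Qed.

Lemma gmxM p q : gmx (p * q)%g = gmx p *m gmx q. Proof. exact: (@GL_ME 6 F p.2 q.2). Qed.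

Lemma gmxV p : gmx (p^-1)%g = invmx (gmx p). Proof. exact: (@GL_VE 6 F p.2). Qed.

Lemma gmx_unit p : gmx p \in unitmx. Proof. exact: (@GL_unitmx 6 F p.2). Qed.

(** Keeping the permutation next to the matrix that induces it makes the covering map the first
    projection and the representation the second. *)
Definition plane_group_set : {set gT} :=
  [set p : gT | (p.1 \in M22) &&
    [forall j : I22, (plane w j *m gmx p == plane w (act22 p.1 j))%MS]].

Lemma in_plane_group (p : gT) : reflect
  (p.1 \in M22 /\ forall j : I22, (plane w j *m gmx p :=: plane w (act22 p.1 j))%MS)
  (p \in plane_group_set).
Proof.
rewrite [p \in _]inE; apply: (iffP andP) => -[pM H]; (split; first exact: pM).
  by move=> j; apply/eqmxP; apply: (forallP H).
by apply/forallP=> j; apply/eqmxP.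
Qed.

Lemma plane_group_group : group_set plane_group_set.
Proof.
apply/group_setP; split=> [|p q].
  apply/in_plane_group; split=> [|j]; first exact: group1.
  by rewrite gmx1 mulmx1 act22_1.
case/in_plane_group=> pM pW /in_plane_group[qM qW]; apply/in_plane_group; split=> [|j] /=.
  by rewrite groupM.
rewrite gmxM mulmxA act22M //; exact: eqmx_trans (eqmxMr _ (pW _)) (qW _).
Qed.
Definition plane_group : {group gT} := Group plane_group_group.

Lemma cover_morph : {in plane_group &, {morph (fun p : gT => p.1) : p q / (p * q)%g}}.
Proof. by []. Qed.
Definition cover : {morphism plane_group >-> {perm line23}} := Morphism cover_morph.

Lemma plane_repr_subproof : mx_repr plane_group (fun p : gT => gmx p).
Proof. by split=> [|p q _ _]; [exact: gmx1 | exact: gmxM]. Qed.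
Definition plane_repr : mx_representation F plane_group 6 := MxRepresentation plane_repr_subproof.

Definition gen_el (g : nat) : gT :=
  (lperm (gen_perm g), insubd (1%g : {'GL_6[F]}) (mat w (gen_mx g))).

Lemma gen_elE g : (g < 3)%N -> gmx (gen_el g) = mat w (gen_mx g).
Proof. by move=> g3; rewrite /gmx /= insubdK //; apply: (gen_unit cF w0 w1 g3). Qed.

Lemma gen_el_in g : (g < 3)%N -> gen_el g \in plane_group.
Proof.
move=> g3; apply/in_plane_group; split; first exact: (lperm_M22 (gen_M22 g3)).
by have [_ _ H] := gen_permutes cF w0 w1 g3; rewrite gen_elE.
Qed.

Local Opaque gen_el.

(** The first two generators give the stabiliser of label 0. The third moves that label and
    conjugates this stabiliser to another one, so [M22_gen] applies. *)
Lemma cover_onto : cover @* plane_group = M22.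
Proof.
have inK g : (g < 3)%N -> lperm (gen_perm g) \in (cover @* plane_group)%G.
  by move=> g3; apply: (mem_morphim cover (gen_el_in g3) (gen_el_in g3)).
apply/eqP; rewrite eqEsubset; apply/andP; split.
  by apply/subsetP=> s /morphimP[p pG _ ->]; case/in_plane_group: pG.
have sub0 : M21 (lab (o22 0)) \subset (cover @* plane_group)%G.
  rewrite -G1_lab0 -K21_G1 gen_subG; apply/subsetP=> s; rewrite !inE => /orP[]/eqP->.
    exact: (inK 0%N).
  exact: (inK 1%N).
have mM := lperm_M22 (gen_M22 (isT : 2 < 3)%N).
apply: (@M22_gen _ (o22 0) (act22 (lperm (gen_perm 2)) (o22 0))) => //.
  apply/eqP=> /(congr1 (@nat_of_ord 22)).
  by rewrite (act_lperm _ (gen_M22 (isT : 2 < 3)%N)) /o22 inordK // gen_perm_move.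
by rewrite lab_act // M21_conj // conj_subG // (inK 2%N).
Qed.

Lemma plane_lift s : s \in M22 -> exists2 u : 'M[F]_6, u \in unitmx &
  forall j : I22, (plane w j *m u :=: plane w (act22 s j))%MS.
Proof.
rewrite -cover_onto => /morphimP[p _ /in_plane_group[_ pW] ->].
by exists (gmx p); first exact: gmx_unit.
Qed.

(** The planes 0, 1, 2 are spanned by unit vectors, so the ranks can be found by hand;
    3-transitivity carries them to all pairs and triples. *)
Lemma planes_base :
  [/\ \rank (plane w 0 :&: plane w 1)%MS = 1%N, \rank (plane w 0 :&: plane w 1 :&: plane w 2)%MS = 0%N
    & \rank (plane w 0 + plane w 1 + plane w 2)%MS = 6%N].
Proof.
have rp j : (j < 22)%N -> \rank (plane w j) = 3%N.
  by move=> j22; apply: (rank_plane cF w0 w1 (Ordinal j22)).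
have r0 := rp 0%N isT; have r1 := rp 1%N isT; have r2 := rp 2%N isT.
have [E0 E1 E2] := plane_base w; set e := fun k => vec w (nth [::] idc k) in E0 E1 E2.
have ei k (A B : 'M[F]_6) : (e k <= A)%MS -> (e k <= A + B)%MS.
  by move=> h; apply: submx_trans h (addsmxSl _ _).
have [p00 p01 p02] : [/\ (e 0%N <= plane w 0)%MS, (e 1%N <= plane w 0)%MS & (e 2%N <= plane w 0)%MS].
  by have := submx_refl (plane w 0); rewrite {1}E0 !addsmx_sub -andbA => /and3P.
have [p10 p13 p14] : [/\ (e 0%N <= plane w 1)%MS, (e 3%N <= plane w 1)%MS & (e 4%N <= plane w 1)%MS].
  by have := submx_refl (plane w 1); rewrite {1}E1 !addsmx_sub -andbA => /and3P.
have [p21 p23 p25] : [/\ (e 1%N <= plane w 2)%MS, (e 3%N <= plane w 2)%MS & (e 5%N <= plane w 2)%MS].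
  by have := submx_refl (plane w 2); rewrite {1}E2 !addsmx_sub -andbA => /and3P.
have full (S : 'M[F]_6) : (forall k, (k < 6)%N -> (e k <= S)%MS) -> \rank S = 6%N.
  move=> H; apply/eqP; rewrite eqn_leq rank_leq_row -{1}(mxrank1 F 6) mxrankS //.
  by rewrite -(mat_id w); apply/row_subP=> i; rewrite rowK H.
have r1e k : (\rank (e k) <= 1)%N by apply: rank_leq_row.
have r01 : \rank (plane w 0 + plane w 1)%MS = 5%N.
  apply/eqP; rewrite eqn_leq; apply/andP; split.
    have le : (plane w 0 + plane w 1 <= plane w 0 + (e 3%N + e 4%N))%MS.
      have h3 : (e 3%N <= plane w 0 + (e 3%N + e 4%N))%MS.
        exact: submx_trans (addsmxSl _ _) (addsmxSr _ _).
      have h4 : (e 4%N <= plane w 0 + (e 3%N + e 4%N))%MS.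
        exact: submx_trans (addsmxSr _ _) (addsmxSr _ _).
      by rewrite addsmx_sub addsmxSl E1 !addsmx_sub ei // h3 h4.
    apply: leq_trans (mxrankS le) _; apply: leq_trans (mxrank_adds_leqif _ _) _; rewrite r0.
    by have := mxrank_adds_leqif (e 3%N) (e 4%N) => -[+ _]; have := r1e 3%N; have := r1e 4%N; clear; lia.
  have : \rank (plane w 0 + plane w 1 + e 5%N)%MS = 6%N.
    have le0 : (plane w 0 <= plane w 0 + plane w 1 + e 5%N)%MS by rewrite -addsmxA addsmxSl.
    have le1 : (plane w 1 <= plane w 0 + plane w 1 + e 5%N)%MS.
      by rewrite (addsmxC (plane w 0)) -addsmxA addsmxSl.
    apply: full => -[|[|[|[|[|[|]]]]]] // _; last exact: addsmxSr.
    - exact: submx_trans p00 le0.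
    - exact: submx_trans p01 le0.
    - exact: submx_trans p02 le0.
    - exact: submx_trans p13 le1.
    - exact: submx_trans p14 le1.
  by have := mxrank_adds_leqif (plane w 0 + plane w 1)%MS (e 5%N) => -[+ _]; have := r1e 5%N; clear; lia.
have r01c : \rank (plane w 0 :&: plane w 1)%MS = 1%N.
  by have := mxrank_sum_cap (plane w 0) (plane w 1); rewrite r01 r0 r1; clear; lia.
split=> //; last first.
  apply: full => k k6; have : (e k <= plane w 0)%MS \/ (e k <= plane w 1)%MS \/ (e k <= plane w 2)%MS.
    by case: k k6 => [|[|[|[|[|[|]]]]]] // _; rewrite ?p00 ?p01 ?p02 ?p13 ?p14 ?p25; auto.
  case=> [h | [] h]; apply: submx_trans h _; rewrite ?addsmxSr //.
    by rewrite -addsmxA addsmxSl.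
  by rewrite (addsmxC (plane w 0)) -addsmxA addsmxSl.
(* A nonzero triple meet would be the line of e_0, so plane 2 would contain e_0; with e_2 and e_4 it
   would then span [V], yet 3 + 2 < 6. *)
apply/eqP; rewrite -leqn0 leqNgt; apply/negP => pos.
have le : (plane w 0 :&: plane w 1 :&: plane w 2 <= plane w 0 :&: plane w 1)%MS by apply: capmxSl.
have e02 : (e 0%N <= plane w 2)%MS.
  have : (plane w 0 :&: plane w 1 <= plane w 0 :&: plane w 1 :&: plane w 2)%MS.
    by rewrite -(geq_leqif (mxrank_leqif_sup le)) r01c.
  move=> h; apply: submx_trans (capmxSr _ _); apply: submx_trans h.
  by rewrite sub_capmx p00 p10.
have /full : forall k, (k < 6)%N -> (e k <= plane w 2 + (e 2%N + e 4%N))%MS.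
  have le2 := addsmxSl (plane w 2) (e 2%N + e 4%N)%MS.
  case=> [|[|[|[|[|[|]]]]]] // _.
  - exact: submx_trans e02 le2.
  - exact: submx_trans p21 le2.
  - exact: submx_trans (addsmxSl _ _) (addsmxSr _ _).
  - exact: submx_trans p23 le2.
  - exact: submx_trans (addsmxSr _ _) (addsmxSr _ _).
  - exact: submx_trans p25 le2.
have := mxrank_adds_leqif (plane w 2) (e 2%N + e 4%N)%MS => -[+ _].
have := mxrank_adds_leqif (e 2%N) (e 4%N) => -[+ _].
by have := r1e 2%N; have := r1e 4%N; rewrite r2; clear; lia.
Qed.

Lemma planes_dual_hyperoval : dual_hyperoval (fun j : I22 => plane w j).
Proof.
have [b1 b2 b3] := planes_base.
have tr3 (i j k : I22) : i != j -> i != k -> j != k -> exists2 u : 'M[F]_6, u \in unitmx &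
    [/\ (plane w 0 *m u :=: plane w i)%MS, (plane w 1 *m u :=: plane w j)%MS
      & (plane w 2 *m u :=: plane w k)%MS].
  move=> ij ik jk.
  have [||s sM [si sj sk]] := @M22_3trans2 (o22 0) (o22 1) (o22 2) i j k.
  - by rewrite /= !inE -!val_eqE /= !inordK.
  - by rewrite /= !inE negb_or ij ik jk.
  have [u uu uW] := plane_lift sM; exists u => //.
  have := (uW (o22 0), uW (o22 1), uW (o22 2)).
  by rewrite si sj sk /= !inordK // => -[[]].
have freeu (u : 'M[F]_6) : u \in unitmx -> row_free u by rewrite row_free_unit.
split=> //.
- by rewrite card_ord.
- by move=> i; apply: (rank_plane cF w0 w1).
- move=> i j ij; have [k /andP[ki kj]] := I22_third i j; rewrite ![k == _]eq_sym in ki kj.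
  have [u uu [E0 E1 _]] := tr3 i j k ij ki kj.
  by rewrite -(cap_eqmx E0 E1) (capmxMunit _ _ uu) mxrankMfree ?freeu.
- move=> i j k ij ik jk; have [u uu [E0 E1 E2]] := tr3 i j k ij ik jk.
  rewrite -(cap_eqmx (cap_eqmx E0 E1) E2) (cap_eqmx (capmxMunit _ _ uu) (eqmx_refl _)).
  by rewrite (capmxMunit _ _ uu) mxrankMfree ?freeu.
move=> i j k ij ik jk; have [u uu [E0 E1 E2]] := tr3 i j k ij ik jk.
have E : ((plane w 0 + plane w 1 + plane w 2)%MS *m u :=: plane w i + plane w j + plane w k)%MS.
  apply: eqmx_trans (addsmxMr _ _ _) (adds_eqmx _ E2).
  exact: eqmx_trans (addsmxMr _ _ _) (adds_eqmx E0 E1).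
by rewrite -E mxrankMfree ?freeu.
Qed.

Lemma cover_kerP (p : gT) : reflect (p.1 = 1%g /\ exists c, gmx p = c%:M) (p \in 'ker cover).
Proof.
apply: (iffP idP) => [pK | [p1 [c pc]]].
  have pG : p \in plane_group by apply: subsetP (subsetIl _ _) _ pK.
  have p1 : p.1 = 1%g by apply: (mker pK).
  split=> //; apply: (kernel_scalar planes_dual_hyperoval); split=> //; first exact: gmx_unit.
  by case/in_plane_group: pG => _ pW j; have := pW j; rewrite p1 act22_1.
have c0 : c != 0.
  by apply: contraTneq (gmx_unit p) => c0; rewrite pc c0 unitmxE det_scalar expr0n unitr0.
apply/kerP => //; apply/in_plane_group; rewrite p1 group1; split=> // j.
by rewrite act22_1 pc mul_mx_scalar; apply: eqmx_scale.
Qed.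

Lemma cover_ker : #|'ker cover| = 3%N.
Proof.
apply: etrans (_ : #|[set~ (0 : F)]| = 3%N); last by rewrite cardsC1 cF.
have scE (c : F) : c != 0 -> GLval (insubd (1%g : {'GL_6[F]}) (c%:M : 'M_6)) = c%:M.
  by move=> c0; rewrite insubdK //; rewrite -topredE /= unitmxE det_scalar unitrX ?unitfE.
have inj : {in 'ker cover &, injective (fun p : gT => gmx p 0 0)}.
  move=> p q /cover_kerP[p1 [c pc]] /cover_kerP[q1 [d qd]] /=; rewrite pc qd !mxE => cd.
  have pq2 : p.2 = q.2 by apply: val_inj; apply: etrans pc (etrans _ (esym qd)); move: cd; rewrite !mulr1n => ->.
  by rewrite [p]surjective_pairing [q]surjective_pairing p1 q1 pq2.
rewrite -(card_in_imset inj); apply: eq_card => c; rewrite !inE.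
apply/imsetP/idP => [[p pK ->] | c0].
  have [_ [d pd]] := cover_kerP _ pK; rewrite pd mxE mulr1n.
  by apply: contraTneq (gmx_unit p) => c0; rewrite pd c0 unitmxE det_scalar expr0n unitr0.
exists (1%g, insubd (1%g : {'GL_6[F]}) (c%:M : 'M_6)) ; last by rewrite /gmx /= scE // mxE eqxx mulr1n.
by apply/cover_kerP; split=> //; exists c; exact: (scE c c0).
Qed.

Lemma cover_central : 'ker cover \subset 'Z(plane_group).
Proof.
apply/subsetP=> p pK; have [p1 [c pc]] := cover_kerP _ pK.
apply/centerP; split; first by apply: subsetP (subsetIl _ _) _ pK.
move=> q _.
have e1 : (p.1 * q.1 = q.1 * p.1)%g by rewrite p1 mul1g mulg1.
have e2 : (p.2 * q.2 = q.2 * p.2)%g.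
  by apply: val_inj; apply: etrans (gmxM p q) (etrans _ (esym (gmxM q p))); rewrite pc scalar_mxC.
exact: (congr2 (@pair _ _) e1 e2).
Qed.

Definition word_el l : gT := foldr (fun g p => gen_el g * p)%g 1%g l.

Lemma word_el_in l : all (gtn 3) l -> word_el l \in plane_group.
Proof.
elim: l => [|g l IH] => [_ | /andP[g3 /IH lG]]; first exact: (group1 plane_group).
exact: (groupM (gen_el_in g3) lG).
Qed.

Lemma word_elE l : all (gtn 3) l -> gmx (word_el l) = mat w (wordc l).
Proof.
elim: l => [|g l IH] => [_ | /andP[g3 /IH E]]; first by rewrite mat_id gmx1.
by rewrite [LHS]gmxM E [RHS](mat_mul cF w0 w1) -gen_elE.
Qed.

Local Opaque word_el wordc mat gmx.

Lemma gmx_comm (p q : gT) c : gmx p *m gmx q = c *: (gmx q *m gmx p) ->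
  gmx [~ p, q]%g = c%:M.
Proof.
rewrite -(gmxM p q) -(gmxM q p) (commgC p q) (gmxM (q * p)%g [~ p, q]%g) => E.
by rewrite -[LHS](mulKmx (gmx_unit (q * p)%g)) E -scalemxAr mulVmx ?gmx_unit // scalemx1.
Qed.

Lemma cover_nonsplit : ~~ [splits plane_group, over 'ker cover].
Proof.
apply/splitsP=> -[K /complP[TI KG]].
have [gl kl] := words_lt.
have [X XG XE] : exists2 X, X \in plane_group & gmx X = mat w (wordc word_g).
  by exists (word_el word_g); [exact: word_el_in gl | exact: word_elE gl].
have [k kG kE'] : exists2 k, k \in plane_group & gmx k = mat w (wordc word_k).
  by exists (word_el word_k); [exact: word_el_in kl | exact: word_elE kl].
pose Y := (k^-1 * X * k)%g; have YG : Y \in plane_group by apply: (groupM (groupM (groupVr kG) XG) kG).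
have /andP[/eqP ki /eqP co] := comm_check.
have kE : invmx (gmx k) = mat w inv_k.
  have E : gmx k *m mat w inv_k = 1%:M by rewrite kE' -(mat_mul cF w0 w1) ki mat_id.
  by rewrite -[LHS]mulmx1 -E mulKmx ?gmx_unit.
have YE : gmx Y = mat w (mmulc (mmulc inv_k (wordc word_g)) (wordc word_k)).
  by rewrite [RHS](mat_mul cF w0 w1) [X in _ = X *m _](mat_mul cF w0 w1) -kE -XE -kE' -gmxV -!gmxM.
have cE : gmx [~ X, Y]%g = (cval w comm_code)%:M.
  by apply: gmx_comm; rewrite YE XE -!(mat_mul cF w0 w1) co (mat_scale cF w0 w1).
have cW : cval w comm_code = w by rewrite comm_codeE.
rewrite cW in cE.
have cG : [~ X, Y]%g \in plane_group by rewrite groupR.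
have cK : [~ X, Y]%g \in 'ker cover.
  apply/cover_kerP; split; last by exists w.
  have [cM cP] := in_plane_group _ cG; apply: (act22_eq1 cM) => j; apply/eqP.
  apply: contraT => nj; have r1 := dho_rank2 planes_dual_hyperoval nj.
  have E : (plane w j :=: plane w (act22 [~ X, Y]%g.1 j))%MS.
    by apply: eqmx_trans (cP j); rewrite cE mul_mx_scalar; apply/eqmx_sym/eqmx_scale.
  have le : (plane w (act22 [~ X, Y]%g.1 j) <= plane w (act22 [~ X, Y]%g.1 j) :&: plane w j)%MS.
    by rewrite sub_capmx submx_refl E submx_refl.
  by have := mxrankS le; rewrite r1 (rank_plane cF w0 w1).
have c1 := split_central_comm cover_central TI KG XG YG cK.
move: cE; rewrite c1 gmx1 => /matrixP/(_ 0 0).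
by rewrite !mxE !mulr1n => /eqP; rewrite eq_sym (negPf w1).
Qed.

Local Transparent mat gmx.

Lemma sum_powers_stable (U : 'M[F]_6) g n : (U *m mat w g <= U)%MS ->
  (U *m mat w (sum_powers g n) <= U)%MS.
Proof.
move=> Ug; have pow k : (U *m mat w (iter k (mmulc g) idc) <= U)%MS.
  elim: k => [|k IH] /=; first by rewrite mat_id mulmx1.
  by rewrite (mat_mul cF w0 w1) mulmxA; apply: submx_trans (submxMr _ Ug) IH.
rewrite /sum_powers; elim: (iota 0 n) => [|k l IH] /=.
  have -> : mat w (nseq 6 zerov) = 0.
    by apply/row_matrixP=> i; rewrite rowK row0 nth_nseq ltn_ord vec_zero.
  by rewrite mulmx0 sub0mx.
by rewrite (mat_add w cF) mulmxDr addmx_sub.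
Qed.

Lemma mat_outer p v : mat w (mkseq (fun k => mulv (nth 0%N p k) v) 6) = (vec w p)^T *m vec w v.
Proof.
apply/row_matrixP=> i; rewrite rowK nth_mkseq // (vec_mul cF w0 w1) row_mul.
rewrite [row i _](_ : _ = (cval w (nth 0%N p i))%:M) ?mul_scalar_mx //.
by apply/rowP=> k; rewrite !mxE (ord1 k) mulr1n.
Qed.

Local Opaque spin sum_powers.

Lemma spin_matrices :
  [/\ mat w (sum_powers (mmulc (gen_mx 1) (gen_mx 2)) 11) = (vec w spin_phi)^T *m vec w spin_v,
      mat w spin1_inv *m mat w (spin gen_mx spin_v spin1_steps) = 1%:M
    & mat w spin2_inv *m mat w (spin (fun g => trc (gen_mx g)) spin_phi spin2_steps) = 1%:M].
Proof.
have /and3P[/eqP sE /eqP i1 /eqP i2] := spins_check; split.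
- by rewrite sE mat_outer.
- by rewrite -(mat_mul cF w0 w1) i1 mat_id.
- by rewrite -(mat_mul cF w0 w1) i2 mat_id.
Qed.

(** Norton's criterion for the rank one matrix obtained from the powers. If a submodule is not
    killed by [spin_phi], it contains [spin_v], whose images span [V]. Otherwise it is also killed
    by the images of [spin_phi] under the transposed generators, which span the dual, and so it is
    0. *)
Lemma plane_repr_irr : mx_irreducible plane_repr.
Proof.
have [st1 st2] := steps_lt; have [sE i1 i2] := spin_matrices.
split; [exact: mxmodule1 | by rewrite -mxrank_eq0 mxrank1 |].
move=> U Umod _ U0.
have Ugen g : (g < 3)%N -> (U *m mat w (gen_mx g) <= U)%MS.
  by move=> g3; rewrite -(gen_elE g3); apply: (mxmoduleP Umod); apply: gen_el_in.
have Ug : (U *m mat w (mmulc (gen_mx 1) (gen_mx 2)) <= U)%MS.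
  by rewrite (mat_mul cF w0 w1) mulmxA; apply: (submx_trans (submxMr _ (Ugen 1%N isT)) (Ugen 2%N isT)).
have := sum_powers_stable 11 Ug; rewrite sE.
rewrite mulmxA; have [Uphi | Uphi] := eqVneq (U *m (vec w spin_phi)^T) 0.
  move=> _; case/negP: U0; apply/eqP.
  have L i : U *m (vec w (nth [::] (spin (fun g => trc (gen_mx g)) spin_phi spin2_steps) i))^T = 0.
    apply: (@spin_ind (fun u => U *m (vec w u)^T = 0)) => //.
      have -> : vec w [::] = 0 by apply/rowP=> k; rewrite !mxE nth_nil.
      by rewrite trmx0 mulmx0.
    move=> u g g3 Uu; rewrite (vec_vmul cF w0 w1) mat_tr trmx_mul trmxK mulmxA.
    have /submxP[D ->] := Ugen g g3; by rewrite -mulmxA Uu mulmx0.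
  have U1 : U *m (mat w (spin (fun g => trc (gen_mx g)) spin_phi spin2_steps))^T = 0.
    apply/trmx_inj; rewrite trmx_mul trmxK trmx0; apply/row_matrixP=> i.
    by rewrite row_mul rowK row0 -[LHS]trmxK trmx_mul trmxK L trmx0.
  have := congr1 trmx i2.
  by rewrite trmx_mul trmx1 => E; rewrite -[U]mulmx1 -E mulmxA U1 mul0mx.
have [i] : exists i, row i (U *m (vec w spin_phi)^T) != 0.
  by apply/existsP; apply: contraNT Uphi; rewrite negb_exists => /forallP H;
    apply/eqP/row_matrixP=> i; rewrite row0; apply/eqP; rewrite -[_ == _]negbK.
set a := row i _ => a0 sub.
have vU : (vec w spin_v <= U)%MS.
  have : (a *m vec w spin_v <= U)%MS by rewrite /a -row_mul; apply: submx_trans (row_sub _ _) sub.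
  rewrite [a]mx11_scalar mul_scalar_mx eqmx_scale //; apply: contraNneq a0 => a00.
  by rewrite [a]mx11_scalar a00 raddf0.
have L i' : (vec w (nth [::] (spin gen_mx spin_v spin1_steps) i') <= U)%MS.
  apply: (@spin_ind (fun u => (vec w u <= U)%MS)) => //.
    have -> : vec w [::] = 0 by apply/rowP=> k; rewrite !mxE nth_nil.
    exact: sub0mx.
  by move=> u g g3 Uu; rewrite (vec_vmul cF w0 w1); apply: submx_trans (submxMr _ Uu) (Ugen g g3).
have LU : (mat w (spin gen_mx spin_v spin1_steps) <= U)%MS.
  by apply/row_subP=> i'; rewrite rowK.
rewrite -i1.
exact: submx_trans (submxMl _ _) LU.
Qed.

Lemma plane_setup : mathieu_setup cover (lab (o22 0)) plane_repr (plane w 0).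
Proof.
split; last split.
- split; [exact: cover_onto | exact: cover_ker | exact: cover_central | exact: cover_nonsplit].
- exact: lab_not_fixed.
- exact: cF.
- exact: plane_repr_irr.
- exact: (rank_plane cF w0 w1 (Ordinal (isT : 0 < 22)%N)).
apply/mxmoduleP=> p pH.
have : p \in cover @*^-1 (M21 (lab (o22 0))) by exact: pH.
case/morphpreP=> pG; rewrite in_M21_lab => /andP[_ /eqP fix0].
have [_ pW] := in_plane_group _ pG; have := pW (o22 0); rewrite [act22 _ _]fix0 /= inordK // => E.
by rewrite E.
Qed.

End Group.

Lemma mathieu_setup_exists : exists (gT : finGroupType) (G : {group gT})
  (f : {morphism G >-> {perm line23}}) (x : line23) (F : finFieldType)
  (rG : mx_representation F G 6) (W : 'M[F]_6), mathieu_setup f x rG W.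
Proof.
have [F _ cF] := @PrimePowerField 2 2 isT isT; rewrite /= in cF.
have [w [w0 w1]] := GF4_primitive cF.
exists _, (plane_group w), (cover w), (lab (o22 0)), F, (plane_repr w), (plane w 0).
exact: plane_setup.
Qed.

End PlaneGroup.

(** * Assembling the results *)

Import FieldOfFour Orthogonality DualHyperovals CosetFamilies CosetDesign DesignPairs PlanePoints GolayCode M22Elements Octads M22Stabilizers M22Labels M21Simplicity M21Preimage SL3Isomorphism SetupPlanes PlaneStabilizer FieldCodes PlaneCoordinates FieldAutomorphism CosetPoints PointStabilizer DesignAutomorphisms PlaneMatrices PlaneGroup.
Local Opaque line23 lperm dec enc is_lperm M22_check M22 M24.

(** The shape of the full group speaks of a subgroup of permutations, so the cover has to be carried
    along an isomorphism. *)
Lemma triple_cover_isog (gT hT : finGroupType) (G : {group gT}) (L : {group hT})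
    (f : {morphism G >-> {perm line23}}) : G \isog L -> triple_cover_M22 f ->
  exists f' : {morphism L >-> {perm line23}}, triple_cover_M22 f'.
Proof.
case/isogP=> k injk; move: L => L kG [fG c3 cen ns].
have {}kG : k @* G = L by [].
pose h y := f (invm injk y).
have hE g : g \in G -> h (k g) = f g by move=> gG; rewrite /h invmE.
have inL y : y \in L -> exists2 g, g \in G & y = k g.
  by rewrite -kG => /morphimP[g gG _ ->]; exists g.
have hM : {in L &, {morph h : y z / y * z}}.
  move=> _ _ /inL[g gG ->] /inL[g' gG' ->].
  by rewrite -morphM // !hE ?groupM // morphM.
have kL g : g \in G -> k g \in L by move=> gG; rewrite -kG mem_morphim.
pose f' := Morphism hM; have f'E g : g \in G -> f' (k g) = f g by exact: hE.
have kerG : 'ker f \subset G by exact: subsetIl.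
have kerE : 'ker f' = k @* 'ker f.
  apply/setP=> y; apply/idP/morphimP => [yK | [g gG gK ->]].
    have yL : y \in L by apply: subsetP (subsetIl _ _) _ yK.
    have [g gG yg] := inL y yL; exists g => //; apply/kerP => //.
    by rewrite -f'E // -yg (mker yK).
  by apply/kerP; rewrite ?kL // f'E // (mker gK).
exists f'; split.
- rewrite -fG; apply/setP=> s; apply/morphimP/morphimP => [[y _ yL ->] | [g _ gG ->]].
    by have [g gG ->] := inL y yL; exists g; rewrite ?f'E.
  by exists (k g); rewrite ?kL ?f'E.
- by rewrite kerE card_injm.
- by rewrite kerE -kG -injm_center // morphimS.
apply: contra ns => /splitsP[K /complP[TI KL]].
have KsL : K \subset L by rewrite -KL mulG_subr.
have KsG : K \subset k @* G by rewrite kG.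
have kerkG : k @* 'ker f \subset k @* G by rewrite morphimS.
apply/splitsP; exists (invm injk @* K)%G; apply/complP.
split; rewrite -{1}(morphim_invm injk kerG).
  by rewrite -injmI ?injm_invm // -kerE TI morphim1.
by rewrite -morphimMl // -kerE KL -kG morphim_invm.
Qed.

Section Setup.

Variables (gT : finGroupType) (G : {group gT}) (f : {morphism G >-> {perm line23}}).
Variables (x : line23) (F : finFieldType) (rG : mx_representation F G 6) (W : 'M[F]_6).
Hypothesis ms : mathieu_setup f x rG W.

Notation X := [set: VG rG].
Notation pt := (pt f x rG W).
Notation Wi := (Wi f x rG W).
Notation P := (points pt).
Notation B := (blocks Wi pt).
Notation psi := (psi_morphism ms).

Let dW := setup_dual_hyperoval ms.

Lemma preim_M21_SL3 : preim_M21 f x \isog SL3 F.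
Proof.
have W3 : \rank W = 3 by case: ms => _ _ _ _ [].
pose Q : 'M[F]_(3, 6) := castmx (W3, erefl 6) (row_base W).
have QW : (Q :=: W)%MS by apply: eqmx_trans (eqmx_cast _ _) (eq_row_base W).
exact: (preim_M21_isog ms QW).
Qed.

Lemma design_points_blocks : symmetric_design P B 1408 336 80.
Proof. exact: (blocks_design dW (ptE ms)). Qed.

Lemma full_group_shape : has_shape_2p12_3M22_2 (design_aut P B).
Proof.
have [c [p [cD cZ cK pK cW]]] := semilinear_involution ms.
have [C [K [C2 LC NK]]] := aut_sdprod ms cD cZ cK pK cW.
exists (psi @* subV rG)%G, (psi @* subG rG)%G, C, K; split=> //.
  exact: abelem_V.
have [tc _ _ _ _] := ms; apply: triple_cover_isog tc.
apply: isog_trans (sub_isog (subxx G) (injm_sdpair2 _)) _.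
exact: sub_isog (subsetT _) (injm_psi ms).
Qed.

Lemma coset_action :
  let P := rcosets (subWH f x rG W) X in
  let Q := coset_blocks X (subWH f x rG W) (subVH f x rG) in
  [/\ #|P| = 1408,
      [/\ imprimitivity_system X P 'Rs Q, #|Q| = 22 & forall q, q \in Q -> #|q| = 64]
    & forall p, p \in P ->
        perm_eq (orbit_lengths 'C_X[p | 'Rs] 'Rs P) [:: 1; 63; 336; 1008]%N].
Proof.
rewrite /= (points_rcosets ms) (coset_blocks_cells ms); split.
- exact: (card_points dW (ptE ms)).
- split; [exact: (Rs_cells ms) | exact: (card_cells ms) |].
  by move=> _ /imsetP[i _ ->]; apply: (card_cell ms).
by move=> _ /pointsP[i [v ->]]; case: (stab_orbits ms i v).
Qed.

Lemma orbit336_design p o : p \in P -> o \in orbit 'Rs 'C_X[p | 'Rs] @: P -> #|o| = 336 ->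
  let D := orbit 'Rs^* X o in
  let A := design_aut P D in
  [/\ symmetric_design P D 1408 336 80,
      flag_transitive X 'Rs D /\ point_imprimitive X 'Rs P,
      [/\ [faithful X, on P | 'Rs], coset_perms P X \subset A & #|A : coset_perms P X| = 2],
      point_imprimitive A 'P P
    & exists C K : {group {perm {set VG rG}}},
        [/\ #|C| = 2, coset_perms P (subG rG) ><| C = K
          & coset_perms P (subV rG) ><| K = A]].
Proof.
move=> pP oP o336; have oE : o = nbhd Wi pt p.
  by case/pointsP: pP oP => i [v ->] oP; case: (stab_orbits ms i v) => _; apply.
rewrite /= oE (orbit_nbhd ms pP) !(coset_permsE ms).
have [c [pm [cD cZ cK pK cW]]] := semilinear_involution ms.
split; [exact: design_points_blocks | split | split | | exact: (aut_sdprod ms cD cZ cK pK cW)].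
- exact: (X_flag ms).
- exists [set cell f x rG W i | i : I22]; exact: (Rs_cells ms).
- exact: (faithful_points ms).
- by apply/subsetP=> _ /morphimP[z _ _ ->]; apply: (psi_aut ms).
- exact: (aut_index ms cD cZ cK pK cW).
exact: (aut_imprimitive ms).
Qed.

End Setup.

Theorem mainTheorem6 :
  (exists (T : finType) (P : {set T}) (B : {set {set T}}),
    [/\ symmetric_design P B 1408 336 80,
        flag_transitive (design_aut P B) 'P B,
        point_imprimitive (design_aut P B) 'P P
      & has_shape_2p12_3M22_2 (design_aut P B)])
  /\
  (exists (gT : finGroupType) (G : {group gT})
      (f : {morphism G >-> {perm line23}}) (x : line23) (F : finFieldType)
      (rG : mx_representation F G 6) (W : 'M[F]_6),
    mathieu_setup f x rG W)
  /\
  (forall (gT : finGroupType) (G : {group gT})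
      (f : {morphism G >-> {perm line23}}) (x : line23) (F : finFieldType)
      (rG : mx_representation F G 6) (W : 'M[F]_6),
    mathieu_setup f x rG W ->
    let X := [set: VG rG] in
    let P := rcosets (subWH f x rG W) X in
    let Q := coset_blocks X (subWH f x rG W) (subVH f x rG) in
    [/\ preim_M21 f x \isog SL3 F,
        #|P| = 1408,
        [/\ imprimitivity_system X P 'Rs Q,
            #|Q| = 22
          & forall q, q \in Q -> #|q| = 64],
        forall p, p \in P ->
          perm_eq (orbit_lengths 'C_X[p | 'Rs] 'Rs P) [:: 1; 63; 336; 1008]%N
      & forall p o, p \in P -> o \in orbit 'Rs 'C_X[p | 'Rs] @: P ->
          #|o| = 336 ->
          let B := orbit 'Rs^* X o in
          let A := design_aut P B in
          [/\ symmetric_design P B 1408 336 80,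
              flag_transitive X 'Rs B /\ point_imprimitive X 'Rs P,
              [/\ [faithful X, on P | 'Rs],
                  coset_perms P X \subset A
                & #|A : coset_perms P X| = 2],
              point_imprimitive A 'P P
            & exists C K : {group {perm {set VG rG}}},
                [/\ #|C| = 2, coset_perms P (subG rG) ><| C = K
                  & coset_perms P (subV rG) ><| K = A]]]).
Proof.
split; last split.
- have [gT [G [f [x [F [rG [W ms]]]]]]] := mathieu_setup_exists.
  exists {set VG rG}, (points (pt f x rG W)), (blocks (Wi f x rG W) (pt f x rG W)).
  split; [exact: (design_points_blocks ms) | exact: (aut_flag ms) | exact: (aut_imprimitive ms) |].
  exact: (full_group_shape ms).
- exact: mathieu_setup_exists.
move=> gT G f x F rG W ms X P Q; have [P1408 PQ Porb] := coset_action ms.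
have PE : P = points (pt f x rG W) by exact: (points_rcosets ms).
split; [exact: (preim_M21_SL3 ms) | exact: P1408 | exact: PQ | exact: Porb |].
by rewrite PE => p o pP oP o336; exact: (orbit336_design ms pP oP o336).
Qed.
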